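(* Let $r,s\ge 1$ and $d\ge 2$ be integers, let $F_1,\ldots,F_r\in\mathbb{Z}[X_1,\ldots,X_s]$ be forms of degree $d$, and for $\mathbf a\in\mathbb{Z}^r\setminus\{\mathbf 0\}$ put $$V_{\mathbf a}^*=\{\mathbf x\in\mathbb{C}^s:\nabla(a_1F_1(\mathbf x)+\ldots+a_rF_r(\mathbf x))=\mathbf 0\}.$$ Suppose that $$s>\max_{\mathbf a\in\mathbb{Z}^r\setminus\{\mathbf 0\}}\dim V_{\mathbf a}^*+r(r+1)(d-1)2^{d-1}.$$ Let $\mathcal B$ be a box in $\mathbb{R}^s$ with sides parallel to the coordinate axes, contained in the unit box, and for $P\ge 1$ let $$\varrho(P)=\#\{\mathbf x\in\mathbb{Z}^s:\mathbf x\in P\mathcal B\text{ and }F_i(\mathbf x)=0\ (1\le i\le r)\}.$$ Then there exists $\delta>0$ such that $$\varrho(P)=\mathfrak J\,\mathfrak S\,P^{s-rd}+O(P^{s-rd-\delta})$$ as $P\to\infty$, where $\mathfrak J$ and $\mathfrak S$ are the singular integral and the singular series, respectively.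
   Context: All dimensions of varieties are affine dimensions. The unit box is $[-1,1]^s$; a box is a product of $s$ bounded intervals of positive length, and $P\mathcal B=\{P\mathbf y:\mathbf y\in\mathcal B\}$. Write $e(x)=e^{2\pi i x}$. The singular integral (depending on $\mathcal B$) and the singular series have their usual circle method meaning: $$\mathfrak J=\int_{\mathbb{R}^r}\int_{\mathcal B}e\Big(\sum_{i=1}^r\gamma_iF_i(\boldsymbol\xi)\Big)\,d\boldsymbol\xi\,d\boldsymbol\gamma,$$ $$\mathfrak S=\sum_{q=1}^\infty\ \sum_{\substack{\mathbf a\in\{1,\ldots,q\}^r\\ \gcd(a_1,\ldots,a_r,q)=1}}q^{-s}\sum_{\mathbf x\in\{1,\ldots,q\}^s}e\Big(\frac1q\sum_{i=1}^ra_iF_i(\mathbf x)\Big).$$ The implied $O$-constant and $\delta$ may depend on $s,r,d,F_1,\ldots,F_r$ and $\mathcal B$. *)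

(* Defs.v *)
From HB Require Import structures.
From mathcomp Require Import all_boot all_order all_algebra finmap.
(* The notations of mpoly clash with those of mathcomp-analysis. *)
From mathcomp Require Import -(notations) mpoly.
From mathcomp Require Import complex.
From mathcomp Require Import all_classical all_reals all_analysis.

Set Implicit Arguments.
Unset Strict Implicit.
Unset Printing Implicit Defensive.

Import Order.TTheory GRing.Theory Num.Theory.
Import numFieldNormedType.Exports.

Local Open Scope classical_set_scope.
Local Open Scope ring_scope.
Local Open Scope complex_scope.

Notation "{ 'mpoly' T [ n ] }" := (mpoly n T).

Section AffineVarieties.
Variables (K : fieldType) (n : nat).

Definition zeros (I : set {mpoly K[n]}) : set (n.-tuple K) :=
  [set x | forall p, I p -> meval (tnth x) p = 0].

Definition zariski_closed (Z : set (n.-tuple K)) : Prop :=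
  exists I, Z = zeros I.

Definition zariski_irreducible (Z : set (n.-tuple K)) : Prop :=
  [/\ zariski_closed Z, Z !=set0 &
      forall A B, zariski_closed A -> zariski_closed B ->
        Z `<=` A `|` B -> Z `<=` A \/ Z `<=` B].

Definition irreducible_chain (V : set (n.-tuple K)) (k : nat)
    (Z : nat -> set (n.-tuple K)) : Prop :=
  (forall i, (i <= k)%N -> zariski_irreducible (Z i) /\ Z i `<=` V) /\
  (forall i, (i < k)%N -> Z i `<` Z i.+1).

(* The supremum of the lengths k of the strict chains of irreducible closed
   subsets of V; in particular the empty set has dimension -oo. *)
Definition variety_dim (R : realType) (V : set (n.-tuple K)) : \bar R :=
  ereal_sup [set k%:R%:E | k in [set k | exists Z, irreducible_chain V k Z]].

End AffineVarieties.

Section LebesgueTuple.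
Variable R : realType.

Definition cons_pair n (p : measurableTypeR R * n.-tuple (measurableTypeR R)) :
  n.+1.-tuple (measurableTypeR R) := [the n.+1.-tuple _ of p.1 :: p.2].

Lemma measurable_cons_pair n : measurable_fun [set: _] (@cons_pair n).
Proof. exact: measurable_cons. Qed.

Definition uncons n (t : n.+1.-tuple (measurableTypeR R)) :
    measurableTypeR R * n.-tuple (measurableTypeR R) :=
  (thead t, [tuple of behead t]).

Lemma measurable_uncons n : measurable_fun [set: _] (@uncons n).
Proof.
apply/measurable_fun_pair; first exact: measurable_tnth.
exact: measurable_behead.
Qed.

Lemma cons_pairK n : cancel (@cons_pair n) (@uncons n).
Proof. by case=> x t; congr pair; apply: val_inj. Qed.

Lemma unconsK n : cancel (@uncons n) (@cons_pair n).
Proof. by move=> t; rewrite [RHS]tuple_eta; apply: val_inj. Qed.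

Section Step.
Variables (n : nat)
  (mu : {sigma_finite_measure set (n.-tuple (measurableTypeR R)) -> \bar R}).

Definition cons_measure : set (n.+1.-tuple (measurableTypeR R)) -> \bar R :=
  pushforward (@lebesgue_measure R \x mu)%E (@cons_pair n).

Let cons_measure0 : cons_measure set0 = 0%E.
Proof. by rewrite /cons_measure /pushforward preimage_set0 measure0. Qed.

Let cons_measure_ge0 A : (0 <= cons_measure A)%E.
Proof. by rewrite /cons_measure /pushforward measure_ge0. Qed.

Let cons_measure_sigma_additive : semi_sigma_additive cons_measure.
Proof.
move=> F mF tF mUF; rewrite /cons_measure /pushforward preimage_bigcup.
have mcons A : measurable A -> measurable (@cons_pair n @^-1` A).
  by move=> mA; rewrite -[X in measurable X]setTI; exact: measurable_cons_pair.
apply: measure_semi_sigma_additive.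
- by move=> k; exact: mcons.
- apply/trivIsetP => /= i j _ _ ij; rewrite -preimage_setI.
  by move/trivIsetP : tF => /(_ _ _ _ _ ij) ->//; rewrite preimage_set0.
- by rewrite -preimage_bigcup; exact: mcons.
Qed.

HB.instance Definition _ := isMeasure.Build _ _ _ cons_measure
  cons_measure0 cons_measure_ge0 cons_measure_sigma_additive.

Let cons_measure_sigma_finite : sigma_finite [set: _] cons_measure.
Proof.
have /sigma_finiteP[F [FT ndF Foo]] := sigma_finiteT (@lebesgue_measure R).
have /sigma_finiteP[G [GT ndG Goo]] := sigma_finiteT mu.
exists (fun i => @uncons n @^-1` (F i `*` G i)).
  apply/esym; rewrite -subTset => t _.
  have [i _ Fi] : (\bigcup_i F i) (uncons t).1 by rewrite -FT.
  have [j _ Gj] : (\bigcup_i G i) (uncons t).2 by rewrite -GT.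
  exists (maxn i j) => //; split.
  - by move: Fi; exact/subsetPset/ndF/leq_maxl.
  - by move: Gj; exact/subsetPset/ndG/leq_maxr.
move=> i; have [mF Fi] := Foo i; have [mG Gi] := Goo i; split.
  rewrite -[X in measurable X]setTI; apply: measurable_uncons => //.
  exact: measurableX.
rewrite /cons_measure /pushforward -comp_preimage.
rewrite (_ : _ \o _ = id); last by apply/funext => p; exact: cons_pairK.
by rewrite preimage_id product_measure1E// lte_mul_pinfty// ge0_fin_numE.
Qed.

HB.instance Definition _ := Measure_isSigmaFinite.Build _ _ _ cons_measure
  cons_measure_sigma_finite.

End Step.

(* The n-dimensional Lebesgue measure, as an iterated product. *)
Fixpoint lebesgue_tuple n :
    {sigma_finite_measure set (n.-tuple (measurableTypeR R)) -> \bar R} :=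
  if n is m.+1 then cons_measure (lebesgue_tuple m)
  else \d_([tuple] : 0.-tuple (measurableTypeR R)).

End LebesgueTuple.

Section CircleMethod.
Variables (R : realType) (r s : nat) (F : 'I_r -> {mpoly int[s]}).

Definition gradient_zeros (a : {ffun 'I_r -> int}) : set (s.-tuple R[i]) :=
  let G : {mpoly R[i][s]} := map_mpoly intr (\sum_(i < r) a i *: F i) in
  [set x | forall j : 'I_s, meval (tnth x) (mderiv j G) = 0].

Definition is_box (B : set (s.-tuple R)) : Prop :=
  exists (lo hi : 'I_s -> R) (lo_closed hi_open : 'I_s -> bool),
    (forall j, lo j < hi j) /\
    B = [set y | forall j, tnth y j \in
           Interval (BSide (lo_closed j) (lo j)) (BSide (hi_open j) (hi j))].

Definition unit_box : set (s.-tuple R) :=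
  [set y | forall j, tnth y j \in `[-1, 1]].

Definition dilate (P : R) (B : set (s.-tuple R)) : set (s.-tuple R) :=
  [set map_tuple ( *%R P) y | y in B].

Definition solutions (B : set (s.-tuple R)) (P : R) : set (s.-tuple int) :=
  [set x | dilate P B (map_tuple intr x) /\
           forall i, meval (tnth x) (F i) = 0].

(* #|` fset_set A| is the number of elements of A if A is finite, which is the
   case here as soon as B is bounded. *)
Definition rho (B : set (s.-tuple R)) (P : R) : nat :=
  #|` fset_set (solutions B P)|.

Definition unit_exp (x : R) : R[i] := cos (2 * pi * x) +i* sin (2 * pi * x).

Definition cintegrable d (T : measurableType d)
    (mu : {measure set T -> \bar R}) (D : set T) (f : T -> R[i]) : Prop :=
  mu.-integrable D (fun x => (complex.Re (f x))%:E) /\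
  mu.-integrable D (fun x => (complex.Im (f x))%:E).

Definition cintegral d (T : measurableType d)
    (mu : {measure set T -> \bar R}) (D : set T) (f : T -> R[i]) : R[i] :=
  (\int[mu]_(x in D) complex.Re (f x)) +i* (\int[mu]_(x in D) complex.Im (f x)).

Definition oscillatory_integral (B : set (s.-tuple R)) (gamma : r.-tuple R) :
    R[i] :=
  cintegral (lebesgue_tuple R s) B (fun xi =>
    unit_exp (\sum_(i < r) tnth gamma i * meval (tnth xi) (map_mpoly intr (F i)))).

Definition singular_integral (B : set (s.-tuple R)) : R[i] :=
  cintegral (lebesgue_tuple R r) [set: _] (oscillatory_integral B).

Definition singular_integral_converges (B : set (s.-tuple R)) : Prop :=
  cintegrable (lebesgue_tuple R r) [set: _] (oscillatory_integral B).

(* {1, ..., q}^n, as a subset of {0, ..., q}^n. *)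
Definition residues (n q : nat) : {set n.-tuple 'I_q.+1} :=
  [set x : n.-tuple 'I_q.+1 | [forall j, (0 < tnth x j)%N]].

Definition gauss_sum (q : nat) (a : r.-tuple 'I_q.+1) : R[i] :=
  \sum_(x in residues s q)
    unit_exp ((\sum_(i < r) (tnth a i)%:Z *
          meval (fun j => (tnth x j)%:Z) (F i))%:~R / q%:R).

Definition singular_series_term (q : nat) : R[i] :=
  \sum_(a in residues r q | \big[gcdn/q]_(i < r) (tnth a i : nat) == 1%N)
    q%:R ^- s * gauss_sum a.

Definition singular_series_partial (N : nat) : R[i]^o :=
  \sum_(1 <= q < N) singular_series_term q.

Definition singular_series_converges : Prop := cvgn singular_series_partial.

Definition singular_series : R[i] := limn singular_series_partial.

End CircleMethod.

Arguments gradient_zeros R {r s} F a.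
Arguments unit_box R s : clear implicits.
Arguments singular_series_converges R {r s} F.
Arguments singular_series R {r s} F.

(* Main.v *)
Require Import Defs.
From HB Require Import structures.
From mathcomp Require Import all_boot all_order all_algebra finmap.
From mathcomp Require Import -(notations) mpoly.
From mathcomp Require Import complex.
From mathcomp Require Import all_classical all_reals all_analysis.
From mathcomp Require Import perm zify ring lra measurable_realfun.
Import Order.TTheory GRing.Theory Num.Theory.
Import numFieldNormedType.Exports.
Import Normc.
Local Open Scope classical_set_scope.
Local Open Scope ring_scope.
Local Open Scope complex_scope.

Set Implicit Arguments.
Unset Strict Implicit.
Unset Printing Implicit Defensive.


(** Differencing the Weyl sum S(alpha) d-1 times leads to counting tuples of
   integer vectors at which the polarizations of the F_i are close to integers
   in the direction alpha.  Shrinking the range of these vectors (geometry of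
   numbers, via the symplectic form on Z^s x Z^s) leaves either a rational
   approximation to alpha or many common zeros of the polarization of one form
   a_1F_1+...+a_rF_r.  By Noetherianity, uniformly in a, linear sections of
   codimension dim V*_a reduce the locus V*_a to the origin, which bounds the
   latter.  Orthogonality is used in the discrete form of an average of
   S(b/M) over b modulo M, with M divisible by all small denominators and
   arbitrarily large. *)

(** The alternative with many common zeros arises for some [a] that depends on [alpha] and on the
    range, so the count must hold with one constant for all nonzero integral [a]. Hence the
    certificates of reduction: matrix identities whose validity is an open condition on [a]. The
    count is affine: with the differences between the first vector and the others fixed, the
    equations for the first vector have leading part (d-1)! times the gradient of the form, and
    lower terms cannot enlarge a fibre beyond a fixed bound.

    The constant r(r+1)(d-1)2^(d-1) is the price of the minor arcs. Points with a common denominator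
    up to Z and error Z/P^d have density about Z^(r+1) P^(-rd), so a saving beyond Z^(r+1) is
    required, while Z = X^(r(d-1)) yields the saving X^((s-k)/2^(d-1)), up to logarithms, k bounding
    the dimensions. The same alternative, read at P = q and at arguments gamma/P^d, also bounds
    Gauss sums and the oscillatory integral. The modulus M is fixed last, after every quantity
    depending on P, so even errors without uniformity in P become negligible. *)

(** * Noetherian rings and Hilbert's basis theorem *)

Section Ideals.
Variable A : comNzRingType.

Definition is_ideal (I : set A) : Prop :=
  [/\ I 0, forall x y, I x -> I y -> I (x + y) & forall a x, I x -> I (a * x)].

(** Finite generation is stated by minimality: every ideal containing [l] contains [I]. This avoids
    writing out linear combinations. *)
Definition noetherian : Prop := forall I, is_ideal I ->
  exists l : seq A, (forall x, x \in l -> I x) /\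
    forall J, is_ideal J -> (forall x, x \in l -> J x) -> I `<=` J.

Lemma ideal0 I : is_ideal I -> I 0. Proof. by case. Qed.
Lemma idealD I x y : is_ideal I -> I x -> I y -> I (x + y).
Proof. by case=> _ h _; exact: h. Qed.
Lemma idealM I a x : is_ideal I -> I x -> I (a * x).
Proof. by case=> _ _ h; exact: h. Qed.
Lemma idealN I x : is_ideal I -> I x -> I (- x).
Proof. by move=> II Ix; rewrite -mulN1r; apply: idealM. Qed.
Lemma idealB I x y : is_ideal I -> I x -> I y -> I (x - y).
Proof. by move=> II Ix Iy; apply: idealD => //; apply: idealN. Qed.
Lemma ideal_sum (T : Type) (r : seq T) (P : pred T) (F : T -> A) I :
  is_ideal I -> (forall i, P i -> I (F i)) -> I (\sum_(i <- r | P i) F i).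
Proof.
move=> II h; apply: (big_ind I) => //; first exact: ideal0.
by move=> x y; apply: idealD.
Qed.

End Ideals.

Lemma noetherian_surj (A B : comNzRingType) (f : A -> B) :
  {morph f : x y / x + y} -> {morph f : x y / x * y} -> f 0 = 0 ->
  (forall y, exists x, f x = y) -> noetherian A -> noetherian B.
Proof.
move=> fD fM f0 fs nA I II.
have II' : is_ideal (f @^-1` I).
  split=> [|x y|a x] /=; first by rewrite f0; apply: ideal0.
    by rewrite fD; apply: idealD.
  by rewrite fM; apply: idealM.
have [l [lI lJ]] := nA _ II'.
exists (map f l); split=> [y /mapP[x xl ->]|J IJ h y Iy]; first exact: lI.
have [x fx] := fs y; rewrite -fx.
apply: (lJ (f @^-1` J)) => [|z zl|] /=; last by rewrite fx.
  split=> [|u v|a u] /=; first by rewrite f0; apply: ideal0.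
    by rewrite fD; apply: idealD.
  by rewrite fM; apply: idealM.
by apply: h; apply: map_f.
Qed.

Section HilbertBasis.
Variable A : comNzRingType.
Implicit Types (I J : set {poly A}) (p q : {poly A}).

Definition lead_ideal I (n : nat) : set A :=
  [set a | exists p, [/\ I p, (size p <= n.+1)%N & p`_n = a]].

Lemma is_ideal_lead I n : is_ideal I -> is_ideal (lead_ideal I n).
Proof.
move=> II; split=> [|x y [p [Ip sp <-]] [q [Iq sq <-]]|a x [p [Ip sp <-]]].
- by exists 0; rewrite coef0 size_poly0; split=> //; apply: ideal0.
- exists (p + q); rewrite coefD; split=> //; first exact: idealD.
  by rewrite (leq_trans (size_polyD _ _))// geq_max sp sq.
- exists (a%:P * p); rewrite coefCM; split=> //; first exact: idealM.
  by rewrite mul_polyC (leq_trans (size_scale_leq _ _)).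
Qed.

Lemma lead_ideal_mono I m n : is_ideal I -> (m <= n)%N ->
  lead_ideal I m `<=` lead_ideal I n.
Proof.
move=> II mn a [p [Ip sp pa]]; exists ('X^(n - m) * p); split.
- exact: idealM.
- rewrite (leq_trans (size_polyMleq _ _))// size_polyXn addSn /=.
  by rewrite (leq_trans (leq_add (leqnn _) sp))// addnS subnK.
- by rewrite coefXnM ltnNge leq_subr/= subKn.
Qed.

(** Hilbert's basis theorem. The ideals of leading coefficients increase with the degree, and their
    union is finitely generated, hence already reached at some degree [N]. Polynomials realising
    generators of those of degree at most [N] generate [I], since leading terms can be cancelled one
    by one. *)
Lemma noetherian_poly : noetherian A -> noetherian {poly A}.
Proof.
move=> nA I II.
pose L : set A := [set a | exists n, lead_ideal I n a].
have IL : is_ideal L.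
  split=> [|x y [m Lx] [n Ly]|a x [n Lx]].
  - by exists 0%N; apply: ideal0; apply: is_ideal_lead.
  - exists (maxn m n); apply: idealD; first exact: is_ideal_lead.
      by apply: lead_ideal_mono Lx => //; apply: leq_maxl.
    by apply: lead_ideal_mono Ly => //; apply: leq_maxr.
  - by exists n; apply: idealM => //; apply: is_ideal_lead.
have [l [lL lJ]] := nA _ IL.
have [N lN] : exists N, forall a, a \in l -> lead_ideal I N a.
  elim: l lL {lJ} => [|a l IH] h; first by exists 0%N.
  have [|N hN] := IH; first by move=> x xl; apply: h; rewrite inE xl orbT.
  have [|M hM] := h a; first by rewrite mem_head.
  exists (maxn M N) => x; rewrite inE => /orP[/eqP->|xl].
    by apply: lead_ideal_mono hM => //; apply: leq_maxl.
  by apply: lead_ideal_mono (hN _ xl) => //; apply: leq_maxr.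
have gens n : exists l' : seq {poly A}, (forall p, p \in l' -> I p) /\
    forall J, is_ideal J -> (forall p, p \in l' -> J p) ->
      lead_ideal I n `<=` lead_ideal (I `&` J) n.
  have [ln [ln1 ln2]] := nA _ (is_ideal_lead n II).
  have /choice[f Hf] : forall a, exists p, a \in ln ->
      [/\ I p, (size p <= n.+1)%N & p`_n = a].
    move=> a; case: (boolP (a \in ln)) => [aln|_]; last by exists 0.
    by have [p hp] := ln1 _ aln; exists p.
  exists (map f ln); split=> [p /mapP[a aln ->]|J IJ h].
    by have [] := Hf _ aln.
  apply: ln2 => [|a aln].
    apply: is_ideal_lead; split=> [|x y [? ?] [? ?]|a x [? ?]].
    - by split; apply: ideal0.
    - by split; apply: idealD.
    - by split; apply: idealM.
  have [Ip sp pa] := Hf _ aln; exists (f a); split=> //; split=> //.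
  by apply: h; apply: map_f.
have /choice[g Hg] := gens.
exists (flatten [seq g n | n <- iota 0 N.+1]); split.
  by move=> p /flattenP[_ /mapP[n _ ->]]; apply: (Hg n).1.
move=> J IJ hJ p; have [n] := ubnP (size p).
elim: n p => // n IH p; rewrite ltnS => sp Ip.
have [->|p0] := eqVneq p 0; first exact: ideal0.
have IIJ : is_ideal (I `&` J).
  split=> [|x y [? ?] [? ?]|a x [? ?]].
  - by split; apply: ideal0.
  - by split; apply: idealD.
  - by split; apply: idealM.
have key k : (k <= N)%N -> lead_ideal I k `<=` lead_ideal (I `&` J) k.
  move=> kN; apply: (Hg k).2 => // q qk; apply: hJ.
  by apply/flattenP; exists (g k) => //; apply: map_f; rewrite mem_iota.
set k := (size p).-1.
have spk : size p = k.+1 by rewrite /k prednK// lt0n size_poly_eq0.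
have : lead_ideal (I `&` J) k (p`_k).
  have pk : lead_ideal I k p`_k by exists p; rewrite spk.
  have [kN|Nk] := leqP k N; first exact: key.
  apply: (lJ (lead_ideal (I `&` J) k)).
  - exact: is_ideal_lead.
  - move=> a al; apply: (lead_ideal_mono IIJ (ltnW Nk)).
    by apply: key => //; apply: lN.
  - by exists k.
move=> [q [[Iq Jq] sq qk]].
have -> : p = q + (p - q) by rewrite addrC subrK.
apply: idealD => //; apply: IH; last exact: idealB.
apply: leq_trans sp; rewrite spk; apply/leq_sizeP => j.
rewrite leq_eqVlt coefB => /orP[/eqP<-|kj]; first by rewrite qk subrr.
by rewrite !nth_default ?subrr// ?spk// (leq_trans sq).
Qed.

End HilbertBasis.

Lemma noetherian_field (K : fieldType) : noetherian K.
Proof.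
move=> I II; have [[x [Ix x0]]|h] := pselect (exists x, I x /\ x != 0).
  exists [:: x]; split=> [y|J IJ hJ y _]; first by rewrite inE => /eqP->.
  have -> : y = y / x * x by rewrite mulfVK.
  by apply: idealM => //; apply: hJ; rewrite mem_head.
exists [::]; split=> // J IJ _ y Iy.
have [->|y0] := eqVneq y 0; first exact: ideal0.
by case: h; exists y.
Qed.

(** Evaluation at the last variable maps the polynomials over the ring in [n] variables onto the
    ring in [n.+1] variables, and noetherianity passes to images. *)
Lemma noetherian_mpoly (K : fieldType) n : noetherian {mpoly K[n]}.
Proof.
elim: n => [|n IH].
  apply: (@noetherian_surj K _ (@mpolyC 0 K)); last exact: noetherian_field.
  - exact: mpolyCD.
  - exact: mpolyCM.
  - exact: mpolyC0.
  - by move=> y; exists (mcoeff mnm0 y); rewrite -nvar0_mpolyC.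
pose X : {mpoly K[n.+1]} := mpolyX K (mnm1 ord_max).
pose f (p : {poly {mpoly K[n]}}) := (mpwiden p).[X].
have fD : {morph f : x y / x + y} by move=> x y; rewrite /f rmorphD hornerD.
have fM : {morph f : x y / x * y} by move=> x y; rewrite /f rmorphM hornerM.
apply: (@noetherian_surj {poly {mpoly K[n]}} _ f) => //.
- by rewrite /f rmorph0 horner0.
- have fC c : f (c%:P) = mwiden c by rewrite /f mpwidenC hornerC.
  have fX : f 'X = X by rewrite /f mpwidenX hornerX.
  have f1 : f 1 = 1 by rewrite -polyC1 fC mwiden1.
  have imX (i : 'I_n.+1) : exists x, f x = mpolyX K (mnm1 i).
    case: (unliftP ord_max i) => [j ->|->]; last by exists 'X.
    exists (mpolyX K (mnm1 j))%:P; rewrite fC mwidenX; congr mpolyX.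
    rewrite mnmwiden1; congr mnm1; apply: val_inj => /=.
    by rewrite /bump leqNgt ltn_ord.
  have imM m : exists x, f x = mpolyX K m.
    rewrite mpolyXE_id; apply: (big_ind (fun y => exists x, f x = y)).
    + by exists 1.
    + by move=> _ _ [x <-] [y <-]; exists (x * y).
    + move=> i _; have [x <-] := imX i; exists (x ^+ m i).
      by elim: (m i) => [|k IHk]; rewrite ?expr0// !exprS fM IHk.
  elim/mpolyind => [|c m p _ _ [x <-]].
    by exists 0; rewrite /f rmorph0 horner0.
  have [y hy] := imM m; exists ((mpolyC _ c)%:P * y + x).
  by rewrite fD fM fC hy mwidenC mul_mpolyC.
- exact: noetherian_poly.
Qed.

(** Quasi-compactness: the finite list consists of members of [S] itself. It is applied to
    descending chains of closed sets and to covers of a parameter space by open sets. *)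
Lemma noetherian_finite (A : comNzRingType) (S : set A) : noetherian A ->
  exists l : seq A, (forall x, x \in l -> S x) /\
    forall J, is_ideal J -> (forall x, x \in l -> J x) -> S `<=` J.
Proof.
move=> nA.
pose I : set A := [set x | exists l : seq A, (forall y, y \in l -> S y) /\
  forall J, is_ideal J -> (forall y, y \in l -> J y) -> J x].
have II : is_ideal I.
  split=> [|x y [l [lS lx]] [m [mS my]]|a x [l [lS lx]]].
  - by exists [::]; split=> // J IJ _; apply: ideal0.
  - exists (l ++ m); split=> [z|J IJ h].
      by rewrite mem_cat => /orP[]; [apply: lS | apply: mS].
    apply: idealD => //.
      by apply: lx => // z zl; apply: h; rewrite mem_cat zl.
    by apply: my => // z zl; apply: h; rewrite mem_cat zl orbT.
  - by exists l; split=> // J IJ h; apply: idealM => //; apply: lx.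
have [l [lI lJ]] := nA _ II.
have [m [mS ml]] : exists m : seq A, (forall y, y \in m -> S y) /\
    forall J, is_ideal J -> (forall y, y \in m -> J y) -> forall x, x \in l -> J x.
  elim: l lI {lJ} => [|a l IH] h; first by exists [::].
  have [|m [mS ml]] := IH; first by move=> x xl; apply: h; rewrite inE xl orbT.
  have [|k [kS ka]] := h a; first by rewrite mem_head.
  exists (k ++ m); split=> [z|J IJ hJ x].
    by rewrite mem_cat => /orP[]; [apply: kS | apply: mS].
  rewrite inE => /orP[/eqP->|].
    by apply: ka => // z zl; apply: hJ; rewrite mem_cat zl.
  by apply: ml => // z zl; apply: hJ; rewrite mem_cat zl orbT.
exists m; split=> // J IJ h x Sx; apply: (lJ J IJ); first exact: ml.
by exists [:: x]; split=> [y|L IL]; [rewrite inE => /eqP->|apply; rewrite mem_head].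
Qed.

(** * Maximal ideals and the Nullstellensatz over an uncountable field *)

Lemma maximal_ideal (A : comNzRingType) (I : set A) : is_ideal I -> ~ I 1 ->
  exists M, [/\ is_ideal M, I `<=` M, ~ M 1 &
    forall y, ~ M y -> exists g, M (g * y - 1)].
Proof.
move=> II I1.
pose P (X : set A) := X = set0 \/ [/\ is_ideal X, I `<=` X & ~ X 1].
have [F FP Ftot|M [PM Mmax]] := @Zorn_bigcup _ P.
  have [[X0 [FX0 X0n]]|h] := pselect (exists X, F X /\ X <> set0); last first.
    left; apply/seteqP; split=> // x [X FX Xx]; apply: h; exists X; split=> // X0.
    by rewrite X0 in Xx.
  have [//|[IX0 IXs X01]] := FP _ FX0.
  right; split.
  - have idF X Y : F X -> X Y -> is_ideal X.
      by move=> FX XY; have [X0'|[]//] := FP _ FX; rewrite X0' in XY.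
    split=> [|x y [X FX Xx] [Y FY Yy]|a x [X FX Xx]].
    + by exists X0 => //; apply: ideal0.
    + have [XY|YX] := Ftot _ _ FX FY.
        by exists Y => //; apply: idealD => //; [apply: idF FY Yy|apply: XY].
      by exists X => //; apply: idealD => //; [apply: idF FX Xx|apply: YX].
    + by exists X => //; apply: idealM => //; apply: idF FX Xx.
  - by move=> x Ix; exists X0 => //; apply: IXs.
  - move=> [X FX X1]; have [X0'|[]//] := FP _ FX; by rewrite X0' in X1.
have [M0|[IM IsM M1]] := PM.
  exfalso; apply: (Mmax I); last by right; split.
  rewrite M0 properEneq; split; last exact: sub0set.
  by apply/eqP => I0; have := ideal0 II; rewrite -I0.
exists M; split=> // y My.
(* The ideal generated by [M] and [y]; by maximality it must contain 1. *)
pose N := [set x | exists m g, M m /\ x = m + g * y].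
have IN : is_ideal N.
  split=> [|_ _ [m [g [Mm ->]]] [m' [g' [Mm' ->]]]|a _ [m [g [Mm ->]]]].
  - by exists 0, 0; split; [apply: ideal0|rewrite mul0r addr0].
  - exists (m + m'), (g + g'); split; first exact: idealD.
    by rewrite mulrDl addrACA.
  - exists (a * m), (a * g); split; first exact: idealM.
    by rewrite mulrDr mulrA.
have MN : M `<=` N by move=> m Mm; exists m, 0; rewrite mul0r addr0.
apply: contrapT => hg; apply: (Mmax N).
  split=> // NM; apply: My; apply: NM.
  by exists 0, 1; rewrite mul1r add0r; split=> //; apply: ideal0.
right; split=> //; first exact: subset_trans MN.
move=> [m [g [Mm e]]]; apply: hg; exists g.
by rewrite e opprD addrCA subrr addr0; apply: idealN.
Qed.

(** The form in which uncountability enters: some member of any countable cover is infinite. The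
    cover used below sorts constants by the degree of an inverse. *)
Definition uncountable_type (K : Type) : Prop := forall A : nat -> set K,
  (forall x, exists n, A n x) -> exists n, infinite_set (A n).

Lemma realType_uncountable (R : realType) : uncountable_type R.
Proof.
move=> A hA; apply: contrapT => h.
have cA : countable (\bigcup_n A n).
  apply: bigcup_countable => // n _; apply: finite_set_countable.
  by apply: contrapT => hn; apply: h; exists n.
have : countable [set` `[0 : R, 1]].
  by apply: sub_countable cA; apply: subset_card_le => x _; have [n] := hA x; exists n.
move=> /countable_lebesgue_measure0; rewrite lebesgue_measure_itv/= lte01 oppr0 adde0.
by move=> /eqP; rewrite onee_eq0.
Qed.

Lemma complex_uncountable (R : realType) : uncountable_type R[i].
Proof.
move=> A hA.
have [|n hn] := @realType_uncountable R (fun n => [set x | A n x%:C]).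
  by move=> x; apply: hA.
exists n => fA; apply: hn.
apply: (@sub_finite_set _ _ ((@complex.Re R) @` (A n))); last exact: finite_image.
by move=> x /= Ax; exists x%:C.
Qed.

Section Nullstellensatz.
Variables (K : closedFieldType) (n : nat).
Hypothesis Kunc : uncountable_type K.
Local Notation mX i := (mpolyX K (mnm1 i) : {mpoly K[n]}).
Local Notation mC c := (mpolyC n c : {mpoly K[n]}).

Lemma kernel_row (p q : nat) (G : 'M[K]_(p, q)) : (q < p)%N ->
  exists2 c : 'rV[K]_p, c != 0 & c *m G = 0.
Proof.
move=> qp; have k0 : kermx G != 0.
  rewrite -mxrank_eq0 mxrank_ker subn_eq0 -ltnNge.
  by rewrite (leq_ltn_trans (rank_leq_col G)).
have /row_subPn[i hi] : ~~ (kermx G <= (0 : 'M[K]_p))%MS by rewrite submx0.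
exists (row i (kermx G)); first by rewrite submx0 in hi.
by apply/eqP; rewrite -row_mul mulmx_ker row0.
Qed.

(** If no [X_i - c] lay in [M], all of them would be invertible modulo [M]. Infinitely many inverses
    have bounded degree, hence are linearly dependent, and clearing denominators produces a nonzero
    polynomial in [X_i] alone that lies in [M]. It splits into linear factors, which are invertible
    modulo [M]: a contradiction. *)
Lemma maximal_ideal_point (M : set {mpoly K[n]}) (i : 'I_n) :
  is_ideal M -> ~ M 1 -> (forall y, ~ M y -> exists g, M (g * y - 1)) ->
  exists c, M (mX i - mC c).
Proof.
move=> IM M1 Mmax; apply: contrapT => hn.
have inv c : exists g, M (g * (mX i - mC c) - 1).
  by apply: Mmax => h; apply: hn; exists c.
pose ev (q : {poly K}) : {mpoly K[n]} := (map_poly (@mpolyC n K) q).[mX i].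
(* Over an algebraically closed field [q] is a product of linear factors, each invertible modulo
   [M]; hence so is [q] evaluated at [X_i]. *)
have nz (q : {poly K}) : q != 0 -> ~ M (ev q).
  move=> q0; have [rs ->] := closed_field_poly_normal q.
  have lq : lead_coef q != 0 by rewrite lead_coef_eq0.
  rewrite /ev map_polyZ hornerZ rmorph_prod => h; apply: M1.
  have {h} : M (\prod_(z <- rs) ('X - (mC z)%:P)).[mX i].
    have := idealM (mC (lead_coef q)^-1) IM h.
    rewrite mulrA -mpolyCM mulVf// mpolyC1 mul1r => h'.
    by under eq_bigr do rewrite -map_polyXsubC.
  elim: rs => [|z rs IH]; first by rewrite big_nil hornerE.
  rewrite big_cons hornerM hornerXsubC => h; apply: IH.
  have [g hg] := inv z; set w := _.[_] in h *.
  have -> : w = g * ((mX i - mC z) * w) - (g * (mX i - mC z) - 1) * w by ring.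
  by apply: idealB => //; [apply: idealM|rewrite mulrC; apply: idealM].
have [D hD] : exists D, infinite_set [set c | exists g : {mpoly K[n]},
    (msize g <= D)%N /\ M (g * (mX i - mC c) - 1)].
  apply: Kunc => c; have [g hg] := inv c.
  by exists (msize g), g.
set A := [set c | _] in hD.
pose T : finType := bmultinom n D.
have [B BA cB] := infinite_set_fset #|T|.+1 hD.
pose lam (k : 'I_#|T|.+1) : K := nth 0 (enum_fset B) k.
have lamA k : A (lam k).
  by apply: BA; apply: mem_nth; apply: leq_trans cB.
have lamI : injective lam.
  move=> k1 k2 /eqP; rewrite nth_uniq ?fset_uniq//.
  - by move=> /eqP; apply: val_inj.
  - by apply: leq_trans (ltn_ord k1) cB.
  - by apply: leq_trans (ltn_ord k2) cB.
have /choice[g hg] : forall k, exists g : {mpoly K[n]},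
    (msize g <= D)%N /\ M (g * (mX i - mC (lam k)) - 1) by exact: lamA.
pose G : 'M[K]_(#|T|.+1, #|T|) := \matrix_(k, m) mcoeff (enum_val m : T) (g k).
(* There is one more inverse than there are monomials of degree below [D], which gives a linear
   relation. *)
have [c c0 cG] := kernel_row G (ltnSn _).
have sum0 : \sum_k mC (c 0 k) * g k = 0.
  apply/mpolyP => m; rewrite mcoeff0 raddf_sum /=.
  have [mD|mD] := ltnP (mdeg m) D; last first.
    apply: big1 => k _; rewrite mcoeffCM memN_msupp_eq0 ?mulr0//.
    by apply: msize_mdeg_ge; apply: leq_trans mD; have [] := hg k.
  transitivity ((c *m G) 0 (enum_rank (BMultinom mD : T))); last by rewrite cG mxE.
  by rewrite mxE; apply: eq_bigr => k _; rewrite mcoeffCM mxE enum_rankK.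
(* The relation between the inverses of [X - lam k], cleared of denominators. At [lam k] only the
   k-th term survives, so [q] is nonzero. *)
pose q : {poly K} := \sum_k (c 0 k)%:P * \prod_(l | l != k) ('X - (lam l)%:P).
apply: (nz q).
  move/rV0Pn: c0 => [k ck]; apply/eqP => q0.
  have : q.[lam k] = c 0 k * \prod_(l | l != k) (lam k - lam l).
    rewrite /q horner_sum (bigD1 k)//= [X in _ + X]big1 ?addr0 => [|l lk].
      rewrite hornerM hornerC horner_prod; congr (_ * _).
      by apply: eq_bigr => l _; rewrite hornerXsubC.
    rewrite hornerM horner_prod (bigD1 k) 1?eq_sym//= hornerXsubC subrr.
    by rewrite mul0r mulr0.
  rewrite q0 horner0 => /esym/eqP; rewrite mulf_eq0 (negPf ck)/=.
  move=> /eqP/eqP; apply/negP; apply/prodf_neq0 => l lk.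
  by rewrite subr_eq0; apply: contra lk => /eqP/lamI ->.
have -> : ev q = \sum_k mC (c 0 k) * \prod_(l | l != k) (mX i - mC (lam l)).
  rewrite /ev /q raddf_sum horner_sum; apply: eq_bigr => k _ /=.
  rewrite rmorphM /= map_polyC hornerM hornerC rmorph_prod horner_prod /=.
  by congr (_ * _); apply: eq_bigr => l _; rewrite map_polyXsubC hornerXsubC.
have <- : \sum_k mC (c 0 k) * \prod_(l | l != k) (mX i - mC (lam l)) -
   (\sum_k mC (c 0 k) * g k) * \prod_l (mX i - mC (lam l)) =
   \sum_k mC (c 0 k) * \prod_(l | l != k) (mX i - mC (lam l)).
  by rewrite sum0 mul0r subr0.
rewrite mulr_suml -sumrB; apply: ideal_sum => // k _.
rewrite (bigD1 k (P := xpredT))//=; set w := \prod_(l | _) _; set u := mX i - _.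
have -> : mC (c 0 k) * w - mC (c 0 k) * g k * (u * w) =
  (- mC (c 0 k) * w) * (g k * u - 1) by ring.
by apply: idealM => //; have [] := hg k.
Qed.

(** Modulo a maximal ideal containing [I] every variable is congruent to a constant, so every
    polynomial is congruent to its value at the point formed by these constants. *)
Lemma nullstellensatz (I : set {mpoly K[n]}) : is_ideal I -> ~ I 1 ->
  exists x : 'I_n -> K, forall p, I p -> meval x p = 0.
Proof.
move=> II I1; have [M [IM IsM M1 Mmax]] := maximal_ideal II I1.
have /choice[x hx] : forall i, exists c, M (mX i - mC c).
  by move=> i; apply: maximal_ideal_point.
have ev p : M (p - mC (meval x p)).
  have evX m : M (mpolyX K m - mC (meval x (mpolyX K m))).
    rewrite mevalX mpolyXE_id.
    apply: (big_rec2 (fun y z => M (y - mC z))).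
      by rewrite mpolyC1 subrr; apply: ideal0.
    move=> i y1 y2 _ h.
    have hX k : M (mX i ^+ k - mC (x i ^+ k)).
      elim: k => [|k IH]; first by rewrite !expr0 mpolyC1 subrr; apply: ideal0.
      rewrite !exprS mpolyCM.
      have -> : mX i * mX i ^+ k - mC (x i) * mC (x i ^+ k) =
        mX i * (mX i ^+ k - mC (x i ^+ k)) + mC (x i ^+ k) * (mX i - mC (x i)) by ring.
      by apply: idealD => //; apply: idealM.
    rewrite mpolyCM; set a := mX i ^+ _; set b := mC (_ ^+ _).
    have -> : a * y1 - b * mC y2 = a * (y1 - mC y2) + mC y2 * (a - b) by ring.
    by apply: idealD => //; apply: idealM => //; apply: hX.
  elim/mpolyind: p => [|c m p _ _ IH].
    by rewrite meval0 mpolyC0 subrr; apply: ideal0.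
  rewrite mevalD mevalZ mpolyCD mpolyCM -mul_mpolyC.
  set a := mpolyX K m; set b := mC (meval x a); set e := mC c; set f := mC _ in IH *.
  have -> : e * a + p - (e * b + f) = e * (a - b) + (p - f) by ring.
  by apply: idealD => //; apply: idealM => //; apply: evX.
exists x => p Ip; apply/eqP; apply: contrapT => /negP px.
apply: M1; have := idealM (mC (meval x p)^-1) IM (idealB IM (IsM _ Ip) (ev p)).
by rewrite opprB addrC subrK -mpolyCM mulVf// mpolyC1.
Qed.

End Nullstellensatz.

(** * Ideals of forms containing all monomials of some degree *)

Section HomogeneousReduction.
Variables (K : fieldType) (n : nat) (T : finType) (e : T -> nat).
Local Notation mX i := (mpolyX K (mnm1 i) : {mpoly K[n]}).
Local Notation mC c := (mpolyC n c : {mpoly K[n]}).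

Lemma pihomogM (k d : nat) (h f : {mpoly K[n]}) : f \is ishomog1 d mdeg ->
  pihomog mdeg k (h * f) = if (d <= k)%N then pihomog mdeg (k - d) h * f else 0.
Proof.
move=> hf; pose S := maxn (msize h) (k - d).+1.
rewrite {1}(@pihomog_partitionE _ _ mdeg S h) ?leq_maxl// mulr_suml raddf_sum /=.
have step (i : 'I_S) : pihomog mdeg k (pihomog mdeg i h * f) =
    if (i + d == k)%N then pihomog mdeg i h * f else 0.
  have hi : pihomog mdeg i h * f \is ishomog1 (i + d) mdeg.
    by apply: dhomogM => //; apply: pihomogP.
  by case: eqP => [<-|/eqP ik]; [apply: pihomog_dE|apply: pihomog_ne0 hi].
rewrite (eq_bigr _ (fun i _ => step i)) -big_mkcond /=.
case: ifP => dk.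
  have kS : (k - d < S)%N by rewrite leq_max ltnSn orbT.
  rewrite (bigD1 (Ordinal kS)) /=; last by rewrite subnK.
  rewrite big1 ?addr0// => i /andP[/eqP ik /eqP]; case; apply: val_inj => /=.
  by rewrite -ik addnK.
rewrite big1// => i /eqP ik; move: dk; by rewrite -ik leq_addl.
Qed.

(* Every monomial of degree N lies in the ideal of the forms f j of degree e j. *)
Definition reduces (N : nat) (f : T -> {mpoly K[n]}) : Prop :=
  forall m : multinom n, mdeg m = N -> exists g : T -> {mpoly K[n]},
    (forall j, g j = 0 \/ ((e j <= N)%N /\ g j \is ishomog1 (N - e j) mdeg)) /\
    mpolyX K m = \sum_j g j * f j.

Lemma homogeneous_part_sum (N : nat) (f h : T -> {mpoly K[n]}) p :
  (forall j, f j \is ishomog1 (e j) mdeg) -> p \is ishomog1 N mdeg ->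
  p = \sum_j h j * f j -> exists g : T -> {mpoly K[n]},
    (forall j, g j = 0 \/ ((e j <= N)%N /\ g j \is ishomog1 (N - e j) mdeg)) /\
    p = \sum_j g j * f j.
Proof.
move=> hf hp eq.
exists (fun j => if (e j <= N)%N then pihomog mdeg (N - e j) (h j) else 0); split.
  by move=> j; case: ifP => ejN; [right; split=> //; apply: pihomogP|left].
rewrite -[LHS](pihomog_dE hp) eq raddf_sum; apply: eq_bigr => j _ /=.
by rewrite (pihomogM _ _ (hf j)); case: ifP => // _; rewrite mul0r.
Qed.

Section Macaulay.
Variable N : nat.
Definition top_mnm := {m : bmultinom n N.+1 | mdeg m == N}.
Definition macaulay_row := (T * bmultinom n N.+1)%type.

(** The Macaulay matrix in degree [N]: the rows are the multiples of the forms by monomials, the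
    columns the monomials of degree [N]. Multiples of another degree are kept as zero rows, so that
    the format does not depend on [f]. The entries are linear in [f], and a left inverse writes each
    monomial of degree [N] in terms of the forms. *)
Definition macaulay (f : T -> {mpoly K[n]}) :
    'M[K]_(#|{: macaulay_row}|, #|{: top_mnm}|) :=
  \matrix_(u, v) let jm : macaulay_row := enum_val u in
    if (mdeg jm.2 + e jm.1 == N)%N
    then mcoeff (bmnm (val (enum_val v : top_mnm))) (mpolyX K (bmnm jm.2) * f jm.1) else 0.

Lemma macaulay_reduces f H : (forall j, f j \is ishomog1 (e j) mdeg) ->
  H *m macaulay f = 1%:M -> reduces N f.
Proof.
move=> hf HM m mN.
have mlt : (mdeg m < N.+1)%N by rewrite mN.
have mtop : mdeg (BMultinom mlt) == N by rewrite /= mN.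
pose v : 'I_#|{: top_mnm}| := enum_rank (Sub (BMultinom mlt) mtop : top_mnm).
pose h j : {mpoly K[n]} := \sum_(mu : bmultinom n N.+1 | (mdeg mu + e j == N)%N)
  H v (enum_rank (j, mu)) *: mpolyX K (bmnm mu).
have hp : mpolyX K m \is ishomog1 N mdeg by rewrite dhomogX; apply/eqP.
apply: (homogeneous_part_sum (h := h) hf hp).
have hh : \sum_j h j * f j \is ishomog1 N mdeg.
  apply: rpred_sum => j _; rewrite mulr_suml; apply: rpred_sum => mu /eqP hmu.
  have : H v (enum_rank (j, mu)) *: mpolyX K (bmnm mu) * f j
      \is ishomog1 (mdeg mu + e j) mdeg.
    by apply: dhomogM => //; rewrite rpredZ// dhomogX.
  by rewrite hmu.
apply/mpolyP => m'; have [m'N|m'N] := eqVneq (mdeg m') N; last first.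
  by rewrite !(dhomog_nemf_coeff _ m'N).
have m'lt : (mdeg m' < N.+1)%N by rewrite m'N.
have m'top : mdeg (BMultinom m'lt) == N by rewrite /= m'N.
pose v' : 'I_#|{: top_mnm}| := enum_rank (Sub (BMultinom m'lt) m'top : top_mnm).
transitivity ((1%:M : 'M[K]_#|{: top_mnm}|) v v').
  rewrite mxE mcoeffX; congr (nat_of_bool _)%:R.
  rewrite (can_eq enum_rankK); apply/eqP/eqP => [e1|[//]].
  by do 2 apply: val_inj; rewrite /= e1.
rewrite -HM mxE raddf_sum /=.
under [RHS]eq_bigr do rewrite mulr_suml raddf_sum /=.
rewrite (reindex (enum_rank : macaulay_row -> _)) /=; last first.
  by apply: onW_bij; apply: enum_rank_bij.
under [RHS]eq_bigr do rewrite big_mkcond /=.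
rewrite [RHS]pair_bigA /=; apply: eq_bigr => -[j mu] _ /=.
rewrite mxE !enum_rankK /=; case: ifP => _; last by rewrite mulr0.
by rewrite -scalerAl mcoeffZ.
Qed.

Lemma reduces_macaulay f : reduces N f -> exists H, H *m macaulay f = 1%:M.
Proof.
move=> hr.
have /choice[g hg] : forall v : 'I_#|{: top_mnm}|, exists g : T -> {mpoly K[n]},
    (forall j, g j = 0 \/ ((e j <= N)%N /\ g j \is ishomog1 (N - e j) mdeg)) /\
    mpolyX K (bmnm (val (enum_val v : top_mnm))) = \sum_j g j * f j.
  by move=> v; apply: hr; apply/eqP; apply: (valP (enum_val v)).
exists (\matrix_(v, u) let jm : macaulay_row := enum_val u in
  mcoeff (bmnm jm.2) (g v jm.1)).
apply/matrixP => v v'; rewrite mxE.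
rewrite (reindex (enum_rank : macaulay_row -> _)) /=; last first.
  by apply: onW_bij; apply: enum_rank_bij.
transitivity (mcoeff (bmnm (val (enum_val v' : top_mnm))) (mpolyX K (bmnm (val (enum_val v : top_mnm))))).
  have [hg0 ->] := hg v; rewrite raddf_sum /=.
  transitivity (\sum_j \sum_(mu : bmultinom n N.+1)
     if (mdeg mu + e j == N)%N then mcoeff (bmnm mu) (g v j) *
       mcoeff (bmnm (val (enum_val v' : top_mnm))) (mpolyX K (bmnm mu) * f j) else 0).
    rewrite pair_bigA /=; apply: eq_bigr => -[j mu] _.
    rewrite !mxE !enum_rankK /=; case: ifP => // _; last by rewrite mulr0.
  apply: eq_bigr => j _.
  have [gj|[ejN gj]] := hg0 j.
    rewrite gj mul0r mcoeff0 big1// => mu _.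
    by rewrite mcoeff0 mul0r; case: ifP.
  have sg : (msize (g v j) <= N.+1)%N.
    rewrite msizeE; apply/bigmax_leqP_seq => m hm _; rewrite ltnS.
    by move/dhomogP: gj => /(_ m hm) ->; apply: leq_subr.
  rewrite {2}(mpolywE sg) mulr_suml raddf_sum /=; apply: eq_bigr => mu _.
  rewrite -scalerAl mcoeffZ; case: ifP => // /negbT hmu.
  rewrite (dhomog_nemf_coeff gj) ?mul0r//.
  by apply: contra hmu => /eqP->; rewrite subnK.
rewrite mcoeffX !mxE; congr (nat_of_bool _)%:R.
apply/eqP/eqP => [h|->//]; apply: enum_val_inj; do 2 apply: val_inj; exact: h.
Qed.

End Macaulay.

(** On common zeros of the [p j] a form [f j] may be replaced by [f j - p j], of degree less than
    [e j]. Hence every monomial of degree at least [N] agrees there with a polynomial of lower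
    degree, and functions on the zeros are spanned by the monomials of degree below [N].
    Interpolation yields all functions on the zeros, whose number is therefore at most the number of
    these monomials. *)
Lemma reduces_perturbed_bound (N m : nat) (f p : T -> {mpoly K[n]})
    (Z : 'I_m -> 'I_n -> K) :
  reduces N f -> (forall j, msize (p j - f j) <= e j)%N ->
  (forall u v, Z u =1 Z v -> u = v) ->
  (forall u j, meval (Z u) (p j) = 0) -> (m <= #|{: bmultinom n N}|)%N.
Proof.
move=> hr hpf Zinj Z0.
(* [R q]: on the points [Z] the polynomial [q] agrees with one of degree less than [N]. *)
pose R (q : {mpoly K[n]}) := exists q' : {mpoly K[n]}, (msize q' <= N)%N /\
  forall u, meval (Z u) q = meval (Z u) q'.
have R0 : R 0 by exists 0; rewrite msize0.
have RD q1 q2 : R q1 -> R q2 -> R (q1 + q2).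
  move=> [q1' [s1 h1]] [q2' [s2 h2]]; exists (q1' + q2'); split=> [|u].
    by rewrite (leq_trans (msizeD_le _ _))// geq_max s1.
  by rewrite !mevalD h1 h2.
have RZ c q : R q -> R (c *: q).
  move=> [q' [s h]]; exists (c *: q'); split=> [|u].
    by rewrite (leq_trans (msizeZ_le _ _)).
  by rewrite !mevalZ h.
have Rsum (q : {mpoly K[n]}) k : (msize q <= k)%N ->
    (forall mu : multinom n, mdeg mu < k -> R (mpolyX K mu))%N -> R q.
  move=> sq hk; rewrite (mpolywE sq); apply: (big_ind R) => // mu _.
  by apply: RZ; apply: hk; apply: bmdeg.
have Rle : forall k (mu : multinom n), (mdeg mu <= k)%N -> R (mpolyX K mu).
  elim=> [|k IH] mu.
    have [N0|N0] := posnP N; last first.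
      by move=> muk; exists (mpolyX K mu); rewrite msizeX (leq_ltn_trans muk N0).
    rewrite leqn0 => /eqP mu0.
    have [g [hg eqm]] := hr mu (etrans mu0 (esym N0)).
    exists 0; split=> [|u]; first by rewrite msize0.
    rewrite eqm raddf_sum meval0 /= big1// => j _; rewrite mevalM.
    have [->|[]] := hg j; first by rewrite meval0 mul0r.
    rewrite N0 leqn0 => /eqP ej _; have := hpf j.
    rewrite ej leqn0 msize_poly_eq0 subr_eq0 => /eqP <-.
    by rewrite Z0 mulr0.
  rewrite leq_eqVlt ltnS => /orP[/eqP muk|]; last exact: IH.
  have [kN|kN|kN] := ltngtP k.+1 N.
  - by exists (mpolyX K mu); rewrite msizeX muk.
  - have [i mui] : exists i, (0 < mu i)%N.
      apply: contrapT => h; have : mdeg mu = 0%N.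
        rewrite mdegE big1// => i _; apply/eqP; rewrite -leqn0 leqNgt.
        by apply/negP => hi; apply: h; exists i.
      by rewrite muk.
    have emu : mu = mnm_add (mnm1 i) (mnm_sub mu (mnm1 i)).
      apply/mnmP => j; rewrite mnmDE mnmBE mnm1E.
      by case: eqVneq => [<-|_]; rewrite ?subn0// subnKC.
    have [|q' [sq hq]] := IH (mnm_sub mu (mnm1 i)).
      move: muk; rewrite {1}emu mdegD mdeg1 add1n => -[->]; exact: leqnn.
    have [q'' [sq' hq']] : R (mX i * q').
      rewrite (mpolywE sq) mulr_sumr; apply: (big_ind R) => // l _.
      rewrite -scalerAr -mpolyXD; apply: RZ; apply: IH.
      by rewrite mdegD mdeg1 add1n (leq_trans (bmdeg l))// -ltnS.
    exists q''; split=> // u.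
    by rewrite emu mpolyXD mevalM hq -mevalM hq'.
  - have [g [hg eqm]] := hr mu (etrans muk kN).
    have [||q' [sq hq]] := Rsum (\sum_j g j * (f j - p j)) N.
    + apply: leq_trans (msize_sum _ _ _) _; apply/bigmax_leqP => j _.
      have [->|[ejN gj]] := hg j; first by rewrite mul0r msize0.
      have [->|gj0] := eqVneq (g j) 0; first by rewrite mul0r msize0.
      have [->|fj0] := eqVneq (f j - p j) 0; first by rewrite mulr0 msize0.
      rewrite msizeM// -(msizeN (_ - _)) opprB.
      have sg : (msize (g j) <= (N - e j).+1)%N.
        rewrite msizeE; apply/bigmax_leqP_seq => m0 hm _; rewrite ltnS.
        by move/dhomogP: gj => /(_ m0 hm) ->.
      have := leq_add sg (hpf j); rewrite addSn subnK//.
      by case: (_ + _)%N.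
    + by move=> l; rewrite -kN ltnS; apply: IH.
    exists q'; split=> // u; rewrite -hq eqm !raddf_sum; apply: eq_bigr => j _ /=.
    by rewrite !mevalM mevalB Z0 subr0.
have Rall (q : {mpoly K[n]}) : R q.
  by apply: (Rsum q (msize q)) => // mu _; apply: (Rle (mdeg mu)).
(* Lagrange interpolation: the indicator of each point is a product of affine forms separating it
   from the other points, brought to degree below [N]. *)
have /choice[q hq] : forall v, exists q : {mpoly K[n]}, (msize q <= N)%N /\
    forall u, meval (Z u) q = (u == v)%:R.
  move=> v.
  have /choice[L hL] : forall w, exists L : {mpoly K[n]}, w != v ->
      meval (Z w) L = 0 /\ meval (Z v) L = 1.
    move=> w; have [->|wv] := eqVneq w v; first by exists 0.
    have [i hi] : exists i, Z v i - Z w i != 0.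
      apply: contrapT => h; move/eqP: wv; apply; apply: Zinj => i.
      apply/eqP; rewrite eq_sym -subr_eq0; apply: contrapT => hi; apply: h.
      by exists i; apply/negP.
    exists ((Z v i - Z w i)^-1 *: (mX i - mC (Z w i))) => _.
    by rewrite !mevalZ !mevalB !mevalXU !mevalC subrr mulr0 mulVf.
  have [q [sq hq]] := Rall (\prod_(w | w != v) L w).
  exists q; split=> // u; rewrite -hq rmorph_prod /=.
  have [->|uv] := eqVneq u v.
    by apply: big1 => w wv; have [] := hL w wv.
  by rewrite (bigD1 u)//= (hL u uv).1 mul0r.
pose E : 'M[K]_(m, #|{: bmultinom n N}|) :=
  \matrix_(u, k) meval (Z u) (mpolyX K (bmnm (enum_val k : bmultinom n N))).
pose C : 'M[K]_(#|{: bmultinom n N}|, m) :=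
  \matrix_(k, v) mcoeff (bmnm (enum_val k : bmultinom n N)) (q v).
apply: (@mulmx1_min _ _ _ E C); apply/matrixP => u v; rewrite !mxE.
have [sq <-] := hq v.
rewrite [RHS](congr1 (meval (Z u)) (mpolywE sq)) raddf_sum /=.
rewrite (reindex (enum_rank : bmultinom n N -> _)) /=; last first.
  by apply: onW_bij; apply: enum_rank_bij.
by apply: eq_bigr => k _; rewrite !mxE enum_rankK mevalZ mulrC.
Qed.

End HomogeneousReduction.

(** * Projective Nullstellensatz *)

Section ProjectiveNullstellensatz.
Variables (K : closedFieldType) (n : nat) (T : finType) (e : T -> nat).
Hypothesis Kunc : uncountable_type K.
Variable f : T -> {mpoly K[n]}.
Hypothesis f_homog : forall j, f j \is ishomog1 (e j) mdeg.
Hypothesis f_zero : forall x : 'I_n -> K,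
  (forall j, meval x (f j) = 0) -> forall l, x l = 0.
Local Notation mX i := (mpolyX K (mnm1 i) : {mpoly K[n]}).

(* Homogenising with respect to X_l kills the multiples of X_l - 1 and sends
   1 to a power of X_l. *)
Lemma power_in_ideal (l : 'I_n) : exists N (h : T -> {mpoly K[n]}),
  mX l ^+ N = \sum_j h j * f j.
Proof.
(* Zeros of [I] would be common zeros of the forms with l-th coordinate 1, but the only common zero
   is the origin; so [I] contains 1. *)
pose I : set {mpoly K[n]} := [set p | exists (h : T -> {mpoly K[n]}) g,
  p = \sum_j h j * f j + g * (mX l - 1)].
have II : is_ideal I.
  split=> [|_ _ [h [g ->]] [h' [g' ->]]|a _ [h [g ->]]].
  - by exists (fun=> 0), 0; rewrite mul0r addr0 big1// => j _; rewrite mul0r.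
  - exists (fun j => h j + h' j), (g + g'); rewrite mulrDl addrACA -big_split /=.
    by congr (_ + _); apply: eq_bigr => j _; rewrite mulrDl.
  - exists (fun j => a * h j), (a * g); rewrite mulrDr mulrA mulr_sumr.
    by congr (_ + _); apply: eq_bigr => j _; rewrite mulrA.
have [[h [g h1]]|I1] := pselect (I 1); last first.
  have [x hx] := nullstellensatz Kunc II I1.
  have x0 : x l = 0.
    apply: f_zero => j; apply: hx; exists (fun k => (k == j)%:R), 0.
    rewrite mul0r addr0 (bigD1 j)//= eqxx mul1r big1 ?addr0// => k /negPf ->.
    by rewrite mul0r.
  have /eqP : meval x (mX l - 1) = 0.
    apply: hx; exists (fun=> 0), 1; rewrite mul1r big1 ?add0r// => j _.
    by rewrite mul0r.
  by rewrite mevalB mevalXU meval1 x0 sub0r oppr_eq0 oner_eq0.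
pose H N (p : {mpoly K[n]}) := \sum_(k < N.+1) mX l ^+ (N - k) * pihomog mdeg k p.
have HD N p q : H N (p + q) = H N p + H N q.
  by rewrite /H -big_split /=; apply: eq_bigr => k _; rewrite raddfD mulrDr.
have HN N p : H N (- p) = - H N p.
  by rewrite /H -sumrN; apply: eq_bigr => k _; rewrite raddfN mulrN.
have HM N d p q : q \is ishomog1 d mdeg -> (d <= N)%N ->
    H N (p * q) = H (N - d)%N p * q.
  have Hn M u : H M u = \sum_(0 <= k < M.+1) mX l ^+ (M - k) * pihomog mdeg k u.
    by rewrite big_mkord.
  move=> hq dN; rewrite !Hn.
  rewrite (@big_cat_nat _ _ _ d 0 N.+1)//=; last by rewrite leqW.
  rewrite big_nat_cond big1 ?add0r; last first.
    by move=> i /andP[/andP[_ id] _]; rewrite (pihomogM _ _ hq) leqNgt id mulr0.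
  rewrite -{1}(add0n d) big_addn subSn// mulr_suml.
  apply: eq_big_nat => i /andP[_ iN].
  by rewrite (pihomogM _ _ hq) leq_addl addnK -subnDA addnC mulrA.
(* [N] is at least every [e j], and exceeds the degree of [g], so that the component of degree [N]
   left over by the telescoping sum vanishes. *)
pose N := (msize g + \sum_j e j).+1.
have eN j : (e j <= N)%N.
  by rewrite /N (bigD1 j)//= ltnW// ltnS addnCA leq_addr.
exists N, (fun j => H (N - e j)%N (h j)).
have H1 : H N 1 = mX l ^+ N.
  rewrite /H big_ord_recl /= subn0 big1 ?addr0 => [|k _].
    by rewrite pihomog_dE ?mulr1// dhomog1.
  by rewrite (@pihomog_ne0 _ _ mdeg 0%N) ?mulr0// dhomog1.
rewrite -H1 h1 HD.
have Hsum (s : seq T) : H N (\sum_(j <- s) h j * f j) =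
    \sum_(j <- s) H (N - e j)%N (h j) * f j.
  elim: s => [|j s IH].
    by rewrite !big_nil /H big1// => k _; rewrite raddf0 mulr0.
  by rewrite !big_cons HD IH (HM _ _ _ _ (f_homog j)).
rewrite Hsum; set s := \sum_(j <- _) _; suff -> : H N (g * (mX l - 1)) = 0 by rewrite addr0.
have hX1 : mX l \is ishomog1 1 mdeg by rewrite dhomogX; apply/eqP; apply: mdeg1.
rewrite mulrBr mulr1 HD HN (HM _ 1%N _ _ hX1) ?(ltn0Sn _)// subn1 /=.
rewrite /H [X in _ - X]big_ord_recr /= subnn expr0 mul1r.
have gN : (msize g <= N)%N by rewrite /N leqW// leq_addr.
have -> : pihomog mdeg N g = 0.
  rewrite (pihomogwE _ _ gN) big1// => m /eqP mN.
  by have := bmdeg m; rewrite [X in (X < _)%N]mN ltnn.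
rewrite addr0 mulr_suml -sumrB big1// => k _.
by rewrite mulrAC -exprSr -subSn ?subrr// -ltnS.
Qed.

(** If X_l^(N_l) lies in the ideal for every l, a monomial of degree equal to the sum of the N_l is
    divisible by one of these powers. *)
Lemma reduces_of_no_zero : (0 < n)%N -> exists N, reduces e N f.
Proof.
move=> n0; have /choice[N /choice[h hN]] := power_in_ideal.
exists (\sum_l N l)%N => m mN.
have [l hl] : exists l, (N l <= m l)%N.
  apply: contrapT => hn; have : (mdeg m < \sum_l N l)%N.
    rewrite mdegE; have i0 : 'I_n by case: n n0 => // ? _; exact: ord0.
    rewrite (bigD1 i0)//= [X in (_ < X)%N](bigD1 i0)//=.
    have lt i : (m i < N i)%N by rewrite ltnNge; apply/negP => ?; apply: hn; exists i.
    by rewrite -addSn leq_add// leq_sum// => i _; apply: ltnW.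
  by rewrite mN ltnn.
have hp : mpolyX K m \is ishomog1 (\sum_l N l)%N mdeg by rewrite dhomogX; apply/eqP.
pose m' := mnm_sub m (mnm_muln (mnm1 l) (N l)).
apply: (homogeneous_part_sum (h := fun j => mpolyX K m' * h l j) f_homog hp).
transitivity (mpolyX K m' * mX l ^+ N l).
  rewrite mpolyXn -mpolyXD /m' submK//; apply/mnm_lepP => i.
  by rewrite mulmnE mnm1E; case: eqVneq => [<-|_]; rewrite ?mul1n// mul0n.
by rewrite hN mulr_sumr; apply: eq_bigr => j _; rewrite mulrA.
Qed.

End ProjectiveNullstellensatz.

(** * Zariski topology and irreducible components *)

Section Zariski.
Variables (K : fieldType) (n : nat).
Implicit Types (V W : set (n.-tuple K)).

Definition vanishing V : set {mpoly K[n]} :=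
  [set p | forall x, V x -> meval (tnth x) p = 0].

Lemma zeros_vanishing V : zariski_closed V -> zeros (vanishing V) = V.
Proof.
move=> [I ->]; apply/seteqP; split=> x hx p; last by apply.
by move=> Ip; apply: hx => y; apply.
Qed.

Lemma closed_setI V W : zariski_closed V -> zariski_closed W -> zariski_closed (V `&` W).
Proof.
move=> [I ->] [J ->]; exists (I `|` J); apply/seteqP; split.
  by move=> x [hI hJ] p [/hI|/hJ].
by move=> x h; split=> p hp; apply: h; [left|right].
Qed.

Lemma closed_setU V W : zariski_closed V -> zariski_closed W -> zariski_closed (V `|` W).
Proof.
move=> [I ->] [J ->].
exists [set p | exists q r, [/\ I q, J r & p = q * r]]; apply/seteqP; split.
  move=> x [h|h] p [q [r [Iq Jr ->]]]; rewrite mevalM.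
    by rewrite (h _ Iq) mul0r.
  by rewrite (h _ Jr) mulr0.
move=> x h; apply: contrapT => /not_orP[/existsNP[q /not_implyP[Iq q0]]].
move=> /existsNP[r /not_implyP[Jr r0]].
have /eqP : meval (tnth x) (q * r) = 0 by apply: h; exists q, r.
by rewrite mevalM mulf_eq0 => /orP[]/eqP.
Qed.

Lemma closed_set0 : zariski_closed (set0 : set (n.-tuple K)).
Proof.
exists setT; apply/seteqP; split=> // x /(_ 1 I) /eqP.
by rewrite meval1 oner_eq0.
Qed.

(** The Zariski topology is noetherian: along an infinite strictly decreasing sequence the union of
    the vanishing ideals would be generated by finitely many polynomials, all of them present at one
    stage. *)
Lemma closed_minimal (C : set (set (n.-tuple K))) :
  (forall V, C V -> zariski_closed V) -> C !=set0 ->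
  exists V, C V /\ forall W, C W -> W `<=` V -> W = V.
Proof.
move=> Ccl [V0 CV0]; apply: contrapT => hn.
have /choice[s hs] : forall V, exists W, C V -> [/\ C W, W `<=` V & W <> V].
  move=> V; have [CV|] := pselect (C V); last by exists V.
  apply: contrapT => h; apply: hn; exists V; split=> // W CW WV.
  by apply: contrapT => WV'; apply: h; exists W.
pose U k := iter k s V0.
have CU k : C (U k) by elim: k => //= k IH; have [] := hs _ IH.
have Udec k m : (k <= m)%N -> U m `<=` U k.
  move=> /subnK <-; elim: (m - k)%N => // j IH; apply: subset_trans IH.
  by have [] := hs _ (CU (j + k)%N).
have [l [lS lJ]] := noetherian_finite
  [set p | exists k, vanishing (U k) p] (@noetherian_mpoly K n).
have [m hm] : exists m, forall p, p \in l -> vanishing (U m) p.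
  elim: l lS {lJ} => [|p l IH] h; first by exists 0%N.
  have [|m hm] := IH; first by move=> q ql; apply: h; rewrite inE ql orbT.
  have [|k hk] := h p; first by rewrite mem_head.
  exists (maxn k m) => q; rewrite inE => /orP[/eqP-> x|ql x] hx.
    by apply: hk; apply: Udec hx; apply: leq_maxl.
  by apply: (hm _ ql); apply: Udec hx; apply: leq_maxr.
have [_ sub neq] := hs _ (CU m); apply: neq; apply/seteqP; split=> // x hx.
change (U m.+1 x); rewrite -(zeros_vanishing (Ccl _ (CU m.+1))) => p hp.
apply: (lJ [set p | meval (tnth x) p = 0]).
- split=> [|p1 p2|a p1] /=; first exact: meval0.
    by rewrite mevalD => -> ->; rewrite addr0.
  by rewrite mevalM => ->; rewrite mulr0.
- by move=> q ql; apply: (hm _ ql).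
- by exists m.+1.
Qed.

Definition seq_union (s : seq (set (n.-tuple K))) := \big[setU/set0]_(Z <- s) Z.

Lemma seq_unionP (s : seq (set (n.-tuple K))) x :
  seq_union s x <-> exists Z, [/\ List.In Z s & Z x].
Proof.
rewrite /seq_union; elim: s => [|Z s IH]; first by rewrite big_nil; split=> // -[? []].
rewrite big_cons; split=> [[Zx|/IH[W [Ws Wx]]]|[W [/= [<-|Ws] Wx]]].
- by exists Z; split=> //; left.
- by exists W; split=> //; right.
- by left.
- by right; apply/IH; exists W.
Qed.

(** Noetherian induction: a minimal counterexample is covered by two closed sets, neither containing
    it, and its intersections with them are smaller. *)
Lemma irreducible_components V : zariski_closed V -> exists s,
  (forall Z, List.In Z s -> zariski_irreducible Z) /\ V = seq_union s.
Proof.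
move=> cV; apply: contrapT => bad.
have [||W [[cW badW] Wmin]] := @closed_minimal [set V | zariski_closed V /\
  ~ exists s, (forall Z, List.In Z s -> zariski_irreducible Z) /\ V = seq_union s].
- by move=> ? [].
- by exists V.
apply: badW.
have [W0|W0] := pselect (W !=set0); last first.
  by exists [::]; rewrite /seq_union big_nil; split=> //; apply/eqP/negPn/negP => /set0P.
have [irr|/not_and3P[//|//|]] := pselect (zariski_irreducible W).
  by exists [:: W]; rewrite /seq_union big_seq1; split=> // Z /= [<-|].
move=> /existsNP[A /existsNP[B /not_implyP[cA /not_implyP[cB]]]].
move=> /not_implyP[WAB /not_orP[nA nB]].
have key D : zariski_closed D -> ~ W `<=` D -> exists s,
    (forall Z, List.In Z s -> zariski_irreducible Z) /\ W `&` D = seq_union s.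
  move=> cD nD; apply: contrapT => h; apply: nD.
  have <- : W `&` D = W; last exact: subIsetr.
  by apply: Wmin; [split=> //; apply: closed_setI|apply: subIsetl].
have [s [hs es]] := key _ cA nA; have [t [ht et]] := key _ cB nB.
exists (s ++ t); split=> [Z hZ|].
  by have [] := List.in_app_or _ _ _ hZ; [apply: hs|apply: ht].
rewrite /seq_union big_cat /= -/(seq_union s) -/(seq_union t) -es -et -setIUr.
by apply/esym/setIidPl.
Qed.

Lemma irreducible_sub_union Z (s : seq (set (n.-tuple K))) : zariski_irreducible Z ->
  (forall W, List.In W s -> zariski_closed W) -> Z `<=` seq_union s ->
  exists W, List.In W s /\ Z `<=` W.
Proof.
move=> [cZ Z0 irr]; elim: s => [|W s IH] cs.
  by rewrite /seq_union big_nil => Zs; have [z Zz] := Z0; have := Zs _ Zz.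
have cu : forall t, (forall W, List.In W t -> zariski_closed W) ->
    zariski_closed (seq_union t).
  elim=> [|Y t IHt] h; first by rewrite /seq_union big_nil; apply: closed_set0.
  rewrite /seq_union big_cons; apply: closed_setU; first by apply: h; left.
  by apply: IHt => X Xt; apply: h; right.
rewrite /seq_union big_cons => /irr[||ZW|Zs].
- by apply: cs; left.
- by apply: cu => X Xs; apply: cs; right.
- by exists W; split=> //; left.
- by have [|Y [Ys ZY]] := IH _ Zs; [move=> X Xs; apply: cs; right|exists Y; split=> //; right].
Qed.

End Zariski.

(** * Sections of cones by rational hyperplanes *)

Section LinearSections.
Variables (K : numFieldType) (n : nat).

Lemma poly_nat_nonroot (p : {poly K}) : p != 0 -> exists t : nat, p.[t%:R] != 0.
Proof.
move=> p0; apply: contrapT => h.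
have rp t : root p t%:R.
  by apply/negPn/negP => hp; apply: h; exists t; rewrite -/(root _ _).
have := @max_poly_roots _ p [seq (i%:R : K) | i <- iota 0 (size p)] p0.
rewrite size_map size_iota ltnn => H; suff: false by []. apply: H; first by apply/allP => _ /mapP[i _ ->].
by rewrite map_inj_uniq ?iota_uniq// => i j /eqP; rewrite eqr_nat => /eqP.
Qed.

(** Along the coefficient vectors (t^j) every nonzero point gives a nonzero polynomial in t, and
    some natural number t avoids the roots of finitely many of them. The linear form is thus
    integral, as the later counting of its values requires. *)
Lemma avoiding_linear_form (s : seq ('I_n -> K)) :
  (forall x, List.In x s -> exists j, x j != 0) ->
  exists l : 'I_n -> int, forall x, List.In x s -> \sum_j (l j)%:~R * x j != 0.
Proof.
move=> hs; pose q (x : 'I_n -> K) : {poly K} := \sum_j x j *: 'X^j.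
have q0 x : List.In x s -> q x != 0.
  move=> /hs[j xj]; apply/eqP => /polyP/(_ j); rewrite coef0 coef_sum (bigD1 j)//=.
  rewrite coefZ coefXn eqxx mulr1 big1 ?addr0; first by move/eqP; rewrite (negPf xj).
  move=> i ij; rewrite coefZ coefXn eq_sym [(_ == _ :> nat)](_ : _ = (i == j))//.
  by rewrite (negPf ij) mulr0.
have [t ht] : exists t : nat, forall x, List.In x s -> (q x).[t%:R] != 0.
  pose Q := \prod_(x <- s) q x.
  have [t ht] : exists t : nat, Q.[t%:R] != 0.
    apply: poly_nat_nonroot; rewrite /Q; elim: s {hs Q} q0 => [|x s IH] h.
      by rewrite big_nil oner_neq0.
    rewrite big_cons mulf_neq0//; first by apply: h; left.
    by apply: IH => y ys; apply: h; right.
  exists t => x xs; apply: contra_neq ht => hx.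
  rewrite /Q; elim: s {hs Q q0} xs => //= y s IH [->|xs].
    by rewrite big_cons hornerM hx mul0r.
  by rewrite big_cons hornerM IH// mulr0.
exists (fun j => (t ^ j)%:Z) => x xs; have := ht x xs.
rewrite /q horner_sum; apply: contra_neq => h; rewrite -[RHS]h; apply: eq_bigr => j _.
by rewrite hornerZ hornerXn mulrC -pmulrn natrX.
Qed.

Definition hyperplane (l : 'I_n -> int) : set (n.-tuple K) :=
  [set x | \sum_j (l j)%:~R * tnth x j = 0].

Lemma closed_hyperplane l : zariski_closed (hyperplane l).
Proof.
pose p : {mpoly K[n]} := \sum_j (l j)%:~R *: mpolyX K (mnm1 j).
have ev x : meval (tnth x) p = \sum_j (l j)%:~R * tnth x j.
  by rewrite /p raddf_sum /=; apply: eq_bigr => j _; rewrite mevalZ mevalXU.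
exists [set p]; apply/seteqP; split=> x; first by move=> h _ ->; rewrite ev.
by move=> h; rewrite /hyperplane /= -ev; apply: h.
Qed.

Definition line (x : n.-tuple K) : set (n.-tuple K) :=
  [set y | exists t, forall j, tnth y j = t * tnth x j].

(** Restriction to the line turns polynomials into univariate ones; the product of two nonzero ones
    is nonzero and cannot vanish at all natural numbers. *)
Lemma irreducible_line (x : n.-tuple K) : (exists j, tnth x j != 0) ->
  zariski_irreducible (line x).
Proof.
move=> [j0 xj0]; split.
- exists [set p | exists i j, p = tnth x i *: mpolyX K (mnm1 j) -
      tnth x j *: mpolyX K (mnm1 i)]; apply/seteqP; split.
    move=> y [t ht] _ [i [j ->]].
    by rewrite mevalB !mevalZ !mevalXU !ht; ring.
  move=> y hy; exists (tnth y j0 / tnth x j0) => j.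
  have : meval (tnth y) (tnth x j0 *: mpolyX K (mnm1 j) -
      tnth x j *: mpolyX K (mnm1 j0)) = 0 by apply: hy; exists j0, j.
  rewrite mevalB !mevalZ !mevalXU => /eqP; rewrite subr_eq0 => /eqP h.
  by rewrite mulrAC [tnth y j0 * _]mulrC -h mulrC mulKf.
- by exists x, 1 => j; rewrite mul1r.
- move=> A B [I ->] [J ->] LAB; apply: contrapT => /not_orP[nA nB].
  pose u (p : {mpoly K[n]}) : {poly K} := mmap polyC (fun i => tnth x i *: 'X) p.
  have uE p t : (u p).[t] = meval (fun i => t * tnth x i) p.
    rewrite /u; elim/mpolyind: p => [|c m p _ _ IH].
      by rewrite /mmap msupp0 big_nil horner0 meval0.
    rewrite mmapD mmapZ hornerD hornerM hornerC mevalD mevalZ -IH; congr (_ * _ + _).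
    rewrite mmapX /mmap1 horner_prod mevalX; apply: eq_bigr => i _.
    by rewrite horner_exp hornerZ hornerX mulrC.
  have pt t : line x [tuple t * tnth x i | i < n] by exists t => j; rewrite tnth_mktuple.
  have evpt t p : meval (tnth [tuple t * tnth x i | i < n]) p = (u p).[t].
    by rewrite uE; apply: meval_eq => i; rewrite tnth_mktuple.
  have key I' : ~ line x `<=` zeros I' -> exists p, I' p /\ u p != 0.
    move=> /existsNP[y /not_implyP[[t ht] /existsNP[p /not_implyP[Ip p0]]]].
    exists p; split=> //; apply/eqP => up; apply: p0.
    by rewrite -[RHS](horner0 t) -up uE; apply: meval_eq.
  have [p [Ip up]] := key _ nA; have [q [Jq uq]] := key _ nB.
  have [t] := poly_nat_nonroot (mulf_neq0 up uq).
  rewrite hornerM mulf_eq0 negb_or => /andP[pt0 qt0].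
  have [h|h] := LAB _ (pt t%:R).
    by have := h _ Ip; rewrite evpt => /eqP; rewrite (negPf pt0).
  by have := h _ Jq; rewrite evpt => /eqP; rewrite (negPf qt0).
Qed.

Lemma irreducible_origin : zariski_irreducible [set [tuple 0 | _ < n] : n.-tuple K].
Proof.
split.
- exists [set p | exists j, p = mpolyX K (mnm1 j)]; apply/seteqP; split.
    by move=> _ -> _ [j ->]; rewrite mevalXU tnth_mktuple.
  move=> x hx; apply: eq_from_tnth => j; rewrite tnth_mktuple.
  by rewrite -(mevalXU (tnth x) j); apply: hx; exists j.
- by exists [tuple 0 | _ < n].
- by move=> A B _ _ h; have [hA|hB] := h _ erefl; [left|right] => _ ->.
Qed.

(* If the section were nonzero, it would contain a line, which extends to a
   chain of length k + 1. *)
Lemma linear_section (V : set (n.-tuple K)) (k : nat) :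
  zariski_closed V ->
  (forall x (t : K), V x -> V [tuple t * tnth x i | i < n]) ->
  (forall m Z, irreducible_chain V m Z -> (m <= k)%N) ->
  exists l : 'I_k -> 'I_n -> int, forall x, V x ->
    (forall i, \sum_j (l i j)%:~R * tnth x j = 0) -> forall j, tnth x j = 0.
Proof.
move=> cV coneV hk.
pose S (l : nat -> 'I_n -> int) m := V `&` [set x | forall i, (i < m)%N -> hyperplane (l i) x].
have cS l m : zariski_closed (S l m).
  elim: m => [|m IH].
    by rewrite (_ : S l 0%N = V)//; apply/seteqP; split=> [x []|x Vx].
  rewrite (_ : S l m.+1 = S l m `&` hyperplane (l m)).
    by apply: closed_setI => //; apply: closed_hyperplane.
  apply/seteqP; split=> [x [Vx h]|x [[Vx h] hm]].
    by split; [split=> // i im; apply: h; rewrite ltnW|apply: h].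
  by split=> // i; rewrite ltnS leq_eqVlt => /orP[/eqP->|/h].
(* Invariant of the construction: every irreducible subset with a nonzero point inside the section
   by [m] hyperplanes is the bottom of a chain of length [m] in [V]. *)
have chains m : exists l, forall Z, zariski_irreducible Z -> Z `<=` S l m ->
    (exists x, Z x /\ exists j, tnth x j != 0) ->
    exists C, irreducible_chain V m C /\ C 0%N = Z.
  elim: m => [|m [l IH]].
    exists (fun _ _ => 0) => Z irrZ ZV _; exists (fun=> Z); split=> //.
    by split=> // i _; split=> // x /ZV[].
  have [cs [irrcs ecs]] := irreducible_components (cS l m).
  (* The next hyperplane will miss one chosen nonzero point of each component. An irreducible subset
     of the new section is then strictly smaller than the component containing it, which lengthens
     the chain by one. *)
  have [pts [pts0 hpts]] : exists pts : seq ('I_n -> K),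
      (forall x, List.In x pts -> exists j, x j != 0) /\
      forall Z, List.In Z cs -> (exists x, Z x /\ exists j, tnth x j != 0) ->
        exists x, Z x /\ List.In (tnth x) pts.
    elim: cs {irrcs ecs} => [|Z cs [pts [h1 h2]]]; first by exists [::].
    have [[x [Zx xj]]|hZ] := pselect (exists x, Z x /\ exists j, tnth x j != 0).
      exists (tnth x :: pts); split=> [y [<-//|/h1//]|Y [<- _|Ys Y0]].
        by exists x; split=> //; left.
      by have [y [? ?]] := h2 _ Ys Y0; exists y; split=> //; right.
    exists pts; split=> // Y [<-//|Ys]; exact: h2.
  have [a ha] := avoiding_linear_form pts0.
  exists (fun i => if i == m then a else l i) => Z irrZ ZS [x [Zx xj]].
  have ZSm : Z `<=` S l m.
    move=> y /ZS[Vy hy]; split=> // i im; have := hy i (leqW im).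
    by rewrite ltn_eqF.
  have [||W [Wcs ZW]] := irreducible_sub_union (s := cs) irrZ.
    by move=> W /irrcs[].
    by rewrite -ecs.
  have [C [[C1 C2] C0]] : exists C, irreducible_chain V m C /\ C 0%N = W.
    apply: IH; [exact: irrcs| |by exists x; split=> //; apply: ZW].
    by rewrite ecs => y Wy; apply/seq_unionP; exists W.
  exists (fun i => if i is j.+1 then C j else Z); split=> //; split.
    move=> [_|i im]; last exact: C1.
    by split=> // y /ZS[].
  move=> [_|i im]; last exact: C2.
  rewrite C0; split=> // WZ.
  have [|y [Wy ypts]] := hpts W Wcs; first by exists x; split=> //; apply: ZW.
  have [_ /(_ m (ltnSn m))] := ZS _ (WZ _ Wy); rewrite eqxx => h0.
  by have := ha _ ypts; rewrite h0 eqxx.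
have [l hl] := chains k.
exists (fun i => l i) => x Vx xl j; apply: contrapT => /eqP xj.
have [|||C [[C1 C2] C0]] := hl (line x).
- by apply: irreducible_line; exists j.
- move=> y [t ht]; split.
    suff -> : y = [tuple t * tnth x i | i < n] by apply: coneV.
    by apply: eq_from_tnth => i; rewrite tnth_mktuple.
  move=> i ik; rewrite /hyperplane /=.
  transitivity (t * \sum_j0 (l i j0)%:~R * tnth x j0).
    by rewrite mulr_sumr; apply: eq_bigr => i' _; rewrite ht mulrCA.
  by rewrite (xl (Ordinal ik)) mulr0.
- by exists x; split; [exists 1 => i; rewrite mul1r|exists j].
have := hk k.+1 (fun i => if i is i'.+1 then C i' else [set [tuple 0 | _ < n]]).
rewrite ltnn => H; suff: false by []. apply: H; split.
  move=> [_|i im]; last exact: C1.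
  split; first exact: irreducible_origin.
  move=> _ ->; rewrite (_ : mktuple _ = [tuple 0 * tnth x i | i < n]); first exact: coneV.
  by apply: eq_from_tnth => i; rewrite !tnth_mktuple mul0r.
move=> [_|i im]; last exact: C2.
rewrite C0; split=> [_ ->|h].
  by exists 0 => i; rewrite tnth_mktuple mul0r.
have : line x x by exists 1 => i; rewrite mul1r.
move=> /h xx; move: xj; by rewrite xx tnth_mktuple eqxx.
Qed.

End LinearSections.

(** * Uniformity of the reduction in affine families of forms *)

Section UniformReduction.
Variables (K : fieldType) (n r : nat) (T : finType) (e : T -> nat).
Variables (I : Type) (N : I -> nat) (f0 : I -> T -> {mpoly K[n]})
  (f1 : I -> 'I_r -> T -> {mpoly K[n]}).
Hypothesis f0_homog : forall i j, f0 i j \is ishomog1 (e j) mdeg.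
Hypothesis f1_homog : forall i k j, f1 i k j \is ishomog1 (e j) mdeg.

Definition affine_family i (a : 'I_r -> K) j := f0 i j + \sum_k a k *: f1 i k j.

Lemma affine_family_homog i a j : affine_family i a j \is ishomog1 (e j) mdeg.
Proof.
rewrite /affine_family; apply: rpredD; first exact: f0_homog.
by apply: rpred_sum => k _; apply: rpredZ; apply: f1_homog.
Qed.

Lemma macaulay_affine i a : macaulay e (N i) (affine_family i a) =
  macaulay e (N i) (f0 i) + \sum_k a k *: macaulay e (N i) (f1 i k).
Proof.
apply/matrixP => u v; rewrite mxE [RHS]mxE summxE [X in _ = X + _]mxE /=.
under [X in _ = _ + X]eq_bigr do rewrite !mxE /=.
case: (_ == _); last by rewrite big1 ?addr0// => k _; rewrite mulr0.
rewrite mulrDr mulr_sumr mcoeffD raddf_sum /=; congr (_ + _).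
by apply: eq_bigr => k _; rewrite -scalerAr mcoeffZ.
Qed.

(* Invertibility of H *m macaulay is an open condition on a, given by the
   nonvanishing of a determinant; open sets are quasi-compact. *)
Lemma reduces_uniform (P : set ('I_r -> K)) :
  (forall a, P a -> exists i, reduces e (N i) (affine_family i a)) ->
  exists s : seq I, forall a, P a ->
    exists i, List.In i s /\ reduces e (N i) (affine_family i a).
Proof.
move=> hP.
(* Polynomials in the parameter whose nonvanishing certifies the reduction with one fixed index [i].
   Finitely many of them have the same common zeros as all of [S]. *)
pose S : set {mpoly K[r]} := [set g | exists i, forall a, meval a g != 0 ->
  reduces e (N i) (affine_family i a)].
have [l [lS lJ]] := noetherian_finite S (@noetherian_mpoly K r).
have [s hs] : exists s : seq I, forall g, g \in l -> exists i, List.In i s /\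
    forall a, meval a g != 0 -> reduces e (N i) (affine_family i a).
  elim: l lS {lJ} => [|g l IH] h; first by exists [::].
  have [|s hs] := IH; first by move=> x xl; apply: h; rewrite inE xl orbT.
  have [|i hi] := h g; first by rewrite mem_head.
  exists (i :: s) => g'; rewrite inE => /orP[/eqP->|/hs[i' [i's hi']]].
    by exists i; split=> //; left.
  by exists i'; split=> //; right.
exists s => a Pa; apply: contrapT => hn.
have [i /(reduces_macaulay)[H HM]] := hP a Pa.
pose A : 'M[{mpoly K[r]}]_(_, _) := map_mx (@mpolyC r K) (macaulay e (N i) (f0 i)) +
  \sum_k mpolyX K (mnm1 k) *: map_mx (@mpolyC r K) (macaulay e (N i) (f1 i k)).
have evA b : map_mx (meval b) A = macaulay e (N i) (affine_family i b).
  rewrite macaulay_affine; apply/matrixP => u v.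
  rewrite mxE [A u v]mxE summxE [RHS]mxE summxE mevalD raddf_sum /= mxE mevalC.
  by congr (_ + _); apply: eq_bigr => k _; rewrite !mxE mevalM mevalXU mevalC.
(* [H] is a left inverse of the Macaulay matrix at [a] only, but the determinant stays nonzero, and
   thus certifies the reduction, in a whole neighbourhood; at [a] itself it is 1. *)
pose g : {mpoly K[r]} := \det (map_mx (@mpolyC r K) H *m A).
have evg b : meval b g = \det (H *m macaulay e (N i) (affine_family i b)).
  rewrite /g -det_map_mx map_mxM evA; congr (\det (_ *m _)).
  by apply/matrixP => u v; rewrite !mxE /= mevalC.
have gS : S g.
  exists i => b; rewrite evg => hb.
  set M := H *m _ in hb.
  have uM : M \in unitmx by rewrite unitmxE unitfE.
  apply: (macaulay_reduces (H := invmx M *m H)); first exact: affine_family_homog.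
  by rewrite -mulmxA mulVmx.
have /eqP : meval a g = 0.
  apply: (lJ [set p | meval a p = 0]) => //.
  - split=> [|p1 p2|c p1] /=; first exact: meval0.
      by rewrite mevalD => -> ->; rewrite addr0.
    by rewrite mevalM => ->; rewrite mulr0.
  - move=> q ql; apply/eqP; apply: contrapT => /negP q0; apply: hn.
    by have [i' [i's hi']] := hs _ ql; exists i'; split=> //; apply: hi'.
by rewrite evg HM det1 oner_eq0.
Qed.

End UniformReduction.

(** * Gradients of the pencil cut by linear forms *)

Section GradientReduction.
Variables (R : realType) (r s d k : nat) (F : 'I_r -> {mpoly int[s]}).
Hypothesis s_gt0 : (0 < s)%N.
Hypothesis F_homog : forall i, F i \is ishomog1 d mdeg.
Hypothesis d_gt1 : (1 < d)%N.
Local Notation K := (R[i]).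

Definition complex_form (i : 'I_r) : {mpoly K[s]} := map_mpoly intr (F i).

Lemma complex_form_homog i : complex_form i \is ishomog1 d mdeg.
Proof.
apply/dhomogP => m; rewrite mcoeff_msupp mcoeff_map_mpoly => h.
move/dhomogP: (F_homog i); apply; rewrite mcoeff_msupp.
by apply: contra h => /eqP ->.
Qed.

Lemma mderiv_homog (L : ringType) (j : 'I_s) (p : {mpoly L[s]}) m :
  p \is ishomog1 m.+1 mdeg -> mderiv j p \is ishomog1 m mdeg.
Proof.
move=> hp; apply/dhomogP => mu; rewrite mcoeff_msupp mcoeff_deriv => h.
have : mnm_add mu (mnm1 j) \in msupp p.
  by rewrite mcoeff_msupp; apply: contra h => /eqP ->; rewrite mul0rn.
move=> hmu; have : mdeg (mnm_add mu (mnm1 j)) = m.+1 by move/dhomogP: hp; apply.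
by rewrite mdegD mdeg1 addn1 => -[].
Qed.

Definition section_degree (t : 'I_s + 'I_k) : nat := if t is inl _ then d.-1 else 1.

Definition linear_form (l : 'I_s -> int) : {mpoly K[s]} :=
  \sum_j (l j)%:~R *: mpolyX K (mnm1 j).

(* The partial derivatives of a_1 F_1 + ... + a_r F_r and k linear forms. *)
Definition section_forms (a : 'I_r -> K) (l : 'I_k -> 'I_s -> int)
    (t : 'I_s + 'I_k) : {mpoly K[s]} :=
  match t with
  | inl j => \sum_i a i *: mderiv j (complex_form i)
  | inr i => linear_form (l i)
  end.

Lemma section_forms_homog a l t : section_forms a l t \is ishomog1 (section_degree t) mdeg.
Proof.
case: t => [j|i] /=; apply: rpred_sum => t _; apply: rpredZ.
  by apply: mderiv_homog; rewrite prednK ?complex_form_homog// ltnW.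
by rewrite dhomogX; apply/eqP; apply: mdeg1.
Qed.

Lemma gradient_zerosP (a : {ffun 'I_r -> int}) (x : s.-tuple K) :
  gradient_zeros R F a x <->
  forall j, meval (tnth x) (\sum_i (a i)%:~R *: mderiv j (complex_form i)) = 0.
Proof.
have eG : map_mpoly intr (\sum_(i < r) a i *: F i) =
    \sum_i (a i)%:~R *: complex_form i :> {mpoly K[s]}.
  apply/mpolyP => m; rewrite mcoeff_map_mpoly (raddf_sum (@mcoeff s int m)).
  rewrite (raddf_sum (@mcoeff s K m)).
  etransitivity; first exact: (rmorph_sum (intmul (1 : K))).
  by apply: eq_bigr => i _; rewrite /= !mcoeffZ mcoeff_map_mpoly rmorphM.
have e j : mderiv j (map_mpoly intr (\sum_(i < r) a i *: F i)) =
    \sum_i (a i)%:~R *: mderiv j (complex_form i).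
  rewrite eG (raddf_sum (@mderiv s K j)).
  by apply: eq_bigr => i _; rewrite /= mderivZ.
by split=> h j; [rewrite -e|have := h j; rewrite -e]; first exact: (h j).
Qed.

Lemma meval_homog_scale (L : comRingType) m (p : {mpoly L[s]}) (t : L) (x : 'I_s -> L) :
  p \is ishomog1 m mdeg -> meval (fun i => t * x i) p = t ^+ m * meval x p.
Proof.
move=> /dhomogP hp; rewrite !mevalE mulr_sumr !big_seq; apply: eq_bigr => mu hmu.
rewrite mulrCA; congr (_ * _); rewrite -(hp _ hmu).
under eq_bigr do rewrite exprMn.
rewrite big_split /=; congr (_ * _).
by rewrite -expr_sum -mdegE.
Qed.

(** For a single [a], the zeros of the gradient form a cone with chains of length at most [k], so
    [k] linear forms cut it down to the origin and the projective Nullstellensatz supplies a degree.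
    The system is linear in [a], whence finitely many pairs [(N, l)] serve all nonzero [a]. *)
Lemma gradient_section_uniform :
  (forall (a : {ffun 'I_r -> int}) m Z, a != 0%R ->
     irreducible_chain (gradient_zeros R F a) m Z -> (m <= k)%N) ->
  exists L : seq (nat * ('I_k -> 'I_s -> int)), forall a : {ffun 'I_r -> int}, a != 0%R ->
    exists N l, List.In (N, l) L /\
      reduces section_degree N (section_forms (fun i => (a i)%:~R) l).
Proof.
move=> hk.
pose I := (nat * ('I_k -> 'I_s -> int))%type.
pose f0 (i : I) (t : 'I_s + 'I_k) : {mpoly K[s]} :=
  if t is inr u then linear_form (i.2 u) else 0.
pose f1 (i : I) (v : 'I_r) (t : 'I_s + 'I_k) : {mpoly K[s]} :=
  if t is inl j then mderiv j (complex_form v) else 0.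
have fE i a : affine_family f0 f1 i a = section_forms a i.2.
  apply/funext => -[j|u]; rewrite /affine_family /= ?add0r//.
  by rewrite big1 ?addr0// => v _; rewrite scaler0.
have f0h i j : f0 i j \is ishomog1 (section_degree j) mdeg.
  case: j => [j|u] /=; first exact: dhomog0.
  exact: (section_forms_homog (fun=> 0) i.2 (inr u)).
have f1h i v j : f1 i v j \is ishomog1 (section_degree j) mdeg.
  case: j => [j|u] /=; last exact: dhomog0.
  by apply: mderiv_homog; rewrite prednK ?complex_form_homog// ltnW.
have [|L hL] := @reduces_uniform K s r _ section_degree I fst f0 f1 f0h f1h
    [set a | exists2 a' : {ffun 'I_r -> int}, a' != 0%R & a = fun i => (a' i)%:~R].
  move=> _ [a a0 ->].
  have [|||l hl] := @linear_section K s (gradient_zeros R F a) k.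
  - exists [set p | exists j, p = \sum_i (a i)%:~R *: mderiv j (complex_form i)].
    apply/seteqP; split=> x.
      by move=> /gradient_zerosP h _ [j ->].
    by move=> h; apply/gradient_zerosP => j; apply: h; exists j.
  - move=> x t /gradient_zerosP h; apply/gradient_zerosP => j.
    transitivity (meval (fun i => t * tnth x i)
        (\sum_i (a i)%:~R *: mderiv j (complex_form i))).
      by apply: meval_eq => i; rewrite tnth_mktuple.
    rewrite (meval_homog_scale _ _ (section_forms_homog (fun i => (a i)%:~R)
      (fun _ _ => 0) (inl j))).
    by rewrite h mulr0.
  - by move=> m Z; apply: hk.
  have [|N hN] := @reduces_of_no_zero K s _ section_degree (@complex_uncountable R)
    (section_forms (fun i => (a i)%:~R) l) (section_forms_homog _ _) _ s_gt0.
    move=> x hx j; pose X : s.-tuple K := [tuple x i | i < s].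
    have xX : tnth X = x by apply/funext => i; rewrite tnth_mktuple.
    rewrite -xX; apply: hl.
      by apply/gradient_zerosP => j'; rewrite xX; apply: (hx (inl j')).
    move=> i; have := hx (inr i); rewrite /= /linear_form raddf_sum /= => h.
    rewrite -[RHS]h; apply: eq_bigr => j' _.
    by rewrite mevalZ mevalXU tnth_mktuple.
  by exists (N, l); rewrite fE.
exists L => a a0; have [|[N l] [inL red]] := hL (fun i => (a i)%:~R).
  by exists a.
by exists N, l; split=> //; rewrite fE in red.
Qed.

End GradientReduction.

(** * Finite differences of polynomial functions *)

Section Differences.
Variables (s : nat).
Local Notation V := 'rV[int]_s.

Definition diff (A : zmodType) (h : V) (f : V -> A) (x : V) : A := f (x + h) - f x.

Fixpoint diffs (A : zmodType) (t : seq V) (f : V -> A) : V -> A :=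
  if t is h :: t' then diffs t' (diff h f) else f.

(* f is a polynomial function of degree < n. *)
Fixpoint polyfun (n : nat) (f : V -> int) : Prop :=
  if n is m.+1 then forall h, polyfun m (diff h f) else forall x, f x = 0.

Lemma diffs_sum (A : zmodType) (I : Type) (r : seq I) (f : I -> V -> A) t x :
  diffs t (fun y => \sum_(i <- r) f i y) x = \sum_(i <- r) diffs t (f i) x.
Proof.
elim: t f x => //= h t IH f x; rewrite -IH; congr (diffs t _ x).
by apply/funext => y; rewrite /diff sumrB.
Qed.

Lemma polyfun_ext n f g : f =1 g -> polyfun n f -> polyfun n g.
Proof. by move=> /funext ->. Qed.

Lemma polyfunD n f g : polyfun n f -> polyfun n g -> polyfun n (fun x => f x + g x).
Proof.
elim: n f g => [|n IH] f g /= hf hg x; first by rewrite hf hg addr0.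
apply: polyfun_ext (IH _ _ (hf x) (hg x)) => y; rewrite /diff; ring.
Qed.

Lemma polyfunZ n c f : polyfun n f -> polyfun n (fun x => c * f x).
Proof.
elim: n f => [|n IH] f /= hf x; first by rewrite hf mulr0.
apply: polyfun_ext (IH _ (hf x)) => y; rewrite /diff; ring.
Qed.

Lemma polyfunS n f : polyfun n f -> polyfun n.+1 f.
Proof.
elim: n f => [|n IH] f /= hf x; last by apply: IH.
by move=> y; rewrite /diff !hf subr0.
Qed.

Lemma polyfun_leq m n f : (m <= n)%N -> polyfun m f -> polyfun n f.
Proof. by move=> /subnK <-; elim: (n - m)%N => // k IH /IH; apply: polyfunS. Qed.

Lemma polyfun_diff n f h : polyfun n f -> polyfun n.-1 (diff h f).
Proof.
by case: n => [|n] /= hf; [move=> x; rewrite /diff !hf subr0|apply: hf].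
Qed.

Lemma polyfunX n f j : polyfun n f -> polyfun n.+1 (fun x => x 0 j * f x).
Proof.
elim: n f => [|n IH] f hf h.
  by move=> x; rewrite /diff !hf !mulr0 subr0.
change (polyfun n.+1 (diff h (fun x => x 0 j * f x))).
apply: (@polyfun_ext _ (fun x => x 0 j * diff h f x + (h 0 j * f x + h 0 j * diff h f x))).
  by move=> x; rewrite /diff !mxE; ring.
apply: polyfunD; first by apply: IH; apply: hf.
by apply: polyfunD; apply: polyfunZ => //; apply: polyfunS; apply: hf.
Qed.

Definition evZ (p : {mpoly int[s]}) (x : V) : int := meval (fun j => x 0 j) p.

Definition dir (h : V) (p : {mpoly int[s]}) : {mpoly int[s]} :=
  \sum_j h 0 j *: mderiv j p.

Fixpoint dirs (t : seq V) p := if t is h :: t' then dirs t' (dir h p) else p.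

Lemma dirD h p q : dir h (p + q) = dir h p + dir h q.
Proof. by rewrite /dir -big_split; apply: eq_bigr => j _; rewrite mderivD scalerDr. Qed.

Lemma dirZ h c p : dir h (c *: p) = c *: dir h p.
Proof.
rewrite /dir scaler_sumr; apply: eq_bigr => j _.
by rewrite mderivZ !scalerA mulrC.
Qed.

Lemma dirM h p q : dir h (p * q) = dir h p * q + p * dir h q.
Proof.
rewrite /dir mulr_suml mulr_sumr -big_split; apply: eq_bigr => j _ /=.
by rewrite mderivM scalerDr -scalerAl -scalerAr.
Qed.

Lemma mderiv_sumZ j (I : Type) (r : seq I) (c : I -> int) (f : I -> {mpoly int[s]}) :
  mderiv j (\sum_(i <- r) c i *: f i) = \sum_(i <- r) c i *: mderiv j (f i).
Proof.
elim: r => [|i r IH]; first by rewrite !big_nil mderiv0.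
by rewrite !big_cons mderivD mderivZ IH.
Qed.

Lemma dirC h g p : dir h (dir g p) = dir g (dir h p).
Proof.
rewrite /dir.
under eq_bigr => j _ do rewrite mderiv_sumZ scaler_sumr.
under [RHS]eq_bigr => j _ do rewrite mderiv_sumZ scaler_sumr.
rewrite exchange_big /=; apply: eq_bigr => j _; apply: eq_bigr => i _.
by rewrite !scalerA mulrC mderiv_comm.
Qed.

Lemma dir_addl h g p : dir (h + g) p = dir h p + dir g p.
Proof.
by rewrite /dir -big_split; apply: eq_bigr => j _; rewrite mxE scalerDl.
Qed.

Lemma dirsD t p q : dirs t (p + q) = dirs t p + dirs t q.
Proof. by elim: t p q => //= h t IH p q; rewrite dirD IH. Qed.

Lemma dirsZ t c p : dirs t (c *: p) = c *: dirs t p.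
Proof. by elim: t p => //= h t IH p; rewrite dirZ IH. Qed.

Lemma dirs_dir t h p : dirs t (dir h p) = dir h (dirs t p).
Proof. by elim: t p => //= g t IH p; rewrite -IH dirC. Qed.

Lemma dirs_perm t u p : perm_eq t u -> dirs t p = dirs u p.
Proof.
elim: t u p => [|h t IH] u p.
  by rewrite perm_sym => /perm_nilP ->.
move=> htu; have hu : h \in u by rewrite -(perm_mem htu) mem_head.
have pu : perm_eq t (rem h u).
  by rewrite -(perm_cons h) (perm_trans htu)// perm_to_rem.
rewrite /= (IH _ _ pu) {htu pu IH t}.
elim: u hu p => //= g u IH; rewrite inE.
case: eqVneq => [<- //|hg /= hu p].
by rewrite /= dirC IH.
Qed.

Lemma dir_size h p n : (msize p <= n.+1)%N -> (msize (dir h p) <= n)%N.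
Proof.
move=> sp; rewrite /dir; apply: leq_trans (msize_sum _ _ _) _.
apply/bigmax_leqP => j _; apply: leq_trans (msizeZ_le _ _) _.
rewrite msizeE; apply/bigmax_leqP_seq => m; rewrite mcoeff_msupp mcoeff_deriv => hm _.
have : mnm_add m (mnm1 j) \in msupp p.
  by rewrite mcoeff_msupp; apply: contra hm => /eqP ->; rewrite mul0rn.
by move=> /msize_mdeg_lt; rewrite mdegD mdeg1 addn1 => /leq_trans /(_ sp).
Qed.

(** The difference and the derivative in the same direction share their leading part, so they agree
    up to degree one lower still. Iterated in [diffs_dirs], this identifies [n] differences of a
    polynomial of degree at most [n] with its [n]-fold derivative. *)
Lemma polyfun_ev p n : (msize p <= n)%N -> polyfun n (evZ p) /\
  forall h, polyfun n.-2 (fun x => diff h (evZ p) x - evZ (dir h p) x).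
Proof.
have mono m : polyfun (mdeg m).+1 (evZ (mpolyX int m)) /\ forall h,
    polyfun (mdeg m).-1 (fun x => diff h (evZ (mpolyX int m)) x -
      evZ (dir h (mpolyX int m)) x).
  have [k] := ubnP (mdeg m); elim: k m => // k IH m; rewrite ltnS => mk.
  have [m0|m0] := eqVneq m mnm0.
    rewrite m0 mpolyX0 mdeg0 /=.
    have ev1 x : evZ 1 x = 1 by rewrite /evZ meval1.
    split=> h x; rewrite /diff !ev1 subrr// sub0r.
    rewrite /dir big1 ?/evZ ?meval0 ?oppr0// => j _.
    by rewrite -mpolyC1 mderivC scaler0.
  have [i mi] : exists i, (0 < m i)%N.
    apply: contrapT => h; move/eqP: m0; apply; apply/mnmP => i; rewrite mnm0E.
    by apply/eqP; rewrite -leqn0 leqNgt; apply/negP => hi; apply: h; exists i.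
  have em : m = mnm_add (mnm1 i) (mnm_sub m (mnm1 i)).
    apply/mnmP => j; rewrite mnmDE mnmBE mnm1E.
    by case: eqVneq => [<-|_]; rewrite ?subn0// subnKC.
  set m' := mnm_sub _ _ in em.
  have dm : mdeg m = (mdeg m').+1 by rewrite {1}em mdegD mdeg1 add1n.
  have [|h1 h2] := IH m'; first by rewrite -dm.
  rewrite dm em mpolyXD.
  have evXi x : evZ (mpolyX int (mnm1 i)) x = x 0 i by rewrite /evZ mevalXU.
  have evC c x : evZ (mpolyC s c) x = c by rewrite /evZ mevalC.
  have evD u v x : evZ (u + v) x = evZ u x + evZ v x by rewrite /evZ mevalD.
  have evM u v x : evZ (u * v) x = evZ u x * evZ v x by rewrite /evZ mevalM.
  have dX h : dir h (mpolyX int (mnm1 i)) = mpolyC s (h 0 i).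
    rewrite /dir (bigD1 i)//= big1 ?addr0 => [|j ji].
      rewrite mderivX mnm1E eqxx scale1r (_ : mnm_sub _ _ = mnm0).
        by rewrite mpolyX0 -mul_mpolyC mulr1.
      by apply/mnmP => j; rewrite mnmBE subnn mnm0E.
    by rewrite mderivX mnm1E eq_sym (negPf ji) scale0r scaler0.
  set g := mpolyX int m' in h1 h2 *.
  split; first by apply: polyfun_ext (polyfunX i h1) => x; rewrite evM evXi.
  move=> h; apply: (@polyfun_ext _ (fun x => x 0 i *
      (diff h (evZ g) x - evZ (dir h g) x) + h 0 i * diff h (evZ g) x)).
    move=> x; rewrite dirM dX /diff evD !evM !evXi evC !mxE; ring.
  apply: polyfunD; last by apply: polyfunZ; apply: (polyfun_diff h h1).
  have [d0|d0] := posnP (mdeg m').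
    have m'0 : m' = mnm0 by apply/eqP; rewrite -mdeg_eq0 d0.
    rewrite d0 => x /=; rewrite /g m'0 mpolyX0 /diff /evZ !meval1 subrr sub0r.
    rewrite /dir big1 ?meval0 ?oppr0 ?mulr0// => j _.
    by rewrite -mpolyC1 mderivC scaler0.
  have := @polyfunX (mdeg m').-1 _ i (h2 h).
  by rewrite prednK.
move=> sp; rewrite (mpolywE sp); split=> [|h].
  have {sp} : forall m : bmultinom s n, polyfun n (evZ (mpolyX int (bmnm m))).
    by move=> m; apply: polyfun_leq (mono m).1; apply: bmdeg.
  move: (index_enum _) => r hr.
  elim: r => [|m r IH].
    rewrite big_nil; apply: (@polyfun_leq 0) => // x; by rewrite /evZ meval0.
  rewrite big_cons; apply: (@polyfun_ext _ (fun x => mcoeff (bmnm m) p *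
      evZ (mpolyX int (bmnm m)) x + evZ (\sum_(j <- r) mcoeff (bmnm j) p *: mpolyX int (bmnm j)) x)).
    by move=> x; rewrite /evZ mevalD mevalZ.
  by apply: polyfunD => //; apply: polyfunZ; apply: hr.
have {sp} : forall m : bmultinom s n, polyfun n.-2 (fun x =>
   diff h (evZ (mpolyX int (bmnm m))) x - evZ (dir h (mpolyX int (bmnm m))) x).
  move=> m; apply: polyfun_leq ((mono m).2 h).
  by have := bmdeg m; move: (mdeg (bmnm m)) => k; lia.
move: (index_enum _) => r hr.
elim: r => [|m r IH].
  rewrite big_nil; apply: (@polyfun_leq 0) => // x.
  by rewrite /diff /dir !big1 ?/evZ ?meval0 ?subrr// => j _; rewrite mderiv0 scaler0.
rewrite big_cons; set q := \sum_(j <- r) _ in IH *; set X := mpolyX _ _.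
apply: (@polyfun_ext _ (fun x => mcoeff (bmnm m) p *
   (diff h (evZ X) x - evZ (dir h X) x) + (diff h (evZ q) x - evZ (dir h q) x))).
  move=> x; rewrite dirD dirZ /diff /evZ !mevalD !mevalZ; ring.
by apply: polyfunD => //; apply: polyfunZ; apply: hr.
Qed.

Lemma diffs_dirs n p f t x : (msize p <= n.+1)%N -> size t = n ->
  polyfun n (fun y => f y - evZ p y) -> diffs t f x = evZ (dirs t p) x.
Proof.
elim: n p f t x => [|n IH] p f t x sp st hf.
  by move/size0nil: st => -> /=; apply/eqP; rewrite -subr_eq0 hf.
case: t st => // h t [st] /=; apply: IH => //; first exact: dir_size.
apply: (@polyfun_ext _ (fun y => diff h (fun z => f z - evZ p z) y +
   (diff h (evZ p) y - evZ (dir h p) y))).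
  by move=> y; rewrite /diff; ring.
by apply: polyfunD; [apply: hf|apply: (polyfun_ev sp).2].
Qed.

End Differences.

(** * Polarization of forms *)

Section PolarForm.
Variables (s : nat).
Local Notation V := 'rV[int]_s.
Local Notation unitv j := (delta_mx 0 j : 'rV[int]_s).

(* For p homogeneous of degree size t, dirs t p is a constant, namely the value
   at t of the symmetric multilinear form whose diagonal is (size t)! p. *)
Definition polar (p : {mpoly int[s]}) (t : seq V) : int := evZ (dirs t p) 0.

Lemma homog_msize_le (L : nzRingType) (p : {mpoly L[s]}) d :
  p \is ishomog1 d mdeg -> (msize p <= d.+1)%N.
Proof.
move=> /dhomogP hp; rewrite msizeE; apply/bigmax_leqP_seq => m hm _.
by rewrite ltnS; apply/eq_leq/hp.
Qed.

Lemma dirs0 (t : seq V) : dirs t (0 : {mpoly int[s]}) = 0.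
Proof. by have := dirsZ t 0 0; rewrite !scale0r. Qed.

Lemma dirs_size (t : seq V) p n : (msize p <= n + size t)%N -> (msize (dirs t p) <= n)%N.
Proof.
elim: t p => [|h t IH] p /=; first by rewrite addn0.
by rewrite addnS => sp; apply: IH; apply: dir_size.
Qed.

Lemma polarE p t x : (msize p <= (size t).+1)%N -> evZ (dirs t p) x = polar p t.
Proof.
move=> sp; have s1 : (msize (dirs t p) <= 1)%N by apply: dirs_size; rewrite add1n.
by rewrite /polar (msize1_polyC s1) /evZ !mevalC.
Qed.

Lemma polar_perm p t u : perm_eq t u -> polar p t = polar p u.
Proof. by move=> htu; rewrite /polar (dirs_perm _ htu). Qed.

Lemma dir_unitv j p : dir (unitv j) p = mderiv j p.
Proof.
rewrite /dir (bigD1 j)//= mxE !eqxx scale1r big1 ?addr0// => i ij.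
by rewrite mxE (negPf ij) andbF scale0r.
Qed.

Lemma polarD p h g t : polar p (h + g :: t) = polar p (h :: t) + polar p (g :: t).
Proof. by rewrite /polar /= dir_addl dirsD /evZ mevalD. Qed.

Lemma polar0 p t : polar p (0 :: t) = 0.
Proof. by apply: (addrI (polar p (0 :: t))); rewrite -polarD !addr0. Qed.

Lemma polarN p h t : polar p (- h :: t) = - polar p (h :: t).
Proof. by apply/eqP; rewrite -addr_eq0 -polarD addNr polar0. Qed.

Lemma polarB p h g t : polar p (h - g :: t) = polar p (h :: t) - polar p (g :: t).
Proof. by rewrite polarD polarN. Qed.

Lemma polar_expand p (h : V) (t : seq V) : polar p (h :: t) = \sum_j h 0 j * polar p (unitv j :: t).
Proof.
rewrite {1}/polar /= {1}/dir; under [RHS]eq_bigr do rewrite /polar /= dir_unitv.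
elim: (index_enum _) => [|j r IH].
  by rewrite !big_nil dirs0 /evZ meval0.
by rewrite !big_cons dirsD dirsZ -IH /evZ mevalD mevalZ.
Qed.

Lemma polar_linear (I : Type) (r : seq I) (c : I -> int) (p : I -> {mpoly int[s]}) t :
  polar (\sum_(i <- r) c i *: p i) t = \sum_(i <- r) c i * polar (p i) t.
Proof.
elim: r => [|i r IH]; rewrite ?big_nil ?big_cons.
  by rewrite /polar dirs0 /evZ meval0.
by rewrite -IH /polar dirsD dirsZ /evZ mevalD mevalZ.
Qed.

Lemma diffs_rcons (A : zmodType) t h (f : V -> A) : diffs (rcons t h) f = diff h (diffs t f).
Proof. by elim: t f => //= g t IH f; rewrite IH. Qed.

Lemma diffs_polar p t x : (msize p <= (size t).+1)%N -> diffs t (evZ p) x = polar p t.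
Proof.
move=> sp; rewrite -(polarE x sp); apply: (@diffs_dirs _ (size t)) => //.
by apply: (@polyfun_leq _ 0) => // y; rewrite subrr.
Qed.

Lemma diffs_polar_slope p t j x : (msize p <= (size t).+2)%N ->
  diffs t (evZ p) (x + unitv j) - diffs t (evZ p) x = polar p (unitv j :: t).
Proof.
move=> sp; rewrite -[LHS]/(diff (unitv j) (diffs t (evZ p)) x) -diffs_rcons.
by rewrite diffs_polar ?size_rcons//; apply: polar_perm; rewrite perm_rcons.
Qed.

Lemma euler_identity (p : {mpoly int[s]}) m : p \is ishomog1 m mdeg ->
  \sum_j mpolyX int (mnm1 j) * mderiv j p = m%:R *: p.
Proof.
move=> /dhomogP hp; apply/mpolyP => mu; rewrite mcoeffZ raddf_sum /=.
have step j : mcoeff mu (mpolyX int (mnm1 j) * mderiv j p) = (mu j)%:R * mcoeff mu p.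
  have [muj|muj] := posnP (mu j).
    rewrite muj mul0r; apply: memN_msupp_eq0; rewrite mulrC.
    apply/negP; rewrite (perm_mem (msuppMX _ _)) => /mapP[m' _ em].
    by move: muj; rewrite em mnmDE mnm1E eqxx.
  have emu : mu = mnm_add (mnm1 j) (mnm_sub mu (mnm1 j)).
    apply/mnmP => i; rewrite mnmDE mnmBE mnm1E.
    by case: eqVneq => [<-|_]; rewrite ?subn0// subnKC.
  rewrite {1}emu mulrC mcoeffMX mcoeff_deriv addmC -emu mnmBE mnm1E eqxx.
  by rewrite subn1 prednK// mulr_natl.
under eq_bigr do rewrite step.
rewrite -mulr_suml -natr_sum -mdegE.
have [mup|/memN_msupp_eq0->] := boolP (mu \in msupp p); last by rewrite !mulr0.
by congr (_%:R * _); apply: hp.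
Qed.

(* The polynomial x |-> dirs [seq x - u | u <- us] p evaluated at x. *)
Fixpoint affine_polar (us : seq V) (p : {mpoly int[s]}) : {mpoly int[s]} :=
  if us is u :: us' then
    \sum_j (mpolyX int (mnm1 j) - mpolyC s (u 0 j)) * affine_polar us' (mderiv j p)
  else p.

Lemma affine_polar_ev us p x :
  evZ (affine_polar us p) x = evZ (dirs [seq x - u | u <- us] p) x.
Proof.
elim: us p => [|u us IH] p //=.
rewrite {1}/evZ raddf_sum /= {1}/dir.
elim: (index_enum _) => [|j r IHr].
  by rewrite !big_nil dirs0 /evZ meval0.
rewrite !big_cons IHr dirsD dirsZ /evZ mevalD mevalZ; congr (_ + _).
rewrite mevalM mevalB mevalXU mevalC !mxE; congr (_ * _); exact: IH.
Qed.

(** If all directions equal [x], Euler's identity applied [m] times produces the factor [m]!; the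
    shifts [us] change only terms of lower degree. *)
Lemma affine_polar_lead us p m : p \is ishomog1 m mdeg -> size us = m ->
  (msize (affine_polar us p - m`!%:R *: p) <= m)%N.
Proof.
elim: us p m => [|u us IH] p m hp.
  by move=> <- /=; rewrite scale1r subrr msize0.
case: m hp => // m hp [sus].
have hd j : mderiv j p \is ishomog1 m mdeg.
  apply/dhomogP => mu; rewrite mcoeff_msupp mcoeff_deriv => h.
  have hmu : mnm_add mu (mnm1 j) \in msupp p.
    by rewrite mcoeff_msupp; apply: contra h => /eqP ->; rewrite mul0rn.
  have : mdeg (mnm_add mu (mnm1 j)) = m.+1 by move/dhomogP: hp; apply.
  by rewrite mdegD mdeg1 addn1 => -[].
rewrite /= factS natrM mulrC -scalerA -(euler_identity hp) scaler_sumr -sumrB.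
apply: leq_trans (msize_sum _ _ _) _; apply/bigmax_leqP => j _.
have := IH _ _ (hd j) sus; set q := affine_polar _ _; set dp := mderiv j p => hq.
set X := mpolyX _ _; set c := mpolyC _ _.
have -> : (X - c) * q - m`!%:R *: (X * dp) = (X - c) * (q - m`!%:R *: dp) - m`!%:R *: (c * dp).
  rewrite -!mul_mpolyC; ring.
apply: leq_trans (msizeD_le _ _) _; rewrite geq_max msizeN; apply/andP; split.
  have [->|q0] := eqVneq (q - m`!%:R *: dp) 0; first by rewrite mulr0 msize0.
  have [->|X0] := eqVneq (X - c) 0; first by rewrite mul0r msize0.
  rewrite msizeM//.
  have : (msize (X - c) <= 2)%N.
    apply: leq_trans (msizeD_le _ _) _; rewrite msizeN msizeX mdeg1 msizeC geq_max /=.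
    by case: (_ == _).
  move=> h; have := leq_add h hq; rewrite add2n.
  by case: (_ + _)%N.
apply: leq_trans (msizeZ_le _ _) _; rewrite /c mul_mpolyC.
by apply: leq_trans (msizeZ_le _ _) _; apply: homog_msize_le (hd j).
Qed.

End PolarForm.

(** * Integer points in boxes and tuples of them *)

Section IntegerBoxes.
Variable n : nat.
Implicit Types (l u : 'I_n -> int) (x : 'rV[int]_n).

Definition width (a b : int) : nat := absz (Num.max 0 (b - a)).

Lemma width_ltP (a b : int) (k : nat) : (k < width a b)%N = (a + k%:Z < b).
Proof.
by rewrite /width -ltz_nat gez0_abs ?le_max ?lexx// lt_max -ltrBrDl; case: ltP => //=; lia.
Qed.

(** Half-open boxes, indexed by functions into one ordinal large enough for every coordinate, so
    that sums of products over a box distribute. *)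
Definition ibox l u : seq 'rV[int]_n :=
  [seq \row_j (l j + (g j : nat)%:Z) | g : {ffun 'I_n -> 'I_(\sum_j width (l j) (u j)).+1}
     <- enum (family (fun j =>
          [pred k : 'I_(\sum_j width (l j) (u j)).+1 | (k < width (l j) (u j))%N]))].

Lemma mem_ibox l u x : (x \in ibox l u) = [forall j, (l j <= x 0 j) && (x 0 j < u j)].
Proof.
apply/mapP/forallP => [[g]|h].
  rewrite mem_enum => /familyP hg -> j.
  by rewrite mxE lerDl lez_nat leq0n /= -width_ltP; apply: hg.
have w j : (absz (x 0 j - l j)%R < width (l j) (u j))%N.
  by have /andP[h1 h2] := h j; rewrite width_ltP gez0_abs ?subr_ge0// addrC subrK.
have w' j : (absz (x 0 j - l j)%R < (\sum_j width (l j) (u j)).+1)%N.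
  by rewrite ltnS (leq_trans (ltnW (w j)))// (bigD1 j)//= leq_addr.
exists [ffun j => Ordinal (w' j)].
  by rewrite mem_enum; apply/familyP => j; rewrite inE ffunE /=.
apply/rowP => j; rewrite !mxE ffunE /= gez0_abs; first by rewrite addrC subrK.
by have /andP[h1 h2] := h j; rewrite subr_ge0.
Qed.

Lemma ibox_uniq l u : uniq (ibox l u).
Proof.
rewrite map_inj_in_uniq ?enum_uniq// => g g' _ _ /rowP h.
apply/ffunP => j; apply: val_inj; have := h j; rewrite !mxE.
by move/addrI => -[].
Qed.

Lemma sum_ibox (A : comPzSemiRingType) l u (g : 'I_n -> int -> A) :
  \sum_(x <- ibox l u) \prod_j g j (x 0 j) =
  \prod_j \sum_(k < width (l j) (u j)) g j (l j + k%:Z).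
Proof.
rewrite big_map big_enum_cond /=.
set W := (\sum_j _)%N.
transitivity (\prod_j \sum_(k : 'I_W.+1 | (k < width (l j) (u j))%N) g j (l j + (k : nat)%:Z)).
  rewrite (bigA_distr_big_dep (fun j (k : 'I_W.+1) => (k < width (l j) (u j))%N)) /=.
  apply: eq_big => [f|f _]; first by rewrite andbT.
  by apply: eq_bigr => j _; rewrite mxE.
apply: eq_bigr => j _.
rewrite [RHS](big_ord_widen W.+1 (fun k => g j (l j + k%:Z)))//.
by rewrite leqW// /W (bigD1 j)//= leq_addr.
Qed.

Lemma size_ibox l u : size (ibox l u) = (\prod_j width (l j) (u j))%N.
Proof.
rewrite -sum1_size; transitivity (\sum_(x <- ibox l u) \prod_(j < n) 1%N)%N.
  by apply: eq_bigr => x _; rewrite big1.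
etransitivity; first exact: (@sum_ibox nat l u (fun _ _ => 1%N)).
by apply: eq_bigr => j _; rewrite sum_nat_const card_ord muln1.
Qed.

Definition ball (N : nat) := ibox (fun=> - N%:Z) (fun=> N%:Z + 1).

Lemma mem_ball N x : (x \in ball N) = [forall j, `|x 0 j| <= N%:Z].
Proof.
rewrite mem_ibox; apply: eq_forallb => j; by rewrite ltzD1 ler_norml.
Qed.

Lemma size_ball N : size (ball N) = ((2 * N).+1 ^ n)%N.
Proof.
rewrite size_ibox prod_nat_const card_ord; congr (_ ^ _)%N.
by rewrite /width; lia.
Qed.

End IntegerBoxes.

Section TupleBoxes.
Variable s : nat.
Local Notation V := 'rV[int]_s.

Fixpoint hseqs (Ns : seq nat) : seq (seq V) :=
  if Ns is N :: Ns' then [seq h :: t | h <- ball s N, t <- hseqs Ns'] else [:: [::]].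

Lemma mem_hseqs Ns t : (t \in hseqs Ns) =
  (size t == size Ns) && all2 (fun h N => h \in ball s N) t Ns.
Proof.
elim: Ns t => [|N Ns IH] t /=; first by case: t.
apply/allpairsP/idP => [[[h t'] /= [hN ht' ->]]|].
  by move: ht'; rewrite IH /= eqSS hN.
case: t => // h t /=; rewrite eqSS => /andP[st /andP[hN ht]].
by exists (h, t); split=> //=; rewrite IH st.
Qed.

Lemma hseqs_uniq Ns : uniq (hseqs Ns).
Proof.
elim: Ns => //= N Ns IH; apply: allpairs_uniq => //; first exact: ibox_uniq.
by move=> [h t] [h' t'] _ _ /= [-> ->].
Qed.

Lemma size_hseqs Ns : size (hseqs Ns) = (\prod_(N <- Ns) (2 * N).+1 ^ s)%N.
Proof.
elim: Ns => [|N Ns IH]; first by rewrite big_nil.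
by rewrite /= size_allpairs IH size_ball big_cons.
Qed.

End TupleBoxes.

Lemma size_fibres (T U : eqType) (S : seq T) (Y : seq U) (f : T -> U) (C : nat) :
  (forall x, x \in S -> f x \in Y) ->
  (forall y, count (fun x => f x == y) S <= C)%N -> (size S <= C * size Y)%N.
Proof.
move=> fY hC; rewrite -sum1_size.
apply: (@leq_trans (\sum_(x <- S) \sum_(y <- Y) (f x == y)))%N.
  rewrite big_seq [X in (_ <= X)%N]big_seq; apply: leq_sum => x xS.
  have : (0 < count (fun y => f x == y) Y)%N.
    by rewrite -has_count; apply/hasP; exists (f x) => //; apply: fY.
  rewrite -sum1_count big_mkcond => /leq_trans; apply; apply: leq_sum => y _.
  by case: (_ == _).
rewrite exchange_big /= mulnC -sum1_size big_distrl /=.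
apply: leq_sum => y _; rewrite mul1n; apply: leq_trans (hC y).
rewrite -sum1_count [X in (_ <= X)%N]big_mkcond; apply: leq_sum => x _.
by case: (_ == _).
Qed.

Lemma leq_expn (m n e : nat) : (m <= n)%N -> (m ^ e <= n ^ e)%N.
Proof. by case: e => // e; rewrite leq_exp2r. Qed.

Lemma meval_map_intr (L : comNzRingType) n (p : {mpoly int[n]}) (x : 'I_n -> int) :
  meval (fun i => (x i)%:~R : L) (map_mpoly intr p) = (meval x p)%:~R.
Proof.
elim/mpolyind: p => [|c m p _ _ IH]; first by rewrite rmorph0 !meval0.
rewrite rmorphD /= !mevalD IH map_mpolyZ map_mpolyX !mevalZ !mevalX rmorphD rmorphM.
congr (_ * _ + _); rewrite rmorph_prod; apply: eq_bigr => i _.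
by rewrite rmorphXn.
Qed.

Lemma mderiv_map_intr (L : nzRingType) n (p : {mpoly int[n]}) j :
  mderiv j (map_mpoly intr p : {mpoly L[n]}) = map_mpoly intr (mderiv j p).
Proof.
apply/mpolyP => m; rewrite mcoeff_deriv !mcoeff_map_mpoly mcoeff_deriv.
exact: esym (rmorphMn (intmul (1 : L)) _ _).
Qed.

Lemma msize_map_intr (L : nzRingType) n (p : {mpoly int[n]}) :
  (msize (map_mpoly intr p : {mpoly L[n]}) <= msize p)%N.
Proof.
rewrite msizeE; apply/bigmax_leqP_seq => m hm _; apply: msize_mdeg_lt.
move: hm; rewrite !mcoeff_msupp mcoeff_map_mpoly; apply: contra => /eqP ->.
by apply/eqP; apply: mulr0z.
Qed.

(** * Counting common zeros of the polarized gradient *)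

Section KernelCount.
Variables (R : realType) (r s d k : nat) (F : 'I_r -> {mpoly int[s]}).
Hypothesis s_gt0 : (0 < s)%N.
Hypothesis F_homog : forall i, F i \is ishomog1 d mdeg.
Hypothesis d_gt1 : (1 < d)%N.
Local Notation K := (R[i]).
Local Notation V := 'rV[int]_s.
Local Notation unitv j := (delta_mx 0 j : 'rV[int]_s).

Definition pencil (a : {ffun 'I_r -> int}) : {mpoly int[s]} := \sum_i a i *: F i.

Lemma pencil_homog a : pencil a \is ishomog1 d mdeg.
Proof. by apply: rpred_sum => i _; apply: rpredZ; apply: F_homog. Qed.

Lemma complex_pencil (a : {ffun 'I_r -> int}) : \sum_i (a i)%:~R *: complex_form R F i = map_mpoly intr (pencil a).
Proof.
apply/mpolyP => m; rewrite mcoeff_map_mpoly (raddf_sum (@mcoeff s int m)).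
rewrite (raddf_sum (@mcoeff s K m)); apply/esym.
etransitivity; first exact: (rmorph_sum (intmul (1 : K))).
by apply: eq_bigr => i _; rewrite /= !mcoeffZ mcoeff_map_mpoly rmorphM.
Qed.

Lemma section_form_deriv (a : {ffun 'I_r -> int}) (l : 'I_k -> 'I_s -> int) j :
  section_forms F (fun i => (a i)%:~R : K) l (inl j) = map_mpoly intr (mderiv j (pencil a)).
Proof.
rewrite -mderiv_map_intr -complex_pencil (raddf_sum (@mderiv s K j)) /=.
by apply: eq_bigr => i _; rewrite mderivZ.
Qed.

Definition kernel_pred (a : {ffun 'I_r -> int}) (t : seq V) : bool :=
  [forall j, polar (pencil a) (unitv j :: t) == 0].

(* The points of a fibre of t |-> (head t - other entries, l (head t)) are the
   zeros of a perturbation of section_forms a l. *)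
Lemma kernel_fibre (a : {ffun 'I_r -> int}) (l : 'I_k -> 'I_s -> int) M (E : seq V) (u : seq V) (b : 'rV[int]_k) :
  reduces (@section_degree s d k) M (section_forms F (fun i => (a i)%:~R : K) l) ->
  uniq E -> size u = d.-2 ->
  (forall x, x \in E -> kernel_pred a (x :: [seq x - y | y <- u]) /\
     forall i, \sum_j l i j * x 0 j = b 0 i) ->
  (size E <= #|{: bmultinom s M}|)%N.
Proof.
move=> red uE su hE.
pose G := pencil a.
(* Division by (d-1)! makes the leading forms those of [section_forms] exactly. In [0 :: u] the
   entry 0 stands for the head, since [x - 0 = x]. *)
pose c : K := (d.-1`!)%:R.
have c0 : c != 0 by rewrite pnatr_eq0 -lt0n fact_gt0.
pose p (t : 'I_s + 'I_k) : {mpoly K[s]} := match t with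
  | inl j => c^-1 *: map_mpoly intr (affine_polar (0 :: u) (mderiv j G))
  | inr i => linear_form R (l i) - mpolyC s (b 0 i)%:~R end.
have hder j : mderiv j G \is ishomog1 d.-1 mdeg.
  by apply: mderiv_homog; rewrite prednK ?pencil_homog// ltnW.
apply: (@reduces_perturbed_bound K s _ (@section_degree s d k) M (size E) _ p
  (fun i j => (nth 0 E i 0 j)%:~R) red).
- case=> [j|i] /=; last first.
    by rewrite addrAC subrr add0r msizeN msizeC; case: (_ == _).
  rewrite -[X in _ - X]/(section_forms F (fun i => (a i)%:~R : K) l (inl j)).
  rewrite section_form_deriv -/G.
  have -> : c^-1 *: map_mpoly intr (affine_polar (0 :: u) (mderiv j G)) -
      map_mpoly intr (mderiv j G) =
      c^-1 *: map_mpoly intr (affine_polar (0 :: u) (mderiv j G) -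
        d.-1`!%:R *: mderiv j G) :> {mpoly K[s]}.
    have e1 : ((d.-1`!)%:R : int)%:~R = c by rewrite natz -pmulrn.
    have e2 : map_mpoly intr (d.-1`!%:R *: mderiv j G) =
        c *: map_mpoly intr (mderiv j G) :> {mpoly K[s]}.
      apply/mpolyP => m; rewrite mcoeff_map_mpoly !mcoeffZ mcoeff_map_mpoly -e1.
      exact: (rmorphM (intmul (1 : K))).
    by rewrite rmorphB /= e2 scalerBr scalerA mulVf// scale1r.
  apply: leq_trans (msizeZ_le _ _) _; apply: leq_trans (msize_map_intr _ _) _.
  by apply: affine_polar_lead; [apply: hder|rewrite /= su; lia].
- move=> v w hvw; apply/val_inj/eqP; rewrite -(nth_uniq 0 (ltn_ord v) (ltn_ord w) uE).
  apply/eqP/rowP => j; apply: (@intr_inj K); exact: hvw.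
- move=> v; set x := nth 0 E v; have [] := hE x (mem_nth _ (ltn_ord v)).
  move=> /forallP ker lin [j|i] /=.
    rewrite mevalZ (meval_map_intr K _ (fun j => x 0 j)).
    rewrite -[meval _ _]/(evZ (affine_polar (0 :: u) (mderiv j G)) x) affine_polar_ev.
    have sz : size [seq x - y | y <- 0 :: u] = d.-1.
      by rewrite size_map /= su; lia.
    rewrite polarE ?sz ?(homog_msize_le (hder j))//.
    have := ker j; rewrite /polar /= dir_unitv subr0 => /eqP ->.
    by rewrite mulr0.
  rewrite mevalB mevalC /linear_form raddf_sum /= -lin rmorph_sum -sumrB big1// => j _.
  by rewrite mevalZ mevalXU rmorphM subrr.
Qed.

(** The [d - 2] differences from the head and the values of the [k] linear forms at the head take
    about N^(s(d-2)+k) values, and [kernel_fibre] bounds the tuples sharing them. The remaining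
    constants compare the ranges [2 * N] of the differences and [L * N] of the values with [N]. *)
Lemma kernel_count_section (a : {ffun 'I_r -> int}) (l : 'I_k -> 'I_s -> int) M :
  reduces (@section_degree s d k) M (section_forms F (fun i => (a i)%:~R : K) l) ->
  forall N, (count (kernel_pred a) (hseqs s (nseq d.-1 N)) <=
    #|{: bmultinom s M}| * (2 ^ (s * d.-2) * (\sum_i \sum_j absz (l i j)).+1 ^ k) *
      (2 * N).+1 ^ (s * d.-2 + k))%N.
Proof.
move=> red N.
pose L := (\sum_i \sum_j absz (l i j))%N.
pose f (t : seq V) := ([seq head 0 t - y | y <- behead t],
  \row_(i < k) \sum_j l i j * head 0 t 0 j).
pose Y := [seq (u, b) | u <- hseqs s (nseq d.-2 (2 * N)%N), b <- ball k (L * N)].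
pose S := [seq t <- hseqs s (nseq d.-1 N) | kernel_pred a t].
have memS t : t \in S -> kernel_pred a t /\ exists x u, [/\ t = x :: u, size u = d.-2,
    x \in ball s N & all (fun y => y \in ball s N) u].
  rewrite mem_filter mem_hseqs size_nseq => /andP[-> /andP[st h]]; split=> //.
  move: st h; have -> : d.-1 = d.-2.+1 by lia.
  case: t => [|x u] //.
  rewrite /= eqSS => /eqP su /andP[xN hu]; exists x, u; split=> //.
  by rewrite -su in hu; elim: u {su} hu => //= y u IH /andP[-> /IH].
rewrite -size_filter -/S.
have step : (size S <= #|{: bmultinom s M}| * size Y)%N.
  apply: (@size_fibres _ _ S Y f).
    move=> t /memS[_ [x [u [-> su xN uN]]]]; rewrite /f /=.
    apply: (@allpairs_f _ _ _ (fun u b => (u, b))).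
    - rewrite mem_hseqs size_map size_nseq su eqxx /=.
      rewrite -su; elim: u uN {su} => //= y u IH /andP[yN uN]; rewrite IH// andbT.
      move: xN yN; rewrite !mem_ball => /forallP hx /forallP hy; apply/forallP => j.
      rewrite !mxE; apply: le_trans (ler_normB _ _) _.
      by rewrite mul2n -addnn PoszD; apply: lerD.
    - rewrite mem_ball; apply/forallP => i; rewrite mxE.
      apply: le_trans (ler_norm_sum _ _ _) _.
      apply: (@le_trans _ _ (\sum_j `|l i j| * N%:Z)).
        apply: ler_sum => j _; rewrite normrM ler_wpM2l//.
        by move: xN; rewrite mem_ball => /forallP.
      rewrite -mulr_suml PoszM ler_wpM2r//.
      have -> : \sum_(j < s) `|l i j| = (\sum_(j < s) absz (l i j))%N%:Z.
        by rewrite -[RHS]natz natr_sum; apply: eq_bigr => j _; rewrite natz abszE.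
      by rewrite lez_nat /L [X in (_ <= X)%N](bigD1 i)//= leq_addr.
  move=> [u b]; rewrite -size_filter.
  set S' := [seq t <- S | _].
  have S'P t : t \in S' -> kernel_pred a t /\ f t = (u, b) /\
      exists x v, [/\ t = x :: v & size v = d.-2].
    rewrite mem_filter => /andP[/eqP ft /memS[kt [x [v [tE sv _ _]]]]].
    by split=> //; split=> //; exists x, v.
  have [S0|] := eqVneq (size S') 0%N; first by rewrite S0.
  rewrite -lt0n => S0.
  have rec t : t \in S' -> t = head 0 t :: [seq head 0 t - y | y <- u].
    move=> /S'P[_ [ft [x [v [tE _]]]]]; move: ft; rewrite tE /f /= => -[<- _].
    by rewrite -map_comp -[X in _ :: X = _]map_id; congr (_ :: _); apply: eq_map => y /=; rewrite opprB addrC subrK.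
  have -> : size S' = size [seq head 0 t | t <- S'] by rewrite size_map.
  apply: (kernel_fibre (u := u) (b := b) red).
  - rewrite map_inj_in_uniq.
      by rewrite !filter_uniq// hseqs_uniq.
    by move=> t t' /rec -> /rec -> /= ->.
  - have /S'P[_ [[<- _] [x [v [-> sv]]]]] : nth [::] S' 0 \in S' by apply: mem_nth.
    by rewrite size_map.
  - move=> x /mapP[t tS' ->]; have [kt [ft _]] := S'P _ tS'; split.
      by rewrite -(rec _ tS').
    move=> i; have := congr1 (fun p : seq V * 'rV[int]_k => p.2 0 i) ft.
    by rewrite /f mxE.
apply: leq_trans step _; rewrite -!mulnA leq_mul2l; apply/orP; right.
rewrite size_allpairs size_hseqs size_ball big_nseq iter_muln_1.
rewrite -expnM expnD [X in (_ <= X)%N]mulnA [X in (_ <= X)%N]mulnACA -!expnMn.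
by apply: leq_mul; apply: leq_expn; rewrite ?mulSn; nia.
Qed.

(** Summing the constants over the finite list of certificates makes the bound independent of
    [a]. *)
Lemma kernel_count :
  (forall (a : {ffun 'I_r -> int}) m Z, a != 0%R ->
     irreducible_chain (gradient_zeros R F a) m Z -> (m <= k)%N) ->
  exists C : nat, forall (a : {ffun 'I_r -> int}) N, a != 0%R ->
    (count (kernel_pred a) (hseqs s (nseq d.-1 N)) <= C * (2 * N).+1 ^ (s * d.-2 + k))%N.
Proof.
move=> hk; have [L hL] := gradient_section_uniform s_gt0 F_homog d_gt1 hk.
pose c (p : nat * ('I_k -> 'I_s -> int)) := (#|{: bmultinom s p.1}| *
  (2 ^ (s * d.-2) * (\sum_i \sum_j absz (p.2 i j)).+1 ^ k))%N.
exists (\sum_(p <- L) c p)%N => a N a0.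
have [M [l [inL red]]] := hL a a0.
apply: leq_trans (kernel_count_section red N) _; rewrite leq_mul2r; apply/orP; right.
rewrite -[X in (X <= _)%N]/(c (M, l)).
elim: (L) inL => //= p L' IH [->|inL]; rewrite big_cons ?leq_addr//.
by apply: leq_trans (IH inL) _; apply: leq_addl.
Qed.

End KernelCount.

(** * Additive characters and the distance to the nearest integer *)

Section UnitExp.
Variable R : realType.
Local Notation e := (@unit_exp R).

Lemma unit_expD x y : e (x + y) = e x * e y.
Proof.
rewrite /unit_exp mulrDr cosD sinD; apply/eqP; rewrite eq_complex /= eqxx /=.
by apply/eqP; ring.
Qed.

Lemma unit_exp0 : e 0 = 1.
Proof. by rewrite /unit_exp mulr0 cos0 sin0. Qed.

Lemma unit_exp1 : e 1 = 1.
Proof. by rewrite /unit_exp mulr1 mulrC mulr_natr cos2pi sin2pi. Qed.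

Lemma unit_expN x : e (- x) = conjc (e x).
Proof. by rewrite /unit_exp mulrN cosN sinN. Qed.

Lemma normc_unit_exp x : normc (e x) = 1.
Proof. by rewrite /unit_exp /normc cos2Dsin2 sqrtr1. Qed.

Lemma unit_expMn x n : e (x *+ n) = e x ^+ n.
Proof. by elim: n => [|n IH]; rewrite ?mulr0n ?unit_exp0// mulrS unit_expD IH exprS. Qed.

Lemma unit_exp_int (z : int) : e z%:~R = 1.
Proof.
have h n : e n%:R = 1 by rewrite unit_expMn unit_exp1 expr1n.
case: z => n; first by rewrite -pmulrn h.
by rewrite NegzE mulrNz -pmulrn unit_expN h conjc1.
Qed.

Lemma normc_sum (I : Type) (r : seq I) (P : pred I) (F : I -> R[i]) :
  normc (\sum_(i <- r | P i) F i) <= \sum_(i <- r | P i) normc (F i).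
Proof.
apply: (big_rec2 (fun x y => normc x <= y)); first by rewrite normc0.
by move=> i y x _ h; apply: le_trans (le_normcD _ _) _; rewrite lerD2l.
Qed.

Lemma normc_ge0 (x : R[i]) : 0 <= normc x.
Proof. by case: x => a b; rewrite /normc sqrtr_ge0. Qed.

Lemma normc_prod (I : Type) (r : seq I) (F : I -> R[i]) :
  normc (\prod_(i <- r) F i) = \prod_(i <- r) normc (F i).
Proof. by apply: (big_morph _ (@normcM R)); apply: normc1. Qed.

Lemma conjc_normc (x : R[i]) : normc (conjc x) = normc x.
Proof. by case: x => a b; rewrite /normc /= sqrrN. Qed.

Lemma normc_sqr (x : R[i]) : normc x ^+ 2 = normc (x * conjc x).
Proof. by rewrite normcM conjc_normc expr2. Qed.

Definition frac (x : R) := x - (Num.floor x)%:~R.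
Definition dist (x : R) := Num.min (frac x) (1 - frac x).

Lemma frac_ge0 x : 0 <= frac x. Proof. by rewrite subr_ge0 floor_le. Qed.
Lemma frac_lt1 x : frac x < 1.
Proof. by rewrite ltrBlDl; have := floorD1_gt x; rewrite rmorphD. Qed.

Lemma dist_ge0 x : 0 <= dist x.
Proof. by rewrite le_min frac_ge0 subr_ge0 ltW// frac_lt1. Qed.

Lemma distE x : exists z : int, dist x = `|x - z%:~R|.
Proof.
rewrite /dist; case: leP => _.
  by exists (Num.floor x); rewrite ger0_norm// frac_ge0.
exists (Num.floor x + 1); rewrite ler0_norm; rewrite rmorphD /= /frac; first by ring.
by have := frac_lt1 x; rewrite /frac; lra.
Qed.

Lemma dist_le x (z : int) : dist x <= `|x - z%:~R|.
Proof.
have [xz|zx] := leP z%:~R x.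
  have zf : (z <= Num.floor x) by rewrite floor_ge_int.
  rewrite ger0_norm ?subr_ge0// ge_min; apply/orP; left.
  by rewrite lerB// ler_int.
have zf : (Num.floor x + 1 <= z) by rewrite -ltzD1 ltzD1 lezD1 floor_lt_int.
rewrite ltr0_norm ?subr_lt0// ge_min; apply/orP; right.
have : (Num.floor x + 1)%:~R <= z%:~R :> R by rewrite ler_int.
by rewrite rmorphD /= /frac; lra.
Qed.

Lemma cos_quarter_le0 (y : R) : 1 / 4 <= y <= 1 / 2 -> cos (2 * pi * y) <= 0.
Proof.
move=> /andP[h1 h2]; have p0 := pi_gt0 R.
rewrite (_ : 2 * pi * y = (2 * pi * y - pi / 2) + pi / 2); last by rewrite subrK.
rewrite cosDpihalf oppr_le0; apply: sin_ge0_pi; apply/andP; split.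
  by rewrite subr_ge0; nra.
by nra.
Qed.

(** Some multiple [n x] lies in [1/4, 1/2], where the cosine is at most 0. Hence 1 <= |1 - e(n x)|
    <= n |1 - e(x)|, and 1/n >= 2 x. *)
Lemma unit_exp_sub1_small (x : R) : 0 < x <= 1 / 2 -> 2 * x <= normc (1 - e x).
Proof.
move=> /andP[x0 x2].
have [n [n1 n2 n3]] : exists n : nat, [/\ 1 / 4 <= n%:R * x, n%:R * x <= 1 / 2 & (0 < n)%N].
  have [x4|x4] := leP (1 / 4) x.
    by exists 1%N; rewrite mul1r; split=> //; lra.
  have q0 : 0 <= 1 / (4 * x) by rewrite divr_ge0//; nra.
  have := truncn_itv q0; set m := Num.truncn _ => /andP[m1 m2].
  exists m.+1; split=> //.
    move: m2; rewrite ltr_pdivrMr; last by nra.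
    by rewrite mulrA; set M := _.+1%:R; nra.
  move: m1; rewrite ler_pdivlMr; last by nra.
  by rewrite -natr1; set M := m%:R; nra.
have tele : forall z : R[i], normc z = 1 -> forall m, normc (1 - z ^+ m) <= m%:R * normc (1 - z).
  move=> z z1; elim=> [|m IH]; first by rewrite expr0 subrr normc0 mul0r.
  rewrite (_ : 1 - z ^+ m.+1 = (1 - z) + z * (1 - z ^+ m)); last by rewrite exprS; ring.
  apply: le_trans (le_normcD _ _) _; rewrite normcM z1 mul1r -natr1 mulrDl mul1r addrC.
  by rewrite lerD2r.
have h1 : 1 <= normc (1 - e (n%:R * x)).
  have c0 := cos_quarter_le0 (introT andP (conj n1 n2)).
  rewrite /unit_exp /normc /=; set c := cos _ in c0 *; set sn := sin _.
  rewrite -{1}(sqrtr1 R); apply: ler_wsqrtr; rewrite sub0r sqrrN.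
  by have := sqr_ge0 sn; nra.
have := tele _ (normc_unit_exp x) n; rewrite -unit_expMn -[x *+ n]mulr_natl => h2.
have N0 : (0 : R) < n%:R by rewrite ltr0n.
have : 1 <= n%:R * normc (1 - e x) by apply: le_trans h1 h2.
have := normc_ge0 (1 - e x); set t := normc _ => t0 h.
by nra.
Qed.

Lemma unit_exp_frac x : e (frac x) = e x.
Proof.
have ex : e (frac x + (Num.floor x)%:~R) = e x by rewrite /frac subrK.
by rewrite -ex unit_expD unit_exp_int mulr1.
Qed.

Lemma unit_exp_sub1 x : 2 * dist x <= normc (1 - e x).
Proof.
rewrite -unit_exp_frac; have f0 := frac_ge0 x; have f1 := frac_lt1 x.
rewrite /dist; set f := frac x in f0 f1 *.
have [fz|fz] := eqVneq f 0.
  by rewrite fz unit_exp0 subrr normc0 minElt subr0 ltr01 mulr0.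
have fp : 0 < f by rewrite lt_def fz.
have [fh|fh] := leP f (1 - f); first by apply: unit_exp_sub1_small; lra.
have -> : normc (1 - e f) = normc (1 - e (- f)).
  rewrite -[LHS]conjc_normc unit_expN; congr normc; case: (e f) => a b.
  by apply/eqP; rewrite eq_complex /= eqxx /=; apply/eqP; ring.
have -> : e (- f) = e (1 - f) by rewrite unit_expD unit_exp1 mul1r.
by apply: unit_exp_sub1_small; lra.
Qed.

Lemma geometric_sum_bound (b : R) (l : int) (w : nat) :
  normc (\sum_(k < w) e (b * (l + k%:Z)%:~R)) * dist b <= 1.
Proof.
have -> : \sum_(k < w) e (b * (l + k%:Z)%:~R) = e (b * l%:~R) * \sum_(k < w) e b ^+ k.
  rewrite mulr_sumr; apply: eq_bigr => k _.
  by rewrite rmorphD /= mulrDr unit_expD -pmulrn mulr_natr unit_expMn.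
rewrite normcM normc_unit_exp mul1r.
set S := \sum_(k < w) _.
have hS : (1 - e b) * S = 1 - e b ^+ w.
  by rewrite -[RHS]opprB subrX1 -mulNr opprB.
have h2 : normc ((1 - e b) * S) <= 2.
  rewrite hS; apply: le_trans (le_normcD _ _) _.
  by rewrite normcN normc1 -unit_expMn normc_unit_exp.
have := unit_exp_sub1 b; rewrite normcM in h2.
have := normc_ge0 S; have := dist_ge0 b; move: h2.
set t := normc (1 - _); set u := normc S; set v := dist b; nra.
Qed.

Lemma sqr_sum_le (I : Type) (r : seq I) (a : I -> R) :
  (\sum_(i <- r) a i) ^+ 2 <= (size r)%:R * \sum_(i <- r) a i ^+ 2.
Proof.
elim: r => [|i r IH]; first by rewrite !big_nil expr0n mul0r.
rewrite !big_cons sqrrD /= -natr1.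
have h : a i * (\sum_(j <- r) a j) *+ 2 <=
    (size r)%:R * a i ^+ 2 + \sum_(j <- r) a j ^+ 2.
  elim: r {IH} => [|j r IH]; first by rewrite !big_nil mulr0 mul0rn mul0r addr0.
  rewrite !big_cons /= -natr1 mulrDr mulrnDl.
  by have := sqr_ge0 (a i - a j); move: IH; nra.
by move: IH h; set S := \sum_(i <- r) a i; set S2 := \sum_(i <- r) _; nra.
Qed.

(** Cauchy's inequality iterated [k] times. *)
Lemma power_mean (I : Type) (r : seq I) (a : I -> R) k : (forall i, 0 <= a i) ->
  (\sum_(i <- r) a i) ^+ (2 ^ k) <=
    (size r)%:R ^+ (2 ^ k - 1) * \sum_(i <- r) a i ^+ (2 ^ k).
Proof.
move=> a0; elim: k => [|k IH].
  by rewrite expn0 subnn expr0 mul1r expr1.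
have -> : (2 ^ k.+1 - 1 = (2 ^ k - 1) * 2 + 1)%N.
  by have := expn_gt0 2 k; rewrite expnS; lia.
rewrite expnS mulnC exprM.
apply: (@le_trans _ _ (((size r)%:R ^+ (2 ^ k - 1) * \sum_(i <- r) a i ^+ (2 ^ k)) ^+ 2)).
  by rewrite lerXn2r ?nnegrE// ?exprn_ge0 ?sumr_ge0// mulr_ge0 ?exprn_ge0 ?sumr_ge0// => i _; rewrite exprn_ge0.
rewrite exprMn exprD expr1 exprM -mulrA ler_wpM2l ?exprn_ge0//.
by under [X in _ <= _ * X]eq_bigr do rewrite exprM; apply: sqr_sum_le.
Qed.

End UnitExp.

(** * Weyl differencing *)

Section WeylDifferencing.
Variables (R : realType) (s : nat).
Local Notation e := (@unit_exp R).
Local Notation V := 'rV[int]_s.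

Lemma ibox_width_ball (l u : 'I_s -> int) N (x y : V) :
  (forall j, u j - l j <= N%:Z + 1) -> x \in ibox l u -> y \in ibox l u ->
  y - x \in ball s N.
Proof.
move=> w; rewrite mem_ball !mem_ibox => /forallP hx /forallP hy; apply/forallP => j.
rewrite !mxE ler_norml; have := hx j; have := hy j; have := w j.
move: (x 0 j) (y 0 j) (l j) (u j) => a b c f h1 /andP[h2 h3] /andP[h4 h5].
by apply/andP; split; lia.
Qed.

Lemma int_itv_shift (a b h x : int) : (a <= x + h < b) && (a <= x < b) =
  (Num.max a (a - h) <= x) && (x < Num.min b (b - h)).
Proof.
rewrite ge_max lt_min; apply/idP/idP.
  by move=> /andP[/andP[h1 h2] /andP[h3 h4]]; do ?[apply/andP; split]; lia.
by move=> /andP[/andP[h1 h2] /andP[h3 h4]]; do ?[apply/andP; split]; lia.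
Qed.

(** The square is expanded as a double sum over x and y = x + h. The x for which both x and x + h
    lie in a box again form a box, so the step can be repeated. *)
Lemma weyl_step (l u : 'I_s -> int) N (f : V -> R) :
  (forall j, u j - l j <= N%:Z + 1) ->
  normc (\sum_(x <- ibox l u) e (f x)) ^+ 2 <=
  \sum_(h <- ball s N) normc (\sum_(x <- ibox (fun j => Num.max (l j) (l j - h 0 j))
     (fun j => Num.min (u j) (u j - h 0 j))) e (diff h f x)).
Proof.
move=> w; rewrite normc_sqr; set A := ibox l u; set z := \sum_(x <- A) _.
have -> : z * conjc z = \sum_(h <- ball s N) \sum_(x <- A | x + h \in A) e (diff h f x).
  have -> : conjc z = \sum_(x <- A) e (- f x).
    by rewrite /z rmorph_sum; apply: eq_bigr => x _; rewrite unit_expN.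
  rewrite mulrC mulr_suml.
  under [RHS]eq_bigr do rewrite big_mkcond /=.
  rewrite exchange_big /= big_seq [RHS]big_seq; apply: eq_bigr => x xA.
  rewrite mulr_sumr -big_mkcond /= -[RHS]big_filter.
  rewrite (perm_big [seq x + h | h <- ball s N & x + h \in A]) /=.
    rewrite big_map; apply: eq_bigr => h _.
    by rewrite -unit_expD addrC.
  apply: uniq_perm; first exact: ibox_uniq.
    by rewrite map_inj_uniq ?filter_uniq ?ibox_uniq//; apply: addrI.
  move=> y; apply/idP/mapP => [yA|[h]]; last by rewrite mem_filter => /andP[? _] ->.
  exists (y - x); last by rewrite addrC subrK.
  by rewrite mem_filter addrC subrK yA; apply: ibox_width_ball xA yA.
apply: le_trans (normc_sum _ _ _) _; apply: ler_sum => h _.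
rewrite -big_filter (perm_big (ibox (fun j => Num.max (l j) (l j - h 0 j))
  (fun j => Num.min (u j) (u j - h 0 j))))//=.
apply: uniq_perm; rewrite ?filter_uniq ?ibox_uniq// => x.
rewrite mem_filter !mem_ibox; apply/andP/forallP => [[/forallP h1 /forallP h2] j|h0].
  by rewrite -int_itv_shift; have := h1 j; rewrite mxE => ->; rewrite h2.
by split; apply/forallP => j; have := h0 j; rewrite ?mxE -int_itv_shift => /andP[].
Qed.

(** The boxes shrink at every step, in a way depending on the directions; the bound [E] may depend
    on the directions but has to hold for all boxes of the given width. *)
Lemma weyl_differencing k (E : seq V -> R) (f : V -> R) (l u : 'I_s -> int) N :
  (forall j, u j - l j <= N%:Z + 1) ->
  (forall t l' u', t \in hseqs s (nseq k N) -> (forall j, u' j - l' j <= N%:Z + 1) ->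
     normc (\sum_(x <- ibox l' u') e (diffs t f x)) <= E t) ->
  normc (\sum_(x <- ibox l u) e (f x)) ^+ (2 ^ k) <=
    (size (ball s N))%:R ^+ (2 ^ k - k - 1) * \sum_(t <- hseqs s (nseq k N)) E t.
Proof.
elim: k E f l u => [|k IH] E f l u w hE.
  rewrite expn0 subn0 subnn expr0 mul1r big_seq1 expr1.
  exact: (hE [::]).
rewrite expnS exprM.
set T := fun h : V => normc (\sum_(x <- ibox (fun j => Num.max (l j) (l j - h 0 j))
     (fun j => Num.min (u j) (u j - h 0 j))) e (diff h f x)).
have T0 h : 0 <= T h by apply: normc_ge0.
apply: (@le_trans _ _ ((\sum_(h <- ball s N) T h) ^+ (2 ^ k))).
  by rewrite lerXn2r ?nnegrE ?exprn_ge0 ?normc_ge0 ?sumr_ge0//; apply: weyl_step.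
apply: le_trans (power_mean _ _ T0) _.
have k2 : (k < 2 ^ k)%N by apply: ltn_expl.
have -> : (2 * 2 ^ k - k.+1 - 1 = (2 ^ k - 1) + (2 ^ k - k - 1))%N by lia.
rewrite exprD -mulrA ler_wpM2l ?exprn_ge0//.
rewrite big_allpairs_dep /= mulr_sumr big_seq [X in _ <= X]big_seq; apply: ler_sum => h hN.
apply: IH => [j|t l' u' ht w'].
  have := w j; move: (u j) (l j) (h 0 j) => a b c.
  by case: leP => ?; case: leP => ? ?; lia.
apply: (hE (h :: t)) => //.
by apply: allpairs_f.
Qed.

End WeylDifferencing.

(** * Sums of products of geometric sums *)

Section CellSum.
Variables (R : realType) (s : nat).
Local Notation V := 'rV[int]_s.

Lemma harmonic_le_ln q : \sum_(c < q.+1) (maxn 1 c)%:R^-1 <= 2 + ln (q.+1%:R : R).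
Proof.
have h : forall n, \sum_(c < n.+2) (maxn 1 c)%:R^-1 <= 2 + ln (n.+1%:R : R).
  elim=> [|n IH].
    by rewrite !big_ord_recr big_ord0 /= (_ : maxn 1 0 = 1%N)// maxnn invr1 ln1; lra.
  rewrite big_ord_recr /= (maxn_idPr _)//.
  apply: (@le_trans _ _ (2 + ln (n.+1%:R : R) + n.+2%:R^-1)); first by rewrite lerD2r.
  rewrite -addrA lerD2l.
  have n1 : (0 : R) < n.+1%:R by rewrite ltr0n.
  have n2 : (0 : R) < n.+2%:R by rewrite ltr0n.
  have := @le_ln1Dx R (- n.+2%:R^-1).
  have -> : 1 + - n.+2%:R^-1 = n.+1%:R / n.+2%:R :> R.
    have e1 : n.+1%:R = n.+2%:R - 1 :> R by rewrite -[n.+2%:R]natr1 addrK.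
    by rewrite e1 mulrBl mulfV ?gt_eqF// mul1r.
  rewrite ln_div ?posrE// ltrN2 invf_lt1// ltr1n => /(_ isT).
  by rewrite lerBlDr => h; rewrite -lerBrDr; apply: le_trans h _; rewrite addrC.
case: q => [|q]; first by rewrite big_ord_recr big_ord0 /= (_ : maxn 1 0 = 1%N)// invr1 ln1; lra.
apply: le_trans (h q) _; rewrite lerD2l ler_ln ?posrE ?ltr0n//.
by rewrite ler_nat.
Qed.

Variables (beta : 'I_s -> V -> R) (g : 'I_s -> V -> R) (N q W : nat).
Hypothesis betaB : forall j h h', beta j (h - h') = beta j h - beta j h'.
Hypothesis Wq : (W <= q.+1)%N.
Hypothesis g_ge0 : forall j h, 0 <= g j h.
Hypothesis g_leW : forall j h, g j h <= W%:R.
Hypothesis g_dist : forall j h, g j h * dist (beta j h) <= 1.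

Let Q : R := q.+1%:R.
Let cell (x : R) : nat := Num.truncn (Q * frac x).
(** Bounds [1/dist] on the c-th of [q.+1] equal cells of the unit interval, from either end. The
    [maxn 1] covers the two extreme cells, where the trivial bound [W <= Q] takes over. *)
Let weight (c : nat) : R := Q * ((maxn 1 c)%:R^-1 + (maxn 1 (q - c))%:R^-1).

Let Q0 : 0 < Q. Proof. by rewrite ltr0n. Qed.

Let cell_itv x : (cell x)%:R <= Q * frac x < (cell x)%:R + 1.
Proof. by rewrite natr1; apply: truncn_itv; rewrite mulr_ge0 ?frac_ge0// ltW. Qed.

Let cell_lt x : (cell x < q.+1)%N.
Proof.
have /andP[h _] := cell_itv x; rewrite -(ltr_nat R); apply: le_lt_trans h _.
by rewrite -[ltRHS]mulr1 ltr_pM2l// frac_lt1.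
Qed.

Let weight_ge0 c : 0 <= weight c.
Proof. by rewrite mulr_ge0 ?addr_ge0 ?invr_ge0 ?ler0n// ltW. Qed.

Let g_weight j h : g j h <= weight (cell (beta j h)).
Proof.
set c := cell _; have gd := g_dist j h; have g0 := g_ge0 j h.
have w1 : Q * (maxn 1 c)%:R^-1 <= weight c.
  by rewrite ler_wpM2l ?(ltW Q0)// lerDl invr_ge0 ler0n.
have w2 : Q * (maxn 1 (q - c))%:R^-1 <= weight c.
  by rewrite ler_wpM2l ?(ltW Q0)// lerDr invr_ge0 ler0n.
have gQ : g j h <= Q by apply: le_trans (g_leW j h) _; rewrite ler_nat.
have [c0|c0] := posnP c.
  by apply: le_trans w1; rewrite c0 /= invr1 mulr1.
have [qc0|qc0] := posnP (q - c)%N.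
  by apply: le_trans w2; rewrite qc0 /= invr1 mulr1.
have [h1 h2] := andP (cell_itv (beta j h)); rewrite -/c in h1 h2.
have cR : (0 : R) < c%:R by rewrite ltr0n.
have qcR : (0 : R) < (q - c)%:R by rewrite ltr0n.
have cq : (c <= q)%N by have := cell_lt (beta j h); rewrite -/c ltnS.
move: gd; rewrite /dist; case: (leP (frac (beta j h)) (1 - frac (beta j h))) => _ gd.
  apply: le_trans w1; rewrite (maxn_idPr c0) ler_pdivlMr//.
  set f := frac _ in h1 h2 gd.
  apply: (@le_trans _ _ (Q * (g j h * f))); first by rewrite mulrCA ler_wpM2l.
  by rewrite -[leRHS]mulr1 ler_wpM2l ?(ltW Q0).
apply: le_trans w2; rewrite (maxn_idPr qc0) ler_pdivlMr//.
have eq1 : (q - c)%:R = Q - 1 - c%:R :> R.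
  by rewrite natrB// /Q -natr1; ring.
rewrite eq1 in qcR *.
set f := frac _ in h1 h2 gd.
have h3 : Q - 1 - c%:R <= Q * (1 - f) by rewrite mulrBr mulr1 -addrA lerD2l -opprD lerN2 addrC ltW.
apply: (@le_trans _ _ (Q * (g j h * (1 - f)))); first by rewrite mulrCA ler_wpM2l.
by rewrite -[leRHS]mulr1 ler_wpM2l ?(ltW Q0).
Qed.

Let sum_weight : \sum_(c < q.+1) weight c <= Q * (4 + 2 * ln Q).
Proof.
rewrite -mulr_sumr ler_wpM2l ?(ltW Q0)// big_split /=.
rewrite [X in _ + X](reindex_inj rev_ord_inj) /=.
rewrite [X in _ + X](eq_bigr (fun c : 'I_q.+1 => (maxn 1 c)%:R^-1)) => [|c _]; last first.
  by rewrite subSS subKn // -ltnS.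
by have := harmonic_le_ln q; rewrite -/Q; lra.
Qed.

(** The fractional parts of the [beta j h] are sorted into cells of length 1/Q. Two points of one
    cell differ by a point counted on the right, in the ball of doubled radius, so all cells are
    equally well bounded; the sum of the weights over all cells is a product of harmonic sums, hence
    the logarithms. *)
Lemma cell_sum : \sum_(h <- ball s N) \prod_j g j h <= (Q * (4 + 2 * ln Q)) ^+ s *
  (count (fun h => [forall j, dist (beta j h) <= Q^-1]) (ball s (2 * N)))%:R.
Proof.
set cnt := count _ _.
pose c (h : V) : {ffun 'I_s -> 'I_q.+1} := [ffun j => Ordinal (cell_lt (beta j h))].
have fibre f : (count (fun h => c h == f) (ball s N) <= cnt)%N.
  have [->|] := posnP (count (fun h => c h == f) (ball s N)); first by [].
  rewrite -has_count => /hasP[h0 h0N /eqP h0f].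
  rewrite /cnt -!size_filter -[X in (X <= _)%N](size_map (fun h : V => h - h0)).
  apply: uniq_leq_size.
    by rewrite map_inj_uniq ?filter_uniq ?ibox_uniq//; apply: addIr.
  move=> _ /mapP[h + ->]; rewrite mem_filter => /andP[/eqP hf hN].
  rewrite mem_filter; apply/andP; split.
    apply/forallP => j; rewrite betaB.
    have ec : cell (beta j h) = cell (beta j h0).
      by move: hf; rewrite -h0f => /ffunP /(_ j); rewrite !ffunE => -[].
    apply: le_trans (dist_le _ (Num.floor (beta j h) - Num.floor (beta j h0))) _.
    rewrite rmorphB /= (_ : _ - _ - _ = frac (beta j h) - frac (beta j h0)); last first.
      by rewrite /frac; ring.
    have := cell_itv (beta j h); have := cell_itv (beta j h0); rewrite ec.
    move=> /andP[a1 a2] /andP[b1 b2].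
    rewrite -[leRHS]mul1r ler_pdivlMr// -[X in _ * X <= _](gtr0_norm Q0) -normrM mulrBl.
    rewrite ler_norml; apply/andP; split.
      by rewrite ![_ * Q]mulrC; lra.
    by rewrite ![_ * Q]mulrC; lra.
  move: hN h0N; rewrite !mem_ball => /forallP hh /forallP hh0; apply/forallP => j.
  rewrite !mxE; apply: le_trans (ler_normB _ _) _.
  by rewrite mul2n -addnn PoszD; apply: lerD.
apply: (@le_trans _ _ (\sum_(h <- ball s N) \prod_j weight (c h j))).
  apply: ler_sum => h _; apply: ler_prod => j _; rewrite g_ge0 /= /c ffunE /=.
  exact: g_weight.
rewrite (partition_big c xpredT) //=.
apply: (@le_trans _ _ (\sum_(f : {ffun 'I_s -> 'I_q.+1}) cnt%:R * \prod_j weight (f j))).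
  apply: ler_sum => f _.
  under eq_bigr => h /eqP hf do rewrite hf.
  rewrite big_const_seq iter_addr_0 -[leLHS]mulr_natl ler_wpM2r ?prodr_ge0//.
  by rewrite ler_nat; apply: fibre.
rewrite -mulr_sumr mulrC ler_wpM2r//.
rewrite -(bigA_distr_bigA (fun (j : 'I_s) (k : 'I_q.+1) => weight k)) /=.
rewrite prodr_const card_ord lerXn2r ?nnegrE ?sumr_ge0//.
by apply: le_trans sum_weight; apply: sumr_ge0.
Qed.

End CellSum.

(** * Geometry of numbers: isotropic subspaces and the shrinking lemma *)

Section MaximalMinor.
Variable R : realFieldType.

(* Choosing columns with maximal minor, Cramer's rule bounds the coordinates of
   the others by 1. *)
Lemma maximal_minor m n (A : 'M[R]_(m, n)) :
  exists (f : 'I_(\rank A) -> 'I_n) (W : 'M[R]_(\rank A, n)),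
    A = colsub f A *m W /\ forall i j, `|W i j| <= 1.
Proof.
set p := \rank A; pose B : 'M[R]_(p, n) := row_base A.
have fB : row_full B^T by rewrite /row_full mxrank_tr; apply: row_base_free.
pose D (f : {ffun 'I_p -> 'I_n}) := `|\det (colsub f B)|.
pose f0 : {ffun 'I_p -> 'I_n} := fullrankfun fB.
case: (@Order.TotalTheory.arg_maxP _ _ _ f0 xpredT D isT) => f _ fmax.
have Df : 0 < D f.
  apply: (@lt_le_trans _ _ (D f0)); last exact: fmax.
  rewrite normr_gt0 -det_tr trmx_mxsub -unitfE -unitmxE; exact: fullrowsub_unit.
have uf : colsub f B \in unitmx by rewrite unitmxE unitfE -normr_gt0.
pose W := invmx (colsub f B) *m B.
have Wf : colsub f W = 1%:M by rewrite -mulmx_colsub mulVmx.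
exists f, W; split.
  rewrite -{1}(mulmx_base A) -/B -{1}(mulKVmx uf B) -/W mulmxA mulmx_colsub.
  by rewrite mulmx_base.
move=> i j.
(* Exchanging the i-th chosen column for the j-th multiplies the minor by [W i j]; maximality then
   gives the bound. *)
pose f' : {ffun 'I_p -> 'I_n} := [ffun k => if k == i then j else f k].
pose X := colsub f' W.
have DX : D f' = D f * `|\det X|.
  by rewrite /D -normrM -det_mulmx mulmx_colsub mulKVmx.
have Xi : \det X = W i j.
  rewrite (expand_det_row X i) (bigD1 i)//= big1 => [|k ki]; last first.
    rewrite /X mxE ffunE (negPf ki).
    by move/matrixP: Wf => /(_ i k); rewrite !mxE eq_sym (negPf ki) => ->; rewrite mul0r.
  rewrite addr0 /X mxE ffunE eqxx /cofactor addnn -signr_odd odd_double expr0 mul1r.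
  rewrite (_ : row' i _ = 1%:M) ?det1 ?mulr1//.
  apply/matrixP => a b; rewrite !mxE ffunE [_ == i]eq_sym (negPf (neq_lift _ _)).
  move/matrixP: Wf => /(_ (lift i a) (lift i b)); rewrite !mxE => ->.
  by rewrite (inj_eq (@lift_inj _ i)).
have : D f' <= D f by apply: fmax.
by rewrite DX Xi ger_pMr.
Qed.

(** The hypothesis says that the rows of [row_mx A B] span an isotropic subspace of the standard
    symplectic space of dimension [n + n]; such a subspace has dimension at most [n]. *)
Lemma isotropic_rank m n (A B : 'M[R]_(m, n)) :
  A *m B^T = B *m A^T -> (\rank (row_mx A B) <= n)%N.
Proof.
move=> AB; set C := row_mx A B.
pose J : 'M[R]_(n + n) := block_mx 0 (- 1%:M) 1%:M 0.
have JJ : J *m (- J) = 1%:M.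
  rewrite /J opp_block_mx mulmx_block.
  rewrite !(mulmx0, mul0mx, oppr0, opprK, mulmxN, mulNmx, mulmx1, mul1mx, addr0, add0r).
  by rewrite -scalar_mx_block.
have uJ : J \in unitmx by case/mulmx1_unit: JJ.
have CJ : C *m (C *m J)^T = 0.
  rewrite /C /J mul_row_block !mulmx0 !mulmx1 mulmxN mulmx1 add0r addr0.
  by rewrite tr_row_mx mul_row_col linearN /= mulmxN AB subrr.
have := mulmx0_rank_max CJ; rewrite mxrank_tr mxrankMfree ?row_free_unit//.
by move: (\rank C) => k; lia.
Qed.

End MaximalMinor.

Section Shrinking.
Variables (R : realType) (s : nat).
Local Notation V := 'rV[int]_s.
Variable M : 'M[R]_s.
Hypothesis M_sym : M^T = M.

Definition lin_form (j : 'I_s) (h : V) : R := \sum_l M j l * (h 0 l)%:~R.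

Lemma lin_formB j h h' : lin_form j (h - h') = lin_form j h - lin_form j h'.
Proof.
rewrite /lin_form -sumrB; apply: eq_bigr => l _.
by rewrite !mxE rmorphB mulrBr.
Qed.

Definition near_count (b tau : R) : nat :=
  count (fun h => [forall j, dist (lin_form j h) <= tau]) (ball s (Num.truncn b)).

Lemma mem_ball_trunc n (b : R) (h : 'rV[int]_n) : 0 <= b ->
  (h \in ball n (Num.truncn b)) = [forall j, `|(h 0 j)%:~R| <= b].
Proof.
move=> b0; rewrite mem_ball; apply: eq_forallb => j.
by rewrite -abszE lez_nat truncn_ge_nat// -intr_norm -abszE -pmulrn.
Qed.

Lemma floor_ball n (b : R) (x : 'I_n -> R) : 0 <= b -> (forall j, `|x j| <= b) ->
  \row_j Num.floor (x j) \in ball n (Num.truncn b).+1.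
Proof.
move=> b0 hx; rewrite mem_ball; apply/forallP => j; rewrite mxE.
have := hx j; rewrite ler_norml => /andP[h1 h2].
have [t1 t2] := andP (truncn_itv b0).
rewrite ler_norml; apply/andP; split.
  rewrite floor_ge_int rmorphN /= -pmulrn; apply: le_trans h1.
  by rewrite lerN2 ltW.
rewrite -ltzD1 floor_lt_int rmorphD /= -pmulrn.
by apply: le_lt_trans h2 (lt_trans t2 _); rewrite ltrDl ltr01.
Qed.

Lemma floor_eq_dist (x y : R) : Num.floor x = Num.floor y -> `|x - y| <= 1.
Proof.
move=> exy; have := floor_itv x; have := floor_itv y; rewrite exy rmorphD /=.
by move=> /andP[a b] /andP[c d]; rewrite ler_norml; apply/andP; split; lra.
Qed.

Variables (b tau kappa : R).
Hypotheses (s_gt0 : (0 < s)%N) (b_gt0 : 0 < b) (tau_gt0 : 0 < tau) (btau : b * tau <= 1).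
Hypotheses (kappa_gt0 : 0 < kappa) (kappa_le1 : kappa <= 1).

Let y (h : V) (j : 'I_s) : int := sval (cid (distE (lin_form j h))).
Let yP h j : dist (lin_form j h) = `|lin_form j h - (y h j)%:~R|.
Proof. by rewrite /y; case: cid. Qed.

Let vp (h : V) : 'rV[R]_s := \row_j ((h 0 j)%:~R / b).
Let vq (h : V) : 'rV[R]_s := \row_j ((lin_form j h - (y h j)%:~R) / tau).
Let v (h : V) : 'rV[R]_(s + s) := row_mx (vp h) (vq h).
Let S := [seq h <- ball s (Num.truncn b) | [forall j, dist (lin_form j h) <= tau]].

Let S_norm h k : h \in S -> `|v h 0 k| <= 1.
Proof.
rewrite mem_filter (mem_ball_trunc _ (ltW b_gt0)) => /andP[/forallP h1 /forallP h2].
rewrite /v mxE; case: (fintype.split k) => j; rewrite mxE normrM normfV.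
  by rewrite (gtr0_norm b_gt0) ler_pdivrMr// mul1r.
by rewrite (gtr0_norm tau_gt0) ler_pdivrMr// mul1r -yP.
Qed.

Let sR : (0 : R) < s%:R. Proof. by rewrite ltr0n. Qed.

(* Vectors of the lattice {(h / b, (M h - y) / tau)} with entries below
   1 / (2 s) are pairwise orthogonal for the symplectic form, because b * tau
   times that form is integral on the lattice. *)
Let isotropic h1 h2 h1' h2' :
  (forall k, `|v h1 0 k - v h2 0 k| <= (2 * s%:R)^-1) ->
  (forall k, `|v h1' 0 k - v h2' 0 k| <= (2 * s%:R)^-1) ->
  \sum_j (vp h1 - vp h2) 0 j * (vq h1' - vq h2') 0 j =
  \sum_j (vq h1 - vq h2) 0 j * (vp h1' - vp h2') 0 j.
Proof.
move=> hv hv'.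
have vL h j : v h 0 (lshift s j) = vp h 0 j by rewrite /v row_mxEl.
have vR h j : v h 0 (rshift s j) = vq h 0 j by rewrite /v row_mxEr.
set p := vp h1 - vp h2; set q := vq h1 - vq h2.
set p' := vp h1' - vp h2'; set q' := vq h1' - vq h2'.
have bp j : `|p 0 j| <= (2 * s%:R)^-1 by have := hv (lshift s j); rewrite !vL /p !mxE.
have bq j : `|q 0 j| <= (2 * s%:R)^-1 by have := hv (rshift s j); rewrite !vR /q !mxE.
have bp' j : `|p' 0 j| <= (2 * s%:R)^-1 by have := hv' (lshift s j); rewrite !vL /p' !mxE.
have bq' j : `|q' 0 j| <= (2 * s%:R)^-1 by have := hv' (rshift s j); rewrite !vR /q' !mxE.
pose g := h1 - h2; pose g' := h1' - h2'.
pose z j := y h1 j - y h2 j; pose z' j := y h1' j - y h2' j.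
have pE j : p 0 j = (g 0 j)%:~R / b by rewrite /p /g !mxE rmorphB mulrBl.
have p'E j : p' 0 j = (g' 0 j)%:~R / b by rewrite /p' /g' !mxE rmorphB mulrBl.
have qE j : q 0 j = (lin_form j g - (z j)%:~R) / tau.
  by rewrite /q /g /z lin_formB !mxE rmorphB /=; ring.
have q'E j : q' 0 j = (lin_form j g' - (z' j)%:~R) / tau.
  by rewrite /q' /g' /z' lin_formB !mxE rmorphB /=; ring.
pose w : int := \sum_j (z j * g' 0 j - g 0 j * z' j).
have symm : \sum_j (g 0 j)%:~R * lin_form j g' = \sum_j lin_form j g * (g' 0 j)%:~R.
  rewrite /lin_form; under eq_bigr do rewrite mulr_sumr.
  under [RHS]eq_bigr do rewrite mulr_suml.
  rewrite exchange_big /=; apply: eq_bigr => j _; apply: eq_bigr => l _.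
  by move/matrixP: M_sym => /(_ j l); rewrite mxE => ->; rewrite mulrCA mulrA.
have key : (\sum_j p 0 j * q' 0 j - \sum_j q 0 j * p' 0 j) * (b * tau) = w%:~R.
  have b0 : b != 0 by rewrite gt_eqF.
  have t0 : tau != 0 by rewrite gt_eqF.
  have -> : w%:~R = \sum_j (((z j)%:~R * (g' 0 j)%:~R) - (g 0 j)%:~R * (z' j)%:~R) :> R.
    by rewrite /w rmorph_sum; apply: eq_bigr => j _; rewrite rmorphB !rmorphM.
  have -> : (\sum_j p 0 j * q' 0 j - \sum_j q 0 j * p' 0 j) * (b * tau) =
     (\sum_j (g 0 j)%:~R * lin_form j g' - \sum_j lin_form j g * (g' 0 j)%:~R) +
     \sum_j (((z j)%:~R * (g' 0 j)%:~R) - (g 0 j)%:~R * (z' j)%:~R).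
    rewrite -!sumrB -big_split /= mulr_suml; apply: eq_bigr => j _.
    by rewrite pE p'E qE q'E; field; rewrite b0 t0.
  by rewrite symm subrr add0r.
have small (a c : 'rV[R]_s) : (forall j, `|a 0 j| <= (2 * s%:R)^-1) ->
    (forall j, `|c 0 j| <= (2 * s%:R)^-1) -> `|\sum_j a 0 j * c 0 j| <= (4 * s%:R)^-1.
  move=> ha hc; apply: le_trans (ler_norm_sum _ _ _) _.
  apply: (@le_trans _ _ (\sum_(j < s) (2 * s%:R)^-1 * (2 * s%:R)^-1)).
    by apply: ler_sum => j _; rewrite normrM ler_pM.
  rewrite sumr_const card_ord -mulr_natl.
  by rewrite le_eqVlt; apply/orP; left; apply/eqP; field; rewrite gt_eqF.
have s4 : (4 * s%:R)^-1 <= 4^-1 :> R.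
  by rewrite lef_pV2 ?posrE ?mulr_gt0// ler_peMr// ler1n.
have w0 : w = 0.
  have : `|w%:~R| < 1 :> R.
    rewrite -key normrM (gtr0_norm (mulr_gt0 b_gt0 tau_gt0)).
    have := small p q' bp bq'; have := small q p' bq bp'; move=> e1 e2.
    have : `|\sum_j p 0 j * q' 0 j - \sum_j q 0 j * p' 0 j| <= 2^-1.
      by apply: le_trans (ler_normB _ _) _; lra.
    move=> h; apply: (@le_lt_trans _ _ (2^-1 * 1)); last by lra.
    by apply: ler_pM => //; rewrite ltW// mulr_gt0.
  rewrite -intr_norm -[1]/(1%:~R) ltr_int => h.
  by apply/eqP; rewrite -normr_eq0; apply/eqP; have := normr_ge0 w; lia.
move: key; rewrite w0 => /eqP; rewrite mulf_eq0 (gt_eqF (mulr_gt0 b_gt0 tau_gt0)) orbF.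
by rewrite subr_eq0 => /eqP.
Qed.

(** Davenport's shrinking lemma, by the pigeonhole principle. A first subdivision, of bounded size,
    makes differences within a cell span at most [s] dimensions by [isotropic]. Then at most [s]
    coordinates control all [2 s] of them, and a second subdivision into about kappa^(-s) cells
    suffices, where kappa^(-2s) would be the naive cost. Points of one final cell inject into the
    smaller count by subtraction. *)
Lemma near_count_shrink : (near_count b tau)%:R <=
  ((4 * s).+3 ^ (s + s))%:R * (4 / kappa) ^+ s * (near_count (kappa * b) (kappa * tau))%:R.
Proof.
set small := near_count (kappa * b) (kappa * tau).
pose mm := (Num.truncn ((2 * kappa)^-1)).+1.
(* Cells of side 1/(2s), as [isotropic] requires; the coordinates are bounded by 1, so there are at
   most (4s+3)^(2s) cells. *)
pose f1 (h : V) : 'rV[int]_(s + s) := \row_k Num.floor (2 * s%:R * v h 0 k).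
have step1 : (size S <= (small * (2 * mm).+1 ^ s) * size (ball (s + s) (2 * s).+1))%N.
  apply: (size_fibres (f := f1)).
    move=> h hS; rewrite (_ : (2 * s)%N = Num.truncn (2 * s%:R : R)); last first.
      by rewrite -natrM natrK.
    apply: floor_ball => [|k]; first by rewrite mulr_ge0.
    rewrite normrM gtr0_norm ?mulr_gt0// ler_piMr ?mulr_ge0//; exact: S_norm.
  move=> c; rewrite -size_filter; set E := [seq h <- S | f1 h == c].
  have Eclose h h' : h \in E -> h' \in E -> forall k, `|v h 0 k - v h' 0 k| <= (2 * s%:R)^-1.
    rewrite !mem_filter => /andP[/eqP e1 _] /andP[/eqP e2 _] k.
    have : Num.floor (2 * s%:R * v h 0 k) = Num.floor (2 * s%:R * v h' 0 k).
      by move: e1; rewrite -e2 => /rowP /(_ k); rewrite !mxE.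
    move/floor_eq_dist; rewrite -mulrBr normrM gtr0_norm ?mulr_gt0// => h1.
    by rewrite -[leRHS]mul1r ler_pdivlMr ?mulr_gt0// mulrC.
  have [E0|] := posnP (size E); first by rewrite E0.
  move=> E0; pose h0 := nth 0 E 0.
  have h0E : h0 \in E by apply: mem_nth.
  pose P : 'M[R]_(size E, s) := \matrix_(i, j) (vp (nth 0 E i) - vp h0) 0 j.
  pose Qm : 'M[R]_(size E, s) := \matrix_(i, j) (vq (nth 0 E i) - vq h0) 0 j.
  have rk : (\rank (row_mx P Qm) <= s)%N.
    apply: isotropic_rank; apply/matrixP => i i'.
    have iE (k : 'I_(size E)) : nth 0 E k \in E by apply: mem_nth; apply: ltn_ord.
    have e1 : (P *m Qm^T) i i' = \sum_j (vp (nth 0 E i) - vp h0) 0 j *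
        (vq (nth 0 E i') - vq h0) 0 j.
      by rewrite mxE; apply: eq_bigr => j _; rewrite [P i j]mxE [Qm^T j i']mxE [Qm i' j]mxE.
    have e2 : (Qm *m P^T) i i' = \sum_j (vq (nth 0 E i) - vq h0) 0 j *
        (vp (nth 0 E i') - vp h0) 0 j.
      by rewrite mxE; apply: eq_bigr => j _; rewrite [Qm i j]mxE [P^T j i']mxE [P i' j]mxE.
    by rewrite e1 e2; apply: isotropic; apply: Eclose.
  (* [f] selects coordinates in which all differences from [h0] can be expressed with coefficients
     of absolute value at most 1. *)
  have [f [W [eA hW]]] := maximal_minor (row_mx P Qm).
  have rowE h : h \in E -> forall k, v h 0 k - v h0 0 k =
      \sum_i (v h 0 (f i) - v h0 0 (f i)) * W i k.
    move=> hE k; have hi : (index h E < size E)%N by rewrite index_mem.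
    have AE k' : (row_mx P Qm) (Ordinal hi) k' = v h 0 k' - v h0 0 k'.
      rewrite /v !mxE; case: (fintype.split k') => j; rewrite !mxE /= nth_index//.
    rewrite -AE (congr1 (fun A : 'M[R]_(_, _) => A (Ordinal hi) k) eA) mxE.
    by apply: eq_bigr => i _; rewrite [colsub _ _ _ _]mxE AE.
  (* Cells of side kappa/s in the selected coordinates: as at most [s] coordinates are selected,
     every coordinate of a difference within a cell is at most kappa. The selected coordinates are
     at most 1/(2s), whence the range [mm]. *)
  pose f2 (h : V) : 'rV[int]_(\rank (row_mx P Qm)) :=
    \row_i Num.floor (s%:R / kappa * (v h 0 (f i) - v h0 0 (f i))).
  apply: (@leq_trans (small * size (ball (\rank (row_mx P Qm)) mm))); last first.
    by rewrite leq_mul2l size_ball leq_pexp2l ?orbT.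
  apply: (size_fibres (f := f2)).
    move=> h hE; apply: floor_ball => [|i]; first by rewrite invr_ge0 mulr_ge0 ?ltW.
    rewrite normrM gtr0_norm ?divr_gt0//.
    have := Eclose _ _ hE h0E (f i) => h1.
    apply: le_trans (ler_wpM2l _ h1) _; first by rewrite divr_ge0 ?ltW.
    by rewrite le_eqVlt; apply/orP; left; apply/eqP; field; rewrite !gt_eqF.
  move=> c2; have [->|] := posnP (count (fun h => f2 h == c2) E); first by [].
  rewrite -has_count => /hasP[h1 h1E /eqP h1c].
  rewrite /small /near_count -!size_filter -[X in (X <= _)%N](size_map (fun h : V => h - h1)).
  apply: uniq_leq_size.
    by rewrite map_inj_uniq ?filter_uniq ?ibox_uniq//; apply: addIr.
  move=> _ /mapP[h + ->]; rewrite mem_filter => /andP[/eqP hc hE].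
  have close k : `|v h 0 k - v h1 0 k| <= kappa.
    have -> : v h 0 k - v h1 0 k = (v h 0 k - v h0 0 k) - (v h1 0 k - v h0 0 k) by ring.
    rewrite (rowE h hE) (rowE h1 h1E) -sumrB.
    apply: le_trans (ler_norm_sum _ _ _) _.
    apply: (@le_trans _ _ (\sum_(i < \rank (row_mx P Qm)) kappa / s%:R)).
      apply: ler_sum => i _; rewrite -mulrBl normrM -[leRHS]mulr1 ler_pM//.
      have : Num.floor (s%:R / kappa * (v h 0 (f i) - v h0 0 (f i))) =
             Num.floor (s%:R / kappa * (v h1 0 (f i) - v h0 0 (f i))).
        by move: hc; rewrite -h1c => /rowP /(_ i); rewrite !mxE.
      move/floor_eq_dist; rewrite -mulrBr normrM gtr0_norm ?divr_gt0// => e1.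
      by rewrite -(invf_div s%:R) -[leRHS]mul1r ler_pdivlMr ?divr_gt0// mulrC.
    rewrite sumr_const card_ord -[leLHS]mulr_natr.
    by rewrite mulrAC ler_pdivrMr// (ler_wpM2l (ltW kappa_gt0))// ler_nat.
  have vL j : v h 0 (lshift s j) - v h1 0 (lshift s j) = ((h - h1) 0 j)%:~R / b.
    by rewrite /v !row_mxEl !mxE rmorphB mulrBl.
  have vR j : v h 0 (rshift s j) - v h1 0 (rshift s j) =
      (lin_form j (h - h1) - (y h j - y h1 j)%:~R) / tau.
    by rewrite /v !row_mxEr !mxE lin_formB rmorphB /=; ring.
  rewrite mem_filter (mem_ball_trunc _ (ltW (mulr_gt0 kappa_gt0 b_gt0))); apply/andP; split.
    apply/forallP => j; apply: le_trans (dist_le _ (y h j - y h1 j)) _.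
    have := close (rshift s j); rewrite vR normrM normfV (gtr0_norm tau_gt0).
    by rewrite ler_pdivrMr.
  apply/forallP => j; have := close (lshift s j); rewrite vL normrM normfV (gtr0_norm b_gt0).
  by rewrite ler_pdivrMr.
have -> : near_count b tau = size S by rewrite size_filter.
have mmR : (2 * mm).+1%:R <= 4 / kappa :> R.
  have k0 : 0 <= (2 * kappa)^-1 by rewrite invr_ge0 mulr_ge0 ?ltW.
  have [t1 _] := andP (truncn_itv k0).
  have ki : 1 <= kappa^-1 by rewrite invf_ge1.
  have e2 : (2 * kappa)^-1 = kappa^-1 / 2 by rewrite invfM mulrC.
  rewrite e2 in t1; rewrite -natr1 natrM /mm -natr1 e2.
  by move: t1; set T := (Num.truncn _)%:R; lra.
move: step1; rewrite -(ler_nat R) => /le_trans; apply.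
rewrite size_ball !natrM !natrX mulrC mulrA -[leLHS]mulrA.
have -> : (2 * (2 * s).+1).+1%:R = (4 * s).+3%:R :> R by congr _%:R; lia.
rewrite -mulrA ler_wpM2l ?exprn_ge0// [leRHS]mulrC.
rewrite ler_wpM2l//; apply: lerXn2r => //; rewrite nnegrE ?ler0n//.
by rewrite divr_ge0// (ltW kappa_gt0).
Qed.

End Shrinking.

(** * Rational approximation from many nearly integral values *)

Section IntegerMatrices.

Lemma det_int_bound n (B : 'M[int]_n) (H : nat) : (forall i j, `|B i j| <= H%:Z) ->
  `|\det B| <= (n`! * H ^ n)%N%:Z.
Proof.
move=> hB; apply: le_trans (ler_norm_sum _ _ _) _.
apply: (@le_trans _ _ (\sum_(sg : {perm 'I_n}) (H ^ n)%N%:Z)).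
  apply: ler_sum => sg _; rewrite normrM normrX normrN1 expr1n mul1r normr_prod.
  apply: (@le_trans _ _ (\prod_(i < n) H%:Z)); last by rewrite prodr_const card_ord -!natz natrX.
  by apply: ler_prod => i _; rewrite normr_ge0 hB.
by rewrite sumr_const card_Sn -mulr_natl natz PoszM.
Qed.

(** A rational kernel vector multiplied by the product of its denominators. *)
Lemma rat_kernel_int m n (A : 'M[int]_(m, n)) : ~~ row_full (map_mx intr A : 'M[rat]_(m, n)) ->
  exists a : {ffun 'I_n -> int}, a != 0%R /\ forall i, \sum_j A i j * a j = 0.
Proof.
set Q := map_mx _ _ => nf.
have k0 : kermx Q^T != 0.
  rewrite -mxrank_eq0 mxrank_ker mxrank_tr subn_eq0 -ltnNge ltn_neqAle rank_leq_col andbT.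
  by apply: contra nf.
have /row_subPn[u hu] : ~~ (kermx Q^T <= (0 : 'M[rat]_n))%MS by rewrite submx0.
rewrite submx0 in hu; set v := row u _ in hu.
have vQ : v *m Q^T = 0 by apply/eqP; rewrite -row_mul mulmx_ker row0.
pose a : {ffun 'I_n -> int} := [ffun j => numq (v 0 j) * \prod_(l | l != j) denq (v 0 l)].
pose D : int := \prod_l denq (v 0 l).
have aE j : (a j)%:~R = v 0 j * D%:~R.
  rewrite /D [X in _ = _ * X%:~R](bigD1 j)//= ffunE !intrM mulrA; congr (_ * _).
  by rewrite -{2}(divq_num_den (v 0 j)) divfK// intr_eq0 denq_neq0.
have D0 : D%:~R != 0 :> rat.
  by rewrite intr_eq0; apply/prodf_neq0 => l _; apply: denq_neq0.
exists a; split.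
  have /rV0Pn[j vj] := hu; apply: contra vj => /eqP a0.
  have := aE j; rewrite a0 ffunE => /esym/eqP.
  by rewrite mulf_eq0 (negPf D0) orbF.
move=> i; apply: (@intr_inj rat); rewrite rmorph_sum /=.
have := congr1 (fun w : 'rV[rat]_m => w 0 i) vQ; rewrite !mxE => h.
transitivity ((\sum_j v 0 j * Q^T j i) * D%:~R); last by rewrite h mul0r.
rewrite mulr_suml; apply: eq_bigr => j _.
by rewrite /= intrM aE !mxE; ring.
Qed.

End IntegerMatrices.

Section MultilinearCount.
Variables (R : realType) (r s : nat) (F : 'I_r -> {mpoly int[s]}).
Variable alpha : 'I_r -> R.
Local Notation V := 'rV[int]_s.
Local Notation unitv j := (delta_mx 0 j : 'rV[int]_s).

(** For tuples of length [d - 1] these are the slopes, in the variable x, of the difference of the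
    phase in the directions [t]; see [diffs_form_comb]. *)
Definition polar_comb (t : seq V) (j : 'I_s) : R :=
  \sum_i alpha i * (polar (F i) (unitv j :: t))%:~R.

Definition polar_count (Ns : seq nat) (tau : R) : nat :=
  count (fun t => [forall j, dist (polar_comb t j) <= tau]) (hseqs s Ns).

(** With all arguments but two fixed, the polar form is a symmetric bilinear form; its symmetry is
    what the shrinking lemma asks for. *)
Definition polar_matrix (t : seq V) : 'M[R]_s :=
  \matrix_(j, l) \sum_i alpha i * (polar (F i) [:: unitv j, unitv l & t])%:~R.

Lemma polar_matrix_sym t : (polar_matrix t)^T = polar_matrix t.
Proof.
apply/matrixP => j l; rewrite !mxE; apply: eq_bigr => i _.
congr (_ * _%:~R); apply: polar_perm.
by apply/seq.permP => c; rewrite /= addnCA.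
Qed.

Lemma polar_comb_cons h t j : polar_comb (h :: t) j = lin_form (polar_matrix t) j h.
Proof.
rewrite /polar_comb /lin_form.
under [RHS]eq_bigr do rewrite mxE mulr_suml.
rewrite exchange_big /=; apply: eq_bigr => i _.
rewrite (polar_perm _ (u := [:: h, unitv j & t])); last first.
  by apply/seq.permP => c; rewrite /= addnCA.
rewrite polar_expand rmorph_sum mulr_sumr; apply: eq_bigr => l _.
rewrite /= intrM mulrCA mulrC; congr (_ * _%:~R * _); apply: polar_perm.
by apply/seq.permP => c; rewrite /= addnCA.
Qed.

Lemma polar_comb_perm t u j : perm_eq t u -> polar_comb t j = polar_comb u j.
Proof.
by move=> tu; apply: eq_bigr => i _; rewrite (polar_perm _ (u := unitv j :: u))// perm_cons.
Qed.

Lemma polar_count_cons N Ns tau : polar_count (N :: Ns) tau =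
  (\sum_(t <- hseqs s Ns)
    count (fun h => [forall j, (dist (lin_form (polar_matrix t) j h) <= tau)%R]) (ball s N))%N.
Proof.
rewrite /polar_count -sum1_count /= big_mkcond big_allpairs_dep /= exchange_big /=.
apply: eq_bigr => t _; rewrite -sum1_count [RHS]big_mkcond /=.
apply: eq_bigr => h _; congr (if _ then _ else _).
by apply: eq_forallb => j; rewrite polar_comb_cons.
Qed.

Lemma polar_count_rot N Ns tau : polar_count (rcons Ns N) tau = polar_count (N :: Ns) tau.
Proof.
have le_rot Ms Ms' (f : seq V -> seq V) : injective f ->
    (forall t, t \in hseqs s Ms -> f t \in hseqs s Ms' /\ perm_eq t (f t)) ->
    (polar_count Ms tau <= polar_count Ms' tau)%N.
  move=> finj hf; rewrite /polar_count -!size_filter -(size_map f).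
  apply: uniq_leq_size; first by rewrite map_inj_uniq ?filter_uniq ?hseqs_uniq.
  move=> _ /mapP[t + ->]; rewrite !mem_filter => /andP[/forallP ht tM].
  have [ftM pt] := hf t tM; rewrite ftM andbT; apply/forallP => j.
  by rewrite -(polar_comb_perm _ pt).
have all2_rcons (T U : Type) (p : T -> U -> bool) t M h n : size t = size M ->
    all2 p (rcons t h) (rcons M n) = all2 p t M && p h n.
  by elim: t M => [|x t IH] [|y M] //= => [|[/IH ->]]; rewrite ?andbT// andbA.
have memrot t h : (rcons t h \in hseqs s (rcons Ns N)) = (h :: t \in hseqs s (N :: Ns)).
  rewrite !mem_hseqs !size_rcons /= !eqSS; case: eqP => //= st.
  by rewrite all2_rcons// andbC.
apply/eqP; rewrite eqn_leq; apply/andP; split.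
  apply: (@le_rot _ _ (fun t => rotr 1 t)) => [|t]; first exact: rotr_inj.
  case/lastP: t => [|t h]; first by rewrite mem_hseqs size_rcons.
  by rewrite memrot rotr1_rcons => ->; split=> //; rewrite perm_rcons.
apply: (@le_rot _ _ (fun t => rot 1 t)) => [|t]; first exact: rot_inj.
case: t => [|h t]; first by rewrite mem_hseqs.
by rewrite -memrot rot1_cons => ->; split=> //; rewrite perm_sym perm_rcons.
Qed.

Lemma polar_count_mono Ns Ns' tau tau' : size Ns = size Ns' ->
  all2 leq Ns Ns' -> tau <= tau' -> (polar_count Ns tau <= polar_count Ns' tau')%N.
Proof.
move=> sN hN ht; rewrite /polar_count -!size_filter.
apply: uniq_leq_size; first by rewrite filter_uniq ?hseqs_uniq.
move=> t; rewrite !mem_filter => /andP[/forallP h tN]; apply/andP; split.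
  by apply/forallP => j; apply: le_trans (h j) ht.
move: tN; rewrite !mem_hseqs sN => /andP[-> /=]; clear h; elim: Ns Ns' t sN hN => [|N Ns IH] [|N' Ns'] //.
move=> [|x t] //= [sN] /andP[NN' hN] /andP[xN tN]; rewrite (IH _ _ sN hN tN) andbT.
move: xN; rewrite !mem_ball => /forallP hx; apply/forallP => j.
by apply: le_trans (hx j) _; rewrite lez_nat.
Qed.

Definition shrink_const : R := ((4 * s).+3 ^ (s + s))%:R * 4 ^+ s.

Hypothesis s_gt0 : (0 < s)%N.

(** The polar form is symmetric, so the entries can be rotated to the head one after another and
    shrunk there while the others stay fixed. Each of the [n] rounds also multiplies the tolerance
    by kappa, which keeps the product of range and tolerance at most 1. *)
Lemma polar_count_shrink n (b tau kappa : R) : 0 < b -> 0 < tau -> b * tau <= 1 ->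
  0 < kappa -> kappa <= 1 ->
  (polar_count (nseq n (Num.truncn b)) tau)%:R <= (shrink_const * kappa ^- s) ^+ n *
    (polar_count (nseq n (Num.truncn (kappa * b))) (kappa ^+ n * tau))%:R.
Proof.
move=> b0 t0 bt k0 k1.
have C0 : 0 <= shrink_const * kappa ^- s.
  by rewrite mulr_ge0 ?mulr_ge0 ?exprn_ge0// invr_ge0 exprn_ge0// ltW.
suff h i : (i <= n)%N -> (polar_count (nseq n (Num.truncn b)) tau)%:R <=
    (shrink_const * kappa ^- s) ^+ i *
    (polar_count (nseq (n - i) (Num.truncn b) ++ nseq i (Num.truncn (kappa * b)))
      (kappa ^+ i * tau))%:R.
  by have := h n (leqnn n); rewrite subnn.
elim: i => [|i IH] hi; first by rewrite subn0 cats0 !expr0 !mul1r.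
apply: le_trans (IH (ltnW hi)) _; rewrite exprSr -mulrA ler_wpM2l ?exprn_ge0//.
have -> : (n - i = (n - i.+1).+1)%N by lia.
rewrite /=; set Ns := _ ++ _.
have -> : nseq (n - i.+1) (Num.truncn b) ++ nseq i.+1 (Num.truncn (kappa * b)) =
    rcons Ns (Num.truncn (kappa * b)).
  rewrite /Ns rcons_cat; congr (_ ++ _).
  by elim: (i) => //= k ->.
rewrite polar_count_rot !polar_count_cons !natr_sum mulr_sumr; apply: ler_sum => t _.
have ki0 : 0 < kappa ^+ i by apply: exprn_gt0.
have := @near_count_shrink R s (polar_matrix t) (polar_matrix_sym t) b (kappa ^+ i * tau)
  kappa s_gt0 b0 (mulr_gt0 ki0 t0) _ k0 k1.
rewrite exprS -[kappa * _ * tau]mulrA.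
rewrite (_ : shrink_const * kappa ^- s = ((4 * s).+3 ^ (s + s))%:R * (4 / kappa) ^+ s); last first.
  by rewrite expr_div_n mulrA.
apply.
apply: le_trans bt; rewrite mulrCA ler_piMl ?(ltW (mulr_gt0 b0 t0))//.
by apply: exprn_ile1 => //; apply: ltW.
Qed.

(** Consider the integer matrix with columns indexed by the forms and rows by the pairs (t, j). If
    its rank is below [r], an integral vector of its kernel is the [a] sought. Otherwise [r]
    independent rows give a square system for alpha with nearly integral right-hand side, and
    Cramer's rule approximates alpha with the determinant as common denominator. *)
Lemma approx_or_kernel (T : seq (seq V)) (H : nat) (tau : R) :
  (forall t i j, t \in T -> `|polar (F i) (unitv j :: t)| <= H%:Z) ->
  (forall t j, t \in T -> dist (polar_comb t j) <= tau) ->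
  (exists a : {ffun 'I_r -> int}, a != 0%R /\ forall t, t \in T -> kernel_pred F a t) \/
  (exists q : nat, [/\ (0 < q)%N, (q <= r`! * H ^ r)%N & forall i, exists z : int,
     `|q%:R * alpha i - z%:~R| <= (r * (r.-1`! * H ^ r.-1))%N%:R * tau]).
Proof.
move=> hH hT.
pose I : finType := ('I_(size T) * 'I_s)%type.
pose A : 'M[int]_(#|I|, r) := \matrix_(u, i)
  polar (F i) (unitv (enum_val u : I).2 :: nth [::] T (enum_val u : I).1).
have [full|nfull] := boolP (row_full (map_mx intr A : 'M[rat]_(_, _))); last first.
  left; have [a [a0 ha]] := rat_kernel_int nfull; exists a; split=> // t tT.
  apply/forallP => j; rewrite polar_linear.
  have it : (index t T < size T)%N by rewrite index_mem.
  have := ha (enum_rank ((Ordinal it, j) : I)) => h; apply/eqP; rewrite -[RHS]h.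
  by apply: eq_bigr => i _; rewrite mxE enum_rankK /= nth_index// mulrC.
right.
(* A choice of [r] independent rows. *)
pose f := fullrankfun full.
pose B : 'M[int]_r := rowsub f A.
have tB k : nth [::] T (enum_val (f k) : I).1 \in T by apply: mem_nth; apply: ltn_ord.
have BH k i : `|B k i| <= H%:Z by rewrite !mxE; apply: hH.
have dB : \det B != 0.
  have := fullrowsub_unit full; rewrite unitmxE unitfE.
  have -> : rowsub f (map_mx intr A) = map_mx intr B :> 'M[rat]_r.
    by apply/matrixP => k i; rewrite !mxE.
  by rewrite det_map_mx intr_eq0.
exists (absz (\det B)); split; first by rewrite absz_gt0.
  by rewrite -lez_nat abszE; apply: det_int_bound.
move=> i.
have [z hz] : exists z : 'I_r -> int, forall k,
    `|\sum_l (B k l)%:~R * alpha l - (z k)%:~R| <= tau.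
  have /choice[z hz] : forall k, exists z : int,
    `|\sum_l (B k l)%:~R * alpha l - z%:~R| <= tau; last by exists z.
  move=> k; set j := (enum_val (f k) : I).2.
  have [z hz] := distE (polar_comb (nth [::] T (enum_val (f k) : I).1) j).
  exists z; have := hT _ j (tB k); rewrite hz; congr (`|_ - _| <= _).
  by apply: eq_bigr => l _; rewrite !mxE mulrC.
have cof k : `|(\adj B) i k| <= (r.-1`! * H ^ r.-1)%N%:Z.
  rewrite mxE /cofactor normrM normrX normrN1 expr1n mul1r.
  by apply: det_int_bound => u v; rewrite !mxE; have := BH (lift k u) (lift i v); rewrite !mxE.
have key : `|(\det B)%:~R * alpha i - (\sum_k (\adj B) i k * z k)%:~R| <=
    (r * (r.-1`! * H ^ r.-1))%N%:R * tau.
  have -> : (\det B)%:~R * alpha i = \sum_k ((\adj B) i k)%:~R * \sum_l (B k l)%:~R * alpha l.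
    under eq_bigr do rewrite mulr_sumr.
    rewrite exchange_big /= (bigD1 i)//= [X in _ + X]big1 ?addr0 => [|l li].
      under eq_bigr do rewrite mulrA -intrM.
      rewrite -mulr_suml -rmorph_sum /=; congr (_%:~R * _).
      by move/matrixP: (mul_adj_mx B) => /(_ i i); rewrite !mxE eqxx mulr1n => <-.
    under eq_bigr do rewrite mulrA -intrM.
    rewrite -mulr_suml -rmorph_sum /=.
    have -> : \sum_k (\adj B) i k * B k l = 0.
      by move/matrixP: (mul_adj_mx B) => /(_ i l); rewrite !mxE eq_sym (negPf li) mulr0n.
    by rewrite mul0r.
  rewrite rmorph_sum -sumrB; apply: le_trans (ler_norm_sum _ _ _) _.
  apply: (@le_trans _ _ (\sum_(k < r) (r.-1`! * H ^ r.-1)%N%:R * tau)); last first.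
    by rewrite sumr_const card_ord -[leLHS]mulr_natl (natrM _ r) -mulrA.
  apply: ler_sum => k _; rewrite /= intrM -mulrBr normrM ler_pM//.
  by rewrite -intr_norm [leRHS]pmulrn ler_int; apply: cof.
have [dp|dn] := leP 0 (\det B).
  exists (\sum_k (\adj B) i k * z k).
  by rewrite [(absz _)%:R]pmulrn abszE (ger0_norm dp).
exists (- \sum_k (\adj B) i k * z k).
rewrite [(absz _)%:R]pmulrn abszE (ltr0_norm dn).
by rewrite !rmorphN /= mulNr -opprD normrN.
Qed.

End MultilinearCount.

(** Multilinear expansion along the basis vectors, entry by entry; only finitely many values on
    basis vectors occur. *)
Lemma polar_bound s (p : {mpoly int[s]}) d : exists c : nat, forall (N : nat) (t : seq 'rV[int]_s) j,
  size t = d -> all (fun h => h \in ball s N) t ->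
  `|polar p (delta_mx 0 j :: t)| <= (c * N ^ d)%N%:Z.
Proof.
pose E (I : seq 'I_s) := [seq (delta_mx 0 j : 'rV[int]_s) | j <- I].
pose c0 := (\sum_(J : d.+1.-tuple 'I_s) absz (polar p (E J)))%N.
have h (N : nat) : forall (t : seq 'rV[int]_s) (I : seq 'I_s), (size t + size I = d.+1)%N ->
    all (fun h => h \in ball s N) t ->
    `|polar p (t ++ E I)| <= (c0 * (s * N) ^ size t)%N%:Z.
  elim=> [|h t IH] I /=.
    move=> sI _; rewrite expn0 muln1 -abszE lez_nat.
    have /eqP sI' : size I = d.+1 by [].
    by rewrite /c0 (bigD1 (Tuple sI'))//= leq_addr.
  move=> st /andP[hN tN]; rewrite polar_expand.
  apply: le_trans (ler_norm_sum _ _ _) _.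
  apply: (@le_trans _ _ (\sum_(j < s) (N * (c0 * (s * N) ^ size t))%N%:Z)).
    apply: ler_sum => j _; rewrite normrM PoszM ler_pM//.
      by move: hN; rewrite mem_ball => /forallP.
    rewrite (polar_perm _ (u := t ++ E (j :: I))).
      by apply: IH => //=; rewrite -st addnS.
    by apply/seq.permP => c; rewrite /= !count_cat /= addnCA.
  rewrite sumr_const card_ord -mulr_natl natz -PoszM lez_nat expnS.
  by rewrite mulnA [X in (_ <= X)%N]mulnCA.
exists (c0 * s ^ d)%N => N t j st tN.
rewrite (polar_perm _ (u := t ++ E [:: j])); last first.
  by apply/seq.permP => c; rewrite /= !count_cat /= addn0 addnC.
have := h N t [:: j]; rewrite /= st addn1 => /(_ erefl tN).
by rewrite expnMn mulnA.
Qed.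

(** * Weyl's inequality for systems of forms *)

Section WeylBound.
Variables (R : realType) (r s d : nat) (F : 'I_r -> {mpoly int[s]}).
Hypothesis s_gt0 : (0 < s)%N.
Hypothesis F_homog : forall i, F i \is ishomog1 d mdeg.
Hypothesis d_gt1 : (1 < d)%N.
Local Notation V := 'rV[int]_s.
Local Notation unitv j := (delta_mx 0 j : 'rV[int]_s).
Local Notation e := (@unit_exp R).

Definition form_comb (alpha : 'I_r -> R) (x : V) : R := \sum_i alpha i * (evZ (F i) x)%:~R.

Lemma diffs_scale (c : R) (g : V -> int) t x :
  diffs t (fun y => c * (g y)%:~R) x = c * (diffs t g x)%:~R.
Proof.
elim: t g => [|h t IH] g //=; rewrite -IH; congr (diffs t _ x).
by apply/funext => y; rewrite /diff intrB mulrBr.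
Qed.

Lemma diffs_form_comb alpha t x : size t = d.-1 ->
  diffs t (form_comb alpha) x =
  diffs t (form_comb alpha) 0 + \sum_j polar_comb F alpha t j * (x 0 j)%:~R.
Proof.
move=> st; rewrite !(diffs_sum _ (fun i y => alpha i * (evZ (F i) y)%:~R)).
under [X in _ + X]eq_bigr do rewrite mulr_suml.
rewrite exchange_big -big_split /=; apply: eq_bigr => i _; rewrite !diffs_scale.
have : diffs (rcons t x) (evZ (F i)) 0 = polar (F i) (x :: t).
  rewrite diffs_polar; last by rewrite size_rcons st prednK ?(ltnW d_gt1)// homog_msize_le.
  by apply: polar_perm; rewrite perm_rcons.
rewrite diffs_rcons /diff add0r polar_expand => /(canRL (subrK _)) ->.
rewrite intrD mulrDr addrC; congr (_ + _).
rewrite rmorph_sum mulr_sumr; apply: eq_bigr => j _.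
by rewrite /= intrM mulrCA mulrC.
Qed.

(** The usual minimum of [N + 1] and [1/dist b]; the first branch also takes care of
    [dist b = 0]. *)
Definition edge_bound (N : nat) (b : R) : R :=
  if dist b * N.+1%:R <= 1 then N.+1%:R else (dist b)^-1.

Lemma edge_bound_ge0 N b : 0 <= edge_bound N b.
Proof. by rewrite /edge_bound; case: ifP => // _; rewrite invr_ge0 dist_ge0. Qed.

Lemma edge_bound_le N b : edge_bound N b <= N.+1%:R.
Proof.
rewrite /edge_bound; case: ifP => // /negbT; rewrite -ltNge => h.
have d0 : 0 < dist b.
  by rewrite lt_neqAle dist_ge0 andbT eq_sym; apply: contraTneq h => ->; rewrite mul0r ltr10.
by rewrite invf_ple ?posrE// -[leLHS]mul1r ler_pdivrMr// ltW.
Qed.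

Lemma edge_bound_dist N b : edge_bound N b * dist b <= 1.
Proof.
rewrite /edge_bound; case: ifP => [|_]; first by rewrite mulrC.
by have [->|h] := eqVneq (dist b) 0; rewrite ?mulr0// mulVf.
Qed.

Lemma linear_sum_bound N (b : R) (l u : int) : u - l <= N%:Z + 1 ->
  normc (\sum_(k < width l u) e (b * (l + k%:Z)%:~R)) <= edge_bound N b.
Proof.
move=> hw; rewrite /edge_bound; case: ifP => [_|/negbT].
  apply: le_trans (normc_sum _ _ _) _.
  under eq_bigr do rewrite normc_unit_exp.
  rewrite sumr_const card_ord -[1 *+ _]/(_%:R) ler_nat /width.
  by move: hw; rewrite maxEle; case: ifP => ? ?; lia.
rewrite -ltNge => h.
have d0 : 0 < dist b.
  by rewrite lt_neqAle dist_ge0 andbT eq_sym; apply: contraTneq h => ->; rewrite mul0r ltr10.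
by rewrite -[leRHS]mul1r ler_pdivlMr// geometric_sum_bound.
Qed.

Lemma linear_form_sum_bound alpha N t (l u : 'I_s -> int) : size t = d.-1 ->
  (forall j, u j - l j <= N%:Z + 1) ->
  normc (\sum_(x <- ibox l u) e (diffs t (form_comb alpha) x)) <=
  \prod_j edge_bound N (polar_comb F alpha t j).
Proof.
move=> st hw.
have -> : \sum_(x <- ibox l u) e (diffs t (form_comb alpha) x) =
    e (diffs t (form_comb alpha) 0) *
    \sum_(x <- ibox l u) \prod_j e (polar_comb F alpha t j * (x 0 j)%:~R).
  rewrite mulr_sumr; apply: eq_bigr => x _; rewrite diffs_form_comb// unit_expD; congr (_ * _).
  by elim/big_rec2: _ => [|j a b _ <-]; rewrite ?unit_exp0// unit_expD.
rewrite (@sum_ibox s R[i] l u (fun j z => e (polar_comb F alpha t j * z%:~R))).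
rewrite normcM normc_unit_exp mul1r normc_prod; apply: ler_prod => j _.
by rewrite normc_ge0 linear_sum_bound.
Qed.

Definition log_factor (N : nat) : R := 4 + 2 * ln (2 * N).+1%:R.

Lemma log_factor_ge0 N : 0 <= log_factor N.
Proof. by rewrite addr_ge0// mulr_ge0// ln_ge0// ler1n. Qed.

Lemma weyl_polar_count alpha N (l u : 'I_s -> int) : (forall j, u j - l j <= N%:Z + 1) ->
  normc (\sum_(x <- ibox l u) e (form_comb alpha x)) ^+ (2 ^ d.-1) <=
  (2 * N).+1%:R ^+ (s * (2 ^ d.-1 - d.-1)) * log_factor N ^+ s *
  (polar_count F alpha (nseq d.-1 (2 * N)) ((2 * N).+1%:R^-1))%:R.
Proof.
move=> hw; apply: le_trans (weyl_differencing (k := d.-1)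
  (E := fun t => \prod_j edge_bound N (polar_comb F alpha t j)) hw _) _.
  move=> t l' u'; rewrite mem_hseqs size_nseq => /andP[/eqP st _].
  exact: linear_form_sum_bound.
have dE : d.-1 = d.-2.+1 by case: (d) d_gt1 => [|[]].
set Q : R := (2 * N).+1%:R; set L := log_factor N.
have Q0 : 0 <= Q by rewrite ler0n.
have step : \sum_(t <- hseqs s (nseq d.-1 N)) \prod_j edge_bound N (polar_comb F alpha t j) <=
    (Q * L) ^+ s * (polar_count F alpha (nseq d.-1 (2 * N)) Q^-1)%:R.
  (* [cell_sum] doubles the range of the head entry only; the other ranges are enlarged afterwards
     to make all entries alike, as the rotations in the shrinking step need. *)
  apply: (@le_trans _ _ ((Q * L) ^+ s *
    (polar_count F alpha (2 * N :: nseq d.-2 N)%N Q^-1)%:R)); last first.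
    rewrite ler_wpM2l ?exprn_ge0 ?mulr_ge0 ?log_factor_ge0// ler_nat dE.
    apply: polar_count_mono => //=; first by rewrite !size_nseq.
    by rewrite leqnn /=; elim: (d.-2) => //= n ->; rewrite leq_pmull.
  rewrite polar_count_cons natr_sum mulr_sumr dE /= big_allpairs_dep /= exchange_big /=.
  apply: ler_sum => t _.
  have betaB j h h' : polar_comb F alpha (h - h' :: t) j =
      polar_comb F alpha (h :: t) j - polar_comb F alpha (h' :: t) j.
    by rewrite !polar_comb_cons lin_formB.
  have := @cell_sum R s (fun j h => polar_comb F alpha (h :: t) j)
    (fun j h => edge_bound N (polar_comb F alpha (h :: t) j)) N (2 * N) N.+1 betaB.
  rewrite -/Q -/(log_factor N) -/L.
  under [X in (_ -> _ -> _ -> _ -> _ <= _ * X%:R) -> _]eq_count.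
    move=> h; under eq_forallb do rewrite polar_comb_cons.
    over.
  apply.
  - by rewrite ltnS leq_pmull.
  - by move=> j h; apply: edge_bound_ge0.
  - by move=> j h; apply: edge_bound_le.
  - by move=> j h; apply: edge_bound_dist.
apply: le_trans (ler_wpM2l _ step) _; first by rewrite exprn_ge0// ler0n.
rewrite size_ball natrX -exprM mulrA ler_wpM2r ?ler0n// exprMn mulrA ler_wpM2r//.
  by rewrite exprn_ge0// log_factor_ge0.
rewrite -/Q -exprD; have -> // : (s * (2 ^ d.-1 - d.-1 - 1) + s = s * (2 ^ d.-1 - d.-1))%N.
have : (d.-1 < 2 ^ d.-1)%N by apply: ltn_expl.
by move=> h; rewrite -mulnSr; congr (s * _)%N; lia.
Qed.

Variable k : nat.
Hypothesis k_dim : forall (a : {ffun 'I_r -> int}) m Z, a != 0%R ->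
  irreducible_chain (gradient_zeros R F a) m Z -> (m <= k)%N.

(** All ranges are shrunk from [2 N] to [X]. If the surviving tuples lie in the kernel of one pencil
    member, their number is at most about X^(s(d-2)+k), which is X^(s-k) below the trivial count.
    Otherwise the polar values, of size about X^(d-1), yield denominators of size X^(r(d-1)). *)
Lemma weyl_dichotomy : exists2 C : R, 1 <= C & forall (N : nat) (X : R) alpha (l u : 'I_s -> int),
  (0 < N)%N -> 1 <= X -> X <= (2 * N)%:R -> (forall j, u j - l j <= N%:Z + 1) ->
  normc (\sum_(x <- ibox l u) e (form_comb alpha x)) ^+ (2 ^ d.-1) * X ^+ s <=
    C * log_factor N ^+ s * (2 * N).+1%:R ^+ (s * 2 ^ d.-1) * X ^+ k \/
  exists q : nat, [/\ (0 < q)%N, q%:R <= C * X ^+ (r * d.-1) & forall i, exists z : int,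
    `|q%:R * alpha i - z%:~R| <= C * X ^+ (r * d.-1) / (2 * N)%:R ^+ d].
Proof.
have [Ck hCk] := kernel_count s_gt0 F_homog d_gt1 k_dim.
have /choice[c hc] : forall i, exists c : nat, forall (N : nat) (t : seq V) j,
  size t = d.-1 -> all (fun h => h \in ball s N) t ->
  `|polar (F i) (unitv j :: t)| <= (c * N ^ d.-1)%N%:Z by move=> i; apply: polar_bound.
pose c0 := (\sum_i c i)%N.
pose C1 : R := shrink_const R s ^+ d.-1 * Ck%:R * 3 ^+ (s * d.-2 + k).
pose C2 : R := (r`! * c0 ^ r)%:R.
pose C3 : R := (r * (r.-1`! * c0 ^ r.-1))%:R.
have sc0 : 0 <= shrink_const R s by rewrite mulr_ge0 ?exprn_ge0.
have C10 : 0 <= C1 by rewrite !mulr_ge0 ?exprn_ge0.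
have C20 : 0 <= C2 by rewrite ler0n.
have C30 : 0 <= C3 by rewrite ler0n.
exists (1 + C1 + C2 + C3); first lra.
move=> N X alpha l u N0 X1 XN hw.
have X0 : 0 < X by lra.
have W := weyl_polar_count alpha hw.
have N2 : 0 < (2 * N)%:R :> R by rewrite ltr0n muln_gt0.
(* The factor that shrinks the range [2 N] to [X]; after [d - 1] rounds the tolerance is at most
   X^(d-1)/(2N)^d. *)
pose kap := X / (2 * N)%:R.
have k0 : 0 < kap by rewrite divr_gt0.
have k1 : kap <= 1 by rewrite ler_pdivrMr// mul1r.
have kX : kap * (2 * N)%:R = X by rewrite divfK// gt_eqF.
set Q : R := (2 * N).+1%:R in W *.
have Q0 : 0 < Q by rewrite ltr0n.
have QN : (2 * N)%:R <= Q by rewrite ler_nat.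
have := @polar_count_shrink R r s F alpha s_gt0 d.-1 (2 * N)%:R Q^-1 kap N2.
rewrite invr_gt0 => /(_ Q0); rewrite ler_pdivrMr// mul1r => /(_ QN k0 k1).
rewrite kX natrK; set n := Num.truncn X; set tau := kap ^+ d.-1 * Q^-1 => Sh.
have nX : n%:R <= X by rewrite /n truncn_le ltW.
have n0 : (0 < n)%N by rewrite /n -truncn_gt0 in X1 *.
pose T := [seq t <- hseqs s (nseq d.-1 n) | [forall j, dist (polar_comb F alpha t j) <= tau]].
have hT t : t \in T -> [/\ forall j, dist (polar_comb F alpha t j) <= tau,
    size t = d.-1 & all (fun h => h \in ball s n) t].
  rewrite mem_filter mem_hseqs size_nseq => /andP[/forallP h /andP[/eqP st tn]].
  split=> //; rewrite -st in tn; elim: t tn {h st} => //= x t IH /andP[-> h].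
  exact: IH.
have tau0 : 0 <= tau by rewrite mulr_ge0 ?exprn_ge0 ?invr_ge0 ?ltW.
case: (@approx_or_kernel R r s F alpha T (c0 * n ^ d.-1) tau).
- move=> t i j /hT[_ st tn]; apply: le_trans (hc i n t j st tn) _.
  by rewrite lez_nat leq_mul2r /c0 (bigD1 i)//= leq_addr orbT.
- by move=> t j /hT[h _ _].
- move=> [a [a0 ha]]; left.
  have cT : (polar_count F alpha (nseq d.-1 n) tau <= Ck * (2 * n).+1 ^ (s * d.-2 + k))%N.
    apply: leq_trans (hCk a n a0); rewrite /polar_count -size_filter -/T -size_filter.
    apply: uniq_leq_size; first by rewrite filter_uniq ?hseqs_uniq.
    by move=> t tT; rewrite mem_filter ha//; move: tT; rewrite mem_filter => /andP[].
  have cT' : (polar_count F alpha (nseq d.-1 n) tau)%:R <=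
      Ck%:R * (3 * X) ^+ (s * d.-2 + k).
    apply: le_trans (_ : (Ck * (2 * n).+1 ^ (s * d.-2 + k))%:R <= _).
      by rewrite ler_nat.
    have n3 : (2 * n).+1%:R <= 3 * X by rewrite -[leLHS]natr1 natrM; lra.
    have X30 : 0 <= 3 * X by lra.
    by rewrite natrM natrX ler_wpM2l ?ler0n// lerXn2r// nnegrE.
  set p1 := (polar_count _ _ _ _)%:R in W Sh.
  set p2 := (polar_count _ _ _ _)%:R in cT' Sh.
  (* Shrinking costs kap^(-s(d-1)), while the kernel contributes X^(s(d-2)+k); the powers of X
     combine to X^(k-s). *)
  have key : p1 <= C1 * Q ^+ (s * d.-1) * X ^+ k / X ^+ s.
    apply: le_trans Sh _.
    apply: le_trans (ler_wpM2l _ cT') _.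
      by rewrite exprn_ge0// mulr_ge0// invr_ge0 exprn_ge0// ltW.
    rewrite exprMn exprVn -exprM.
    have -> : kap ^+ (s * d.-1) = X ^+ (s * d.-2) * X ^+ s / (2 * N)%:R ^+ (s * d.-1).
      rewrite /kap expr_div_n; congr (_ / _); rewrite -exprD; congr (_ ^+ _).
      by rewrite -mulnSr; case: (d) d_gt1 => [|[]].
    have -> : (3 * X) ^+ (s * d.-2 + k) = 3 ^+ (s * d.-2 + k) * (X ^+ (s * d.-2) * X ^+ k).
      by rewrite exprMn (exprD X).
    have -> : shrink_const R s ^+ d.-1 *
      (X ^+ (s * d.-2) * X ^+ s / (2 * N)%:R ^+ (s * d.-1))^-1 *
      (Ck%:R * (3 ^+ (s * d.-2 + k) * (X ^+ (s * d.-2) * X ^+ k))) =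
      C1 * (2 * N)%:R ^+ (s * d.-1) * X ^+ k / X ^+ s.
      rewrite /C1; field.
      by rewrite !expf_neq0 ?gt_eqF.
    rewrite ler_wpM2r ?invr_ge0 ?exprn_ge0 ?(ltW X0)// ler_wpM2r ?exprn_ge0 ?(ltW X0)//.
    by rewrite ler_wpM2l// lerXn2r// nnegrE ltW.
  have L0 := log_factor_ge0 N.
  apply: le_trans (ler_wpM2r _ W) _; first by rewrite exprn_ge0// ltW.
  apply: (@le_trans _ _ (Q ^+ (s * (2 ^ d.-1 - d.-1)) * log_factor N ^+ s *
     (C1 * Q ^+ (s * d.-1) * X ^+ k / X ^+ s) * X ^+ s)).
    rewrite ler_wpM2r ?exprn_ge0 ?(ltW X0)// ler_wpM2l//.
    by rewrite mulr_ge0 ?exprn_ge0 ?(ltW Q0).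
  have -> : Q ^+ (s * 2 ^ d.-1) = Q ^+ (s * (2 ^ d.-1 - d.-1)) * Q ^+ (s * d.-1).
    rewrite -exprD -mulnDr subnK//; apply: ltnW; exact: ltn_expl.
  set qa := Q ^+ (s * (_ - _)); set qb := Q ^+ (s * d.-1); set L := log_factor N ^+ s.
  have Xs : X ^+ s != 0 by rewrite expf_neq0// gt_eqF.
  have -> : qa * L * (C1 * qb * X ^+ k / X ^+ s) * X ^+ s = C1 * (L * (qa * qb) * X ^+ k).
    by field.
  rewrite -[_ * L * _]mulrA -[(1 + _ + _ + _) * _ * _]mulrA ler_wpM2r//; last lra.
  by rewrite !mulr_ge0 ?exprn_ge0// ltW.
move=> [q [q0 qH hq]]; right; exists q; split=> //.
  apply: (@le_trans _ _ (r`! * (c0 * n ^ d.-1) ^ r)%:R); first by rewrite ler_nat.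
  rewrite expnMn mulnA natrM -/C2 -expnM natrX mulnC.
  apply: ler_pM; rewrite ?exprn_ge0//; first lra.
  by rewrite lerXn2r ?nnegrE ?(ltW X0).
move=> i; have [z hz] := hq i; exists z; apply: le_trans hz _.
(* The cofactors contribute X^((d-1)(r-1)) and the tolerance a further X^(d-1), which together is
   the power X^(r(d-1)) claimed. *)
have -> : (r * (r.-1`! * (c0 * n ^ d.-1) ^ r.-1) = (r * (r.-1`! * c0 ^ r.-1)) * n ^ (d.-1 * r.-1))%N.
  by rewrite expnMn -expnM !mulnA.
rewrite natrM -/C3 natrX -mulrA.
have hn : n%:R ^+ (d.-1 * r.-1) <= X ^+ (d.-1 * r.-1).
  by rewrite lerXn2r ?nnegrE ?(ltW X0).
have ht : tau <= X ^+ d.-1 / (2 * N)%:R ^+ d.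
  rewrite /tau /kap expr_div_n -mulrA ler_wpM2l ?exprn_ge0 ?(ltW X0)//.
  rewrite -invfM lef_pV2 ?posrE ?mulr_gt0 ?exprn_gt0//.
  have -> : d = d.-1.+1 by rewrite prednK// ltnW.
  by rewrite exprSr /= ler_wpM2l// exprn_ge0// ltW.
have rE : (r * d.-1 = d.-1 * r.-1 + d.-1)%N.
  by rewrite -mulnSr prednK ?(leq_ltn_trans _ (ltn_ord i))// mulnC.
apply: (@le_trans _ _ (C3 * (X ^+ (d.-1 * r.-1) * (X ^+ d.-1 / (2 * N)%:R ^+ d)))).
  by rewrite ler_wpM2l// ler_pM.
rewrite [X ^+ _ * _]mulrA -exprD -rE mulrA ler_wpM2r ?invr_ge0 ?exprn_ge0 ?(ltW N2)//.
by rewrite ler_wpM2r ?exprn_ge0 ?(ltW X0)//; lra.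
Qed.

End WeylBound.

(** * The Weyl alternative with a power saving *)

Lemma ln_le_powR (R : realType) (x eps : R) : 0 < eps -> 0 < x -> ln x <= x `^ eps / eps.
Proof.
move=> e0 x0; rewrite ler_pdivlMr// mulrC -ln_powR ltW// ln_sublinear//.
exact: powR_gt0.
Qed.

Lemma root_pow (R : realType) (x : R) n : 0 <= x -> (0 < n)%N -> (x `^ n%:R^-1) ^+ n = x.
Proof.
by move=> x0 n0; rewrite -powR_mulrn ?powR_ge0// -powRrM mulVf ?powRr1// pnatr_eq0 -lt0n.
Qed.

Section WeylAlternative.
Variables (R : realType) (r s d : nat) (F : 'I_r -> {mpoly int[s]}).
Hypothesis r_gt0 : (0 < r)%N.
Hypothesis s_gt0 : (0 < s)%N.
Hypothesis F_homog : forall i, F i \is ishomog1 d mdeg.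
Hypothesis d_gt1 : (1 < d)%N.
Variable k : nat.
Hypothesis k_dim : forall (a : {ffun 'I_r -> int}) m Z, a != 0%R ->
  irreducible_chain (gradient_zeros R F a) m Z -> (m <= k)%N.
Hypothesis s_large : (k + 2 ^ d.-1 * r.+1 * (r * d.-1) < s)%N.
Local Notation e := (@unit_exp R).
Local Notation D := (2 ^ d.-1)%N.
Local Notation n0 := (r * d.-1)%N.

(** With D = 2^(d-1) and n0 = r(d-1), integrality gives s - k >= D (r+1) n0 + 1, so the saving
    X^((s-k)/D) with X = Y^(1/n0) is at least Y^(r+1+1/(n0 D)). Half of the gain 1/(n0 D) is given
    up to absorb the logarithms. *)
Definition weyl_exponent : R := r.+1%:R + (2 * n0 * D)%:R^-1.

Let n0_gt0 : (0 < n0)%N.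
Proof. by rewrite muln_gt0 r_gt0 -ltnS prednK// ltnW. Qed.
Let D_gt0 : (0 < D)%N. Proof. by rewrite expn_gt0. Qed.

Lemma log_factor_powR (c : R) : 0 < c -> exists2 K : R, 1 <= K & forall (P : R) N, 1 <= P ->
  N%:R <= 2 * P -> log_factor R N ^+ s <= K * P `^ c.
Proof.
move=> c0; pose eps := c / s%:R.
have sR : (0 : R) < s%:R by rewrite ltr0n.
have e0 : 0 < eps by rewrite divr_gt0.
pose K := 4 + (2 / eps) * 5 `^ eps.
have K1 : 1 <= K.
  have : 0 <= (2 / eps) * 5 `^ eps by rewrite mulr_ge0 ?powR_ge0// divr_ge0// ltW.
  by rewrite /K; lra.
exists (K ^+ s) => [|P N P1 NP]; first exact: exprn_ege1.
have P0 : 0 < P by lra.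
have N5 : (2 * N).+1%:R <= 5 * P by rewrite -[leLHS]natr1 natrM; lra.
have Pe : 1 <= P `^ eps by rewrite -[leLHS](powRr0 P) ler_powR// ltW.
have -> : P `^ c = (P `^ eps) ^+ s.
  by rewrite -powR_mulrn ?powR_ge0// -powRrM divfK// gt_eqF.
rewrite -exprMn lerXn2r ?nnegrE ?log_factor_ge0//.
  by rewrite mulr_ge0 ?powR_ge0//; lra.
have h1 : ln (2 * N).+1%:R <= (5 * P) `^ eps / eps.
  apply: le_trans (ln_le_powR e0 _); last by rewrite mulr_gt0.
  by rewrite ler_ln ?posrE ?ltr0n// mulr_gt0.
rewrite powRM// ?(ltW P0)// in h1.
rewrite /log_factor /K.
have -> : (4 + 2 / eps * 5 `^ eps) * P `^ eps = 4 * P `^ eps + 2 * (5 `^ eps * P `^ eps / eps).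
  by ring.
lra.
Qed.

Lemma normc_box_sum (l u : 'I_s -> int) N (f : 'rV[int]_s -> R) : (forall j, u j - l j <= N%:Z + 1) ->
  normc (\sum_(x <- ibox l u) e (f x)) <= N.+1%:R ^+ s.
Proof.
move=> hw; apply: le_trans (normc_sum _ _ _) _.
under eq_bigr do rewrite normc_unit_exp.
rewrite big_const_seq count_predT iter_addr_0 size_ibox -natrX ler_nat.
rewrite -[X in (_ <= _ ^ X)%N](card_ord s) -prod_nat_const; apply: leq_prod => j _.
by have := hw j; rewrite /width maxEle; case: ifP => ? ?; lia.
Qed.

(** [weyl_dichotomy] parametrised by the bound Y on the denominators. The condition [P^eta <= Y]
    converts the logarithms of P into a small power of Y. Different choices of P and Y serve the
    minor arcs, the Gauss sums and the oscillatory integral. *)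
Lemma weyl_alternative (eta : R) : 0 < eta -> exists2 C : R, 1 <= C &
  forall (P Y : R) alpha (l u : 'I_s -> int), 1 <= P -> P `^ eta <= Y -> Y <= P ^+ n0 ->
  (forall j, - P <= (l j)%:~R) -> (forall j, (u j)%:~R - 1 <= P) ->
  normc (\sum_(x <- ibox l u) e (form_comb F alpha x)) <= C * P ^+ s / Y `^ weyl_exponent \/
  exists q : nat, [/\ (0 < q)%N, q%:R <= Y & forall i, exists z : int,
    `|q%:R * alpha i - z%:~R| <= Y / P ^+ d].
Proof.
move=> eta0; have [C0 C01 hC] := weyl_dichotomy s_gt0 F_homog d_gt1 k_dim.
have n0R : (0 : R) < n0%:R by rewrite ltr0n.
have DR : (0 : R) < D%:R by rewrite ltr0n.
pose c : R := (2 * n0%:R)^-1.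
have c0 : 0 < c by rewrite invr_gt0 mulr_gt0.
have [K K1 hK] := log_factor_powR (mulr_gt0 eta0 c0).
have wD : weyl_exponent * D%:R = (D * r.+1)%:R + c.
  rewrite /weyl_exponent mulrDl -natrM [(D * _)%N]mulnC; congr (_ + _).
  rewrite /c natrM [(2 * n0)%:R]natrM; move: n0R DR; set x := n0%:R; set y := D%:R => x0 y0.
  by rewrite invfM -mulrA mulVf ?mulr1// gt_eqF.
have we0 : 0 <= weyl_exponent by rewrite addr_ge0.
pose K2 := C0 * K * 5 ^+ (s * D) * C0 ^+ (D * r.+1) * C0 `^ n0%:R^-1.
have C0e : 1 <= C0 `^ n0%:R^-1.
  by rewrite -[leLHS](powRr0 C0) ler_powR// invr_ge0 ltW.
have K21 : 1 <= K2.
  have m (x y : R) : 1 <= x -> 1 <= y -> 1 <= x * y by move=> hx hy; rewrite -[1]mulr1 ler_pM.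
  by rewrite /K2 !m// exprn_ege1//; lra.
exists (K2 + 3 ^+ s * C0 `^ weyl_exponent) => [|P Y alpha l u P1 PY YP hl hu].
  by rewrite -[1]addr0 lerD// mulr_ge0 ?powR_ge0 ?exprn_ge0.
have P0 : 0 < P by lra.
have Y0 : 0 < Y by apply: lt_le_trans PY; apply: powR_gt0.
(* The box lies between -P and P + 1, so its sides are at most [N + 1]. *)
pose N := Num.truncn (2 * P).
have NP : N%:R <= 2 * P by rewrite truncn_le mulr_ge0 ?(ltW P0).
have PN : P <= N%:R.
  by have := truncnS_gt (2 * P); rewrite -/N -natr1; lra.
have N0 : (0 < N)%N by rewrite truncn_gt0; lra.
have hw j : u j - l j <= N%:Z + 1.
  rewrite -lerBlDr; case: (leP (u j - l j - 1) 0) => [|h]; first by move=> h; apply: le_trans h _.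
  have [m hm] : exists m : nat, u j - l j - 1 = m%:Z.
    by exists (absz (u j - l j - 1)%R); rewrite abszE gtr0_norm.
  rewrite hm lez_nat truncn_ge_nat ?mulr_ge0 ?(ltW P0)//.
  have -> : m%:R = (u j)%:~R - (l j)%:~R - 1 :> R by rewrite -[1]/(1%:~R) -!intrB hm.
  by have := hl j; have := hu j; lra.
set S := normc _.
have S0 : 0 <= S by apply: normc_ge0.
have Yw : 0 < Y `^ weyl_exponent by apply: powR_gt0.
(* For bounded Y the trivial bound suffices, at the price of a larger constant. *)
have [YC|CY] := ltP Y C0.
  left; rewrite ler_pdivlMr//.
  have h1 : S <= 3 ^+ s * P ^+ s.
    apply: le_trans (normc_box_sum _ hw) _; rewrite -exprMn lerXn2r ?nnegrE ?mulr_ge0 ?(ltW P0)//.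
    by rewrite -natr1; lra.
  have h2 : Y `^ weyl_exponent <= C0 `^ weyl_exponent.
    by apply: ge0_ler_powR; rewrite ?nnegrE ?(ltW Y0) ?(ltW YC)//; lra.
  apply: le_trans (ler_pM S0 (ltW Yw) h1 h2) _.
  rewrite mulrAC ler_wpM2r ?exprn_ge0 ?(ltW P0)//; lra.
(* Chosen so that [C0 * X ^+ n0 = Y]: the denominators of the dichotomy are then at most Y. *)
pose X := (Y / C0) `^ n0%:R^-1.
have YC0 : 0 <= Y / C0 by rewrite divr_ge0 ?(ltW Y0)//; lra.
have YC1 : 1 <= Y / C0 by rewrite ler_pdivlMr ?mul1r//; lra.
have XE : X ^+ n0 = Y / C0 by apply: root_pow.
have X1 : 1 <= X by rewrite -[leLHS](powRr0 (Y / C0)) ler_powR// invr_ge0 ltW.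
have X0 : 0 < X by lra.
have XP : X <= P.
  rewrite -(ler_pXn2r n0_gt0) ?nnegrE ?(ltW X0) ?(ltW P0)// XE.
  apply: le_trans YP; rewrite ler_pdivrMr; last lra.
  by rewrite ler_peMr// ltW.
have N2P : P <= (2 * N)%:R by rewrite natrM; lra.
case: (hC N X alpha l u N0 X1 (le_trans XP N2P) hw) => [h|[q [q0 hq hz]]]; last first.
  right; exists q; rewrite XE mulrC divfK in hq; last by rewrite gt_eqF//; lra.
  split=> // i; have [z hzi] := hz i; exists z; apply: le_trans hzi _.
  rewrite XE.
  rewrite [C0 * _]mulrC divfK; last by rewrite gt_eqF//; lra.
  by rewrite ler_wpM2l ?(ltW Y0)// lef_pV2 ?posrE ?exprn_gt0 ?(lt_le_trans P0)// lerXn2r ?nnegrE ?(ltW P0).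
left; rewrite -/S in h.
apply: (@le_trans _ _ (K2 * P ^+ s / Y `^ weyl_exponent)); last first.
  rewrite ler_wpM2r ?invr_ge0 ?(ltW Yw)// ler_wpM2r ?exprn_ge0 ?(ltW P0)//.
  by rewrite lerDl mulr_ge0 ?powR_ge0 ?exprn_ge0.
(* The strict inequality between integers in [s_large] supplies the extra factor X, the source of
   the gain beyond Y^(r+1). *)
have h1 : S ^+ D * X ^+ (D * r.+1 * n0).+1 <= C0 * log_factor R N ^+ s * (2 * N).+1%:R ^+ (s * D).
  have Xk : 0 < X ^+ k by apply: exprn_gt0.
  rewrite -(ler_pM2r Xk); apply: le_trans h; rewrite -mulrA ler_wpM2l ?exprn_ge0//.
  by rewrite -exprD ler_weXn2l// addSn addnC.
have h2 : X ^+ (D * r.+1 * n0).+1 = Y `^ ((D * r.+1)%:R + n0%:R^-1) / (C0 ^+ (D * r.+1) * C0 `^ n0%:R^-1).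
  rewrite exprSr mulnC exprM XE powRD; last by rewrite gt_eqF// implybT.
  rewrite powR_mulrn ?(ltW Y0)// /X expr_div_n powRM ?invr_ge0 ?(ltW Y0)//; last lra.
  rewrite -[C0^-1]powR_inv1; last lra.
  by rewrite -powRrM mulN1r powRN invfM mulrACA.
set Xp := X ^+ _ in h1 h2.
have Xp0 : 0 < Xp by apply: exprn_gt0.
have hlog : log_factor R N ^+ s <= K * Y `^ c.
  apply: le_trans (hK P N P1 NP) _; rewrite ler_wpM2l//; first lra.
  rewrite powRrM; apply: ge0_ler_powR; rewrite ?nnegrE ?powR_ge0 ?(ltW c0)//; exact: ltW.
have hQ : (2 * N).+1%:R ^+ (s * D) <= 5 ^+ (s * D) * P ^+ (s * D).
  rewrite -exprMn lerXn2r ?nnegrE ?mulr_ge0 ?(ltW P0)//.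
  by rewrite -[leLHS]natr1 natrM; lra.
set Lg := log_factor R N ^+ s in h1 hlog; set Qp := _ ^+ (s * D) in h1 hQ.
have Lg0 : 0 <= Lg by rewrite exprn_ge0// log_factor_ge0.
have Qp0 : 0 <= Qp by rewrite exprn_ge0.
have Yc : 0 < Y `^ c by apply: powR_gt0.
have YwD : (Y `^ weyl_exponent) ^+ D = Y `^ ((D * r.+1)%:R + c).
  by rewrite -powR_mulrn ?powR_ge0// -powRrM wD.
have n0c : n0%:R^-1 = c + c :> R.
  by rewrite /c invfM -mulrDl [_ + _](_ : _ = 1 :> R) ?mul1r//; lra.
have YE : Y `^ ((D * r.+1)%:R + n0%:R^-1) = (Y `^ weyl_exponent) ^+ D * Y `^ c.
  by rewrite YwD n0c addrA powRD// (gt_eqF Y0) implybT.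
have S1 : S ^+ D <= K2 * P ^+ (s * D) / (Y `^ weyl_exponent) ^+ D.
  rewrite -(ler_pM2r Xp0); apply: le_trans h1 _.
  apply: (@le_trans _ _ (C0 * (K * Y `^ c) * (5 ^+ (s * D) * P ^+ (s * D)))).
    apply: ler_pM => //; first by rewrite mulr_ge0//; lra.
    by rewrite ler_wpM2l//; lra.
  rewrite h2 YE /K2.
  have : (Y `^ weyl_exponent) ^+ D != 0 by rewrite gt_eqF// exprn_gt0.
  have : C0 ^+ (D * r.+1) != 0 by rewrite gt_eqF// exprn_gt0//; lra.
  have : C0 `^ n0%:R^-1 != 0 by rewrite gt_eqF// powR_gt0//; lra.
  set x1 := C0 `^ _; set x2 := C0 ^+ _; set x3 := _ ^+ D => g1 g2 g3.
  set y1 := 5 ^+ _; set y2 := P ^+ _; set y3 := Y `^ c.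
  by rewrite le_eqVlt; apply/orP; left; apply/eqP; field; rewrite g1 g2 g3.
have B0 : 0 <= K2 * P ^+ s / Y `^ weyl_exponent.
  by rewrite divr_ge0 ?(ltW Yw)// mulr_ge0 ?exprn_ge0 ?(ltW P0)//; lra.
rewrite -(ler_pXn2r D_gt0) ?nnegrE//; apply: le_trans S1 _.
rewrite expr_div_n exprMn -exprM ler_wpM2r ?invr_ge0 ?exprn_ge0 ?(ltW Yw)//.
rewrite ler_wpM2r ?exprn_ge0 ?(ltW P0)//.
by rewrite -[leLHS]expr1 ler_weXn2l.
Qed.


End WeylAlternative.

(** * Measurability of Lipschitz functions on tuples *)

Section LipschitzMeasurable.
Variables (R : realType).
Local Notation RR := (measurableTypeR R).

Definition l1dist n (x y : n.-tuple RR) : R := \sum_j `|(tnth x j : R) - tnth y j|.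

Lemma l1dist_ge0 n (x y : n.-tuple RR) : 0 <= l1dist x y.
Proof. by apply: sumr_ge0 => j _; apply: normr_ge0. Qed.

Definition lipschitz n (L : R) (f : n.-tuple RR -> R) : Prop :=
  forall x y, `|f x - f y| <= L * l1dist x y.

Lemma countable_tuple_int n : countable [set: n.-tuple int].
Proof. exact: countableP. Qed.

Definition grid_floor n k (x : n.-tuple RR) : n.-tuple int :=
  map_tuple (fun t : RR => Num.floor (k.+1%:R * (t : R))) x.

Definition grid_point n k (z : n.-tuple int) : n.-tuple RR :=
  map_tuple (fun t : int => t%:~R / k.+1%:R : RR) z.

Lemma grid_floor_dist n k (x : n.-tuple RR) :
  l1dist (grid_point k (grid_floor k x)) x <= n%:R / k.+1%:R.
Proof.
have k0 : (0 : R) < k.+1%:R by rewrite ltr0n.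
apply: (@le_trans _ _ (\sum_(j < n) k.+1%:R^-1)); last first.
  by rewrite sumr_const card_ord -[leLHS]mulr_natl.
apply: ler_sum => j _; rewrite !tnth_map.
set t : R := tnth x j; have /andP[h1 h2] := floor_itv (k.+1%:R * t).
rewrite intrD in h2.
have -> : (Num.floor (k.+1%:R * t))%:~R / k.+1%:R - t =
   ((Num.floor (k.+1%:R * t))%:~R - k.+1%:R * t) / k.+1%:R.
  by rewrite mulrBl [k.+1%:R * t]mulrC mulfK// gt_eqF.
rewrite normrM (@ger0_norm _ k.+1%:R^-1) ?invr_ge0 ?(ltW k0)// ler_piMl ?invr_ge0 ?(ltW k0)//.
by rewrite ler_norml; apply/andP; split; lra.
Qed.

Lemma measurable_grid_floor n k (z : n.-tuple int) : measurable (grid_floor k @^-1` [set z]).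
Proof.
have k0 : (0 : R) < k.+1%:R by rewrite ltr0n.
have -> : grid_floor k @^-1` [set z] = \bigcap_(j in [set: 'I_n])
    ((fun x : n.-tuple RR => tnth x j) @^-1`
       [set` `[(tnth z j)%:~R / k.+1%:R, (tnth z j + 1)%:~R / k.+1%:R[ ]).
  have E (x : n.-tuple RR) j : (Num.floor (k.+1%:R * (tnth x j : R)) = tnth z j) <->
      ((tnth x j : R) \in `[(tnth z j)%:~R / k.+1%:R, (tnth z j + 1)%:~R / k.+1%:R[).
    rewrite in_itv /= ler_pdivrMr// ltr_pdivlMr// ![_ * k.+1%:R]mulrC -floor_eq.
    by split=> [->|/eqP].
  apply/seteqP; split=> x /=.
    by move=> xz j _ /=; apply/E; rewrite -xz tnth_map.
  by move=> h; apply/eq_from_tnth => j; rewrite tnth_map; apply/E; apply: h.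
apply: fin_bigcap_measurable => [|j _]; first exact: finite_finset.
rewrite -[X in measurable X]setTI; exact: measurable_tnth.
Qed.

(** The sigma-algebra on tuples is generated by the coordinates. The function is the pointwise limit
    of its values at nearby grid points, each of which is constant on countably many measurable
    cells. *)
Lemma lipschitz_measurable n L (f : n.-tuple RR -> R) : lipschitz L f ->
  measurable_fun [set: n.-tuple RR] f.
Proof.
move=> fL.
pose fk k (x : n.-tuple RR) : R := f (grid_point k (grid_floor k x)).
have mfk k : measurable_fun [set: _] (fk k).
  move=> _ Y mY; rewrite setTI.
  have -> : fk k @^-1` Y = \bigcup_(z in [set: n.-tuple int])
      (if f (grid_point k z) \in Y then grid_floor k @^-1` [set z] else set0).
    apply/seteqP; split=> x /=.
      by move=> h; exists (grid_floor k x) => //; rewrite mem_set.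
    by case=> z _; case: ifPn => // /set_mem h xz; rewrite /fk /= xz.
  apply: countable_bigcupT_measurable; first exact: countable_tuple_int.
  by move=> z; case: ifP => // _; apply: measurable_grid_floor.
apply/measurable_EFinP.
apply: (@emeasurable_fun_cvg _ _ _ _ (fun k x => (fk k x)%:E)).
  by move=> k; apply/measurable_EFinP.
move=> x _; apply/fine_cvgP; split; first by apply: nearW => k.
apply/cvgrPdist_le => eps e0.
have L0 : 0 <= `|L| * n%:R + 1 by rewrite addr_ge0// mulr_ge0.
near=> k.
rewrite /= distrC; apply: le_trans (fL _ _) _.
apply: (@le_trans _ _ (`|L| * (n%:R / k.+1%:R))).
  apply: le_trans (ler_wpM2r (l1dist_ge0 _ _) (ler_norm L)) _.
  by rewrite ler_wpM2l// grid_floor_dist.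
rewrite mulrA ler_pdivrMr ?ltr0n// [eps * _]mulrC -ler_pdivrMr//.
near: k; exists (Num.truncn ((`|L| * n%:R) / eps)).+1%N => // k /= hk.
apply: le_trans (ltW (truncnS_gt _)) _.
by rewrite ler_nat; apply: leq_trans hk _.
Unshelve. all: by end_near.
Qed.

End LipschitzMeasurable.

(** * Riemann sums with explicit error over boxes *)

Section RiemannLine.
Variable R : realType.
Local Notation mu := (@lebesgue_measure R).

(** The least integer to the right of the boundary [BSide b x]. The integers of an interval are thus
    those from one cut, included, to the other, excluded, whichever ends are closed. *)
Definition cut (b : bool) (x : R) : int := if b then Num.ceil x else Num.floor x + 1.

Lemma cut_le b (x : R) (k : int) : (cut b x <= k) = (if b then x <= k%:~R else x < k%:~R).
Proof.
case: b => /=; first by rewrite ceil_le_int.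
by rewrite -floor_lt_int lezD1.
Qed.

Lemma cut_ge b (x : R) : x <= (cut b x)%:~R.
Proof. by have := lexx (cut b x); rewrite cut_le; case: b => // /ltW. Qed.

Lemma cut_le1 b (x : R) : (cut b x)%:~R <= x + 1.
Proof.
have h : cut b x <= Num.floor x + 1.
  by rewrite cut_le; case/andP: (floor_itv x) => _; case: b => // /ltW.
apply: (@le_trans _ _ (Num.floor x + 1)%:~R); first by rewrite ler_int.
by rewrite intrD lerD2r floor_le.
Qed.

Lemma cut_lt a b (x y : R) : x < y -> cut a x <= cut b y.
Proof.
move=> xy; rewrite cut_le; have h := cut_ge b y.
by case: a; rewrite ?ltW//; apply: lt_le_trans xy h.
Qed.

Lemma mem_cut a b (lo hi : R) h w (k : int) : 0 < h ->
  (h * k%:~R + w \in Interval (BSide a lo) (BSide b hi)) =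
  (cut a ((lo - w) / h) <= k) && (k < cut b ((hi - w) / h)).
Proof.
move=> h0; rewrite ltNge !cut_le in_itv /=.
have e1 x : (x <= h * k%:~R + w) = ((x - w) / h <= k%:~R) by rewrite ler_pdivrMr// lerBlDr mulrC.
have e2 x : (x < h * k%:~R + w) = ((x - w) / h < k%:~R) by rewrite ltr_pdivrMr// ltrBlDr mulrC.
congr (_ && _); first by case: a => /=; rewrite ?e1 ?e2.
by case: b => /=; rewrite -?e1 -?e2 -?leNgt -?ltNge.
Qed.

Variables (g : R -> R) (K L : R).
Hypothesis g_bound : forall x, `|g x| <= K.
Hypothesis g_lip : forall x y, `|g x - g y| <= L * `|x - y|.
Hypothesis g_meas : measurable_fun [set: R] g.

Let K0 : 0 <= K. Proof. exact: le_trans (normr_ge0 (g 0)) (g_bound 0). Qed.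
Let L0 : 0 <= L.
Proof. by have := g_lip 1 0; rewrite subr0 normr1 mulr1; apply: le_trans. Qed.

Lemma itv_measure_fin a b (x y : R) : (mu [set` Interval (BSide a x) (BSide b y)] < +oo)%E.
Proof. by rewrite lebesgue_measure_itv; case: ifP => // _; rewrite -EFinB ltry. Qed.

Lemma lip_integrable a b (x y : R) : mu.-integrable [set` Interval (BSide a x) (BSide b y)] (EFin \o g).
Proof.
apply: measurable_bounded_integrable => //.
- exact: itv_measure_fin.
- exact: measurable_funS g_meas.
- by exists K; split; [exact: num_real | move=> M KM t _; apply: le_trans (g_bound t) (ltW KM)].
Qed.

Let G (lo x : R) := \int[mu]_(t in `[lo, x]) g t.

Lemma fine_itv_measure a b (x y : R) : x <= y -> fine (mu [set` Interval (BSide a x) (BSide b y)]) = y - x.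
Proof.
move=> xy; rewrite lebesgue_measure_itv /= lte_fin; case: ltP => //= yx.
by apply/esym/eqP; rewrite subr_eq0 eq_le xy yx.
Qed.

Lemma itv_integral_bound (x y : R) (f : R -> R) C : x <= y -> mu.-integrable `]x, y] (EFin \o f) ->
  (forall t, t \in `]x, y] -> `|f t| <= C) -> `|\int[mu]_(t in `]x, y]) f t| <= C * (y - x).
Proof.
move=> xy fi fC; apply: le_trans (le_normr_Rintegral _ fi) _ => //.
rewrite -(fine_itv_measure false false xy) -Rintegral_cst//.
apply: le_Rintegral => //.
- exact: (integrable_norm fi).
- apply: measurable_bounded_integrable => //; first exact: itv_measure_fin.
  by exists `|C|; split; [exact: num_real | move=> M KM t _; exact: ltW].
Qed.

Lemma G_sub lo x y : lo <= x -> x <= y -> G lo y - G lo x = \int[mu]_(t in `]x, y]) g t.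
Proof. by move=> lx xy; apply: Rintegral_itvB; rewrite ?bnd_simp//; apply: lip_integrable. Qed.

Lemma G_bound lo x y : lo <= x -> x <= y -> `|G lo y - G lo x| <= K * (y - x).
Proof.
move=> lx xy; rewrite G_sub//; apply: itv_integral_bound => //.
exact: lip_integrable.
Qed.

Lemma G_lip lo x y : lo <= x -> x <= y -> `|G lo y - G lo x - g x * (y - x)| <= L * (y - x) ^+ 2.
Proof.
move=> lx xy; rewrite G_sub//.
have cst : mu.-integrable `]x, y] (EFin \o (fun=> g x)).
  apply: measurable_bounded_integrable => //; first exact: itv_measure_fin.
  by exists K; split; [exact: num_real | move=> M KM t _; apply: le_trans (g_bound x) (ltW KM)].
rewrite -(fine_itv_measure false false xy) -Rintegral_cst// -RintegralB//; last exact: lip_integrable.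
rewrite expr2 mulrA fine_itv_measure//; apply: itv_integral_bound => //.
  have := integrableB _ (lip_integrable false false x y) cst.
  by apply => //.
move=> t; rewrite in_itv /= => /andP[xt ty]; apply: le_trans (g_lip _ _) _.
by rewrite ler_wpM2l// ger0_norm ?subr_ge0 ?(ltW xt)// lerD2r.
Qed.

Lemma cut_width a b (lo hi h w : R) : lo < hi -> 0 < h ->
  (width (cut a ((lo - w) / h)) (cut b ((hi - w) / h)))%:R * h <= hi - lo + h.
Proof.
move=> lohi h0; set l := cut a _; set u := cut b _.
have lu : l <= u by apply: cut_lt; rewrite ltr_pM2r ?invr_gt0// ltrD2r.
have -> : (width l u)%:R = u%:~R - l%:~R :> R.
  by rewrite -intrB [LHS]pmulrn /width abszE ger0_norm (max_idPr _) ?subr_ge0.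
have := cut_ge a ((lo - w) / h); have := cut_le1 b ((hi - w) / h).
rewrite -/l -/u -lerBlDr ler_pdivlMr// ler_pdivrMr// mulrBl mulrBl; lra.
Qed.

(** The sum telescopes against a primitive of [g]. Each step costs [L h^2], and the two ends, where
    the grid overshoots by at most [h], cost [K h] each. *)
Lemma riemann_line a b (lo hi h w : R) : lo < hi -> 0 < h -> h <= 1 ->
  `|h * (\sum_(k < width (cut a ((lo - w) / h)) (cut b ((hi - w) / h)))
      g (h * (cut a ((lo - w) / h) + k%:Z)%:~R + w)) -
    \int[mu]_(t in [set` Interval (BSide a lo) (BSide b hi)]) g t| <=
  h * (2 * K + L * (hi - lo + 1)).
Proof.
move=> lohi h0 h1; have cnt := cut_width a b w lohi h0.
set l := cut a _ in cnt *; set u := cut b _ in cnt *.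
have lu : l <= u by apply: cut_lt; rewrite ltr_pM2r ?invr_gt0// ltrD2r.
pose x (k : nat) : R := h * (l + k%:Z)%:~R + w.
have xl : lo <= x 0%N <= lo + h.
  have := cut_ge a ((lo - w) / h); have := cut_le1 a ((lo - w) / h).
  rewrite -/l /x addr0 -lerBlDr !ler_pdivrMr// ler_pdivlMr// => p1 p2.
  by apply/andP; split; nra.
have wE : (width l u)%:Z = u - l.
  by rewrite /width abszE ger0_norm (max_idPr _) ?subr_ge0.
have xu : hi <= x (width l u) <= hi + h.
  have := cut_ge b ((hi - w) / h); have := cut_le1 b ((hi - w) / h).
  rewrite -/u /x (_ : l + _ = u); last by rewrite wE addrC subrK.
  rewrite -lerBlDr !ler_pdivrMr// ler_pdivlMr// => p1 p2.
  by apply/andP; split; nra.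
have xS k : x k.+1 = x k + h by rewrite /x -addn1 PoszD !intrD; ring.
have xlo k : lo <= x k by elim: k => [|k IH]; [case/andP: xl|rewrite xS; lra].
have step n : `|h * (\sum_(k < n) g (x k)) - (G lo (x n) - G lo (x 0%N))| <= n%:R * (L * h ^+ 2).
  elim: n => [|n IH]; first by rewrite big_ord0 mulr0 subrr subr0 normr0 mul0r.
  rewrite big_ord_recr /= mulrDr -natr1 mulrDl mul1r.
  set p := h * _ in IH *.
  rewrite (_ : p + _ - _ = p - (G lo (x n) - G lo (x 0%N)) -
    (G lo (x n.+1) - G lo (x n) - h * g (x n))); last by ring.
  apply: le_trans (ler_normB _ _) _; apply: (lerD IH).
  have := @G_lip lo (x n) (x n.+1) (xlo n); rewrite xS [x n + h - x n]addrAC subrr add0r [g _ * h]mulrC.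
  by apply; lra.
have -> : \int[mu]_(t in [set` Interval (BSide a lo) (BSide b hi)]) g t = G lo hi.
  rewrite /G; have e1 : \int[mu]_(t in [set` Interval (BSide a lo) (BSide b hi)]) g t =
     \int[mu]_(t in [set` Interval (BSide a lo) (BSide false hi)]) g t.
    by case: b @u lu wE xu cnt => // *; apply: Rintegral_itv_bndo_bndc; apply: lip_integrable.
  rewrite e1; case: a @l lu @x xl wE xu xS xlo step cnt e1 => // *.
  by apply: Rintegral_itv_obnd_cbnd; apply: lip_integrable.
have S := step (width l u).
set A := h * _ in S *.
case/andP: xl => xl1 xl2; case/andP: xu => xu1 xu2.
have b1 := G_bound (lexx lo) xl1.
have b2 := G_bound (ltW lohi) xu1.
have G0 : G lo lo = 0 by rewrite /G set_itv1 Rintegral_set1.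
have c1 : `|G lo (x 0%N) - G lo lo| <= K * h by apply: le_trans b1 _; rewrite ler_wpM2l//; lra.
have c2 : `|G lo (x (width l u)) - G lo hi| <= K * h by apply: le_trans b2 _; rewrite ler_wpM2l//; lra.
have c3 : (width l u)%:R * (L * h ^+ 2) <= h * (L * (hi - lo + 1)).
  have -> : (width l u)%:R * (L * h ^+ 2) = ((width l u)%:R * h) * (L * h) by ring.
  have -> : h * (L * (hi - lo + 1)) = (hi - lo + 1) * (L * h) by ring.
  by rewrite ler_wpM2r ?mulr_ge0 ?(ltW h0)//; lra.
rewrite G0 subr0 in c1.
have -> : A - G lo hi = (A - (G lo (x (width l u)) - G lo (x 0%N))) +
   (G lo (x (width l u)) - G lo hi) - G lo (x 0%N) by ring.
apply: le_trans (ler_normB _ _) _.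
apply: le_trans (lerD (ler_normD _ _) (lexx _)) _.
have -> : h * (2 * K + L * (hi - lo + 1)) = h * (L * (hi - lo + 1)) + K * h + K * h by ring.
by apply: lerD => //; apply: lerD => //; apply: le_trans S c3.
Qed.

End RiemannLine.

Section IntegerTuples.

Definition zrange (l u : int) : seq int := [seq l + k%:Z | k <- iota 0 (width l u)].

Lemma mem_zrange l u z : (z \in zrange l u) = (l <= z < u).
Proof.
apply/mapP/idP => [[k + ->]|/andP[lz zu]].
  by rewrite mem_iota add0n /= width_ltP lerDl.
exists (absz (z - l)%R); last by rewrite abszE ger0_norm ?subr_ge0// addrC subrK.
by rewrite mem_iota add0n /= width_ltP abszE ger0_norm ?subr_ge0// addrC subrK.
Qed.

Lemma zrange_uniq l u : uniq (zrange l u).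
Proof. by rewrite map_inj_uniq ?iota_uniq// => i j /addrI[]. Qed.

Variable n : nat.

Definition row_tuple m (x : 'rV[int]_m) : m.-tuple int := [tuple x 0 j | j < m].

Lemma row_tuple_inj m : injective (@row_tuple m).
Proof.
by move=> x y xy; apply/rowP => j; have := congr1 (fun t => tnth t j) xy; rewrite /= !tnth_mktuple.
Qed.

Definition tseq m (l u : 'I_m -> int) : seq (m.-tuple int) := [seq row_tuple x | x <- ibox l u].

Lemma mem_tseq m (l u : 'I_m -> int) t :
  (t \in tseq l u) = [forall j, (l j <= tnth t j) && (tnth t j < u j)].
Proof.
have -> : t = row_tuple (\row_j tnth t j) by apply/eq_from_tnth => j; rewrite tnth_mktuple mxE.
rewrite mem_map ?mem_ibox; last exact: row_tuple_inj.
by apply: eq_forallb => j; rewrite tnth_mktuple.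
Qed.

Lemma tseq_uniq m (l u : 'I_m -> int) : uniq (tseq l u).
Proof. by rewrite map_inj_uniq ?ibox_uniq//; apply: row_tuple_inj. Qed.

Lemma sum_tseqS (A : nmodType) (l u : 'I_n.+1 -> int) (G : n.+1.-tuple int -> A) :
  \sum_(t <- tseq l u) G t = \sum_(k < width (l ord0) (u ord0))
    \sum_(t <- tseq (l \o lift ord0) (u \o lift ord0)) G [tuple of (l ord0 + k%:Z) :: t].
Proof.
transitivity (\sum_(t <- [seq (cons_tuple z t : n.+1.-tuple int) | z <- zrange (l ord0) (u ord0),
    t <- tseq (l \o lift ord0) (u \o lift ord0)]) G t).
  apply: perm_big; apply: uniq_perm; first exact: tseq_uniq.
    apply: allpairs_uniq; [exact: zrange_uniq|exact: tseq_uniq|].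
    by move=> [z t] [z' t'] _ _ /= /(congr1 val) /= [-> /val_inj ->].
  move=> t; rewrite mem_tseq; apply/forallP/allpairsP => [h|[[z t'] [/= + + ->]]].
    exists (thead t, [tuple of behead t]); split=> /=; last exact: tuple_eta.
      by rewrite mem_zrange; apply: h.
    by rewrite mem_tseq; apply/forallP => j /=; have -> : tnth [tuple of behead t] j = tnth t (lift ord0 j);
      [by rewrite [in RHS](tuple_eta t) tnthS|apply: h].
  rewrite mem_zrange mem_tseq => hz /forallP ht j.
  by case: (unliftP ord0 j) => [i ->|->]; [rewrite tnthS; apply: ht|rewrite tnth0].
rewrite big_allpairs_dep /= /zrange big_map -{1}[width _ _]subn0 -/(index_iota _ _) big_mkord.
by apply: eq_bigr => k _.
Qed.

Lemma sum_tseq0 (A : nmodType) (l u : 'I_0 -> int) (G : 0.-tuple int -> A) :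
  \sum_(t <- tseq l u) G t = G [tuple].
Proof.
have -> : tseq l u = [:: [tuple]].
  apply: perm_small_eq => //; apply: uniq_perm => //; first exact: tseq_uniq.
  by move=> t; rewrite mem_tseq inE [t]tuple0 [RHS]eqxx; apply/forallP; case.
by rewrite big_seq1.
Qed.

End IntegerTuples.

Section TupleIntegral.
Variable R : realType.
Local Notation RR := (measurableTypeR R).
Local Notation mu := (lebesgue_tuple R).
Local Notation lambda := (@lebesgue_measure R).

Lemma Rintegral_bound d (T : measurableType d) (m : {measure set T -> \bar R}) (D : set T)
    (f : T -> R) C : measurable D -> (m D < +oo)%E -> measurable_fun D f ->
  (forall x, D x -> `|f x| <= C) ->
  m.-integrable D (EFin \o f) /\ `|\int[m]_(x in D) f x| <= C * fine (m D).
Proof.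
move=> mD Doo mf fC.
have fi : m.-integrable D (EFin \o f).
  apply: measurable_bounded_integrable => //.
  by exists C; split; [exact: num_real | move=> M KM t Dt; apply: le_trans (fC t Dt) (ltW KM)].
split=> //; apply: le_trans (le_normr_Rintegral _ fi) _ => //.
rewrite -Rintegral_cst//; apply: le_Rintegral => //.
- exact: (integrable_norm fi).
- apply: measurable_bounded_integrable => //.
  by exists `|C|; split; [exact: num_real | move=> M KM t _; exact: ltW].
Qed.

Definition tbox n (a b : 'I_n -> bool) (lo hi : 'I_n -> R) : set (n.-tuple RR) :=
  [set y | forall j, (tnth y j : R) \in Interval (BSide (a j) (lo j)) (BSide (b j) (hi j))].

Lemma measurable_tbox n (a b : 'I_n -> bool) (lo hi : 'I_n -> R) : measurable (tbox a b lo hi).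
Proof.
have -> : tbox a b lo hi = \bigcap_(j in [set: 'I_n])
    ((fun x : n.-tuple RR => tnth x j) @^-1` [set` Interval (BSide (a j) (lo j)) (BSide (b j) (hi j))]).
  by apply/seteqP; split=> x /= h j; [move=> _; apply: h|apply: (h j)].
apply: fin_bigcap_measurable => [|j _]; first exact: finite_finset.
rewrite -[X in measurable X]setTI; exact: measurable_tnth.
Qed.

Local Notation tl f := (f \o lift ord0).

Lemma cons_pair_tbox n (a b : 'I_n.+1 -> bool) (lo hi : 'I_n.+1 -> R) :
  @cons_pair R n @^-1` (tbox a b lo hi) =
  [set` Interval (BSide (a ord0) (lo ord0)) (BSide (b ord0) (hi ord0))] `*`
    tbox (tl a) (tl b) (tl lo) (tl hi).
Proof.
apply/seteqP; split=> -[x t] /=.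
  by move=> h; split=> [|j]; [apply: (h ord0)|have := h (lift ord0 j); rewrite tnthS].
move=> [h0 h] j; case: (unliftP ord0 j) => [i ->|->]; first by rewrite tnthS; apply: h.
by rewrite tnth0.
Qed.

Lemma tbox_measure n (a b : 'I_n -> bool) (lo hi : 'I_n -> R) : (forall j, lo j < hi j) ->
  mu n (tbox a b lo hi) = (\prod_j (hi j - lo j))%:E.
Proof.
elim: n a b lo hi => [|n IH] a b lo hi lohi.
  by rewrite big_ord0 /= diracE mem_set//; case.
rewrite /= /cons_measure /pushforward cons_pair_tbox product_measure1E//; last first.
  exact: measurable_tbox.
rewrite IH => [|j]; last exact: lohi.
have e : lambda [set` Interval (BSide (a ord0) (lo ord0)) (BSide (b ord0) (hi ord0))] =
    (hi ord0 - lo ord0)%:E by rewrite lebesgue_measure_itv /= lte_fin lohi -EFinB.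
by apply: etrans (congr1 (fun z => z * _)%E e) _; rewrite -EFinM big_ord_recl.
Qed.

Lemma tbox_fin n (a b : 'I_n -> bool) (lo hi : 'I_n -> R) : (forall j, lo j < hi j) ->
  (mu n (tbox a b lo hi) < +oo)%E.
Proof. by move=> h; rewrite tbox_measure// ltry. Qed.

Lemma lipschitz_cons n L (f : n.+1.-tuple RR -> R) x : lipschitz L f ->
  lipschitz L (fun t : n.-tuple RR => f [tuple of x :: t]).
Proof.
move=> fL t u; apply: le_trans (fL _ _) _; rewrite /l1dist big_ord_recl !tnth0 subrr normr0 add0r.
by under eq_bigr do rewrite !tnthS.
Qed.

Lemma lipschitz_head n L (f : n.+1.-tuple RR -> R) (t : n.-tuple RR) (x y : RR) : lipschitz L f ->
  `|f [tuple of x :: t] - f [tuple of y :: t]| <= L * `|(x : R) - y|.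
Proof.
move=> fL; apply: le_trans (fL _ _) _; rewrite /l1dist big_ord_recl !tnth0.
by rewrite big1 ?addr0// => j _; rewrite !tnthS subrr normr0.
Qed.

Lemma tbox_fubini n (a b : 'I_n.+1 -> bool) (lo hi : 'I_n.+1 -> R) (K L : R) (f : n.+1.-tuple RR -> R) :
  (forall j, lo j < hi j) -> (forall x, `|f x| <= K) -> lipschitz L f ->
  \int[mu n.+1]_(x in tbox a b lo hi) f x =
  \int[lambda]_(x in [set` Interval (BSide (a ord0) (lo ord0)) (BSide (b ord0) (hi ord0))])
    \int[mu n]_(t in tbox (tl a) (tl b) (tl lo) (tl hi)) f [tuple of x :: t].
Proof.
move=> lohi fK fL.
have mf := lipschitz_measurable fL.
pose I0 : set RR := [set` Interval (BSide (a ord0) (lo ord0)) (BSide (b ord0) (hi ord0))].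
pose T' : set (n.-tuple RR) := tbox (tl a) (tl b) (tl lo) (tl hi).
have mI0 : measurable I0 by exact: measurable_itv.
have mT' : measurable T' by apply: measurable_tbox.
have mfc : measurable_fun [set: RR * n.-tuple RR] (f \o @cons_pair R n).
  by apply: measurableT_comp => //; exact: measurable_cons_pair.
pose D : set (RR * n.-tuple RR) := I0 `*` T'.
have mD : measurable D by apply: measurableX.
have Doo : ((lambda \x mu n)%E D < +oo)%E.
  rewrite product_measure1E// /T' tbox_measure => [|j]; last exact: lohi.
  by apply: lte_mul_pinfty; rewrite ?ltry ?measure_ge0 ?ge0_fin_numE ?itv_measure_fin.
have ficD : (lambda \x mu n)%E.-integrable D (EFin \o (f \o @cons_pair R n)).
  have mfD : measurable_fun D (f \o @cons_pair R n).
    by apply: (measurable_funS measurableT _ mfc).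
  by have := proj1 (Rintegral_bound mD Doo mfD (fun p _ => fK _)).
rewrite /Rintegral; congr fine.
rewrite [LHS](@integral_pushforward _ _ _ _ _ _ (@measurable_cons_pair R n)); first last.
- exact: measurable_tbox.
- by rewrite cons_pair_tbox; exact: ficD.
- by apply/measurable_EFinP.
rewrite cons_pair_tbox -/I0 -/T' -/D integral_mkcond.
rewrite -integral12_prod_meas1; last by rewrite -integrable_mkcond.
rewrite [RHS]integral_mkcond; apply: eq_integral => x _.
rewrite /fubini_F /patch; case: ifPn => xI.
  rewrite fineK; last first.
    have T'oo : (mu n T' < +oo)%E by apply: tbox_fin => j; apply: lohi.
    have mfx : measurable_fun T' (fun t : n.-tuple RR => f [tuple of x :: t]).
      by apply: (measurable_funS measurableT _ (lipschitz_measurable (lipschitz_cons x fL))).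
    by apply: integrable_fin_num => //; have := proj1 (Rintegral_bound mT' T'oo mfx (fun t _ => fK _)).
  rewrite [RHS]integral_mkcond; apply: eq_integral => t _.
  by rewrite /patch /D in_setX xI.
by apply: integral0_eq => t _; rewrite /D in_setX (negPf xI).
Qed.

(** The offset [w] allows the sum over one residue class of integer points to be read as a Riemann
    sum over the same box. *)
Definition grid_at n (h : R) (w : 'I_n -> R) (t : n.-tuple int) : n.-tuple RR :=
  [tuple h * (tnth t j)%:~R + w j : RR | j < n].

Lemma lip_continuous L (g : R -> R) : (forall x y, `|g x - g y| <= L * `|x - y|) -> continuous g.
Proof.
move=> gL x; apply/cvgrPdist_le => eps e0; near=> y.
have L1 : 0 < `|L| + 1 by apply: ltr_wpDl.
apply: le_trans (gL _ _) _; apply: (@le_trans _ _ ((`|L| + 1) * `|x - y|)).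
  by rewrite ler_wpM2r//; apply: le_trans (ler_norm L) _; rewrite lerDl.
rewrite mulrC -ler_pdivlMr//; near: y.
by apply: cvgr_dist_le; [exact: cvg_id|rewrite divr_gt0].
Unshelve. all: by end_near.
Qed.

Lemma grid_at_cons n (h : R) (w : 'I_n.+1 -> R) (z : int) (t : n.-tuple int) :
  grid_at h w [tuple of z :: t] = [tuple of (h * z%:~R + w ord0 : RR) :: grid_at h (tl w) t].
Proof.
apply/eq_from_tnth => j; rewrite tnth_mktuple.
by case: (unliftP ord0 j) => [i ->|->]; rewrite ?tnthS ?tnth0// tnth_mktuple.
Qed.

(** Induction by Fubini: the integral over the last [n] coordinates is, as a function of the first
    one, again bounded and Lipschitz, with constants enlarged by the volume W^n at most. *)
Theorem riemann_sum n (a b : 'I_n -> bool) (lo hi w : 'I_n -> R) (h K L W : R) (f : n.-tuple RR -> R) :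
  (forall j, lo j < hi j) -> (forall j, hi j - lo j <= W) -> 0 <= W -> 0 < h -> h <= 1 ->
  (forall x, `|f x| <= K) -> lipschitz L f ->
  `|h ^+ n * \sum_(t <- tseq (fun j => cut (a j) ((lo j - w j) / h)) (fun j => cut (b j) ((hi j - w j) / h)))
      f (grid_at h w t) - \int[mu n]_(x in tbox a b lo hi) f x| <=
  h * (n%:R * (W + 1) ^+ n * (2 * K + L * (W + 1))).
Proof.
move=> + + W0 h0 h1.
elim: n a b lo hi w f => [|n IH] a b lo hi w f lohi hW fK fL.
  rewrite sum_tseq0 expr0 !mul1r !mul0r mulr0 normr_le0 subr_eq0; apply/eqP.
  have -> : tbox a b lo hi = setT by apply/seteqP; split=> // x _ [].
  rewrite /Rintegral /= integral_dirac//; last by apply/measurable_EFinP; exact: lipschitz_measurable fL.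
  by rewrite diracT mul1e /=; congr f; apply/eq_from_tnth; case.
set l := fun j => cut _ _; set u := fun j => cut _ _.
rewrite (tbox_fubini a b lohi fK fL) sum_tseqS.
set T' := tbox (tl a) _ _ _; pose g (x : R) := \int[mu n]_(t in T') f [tuple of (x : RR) :: t].
have lohi' j : (tl lo) j < (tl hi) j by apply: lohi.
have hW' j : (tl hi) j - (tl lo) j <= W by apply: hW.
have mT' : measurable T' by apply: measurable_tbox.
have T'oo : (mu n T' < +oo)%E by apply: tbox_fin.
have vol : 0 <= fine (mu n T') <= W ^+ n.
  rewrite tbox_measure//= prodr_ge0 /= => [|j _]; last by rewrite subr_ge0 ltW.
  rewrite -[X in _ <= _ ^+ X](card_ord n) -prodr_const; apply: ler_prod => j _.
  by rewrite hW' andbT subr_ge0 ltW.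
case/andP: vol => vol0 volW.
have K0 : 0 <= K by apply: le_trans (fK (grid_at h w [tuple of nseq n.+1 0])).
have L0 : 0 <= L.
  have := lipschitz_head [tuple of nseq n (0 : RR)] (1 : R) (0 : R) fL.
  by rewrite subr0 normr1 mulr1; apply: le_trans.
have msec (x : R) : measurable_fun T' (fun t : n.-tuple RR => f [tuple of (x : RR) :: t]).
  by apply: (measurable_funS measurableT _ (lipschitz_measurable (lipschitz_cons x fL))).
have isec x := proj1 (Rintegral_bound mT' T'oo (msec x) (fun t _ => fK _)).
have gK x : `|g x| <= K * W ^+ n.
  apply: le_trans (proj2 (Rintegral_bound mT' T'oo (msec x) (fun t _ => fK _))) _.
  by rewrite ler_wpM2l.
have gL x y : `|g x - g y| <= L * W ^+ n * `|x - y|.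
  rewrite /g -RintegralB//.
  apply: le_trans (proj2 (@Rintegral_bound _ _ (mu n) T' _ (L * `|x - y|) mT' T'oo _ _)) _.
  - exact: measurable_funB.
  - by move=> t _; apply: lipschitz_head.
  - by rewrite mulrAC ler_wpM2r// ler_wpM2l.
have mg : measurable_fun [set: R] g by apply: continuous_measurable_fun; apply: lip_continuous gL.
have RL := riemann_line gK gL mg (a ord0) (b ord0) (w ord0) (lohi ord0) h0 h1.
have CW := cut_width (a ord0) (b ord0) (w ord0) (lohi ord0) h0.
rewrite -/(l ord0) -/(u ord0) in RL CW.
set N := width _ _ in RL CW *; set J := \int[lambda]_(t in _) _ in RL *.
pose A (k : nat) := h ^+ n * \sum_(t <- tseq (tl l) (tl u)) f (grid_at h w [tuple of (l ord0 + k%:Z) :: t]).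
pose E := n%:R * (W + 1) ^+ n * (2 * K + L * (W + 1)).
have E0 : 0 <= E by rewrite !mulr_ge0 ?addr_ge0 ?exprn_ge0 ?mulr_ge0 ?addr_ge0.
have hA k : `|A k - g (h * (l ord0 + k%:Z)%:~R + w ord0)| <= h * E.
  rewrite /A; under eq_bigr do rewrite grid_at_cons.
  apply: (IH (tl a) (tl b) (tl lo) (tl hi) (tl w)
    (fun t => f [tuple of (h * (l ord0 + k%:Z)%:~R + w ord0 : RR) :: t])) => //.
  exact: lipschitz_cons.
have -> : h ^+ n.+1 * (\sum_(k < N) \sum_(t <- tseq (tl l) (tl u)) f (grid_at h w [tuple of l ord0 + k%:Z :: t]))
   - J = h * (\sum_(k < N) (A k - g (h * (l ord0 + k%:Z)%:~R + w ord0))) +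
   (h * (\sum_(k < N) g (h * (l ord0 + k%:Z)%:~R + w ord0)) - J).
  rewrite sumrB mulrBr addrA subrK; congr (_ - _).
  by rewrite exprS -mulrA mulr_sumr.
apply: le_trans (ler_normD _ _) _.
apply: (@le_trans _ _ (h * ((W + 1) * E) + h * ((W + 1) ^+ n * (2 * K + L * (W + 1))))); last first.
  rewrite -mulrDr ler_wpM2l ?(ltW h0)// /E [(W + 1) ^+ n.+1]exprS -[n.+1%:R]natr1.
  set Wn := (W + 1) ^+ n; set nn := n%:R; set Q := 2 * K + _.
  have : 0 <= W * (Wn * Q) by rewrite !mulr_ge0 ?exprn_ge0 ?addr_ge0 ?mulr_ge0 ?addr_ge0.
  by rewrite -subr_ge0; congr (0 <= _); ring.
apply: lerD.
  rewrite normrM (gtr0_norm h0) ler_wpM2l ?(ltW h0)//.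
  apply: le_trans (ler_norm_sum _ _ _) _.
  apply: (@le_trans _ _ (\sum_(k < N) h * E)); first by apply: ler_sum => k _; apply: hA.
  rewrite sumr_const card_ord -[leLHS]mulr_natl mulrA ler_wpM2r//.
  by apply: le_trans CW _; have := hW ord0; lra.
apply: le_trans RL _; rewrite ler_wpM2l ?(ltW h0)//.
have W1 : W ^+ n <= (W + 1) ^+ n by rewrite lerXn2r ?nnegrE ?addr_ge0// lerDl.
apply: (@le_trans _ _ (W ^+ n * (2 * K + L * (W + 1)))); last first.
  by rewrite ler_wpM2r// addr_ge0 ?mulr_ge0 ?addr_ge0.
rewrite -subr_ge0 (_ : _ - _ = L * W ^+ n * (W - (hi ord0 - lo ord0))); last by ring.
by rewrite !mulr_ge0 ?exprn_ge0// subr_ge0.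
Qed.

End TupleIntegral.

(** * Lipschitz bounds for characters and polynomials *)

Section Trigonometry.
Variable R : realType.

Lemma lip_of_derive (f df : R -> R) C : (forall x : R, is_derive x 1 f (df x)) -> continuous f ->
  (forall x, `|df x| <= C) -> forall x y, `|f x - f y| <= C * `|x - y|.
Proof.
move=> fd fc dC x y; wlog xy : x y / x <= y => [hw|].
  have [/hw//|/ltW/hw] := leP x y; by rewrite distrC [X in _ -> _ <= _ * X]distrC.
have [c _ h] := MVT_segment xy (fun x _ => fd x) (continuous_subspaceT fc).
by rewrite distrC h normrM (distrC x y) ler_wpM2r.
Qed.

Lemma cos_lip (x y : R) : `|cos x - cos y| <= `|x - y|.
Proof.
have h (t : R) : `|- sin t| <= 1 by rewrite normrN ler_norml sin_geN1 sin_le1.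
by have := lip_of_derive (@is_derive_cos R) (@continuous_cos R) h x y; rewrite mul1r.
Qed.

Lemma sin_lip (x y : R) : `|sin x - sin y| <= `|x - y|.
Proof.
have h (t : R) : `|cos t| <= 1 by rewrite ler_norml cos_geN1 cos_le1.
by have := lip_of_derive (@is_derive_sin R) (@continuous_sin R) h x y; rewrite mul1r.
Qed.

Lemma normc_le_parts (z : R[i]) : normc z <= `|complex.Re z| + `|complex.Im z|.
Proof.
case: z => a b /=; rewrite -[leRHS]ger0_norm ?addr_ge0// -sqrtr_sqr ler_wsqrtr//.
rewrite sqrrD !real_normK ?num_real//; have : 0 <= `|a| * `|b| by rewrite mulr_ge0.
by rewrite mulr2n; lra.
Qed.

Lemma Re_sum (I : Type) (r : seq I) (f : I -> R[i]) :
  complex.Re (\sum_(i <- r) f i) = \sum_(i <- r) complex.Re (f i).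
Proof. by elim/big_rec2: _ => // i x y _ <-; case: (f i) y => [? ?] [? ?]. Qed.

Lemma Im_sum (I : Type) (r : seq I) (f : I -> R[i]) :
  complex.Im (\sum_(i <- r) f i) = \sum_(i <- r) complex.Im (f i).
Proof. by elim/big_rec2: _ => // i x y _ <-; case: (f i) y => [? ?] [? ?]. Qed.

Lemma Re_scale (a : R) (z : R[i]) : complex.Re (a%:C * z) = a * complex.Re z.
Proof. by case: z => x y /=; rewrite mul0r subr0. Qed.

Lemma Im_scale (a : R) (z : R[i]) : complex.Im (a%:C * z) = a * complex.Im z.
Proof. by case: z => x y /=; rewrite mul0r addr0. Qed.

Lemma unit_exp_Re_lip (x y : R) : `|complex.Re (unit_exp x) - complex.Re (unit_exp y)| <= 2 * pi * `|x - y|.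
Proof.
apply: le_trans (cos_lip _ _) _; rewrite -mulrBr normrM ger0_norm//.
by rewrite mulr_ge0// pi_ge0.
Qed.

Lemma unit_exp_Im_lip (x y : R) : `|complex.Im (unit_exp x) - complex.Im (unit_exp y)| <= 2 * pi * `|x - y|.
Proof.
apply: le_trans (sin_lip _ _) _; rewrite -mulrBr normrM ger0_norm//.
by rewrite mulr_ge0// pi_ge0.
Qed.

Lemma unit_exp_Re_le (x : R) : `|complex.Re (unit_exp x)| <= 1.
Proof. by rewrite ler_norml cos_geN1 cos_le1. Qed.

Lemma unit_exp_Im_le (x : R) : `|complex.Im (unit_exp x)| <= 1.
Proof. by rewrite ler_norml sin_geN1 sin_le1. Qed.

End Trigonometry.

Section PolynomialLipschitz.
Variables (R : realType) (s : nat).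

Definition in_cube (x : 'I_s -> R) : Prop := forall j, `|x j| <= 1.

(** Polynomials are Lipschitz on bounded sets only. The bound on [f] itself is carried along because
    products need it. *)
Definition cube_lip (f : ('I_s -> R) -> R) : Prop := exists2 C, 0 <= C &
  forall x y, in_cube x -> in_cube y -> `|f x| <= C /\ `|f x - f y| <= C * \sum_j `|x j - y j|.

Lemma cube_lipM f g : cube_lip f -> cube_lip g -> cube_lip (fun x => f x * g x).
Proof.
move=> [A A0 hA] [B B0 hB]; exists (2 * A * B) => [|x y cx cy]; first by rewrite !mulr_ge0.
have [fx fxy] := hA x y cx cy; have [gx gxy] := hB x y cx cy; have [gy _] := hB y x cy cx.
have AB : 0 <= A * B by rewrite mulr_ge0.
split; first by rewrite normrM; apply: le_trans (ler_pM _ _ fx gx) _ => //; lra.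
have -> : f x * g x - f y * g y = f x * (g x - g y) + (f x - f y) * g y by ring.
apply: le_trans (ler_normD _ _) _; rewrite !normrM; set D := \sum_j _ in fxy gxy *.
have -> : 2 * A * B * D = A * (B * D) + (A * D) * B by ring.
by apply: lerD; apply: ler_pM.
Qed.

Lemma cube_lipD f g : cube_lip f -> cube_lip g -> cube_lip (fun x => f x + g x).
Proof.
move=> [A A0 hA] [B B0 hB]; exists (A + B) => [|x y cx cy]; first by rewrite addr_ge0.
have [fx fxy] := hA x y cx cy; have [gx gxy] := hB x y cx cy.
split; first by apply: le_trans (ler_normD _ _) (lerD fx gx).
rewrite opprD addrACA; apply: le_trans (ler_normD _ _) _.
by rewrite mulrDl lerD.
Qed.

Lemma cube_lip_cst c : cube_lip (fun=> c).
Proof.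
exists `|c| => // x y _ _; split=> //; rewrite subrr normr0 mulr_ge0//.
by apply: sumr_ge0.
Qed.

Lemma cube_lip_coord j : cube_lip (fun x => x j).
Proof.
exists 1 => // x y cx _; split; first exact: cx.
by rewrite mul1r (bigD1 j)//= lerDl sumr_ge0.
Qed.

Lemma meval_cube_lip (p : {mpoly R[s]}) : cube_lip (fun x => meval x p).
Proof.
have ext f g : f =1 g -> cube_lip f -> cube_lip g by move=> /funext ->.
elim/mpolyind: p => [|c m p _ _ IH].
  by apply: ext (cube_lip_cst 0) => x; rewrite meval0.
apply: (ext (fun x => c * \prod_i x i ^+ m i + meval x p)).
  by move=> x; rewrite mevalD mevalZ mevalX.
apply: cube_lipD IH; apply: cube_lipM; first exact: cube_lip_cst.
elim: (index_enum _) => [|i l IHl].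
  by apply: ext (cube_lip_cst 1) => x; rewrite big_nil.
apply: (ext (fun x => x i ^+ m i * \prod_(i <- l) x i ^+ m i)).
  by move=> x; rewrite big_cons.
apply: cube_lipM IHl; elim: (m i) => [|n IHn]; first exact: cube_lip_cst.
by apply: (ext (fun x => x i * x i ^+ n)) => [x|]; [rewrite exprS|apply: cube_lipM IHn; apply: cube_lip_coord].
Qed.

(** Retraction onto [-1, 1]. It extends the phase from the box to a globally Lipschitz function with
    the same integral, as [riemann_sum] demands. *)
Definition clamp (x : R) : R := Num.max (-1) (Num.min 1 x).

Lemma clamp_le1 x : `|clamp x| <= 1.
Proof. by rewrite /clamp ler_norml le_max ge_max ge_min !lexx /= andbT; lra. Qed.

Lemma clamp_id x : `|x| <= 1 -> clamp x = x.
Proof.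
rewrite ler_norml => /andP[h1 h2]; rewrite /clamp (min_r h2); exact: max_r.
Qed.

Lemma clamp_lip x y : `|clamp x - clamp y| <= `|x - y|.
Proof.
wlog xy : x y / x <= y => [hw|].
  have [/hw//|/ltW/hw] := leP x y; by rewrite distrC [X in _ -> _ <= X]distrC.
have c1 (z : R) : -1 <= clamp z by rewrite le_max lexx.
have c2 (z : R) : Num.min 1 z <= clamp z by rewrite le_max lexx orbT.
have m1 (z : R) : Num.min 1 z <= 1 by rewrite ge_min lexx.
have m2 (z : R) : Num.min 1 z <= z by rewrite ge_min lexx orbT.
have mono : clamp x <= clamp y.
  rewrite ge_max c1 /=; apply: le_trans (c2 y); rewrite le_min m1 /=.
  exact: le_trans (m2 x) xy.
rewrite !ler0_norm ?subr_le0// !opprB lerBlDl ge_max; apply/andP; split.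
  by have := c1 x; lra.
have := c2 x; have := m1 y; have := m2 y; by have [x1|x1] := leP x 1; lra.
Qed.

End PolynomialLipschitz.

Lemma map_homog (L : comNzRingType) n m (p : {mpoly int[n]}) : p \is ishomog1 m mdeg ->
  (map_mpoly intr p : {mpoly L[n]}) \is ishomog1 m mdeg.
Proof.
move=> hp; apply/dhomogP => u; rewrite mcoeff_msupp mcoeff_map_mpoly => h.
by move/dhomogP: hp; apply; rewrite mcoeff_msupp; apply: contra h => /eqP ->.
Qed.

(** * The oscillatory integral *)

Section OscillatoryIntegral.
Variables (R : realType) (r s d : nat) (F : 'I_r -> {mpoly int[s]}).
Hypothesis F_homog : forall i, F i \is ishomog1 d mdeg.
Local Notation RR := (measurableTypeR R).
Local Notation mu := (lebesgue_tuple R).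
Local Notation e := (@unit_exp R).

Definition phase (gamma : 'I_r -> R) (x : 'I_s -> R) : R :=
  \sum_i gamma i * meval x (map_mpoly intr (F i)).

Lemma phase_lip : exists2 C : R, 0 <= C & forall x, in_cube x ->
  (forall gamma gamma', `|phase gamma x - phase gamma' x| <= C * \sum_i `|gamma i - gamma' i|) /\
  forall y gamma T, in_cube y -> (forall i, `|gamma i| <= T) ->
    `|phase gamma x - phase gamma y| <= C * T * \sum_j `|x j - y j|.
Proof.
have /choice[c hc] : forall i, exists c : R, 0 <= c /\ forall x y, in_cube x -> in_cube y ->
    `|meval x (map_mpoly intr (F i) : {mpoly R[s]})| <= c /\
    `|meval x (map_mpoly intr (F i) : {mpoly R[s]}) - meval y (map_mpoly intr (F i))| <=
      c * \sum_j `|x j - y j|.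
  by move=> i; have [c c0 h] := meval_cube_lip (map_mpoly intr (F i) : {mpoly R[s]}); exists c.
have c0 i : 0 <= c i by case: (hc i).
exists (\sum_i c i) => [|x cx]; first exact: sumr_ge0.
split=> [gamma gamma'|y gamma T cy hT].
  rewrite /phase -sumrB mulr_sumr; apply: le_trans (ler_norm_sum _ _ _) _.
  apply: ler_sum => i _; rewrite -mulrBl normrM mulrC ler_wpM2r//.
  apply: le_trans (proj1 ((hc i).2 x x cx cx)) _.
  by rewrite (bigD1 i)//= lerDl sumr_ge0.
rewrite /phase -sumrB; apply: le_trans (ler_norm_sum _ _ _) _.
rewrite -mulrA mulr_suml; apply: ler_sum => i _; rewrite -mulrBr normrM mulrCA.
by apply: ler_pM => //; exact: (proj2 ((hc i).2 x y cx cy)).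
Qed.

Lemma phase_scale (t : R) gamma x :
  phase gamma (fun j => t * x j) = t ^+ d * phase gamma x.
Proof.
rewrite /phase mulr_sumr; apply: eq_bigr => i _.
rewrite mulrCA; congr (_ * _); apply: meval_homog_scale.
by apply: map_homog; apply: F_homog.
Qed.

Lemma phase_int gamma (x : 'rV[int]_s) : phase gamma (fun j => (x 0 j)%:~R) = form_comb F gamma x.
Proof. by apply: eq_bigr => i _; rewrite meval_map_intr. Qed.

Variables (a b : 'I_s -> bool) (lo hi : 'I_s -> R).
Hypothesis lohi : forall j, lo j < hi j.
Hypothesis in_unit : tbox a b lo hi `<=` unit_box R s.
Local Notation B := (tbox a b lo hi).
Local Notation osc := (fun gamma : 'I_r -> R => oscillatory_integral F B (mktuple gamma)).

Lemma box_bounds j : -1 <= lo j /\ hi j <= 1.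
Proof.
have inB (f : 'I_s -> R) : (forall i, lo i < f i < hi i) -> forall i, -1 <= f i <= 1.
  move=> hf i; have := @in_unit (mktuple f); rewrite /unit_box /= => /(_ _ i).
  rewrite tnth_mktuple in_itv /=; apply=> k; rewrite tnth_mktuple in_itv /=.
  by case/andP: (hf k) => h1 h2; apply/andP; split; [case: (a k)|case: (b k)] => //=; apply: ltW.
have mid i : lo i < (lo i + hi i) / 2 < hi i by have := lohi i; lra.
split; rewrite leNgt; apply/negP => h.
  (* A point of the open box whose j-th coordinate is below -1; the other coordinates are
     midpoints. *)
  pose f i := if i == j then (lo j + Num.min (-1) (hi j)) / 2 else (lo i + hi i) / 2.
  have hf i : lo i < f i < hi i.
    rewrite /f; case: eqP => [->|_]; last exact: mid.
    by rewrite minEle; have := lohi j; case: ifP => /idP ? ?; lra.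
  have := inB f hf j; rewrite /f eqxx minEle; have := lohi j; case: ifP => /negP ? ?; lra.
pose f i := if i == j then (hi j + Num.max 1 (lo j)) / 2 else (lo i + hi i) / 2.
have hf i : lo i < f i < hi i.
  rewrite /f; case: eqP => [->|_]; last exact: mid.
  by rewrite maxEle; have := lohi j; case: ifP => /negP ? ?; lra.
have := inB f hf j; rewrite /f eqxx maxEle; have := lohi j; case: ifP => /negP ? ?; lra.
Qed.

Definition clamped (gamma : 'I_r -> R) (x : s.-tuple RR) : R :=
  phase gamma (fun j => clamp (tnth x j)).

Lemma in_cube_clamp (x : s.-tuple RR) : in_cube (fun j => clamp (tnth x j : R)).
Proof. by move=> j; apply: clamp_le1. Qed.

Lemma clamped_eq gamma (x : s.-tuple RR) : B x -> clamped gamma x = phase gamma (tnth x).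
Proof.
move=> Bx; congr phase; apply/funext => j; apply: clamp_id.
by have := in_unit Bx j; rewrite in_itv /= ler_norml.
Qed.

Lemma clamped_lip : exists2 C : R, 0 <= C & forall gamma T, 0 <= T -> (forall i, `|gamma i| <= T) ->
  lipschitz (C * T) (fun x => complex.Re (e (clamped gamma x))) /\
  lipschitz (C * T) (fun x => complex.Im (e (clamped gamma x))).
Proof.
have [C C0 hC] := phase_lip; have pi2 : 0 <= 2 * pi :> R by rewrite mulr_ge0// pi_ge0.
exists (2 * pi * C) => [|gamma T T0 hT]; first by rewrite mulr_ge0.
have key x y : 2 * pi * `|clamped gamma x - clamped gamma y| <= 2 * pi * C * T * l1dist x y.
  rewrite -[_ * C * T]mulrA -[leRHS]mulrA ler_wpM2l//.
  apply: le_trans (proj2 (hC _ (in_cube_clamp x)) _ gamma T (in_cube_clamp y) hT) _.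
  by rewrite ler_wpM2l ?mulr_ge0//; apply: ler_sum => j _; exact: clamp_lip.
split=> x y.
  exact: le_trans (unit_exp_Re_lip _ _) (key x y).
exact: le_trans (unit_exp_Im_lip _ _) (key x y).
Qed.

Let mB : measurable (B : set (s.-tuple RR)). Proof. exact: measurable_tbox. Qed.

Lemma osc_clamped gamma : osc gamma =
  (\int[mu s]_(x in B) complex.Re (e (clamped gamma x))) +i*
  (\int[mu s]_(x in B) complex.Im (e (clamped gamma x))).
Proof.
have E x : B x -> \sum_(i < r) tnth (mktuple gamma) i * meval (tnth x) (map_mpoly intr (F i)) =
    clamped gamma x.
  by move=> Bx; rewrite clamped_eq//; apply: eq_bigr => i _; rewrite tnth_mktuple.
rewrite /oscillatory_integral /cintegral; congr (_ +i* _).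
  by congr fine; apply: eq_integral => x /set_mem Bx; congr (complex.Re (e _))%:E; apply: E.
by congr fine; apply: eq_integral => x /set_mem Bx; congr (complex.Im (e _))%:E; apply: E.
Qed.

(** The Lipschitz constant of the integrand grows linearly with the size [T] of gamma, whence the
    factor [1 + T]. The constant depends neither on the mesh nor on the offset. *)
Lemma osc_riemann : exists2 C : R, 0 <= C & forall gamma T (h : R) (w : 'I_s -> R),
  0 <= T -> (forall i, `|gamma i| <= T) -> 0 < h -> h <= 1 ->
  normc ((h ^+ s)%:C * (\sum_(t <- tseq (fun j => cut (a j) ((lo j - w j) / h))
      (fun j => cut (b j) ((hi j - w j) / h))) e (phase gamma (tnth (grid_at h w t)))) - osc gamma) <=
  C * (1 + T) * h.
Proof.
have [C C0 hC] := clamped_lip.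
pose E := s%:R * (2 + 1) ^+ s * (2 + C * (2 + 1)).
exists (E + E) => [|gamma T h w T0 hT h0 h1]; first by rewrite addr_ge0 ?mulr_ge0 ?addr_ge0 ?mulr_ge0.
have [reL imL] := hC gamma T T0 hT.
have hW j : hi j - lo j <= 2.
  by have [? ?] := box_bounds j; lra.
set L := tseq _ _.
have inB t : t \in L -> B (grid_at h w t).
  rewrite mem_tseq => /forallP ht j; rewrite tnth_mktuple mem_cut//.
have -> : \sum_(t <- L) e (phase gamma (tnth (grid_at h w t))) =
    \sum_(t <- L) e (clamped gamma (grid_at h w t)).
  by rewrite !big_seq; apply: eq_bigr => t /inB Bt; rewrite clamped_eq.
rewrite osc_clamped; apply: le_trans (normc_le_parts _) _.
have split_re (x y : R[i]) : complex.Re (x - y) = complex.Re x - complex.Re y.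
  by case: x y => [? ?] [? ?].
have split_im (x y : R[i]) : complex.Im (x - y) = complex.Im x - complex.Im y.
  by case: x y => [? ?] [? ?].
rewrite split_re split_im Re_scale Im_scale Re_sum Im_sum /=.
have E0 : h * (s%:R * (2 + 1) ^+ s * (2 * 1 + C * T * (2 + 1))) <= E * (1 + T) * h.
  rewrite mulrC ler_wpM2r ?(ltW h0)// /E -!mulrA ler_wpM2l// ler_wpM2l ?exprn_ge0 ?addr_ge0//.
  have : 0 <= C * 3 by rewrite mulr_ge0.
  have : 0 <= T * C by rewrite mulr_ge0.
  nra.
have -> : (E + E) * (1 + T) * h = E * (1 + T) * h + E * (1 + T) * h by ring.
apply: lerD; apply: le_trans E0.
  apply: (@riemann_sum R s a b lo hi w h 1 (C * T) 2
    (fun x => complex.Re (e (clamped gamma x))) lohi hW) => // x.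
  exact: unit_exp_Re_le.
apply: (@riemann_sum R s a b lo hi w h 1 (C * T) 2
    (fun x => complex.Im (e (clamped gamma x))) lohi hW) => // x.
exact: unit_exp_Im_le.
Qed.

Lemma osc_lip : exists2 C : R, 0 <= C & forall gamma gamma',
  [/\ `|complex.Re (osc gamma)| <= C, `|complex.Im (osc gamma)| <= C,
    `|complex.Re (osc gamma) - complex.Re (osc gamma')| <= C * \sum_i `|gamma i - gamma' i| &
    `|complex.Im (osc gamma) - complex.Im (osc gamma')| <= C * \sum_i `|gamma i - gamma' i| ].
Proof.
have [C C0 hC] := phase_lip; have pi2 : 0 <= 2 * pi :> R by rewrite mulr_ge0// pi_ge0.
have [C1 C10 hC1] := clamped_lip.
have Boo : (mu s B < +oo)%E by apply: tbox_fin.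
pose V := fine (mu s B).
have V0 : 0 <= V by apply: fine_ge0.
have PC : 0 <= 2 * pi * C by rewrite mulr_ge0.
exists ((1 + 2 * pi * C) * V) => [|gamma gamma']; first by rewrite mulr_ge0// addr_ge0.
have T_ex (g : 'I_r -> R) : forall i, `|g i| <= \sum_i `|g i|.
  by move=> i; rewrite (bigD1 i)//= lerDl sumr_ge0.
have S_ge0 (g : 'I_r -> R) : 0 <= \sum_i `|g i| by apply: sumr_ge0.
have mre g : measurable_fun B (fun x : s.-tuple RR => complex.Re (e (clamped g x))).
  exact: (measurable_funS measurableT _ (lipschitz_measurable (proj1 (hC1 g _ (S_ge0 g) (T_ex g))))).
have mim g : measurable_fun B (fun x : s.-tuple RR => complex.Im (e (clamped g x))).
  exact: (measurable_funS measurableT _ (lipschitz_measurable (proj2 (hC1 g _ (S_ge0 g) (T_ex g))))).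
have key x : 2 * pi * `|clamped gamma x - clamped gamma' x| <= 2 * pi * C * \sum_i `|gamma i - gamma' i|.
  by rewrite -[leRHS]mulrA ler_wpM2l//; exact: (proj1 (hC _ (in_cube_clamp x))).
have bre g := Rintegral_bound mB Boo (mre g) (fun x _ => unit_exp_Re_le _).
have bim g := Rintegral_bound mB Boo (mim g) (fun x _ => unit_exp_Im_le _).
have V1 : 1 * V <= (1 + 2 * pi * C) * V by rewrite ler_wpM2r// lerDl.
rewrite !osc_clamped /=; split.
- exact: le_trans (proj2 (bre gamma)) V1.
- exact: le_trans (proj2 (bim gamma)) V1.
- rewrite -RintegralB//; [|exact: (proj1 (bre gamma))|exact: (proj1 (bre gamma'))].
  apply: le_trans (proj2 (Rintegral_bound (C := 2 * pi * C * \sum_i `|gamma i - gamma' i|) mB Boo _ _)) _.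
  + exact: (measurable_funB (mre gamma) (mre gamma')).
  + by move=> x _; apply: le_trans (unit_exp_Re_lip _ _) (key x).
  + by rewrite mulrAC ler_wpM2r ?sumr_ge0// ler_wpM2r// lerDr.
- rewrite -RintegralB//; [|exact: (proj1 (bim gamma))|exact: (proj1 (bim gamma'))].
  apply: le_trans (proj2 (Rintegral_bound (C := 2 * pi * C * \sum_i `|gamma i - gamma' i|) mB Boo _ _)) _.
  + exact: (measurable_funB (mim gamma) (mim gamma')).
  + by move=> x _; apply: le_trans (unit_exp_Im_lip _ _) (key x).
  + by rewrite mulrAC ler_wpM2r ?sumr_ge0// ler_wpM2r// lerDr.
Qed.

End OscillatoryIntegral.

Lemma normc_real (R : realType) (x : R) : normc x%:C = `|x|.
Proof. by rewrite /normc /= expr0n addr0 sqrtr_sqr. Qed.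

(** * Sums over dilated boxes and decay of the oscillatory integral *)

Section BoxSums.
Variables (R : realType) (r s d : nat) (F : 'I_r -> {mpoly int[s]}).
Hypothesis F_homog : forall i, F i \is ishomog1 d mdeg.
Variables (a b : 'I_s -> bool) (lo hi : 'I_s -> R).
Local Notation e := (@unit_exp R).

Definition box_lo (P : R) (j : 'I_s) : int := cut (a j) (lo j * P).
Definition box_hi (P : R) (j : 'I_s) : int := cut (b j) (hi j * P).

Definition box_sum (P : R) (alpha : 'I_r -> R) : R[i] :=
  \sum_(x <- ibox (box_lo P) (box_hi P)) e (form_comb F alpha x).

Lemma phase_div (P : R) alpha x : P != 0 ->
  phase F (fun i => P ^+ d * alpha i) (fun j => x j / P) = phase F alpha x.
Proof.
move=> P0; have -> : (fun j => x j / P) = (fun j => P^-1 * x j) by apply/funext => j; rewrite mulrC.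
rewrite (phase_scale F_homog) /phase mulr_sumr; apply: eq_bigr => i _.
by rewrite mulrA mulrA -exprMn mulVf// expr1n mul1r.
Qed.

Lemma box_sum_grid (P : R) alpha : 0 < P -> box_sum P alpha =
  \sum_(t <- tseq (fun j => cut (a j) ((lo j - 0) / P^-1)) (fun j => cut (b j) ((hi j - 0) / P^-1)))
     e (phase F (fun i => P ^+ d * alpha i) (tnth (grid_at P^-1 (fun=> 0) t))).
Proof.
move=> P0.
have -> : (fun j => cut (a j) ((lo j - 0) / P^-1)) = box_lo P.
  by apply/funext => j; rewrite subr0 invrK.
have -> : (fun j => cut (b j) ((hi j - 0) / P^-1)) = box_hi P.
  by apply/funext => j; rewrite subr0 invrK.
rewrite /tseq big_map; apply: eq_bigr => x _; congr e.
rewrite -(phase_int F) -(phase_div alpha _ (lt0r_neq0 P0)); congr phase.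
by apply/funext => j; rewrite !tnth_mktuple addr0 mulrC.
Qed.

End BoxSums.

Lemma decay_arith1 (R : realType) (q Y : R) : 1 <= q -> q <= Y -> 2 <= Y -> q * (2 * Y) + Y < Y ^+ 6.
Proof.
move=> q1 qY Y2; have Y4 : 4 <= Y * Y.
  by have := ler_pM (ler0n R 2) (ler0n R 2) Y2 Y2; rewrite -natrM.
have e : Y ^+ 6 = (Y * Y) * (Y * Y) * (Y * Y) by ring.
apply: (@le_lt_trans _ _ (3 * (Y * Y))).
  have : q * Y <= Y * Y by rewrite ler_wpM2r//; lra.
  have : 1 * Y <= Y * Y by rewrite ler_wpM2r//; lra.
  lra.
rewrite e; move: Y4; set Z := Y * Y => Z4.
have : 4 * 4 <= Z * Z by apply: ler_pM => //; lra.
move=> h; have : 16 * Z <= Z * Z * Z by rewrite ler_wpM2r//; lra.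
lra.
Qed.

Lemma decay_arith2 (R : realType) (q Y : R) : 1 <= q -> 0 < Y -> q * (2 * Y) <= Y -> False.
Proof.
move=> q1 Y0 h; have : 1 * (2 * Y) <= q * (2 * Y) by rewrite ler_wpM2r//; lra.
lra.
Qed.

Lemma decay_arith3 (R : realType) (Y : R) : 2 <= Y -> 1 + 2 * Y <= 3 * (Y * Y).
Proof.
move=> Y2; have : 2 * Y <= Y * Y by rewrite ler_wpM2r//; lra.
lra.
Qed.

Section Decay.
Variables (R : realType) (r s d : nat) (F : 'I_r -> {mpoly int[s]}).
Hypothesis r_gt0 : (0 < r)%N.
Hypothesis s_gt0 : (0 < s)%N.
Hypothesis F_homog : forall i, F i \is ishomog1 d mdeg.
Hypothesis d_gt1 : (1 < d)%N.
Variable k : nat.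
Hypothesis k_dim : forall (a : {ffun 'I_r -> int}) m Z, a != 0%R ->
  irreducible_chain (gradient_zeros R F a) m Z -> (m <= k)%N.
Hypothesis s_large : (k + 2 ^ d.-1 * r.+1 * (r * d.-1) < s)%N.
Variables (a b : 'I_s -> bool) (lo hi : 'I_s -> R).
Hypothesis lohi : forall j, lo j < hi j.
Hypothesis in_unit : tbox a b lo hi `<=` unit_box R s.
Local Notation B := (tbox a b lo hi).
Local Notation osc := (fun gamma : 'I_r -> R => oscillatory_integral F B (mktuple gamma)).

Lemma box_lo_ge (P : R) j : 0 <= P -> - P <= (box_lo a lo P j)%:~R.
Proof.
move=> P0; apply: le_trans (cut_ge _ _).
by have [h _] := box_bounds lohi in_unit j; rewrite -mulN1r ler_wpM2r.
Qed.

Lemma box_hi_le (P : R) j : 0 <= P -> (box_hi b hi P j)%:~R - 1 <= P.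
Proof.
move=> P0; rewrite lerBlDr; apply: le_trans (cut_le1 _ _) _; rewrite lerD2r.
by have [_ h] := box_bounds lohi in_unit j; rewrite -[leRHS]mul1r ler_wpM2r.
Qed.

Lemma weyl_exponent_ge : r.+1%:R <= weyl_exponent R r d.
Proof. by rewrite lerDl. Qed.

(** The integral is compared with the sum at gamma/P^d over the box dilated by P, to which the Weyl
    alternative is applied. A rational approximation is excluded: P^d is so large that the
    numerators would vanish, and gamma is too large for that. The order [r + 1] of decay makes the
    integral over gamma in dimension [r] converge. *)
Lemma osc_decay : exists2 C : R, 0 <= C & forall gamma T, 4 <= T -> (exists i, T <= `|gamma i|) ->
  normc (osc gamma) <= C / T ^+ r.+1.
Proof.
have r3 : (0 : R) < (r + 3)%:R by rewrite ltr0n addn3.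
have [C1 C11 W] := weyl_alternative r_gt0 s_gt0 F_homog d_gt1 k_dim s_large
  (eta := (r + 3)%:R^-1) ltac:(by rewrite invr_gt0).
have [C2 C20 Q] := osc_riemann F lohi in_unit.
exists ((C1 + 3 * C2) * 2 ^+ r.+1) => [|gamma T0 T04 [i0 hi0]].
  by rewrite mulr_ge0 ?exprn_ge0// addr_ge0 ?mulr_ge0//; lra.
have [i1 _ max_i1] := @Order.TotalTheory.arg_maxP _ _ 'I_r i0 xpredT (fun i => `|gamma i|) isT.
pose T := `|gamma i1|; have hT i : `|gamma i| <= T by apply: max_i1.
have TT0 : T0 <= T by apply: le_trans hi0 (hT i0).
have T4 : 4 <= T by lra.
(* Half of T, so that zero numerators contradict the approximation bound; P = Y^(r+3) is large
   enough for the Riemann error, of order T/P, to be at most of order Y^(-r-1). *)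
pose Y := T / 2; have [P PE] : {P : R | P = Y ^+ (r + 3)} by exists (Y ^+ (r + 3)).
have Y2 : 2 <= Y by rewrite /Y; lra.
have Y0 : 0 < Y by lra.
have Y1 : 1 <= Y by lra.
have P1 : 1 <= P by rewrite PE; apply: exprn_ege1.
have P0 : 0 < P by lra.
have YP : Y <= P by rewrite PE -[leLHS]expr1 ler_weXn2l// addn3.
have Peta : P `^ (r + 3)%:R^-1 <= Y.
  by rewrite PE -powR_mulrn ?(ltW Y0)// -powRrM mulfV ?gt_eqF// powRr1 ?(ltW Y0).
have PY : Y <= P ^+ (r * d.-1).
  apply: le_trans YP _; rewrite -[leLHS]expr1 ler_weXn2l// muln_gt0 r_gt0.
  by rewrite -ltnS prednK// ltnW.
pose alpha i := gamma i / P ^+ d.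
have Pd : P ^+ d != 0 by rewrite expf_neq0// gt_eqF.
have gE : (fun i => P ^+ d * alpha i) = gamma by apply/funext => i; rewrite /alpha mulrC divfK.
have Pd0 : 0 < P ^+ d by apply: exprn_gt0.
have PdY : Y ^+ 6 <= P ^+ d.
  apply: (@le_trans _ _ (P ^+ 2)); last exact: ler_weXn2l.
  by rewrite PE -exprM; apply: ler_weXn2l => //; exact: (leq_mul (leq_addl r 3) (leqnn 2)).
have S : normc (box_sum F a b lo hi P alpha) <= C1 * P ^+ s / Y ^+ r.+1.
  case: (W P Y alpha (box_lo a lo P) (box_hi b hi P) P1 Peta PY).
  - by move=> j; apply: box_lo_ge; apply: ltW.
  - by move=> j; apply: box_hi_le; apply: ltW.
  - move=> h; apply: le_trans h _; rewrite ler_wpM2l ?mulr_ge0 ?exprn_ge0 ?(ltW P0)//; first lra.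
    rewrite lef_pV2 ?posrE ?exprn_gt0 ?powR_gt0//.
    by rewrite -powR_mulrn ?(ltW Y0)// ler_powR// weyl_exponent_ge.
  move=> [q [q0 qY hq]]; exfalso; have [z hz] := hq i1.
  have q1 : 1 <= q%:R :> R by rewrite ler1n.
  have zz : `|z%:~R * P ^+ d : R| <= q%:R * T + Y.
    have -> : z%:~R * P ^+ d = q%:R * gamma i1 - (q%:R * alpha i1 - z%:~R) * P ^+ d.
      by rewrite /alpha; field.
    apply: le_trans (ler_normB _ _) _; rewrite !normrM normr_nat (gtr0_norm Pd0).
    by rewrite lerD2l -ler_pdivlMr.
  have TY : T = 2 * Y by rewrite /Y; lra.
  have zb : `|z%:~R : R| * P ^+ d < P ^+ d.
    rewrite -[X in _ * X](gtr0_norm Pd0) -normrM; apply: le_lt_trans zz _.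
    apply: lt_le_trans PdY; rewrite TY.
    exact: decay_arith1.
  (* The size of z P^d is at most q T + Y, which is less than Y^6 and hence than P^d. *)
  have z0 : z = 0.
    move: zb; rewrite gtr_pMl// -intr_norm -[1 in X in X -> _]/(1%:~R) ltr_int => zb.
    by apply/eqP; rewrite -absz_eq0; move: zb; rewrite -abszE; case: absz.
  rewrite z0 mulr0z subr0 /alpha normrM normr_nat normf_div (gtr0_norm Pd0) mulrA in hz.
  by move: hz; rewrite ler_pM2r ?invr_gt0// -/T TY; apply: decay_arith2.
have := Q gamma T P^-1 (fun=> 0) ltac:(by lra) hT ltac:(by rewrite invr_gt0)
  ltac:(by rewrite invf_le1).
rewrite -{1}gE -(box_sum_grid F_homog a b lo hi alpha P0) => hQ.
set Sm := box_sum _ _ _ _ _ _ _ in S hQ.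
have Ps0 : 0 < P ^+ s by apply: exprn_gt0.
have h1 : normc ((P^-1 ^+ s)%:C * Sm) <= C1 / Y ^+ r.+1.
  rewrite normcM normc_real ger0_norm ?exprn_ge0 ?invr_ge0 ?(ltW P0)// exprVn mulrC.
  by rewrite ler_pdivrMr// mulrAC.
have h2 : C2 * (1 + T) * P^-1 <= 3 * C2 / Y ^+ r.+1.
  have -> : P = Y ^+ r.+1 * Y ^+ 2 by rewrite PE -exprD addn2 addn3.
  rewrite invfM [(Y ^+ r.+1)^-1 * _]mulrC mulrA ler_wpM2r ?invr_ge0 ?exprn_ge0 ?(ltW Y0)//.
  have TY : T = 2 * Y by rewrite /Y; lra.
  rewrite ler_pdivrMr ?exprn_gt0// TY [_ ^+ 2]expr2.
  have -> : 3 * C2 * (Y * Y) = C2 * (3 * (Y * Y)) by ring.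
  by rewrite ler_wpM2l//; exact: decay_arith3.
have h3 : normc (osc gamma) <= (C1 + 3 * C2) / Y ^+ r.+1.
  rewrite mulrDl; have -> : osc gamma = (P^-1 ^+ s)%:C * Sm - ((P^-1 ^+ s)%:C * Sm - osc gamma).
    by rewrite opprB addrC subrK.
  apply: le_trans (le_normcD _ _) _; rewrite normcN; apply: lerD => //.
  exact: le_trans hQ h2.
apply: le_trans h3 _.
have -> : (C1 + 3 * C2) / Y ^+ r.+1 = (C1 + 3 * C2) * 2 ^+ r.+1 / T ^+ r.+1.
  by rewrite /Y expr_div_n invf_div mulrA.
rewrite ler_wpM2l ?mulr_ge0 ?exprn_ge0 ?addr_ge0 ?mulr_ge0//; first lra.
by rewrite lef_pV2 ?posrE ?exprn_gt0 ?lerXn2r ?nnegrE//; lra.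
Qed.

End Decay.

(** * Integrability from decay at infinity *)

Section Tail.
Variable R : realType.
Local Notation RR := (measurableTypeR R).
Local Notation mu := (lebesgue_tuple R).

Definition cube n (T : R) : set (n.-tuple RR) :=
  tbox (fun=> true) (fun=> false) (fun=> - T) (fun=> T).

Lemma cubeP n (T : R) (x : n.-tuple RR) : cube T x <-> forall i, `|tnth x i : R| <= T.
Proof. by split=> h i; have := h i; rewrite in_itv /= ler_norml. Qed.

Lemma measurable_cube n (T : R) : measurable (@cube n T).
Proof. exact: measurable_tbox. Qed.

Lemma cube_measure n (T : R) : 0 < T -> mu n (cube T) = ((2 * T) ^+ n)%:E.
Proof.
move=> T0; rewrite tbox_measure => [|j]; last by lra.
by rewrite prodr_const card_ord opprK -mulr2n mulr_natl.
Qed.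

Lemma half_series m : \sum_(0 <= j < m) (2 ^+ j)^-1 <= 2 :> R.
Proof.
suff -> : \sum_(0 <= j < m) (2 ^+ j)^-1 = 2 - 2 / 2 ^+ m :> R.
  by rewrite gerBl divr_ge0 ?exprn_ge0.
elim: m => [|m IH]; first by rewrite big_geq// expr0 divr1 subrr.
rewrite big_nat_recr//= IH exprS; have : (2 : R) ^+ m != 0 by rewrite expf_neq0.
by move=> h; field.
Qed.

Variables (n : nat) (g : n.-tuple RR -> R) (C : R).
Hypothesis g_meas : measurable_fun [set: n.-tuple RR] g.
Hypothesis g_bound : forall x, `|g x| <= C.
Hypothesis g_decay : forall x T, 4 <= T -> (exists i, T <= `|tnth x i : R|) -> `|g x| <= C / T ^+ n.+1.

Let C0 : 0 <= C. Proof. exact: le_trans (normr_ge0 _) (g_bound [tuple of nseq n (0 : RR)]). Qed.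

(** Dyadic decomposition: between the cubes of half-sides 2^j T and 2^(j+1) T the function is at
    most C/(2^j T)^(n+1), while the larger cube has volume (4 2^j T)^n. The bounds form a geometric
    series of ratio 1/2. Full cubes replace the shells, since only an upper bound is wanted. *)
Lemma tail_abs (T : R) : 4 <= T ->
  (\int[mu n]_(x in ~` cube T) `|(g x)%:E| <= (2 * C * 4 ^+ n / T)%:E)%E.
Proof.
move=> T4; have T0 : 0 < T by lra.
pose A j : set (n.-tuple RR) := cube (2 ^+ j.+1 * T).
pose c j : R := C / (2 ^+ j * T) ^+ n.+1.
have p0 j : 0 < 2 ^+ j * T by rewrite mulr_gt0 ?exprn_gt0.
have c0 j : 0 <= c j by rewrite divr_ge0 ?exprn_ge0// ltW.
have mD : measurable (~` cube T : set (n.-tuple RR)) by apply: measurableC; exact: measurable_cube.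
have mA j : measurable (A j) by exact: measurable_cube.
pose h j (x : n.-tuple RR) : \bar R := ((c j)%:E * (\1_(A j) x)%:E)%E.
have h0 j x : (0 <= h j x)%E by rewrite mule_ge0// lee_fin.
have m1 j : measurable_fun (~` cube T : set (n.-tuple RR)) (fun x => (\1_(A j) x)%:E : \bar R).
  by apply/measurable_EFinP; exact: measurable_indic.
have mh j : measurable_fun (~` cube T : set (n.-tuple RR)) (h j).
  by apply: emeasurable_funM => //; exact: measurable_cst.
apply: (@le_trans _ _ (\int[mu n]_(x in ~` cube T) (\sum_(0 <= j <oo) h j x))%E).
  apply: ge0_le_integral => //.
  - apply: measurableT_comp => //; apply/measurable_EFinP; exact: measurable_funTS.
  - exact: (ge0_emeasurable_sum (P := predT)).
  - move=> x nx.
    have [j Aj] : exists j, `[< A j x >].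
      exists (Num.truncn (\sum_i `|tnth x i : R|)).+1; apply/asboolP/cubeP => i.
      apply: (@le_trans _ _ (\sum_i `|tnth x i : R|)).
        by rewrite (bigD1 i)//= lerDl sumr_ge0.
      apply: (@le_trans _ _ ((Num.truncn (\sum_i `|tnth x i : R|)).+1%:R)); first exact/ltW/truncnS_gt.
      rewrite -[leLHS]mulr1 ler_pM//; last lra.
      by rewrite -natrX ler_nat; apply: leq_trans (leqnSn _) (ltnW (ltn_expl _ _)).
    (* The least of the cubes containing [x]; being outside the preceding one, [x] satisfies the
       decay hypothesis at that scale. *)
    have [m /asboolP Am min_m] := ex_minnP (P := fun j => `[< A j x >]) (ex_intro _ j Aj).
    have [i hi] : exists i, 2 ^+ m * T <= `|tnth x i : R|.
      apply: contrapT => nex; have lt i : `|tnth x i : R| < 2 ^+ m * T.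
        by rewrite ltNge; apply/negP => hi; apply: nex; exists i.
      case: m {Am} min_m {nex} lt => [_|m min_m] lt.
        by apply: nx; apply/cubeP => i; have := lt i; rewrite expr0 mul1r => /ltW.
      have := min_m m; rewrite ltnn => H; apply: (notF (H _)).
      by apply/asboolP/cubeP => i; apply: ltW.
    have gx : (`|(g x)%:E| <= h m x)%E.
      rewrite /h indicE mem_set// mule1 /= lee_fin; apply: g_decay; last by exists i.
      by apply: le_trans T4 _; rewrite ler_peMl ?(ltW T0)// exprn_ege1// ler1n.
    apply: le_trans gx _; apply: le_trans (@nneseries_lim_ge R (fun j => h j x) xpredT 0 m.+1 (fun j _ _ => h0 j x)).
    by rewrite big_nat_recr//= leeDr// sume_ge0.
rewrite integral_nneseries//.
apply: lime_le; first by apply: is_cvg_nneseries => k _ _; apply: integral_ge0.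
apply: nearW => m.
have hj j : (\int[mu n]_(x in ~` cube T) h j x <= (C * 4 ^+ n / T * (2 ^+ j)^-1)%:E)%E.
  rewrite ge0_integralZl_EFin// integral_indic//.
  apply: (@le_trans _ _ ((c j)%:E * mu n (A j))%E).
    apply: lee_wpmul2l; first by rewrite lee_fin.
    by apply: le_measure; rewrite ?inE//; apply: measurableI.
  rewrite cube_measure; last exact: p0.
  rewrite -EFinM lee_fin /c [2 * _](_ : _ = 4 * (2 ^+ j * T)); last by rewrite exprS; ring.
  rewrite [(4 * _) ^+ n]exprMn [_ ^+ n.+1]exprSr.
  have hx : (2 ^+ j * T) ^+ n != 0 by rewrite expf_neq0// gt_eqF.
  have h2 : (2 : R) ^+ j != 0 by rewrite expf_neq0.
  rewrite le_eqVlt; apply/orP; left; apply/eqP; move: hx; set X := _ ^+ n => hx; field.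
  by rewrite hx h2 gt_eqF.
apply: (@le_trans _ _ (\sum_(0 <= j < m) (C * 4 ^+ n / T * (2 ^+ j)^-1)%:E)%E).
  by apply: lee_sum => j _; apply: hj.
rewrite sumEFin lee_fin -mulr_sumr.
have -> : 2 * C * 4 ^+ n / T = C * 4 ^+ n / T * 2 by ring.
rewrite ler_wpM2l ?half_series//.
by rewrite divr_ge0 ?mulr_ge0 ?exprn_ge0// ltW.
Qed.

Lemma tail_integrable : (mu n).-integrable [set: n.-tuple RR] (EFin \o g).
Proof.
apply/integrableP; split; first exact/measurable_EFinP.
have mC := @measurable_cube n 4.
rewrite -(setUv (cube 4 : set (n.-tuple RR))) ge0_integral_setU//; last 3 first.
- exact: measurableC.
- by rewrite setUv; apply: measurableT_comp => //; apply/measurable_EFinP.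
- exact/disj_setPCl.
rewrite lte_add_pinfty//; last first.
  by apply: le_lt_trans (tail_abs (lexx 4)) _; exact: ltry.
have Coo : (mu n (cube 4) < +oo)%E by rewrite cube_measure// ltry.
have [/integrableP[_ ->]//] := Rintegral_bound mC Coo (measurable_funTS g_meas) (fun x _ => g_bound x).
Qed.

Lemma tail_bound (T : R) : 4 <= T ->
  `|\int[mu n]_x g x - \int[mu n]_(x in cube T) g x| <= 2 * C * 4 ^+ n / T.
Proof.
move=> T4; have mC := @measurable_cube n T.
have mD : measurable (~` cube T : set (n.-tuple RR)) by apply: measurableC.
have gi := tail_integrable.
rewrite -{1}(setUv (cube T : set (n.-tuple RR))) Rintegral_setU//; last 2 first.
- by rewrite setUv.
- exact/disj_setPCl.
rewrite addrAC subrr add0r.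
have giD : (mu n).-integrable (~` cube T) (EFin \o g) by apply: integrableS gi.
apply: le_trans (le_normr_Rintegral mD giD) _.
have := tail_abs T4; rewrite /Rintegral; set I := (\int[_]_(x in _) _)%E => hI.
have I0 : (0 <= I)%E by apply: integral_ge0.
rewrite -[X in _ <= X]/(fine (2 * C * 4 ^+ n / T)%:E); apply: fine_le => //.
by rewrite ge0_fin_numE//; apply: le_lt_trans hI _; exact: ltry.
Qed.

End Tail.

(** * Complete exponential sums *)

Section Residues.
Variables (n q : nat).

Definition residue_tuple (x : n.-tuple 'I_q.+1) : n.-tuple int := map_tuple (fun i : 'I_q.+1 => (i : nat)%:Z) x.

Lemma perm_residues : perm_eq [seq residue_tuple x | x <- enum (residues n q)]
  (tseq (fun=> 1) (fun=> q%:Z + 1)).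
Proof.
have inj : injective residue_tuple.
  move=> x y xy; apply/eq_from_tnth => j; apply/val_inj/eqP.
  have := congr1 (fun t => tnth t j) xy; rewrite /= !tnth_map => -[/eqP].
  by rewrite eqE.
apply: uniq_perm; [by rewrite map_inj_uniq ?enum_uniq|exact: tseq_uniq|].
move=> t; rewrite mem_tseq; apply/mapP/forallP => [[x + ->] j|h].
  rewrite mem_enum inE => /forallP /(_ j) x0; rewrite tnth_map.
  by have -> : q%:Z + 1 = q.+1%:Z; [rewrite -addn1 PoszD|rewrite lez_nat x0 ltz_nat ltn_ord].
have hb j : (absz (tnth t j) < q.+1)%N.
  by have /andP[h1 h2] := h j; move: h1 h2; case: (tnth t j) => m //; rewrite -PoszD ltz_nat addn1.
exists [tuple Ordinal (hb j) | j < n].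
  rewrite mem_enum inE; apply/forallP => j; rewrite tnth_mktuple /=.
  by have /andP[h1 h2] := h j; move: h1; case: (tnth t j).
apply/eq_from_tnth => j; rewrite tnth_map tnth_mktuple /=.
by have /andP[h1 h2] := h j; move: h1; case: (tnth t j).
Qed.

Lemma sum_residues (A : nmodType) (G : n.-tuple int -> A) :
  \sum_(x in residues n q) G (residue_tuple x) = \sum_(t <- tseq (fun=> 1) (fun=> q%:Z + 1)) G t.
Proof. by rewrite -(perm_big _ perm_residues) big_map big_enum_cond; apply: eq_bigl => x; rewrite andbT. Qed.

Lemma card_residues : #|residues n q| = (q ^ n)%N.
Proof.
have := perm_size perm_residues; rewrite size_map -cardE => ->.
rewrite size_map size_ibox (eq_bigr (fun=> q)) ?prod_nat_const ?card_ord// => j _.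
by rewrite /width addrK max_r.
Qed.

End Residues.

Lemma biggcd_dvd r q q' (a : 'I_r -> nat) : (forall i, q %| q' * a i)%N ->
  (\big[gcdn/q]_(i < r) a i = 1)%N -> (q %| q')%N.
Proof.
move=> h g1; rewrite -[q']muln1 -g1; elim/big_rec: _ => [|i x _ IH]; first exact: dvdn_mull.
by rewrite muln_gcdr dvdn_gcd h.
Qed.

Section GaussSums.
Variables (R : realType) (r s d : nat) (F : 'I_r -> {mpoly int[s]}).
Hypothesis r_gt0 : (0 < r)%N.
Hypothesis s_gt0 : (0 < s)%N.
Hypothesis F_homog : forall i, F i \is ishomog1 d mdeg.
Hypothesis d_gt1 : (1 < d)%N.
Variable k : nat.
Hypothesis k_dim : forall (a : {ffun 'I_r -> int}) m Z, a != 0%R ->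
  irreducible_chain (gradient_zeros R F a) m Z -> (m <= k)%N.
Hypothesis s_large : (k + 2 ^ d.-1 * r.+1 * (r * d.-1) < s)%N.
Local Notation e := (@unit_exp R).
Local Notation we := (weyl_exponent R r d).

Definition fraction q (a : r.-tuple 'I_q.+1) (i : 'I_r) : R := (tnth a i)%:R / q%:R.

Lemma gauss_sumE q (a : r.-tuple 'I_q.+1) : gauss_sum R F a =
  \sum_(x <- ibox (fun=> 1) (fun=> q%:Z + 1)) e (form_comb F (fraction a) x).
Proof.
transitivity (\sum_(t <- tseq (fun=> 1) (fun=> q%:Z + 1))
    e ((\sum_(i < r) (tnth a i)%:Z * meval (tnth t) (F i))%:~R / q%:R)).
  rewrite -sum_residues; apply: eq_bigr => x _; congr (e (_%:~R / _)).
  apply: eq_bigr => i _; congr (_ * meval _ _); apply/funext => j.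
  by rewrite tnth_map.
rewrite big_map; apply: eq_bigr => x _; congr e.
rewrite rmorph_sum mulr_suml; apply: eq_bigr => i _.
rewrite /= intrM /fraction [RHS]mulrAC; congr (_ * _%:~R / _); rewrite /evZ; congr meval.
by apply/funext => j; rewrite tnth_mktuple.
Qed.

Lemma gauss_sum_trivial q (a : r.-tuple 'I_q.+1) : normc (gauss_sum R F a) <= q%:R ^+ s.
Proof.
rewrite /gauss_sum; apply: le_trans (normc_sum _ _ _) _.
under eq_bigr do rewrite normc_unit_exp.
by rewrite sumr_const card_residues natrX.
Qed.

(** The Weyl alternative with P = q and Y = q/2, over one full period. A simultaneous approximation
    to the a_i/q with denominator q' <= q/2 has error at most 1/(2q), hence is exact, so that q
    divides q' by coprimality, which is impossible. For q < 4 the trivial bound is used. *)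
Lemma gauss_sum_bound : exists2 C : R, 1 <= C & forall q (a : r.-tuple 'I_q.+1), (0 < q)%N ->
  \big[gcdn/q]_(i < r) (tnth a i : nat) = 1%N ->
  normc (q%:R ^- s * gauss_sum R F a) <= C / q%:R `^ we.
Proof.
have [C C1 W] := weyl_alternative r_gt0 s_gt0 F_homog d_gt1 k_dim s_large
  (eta := 2^-1) ltac:(by rewrite invr_gt0).
have we0 : 0 <= we by apply: le_trans (weyl_exponent_ge R r d).
have p4 : 0 < 4 `^ we :> R by apply: powR_gt0.
exists (C * 4 `^ we) => [|q a q0 ga].
  apply: mulr_ege1 => //; rewrite -[leLHS](powRr0 (4 : R)); apply: ler_powR => //; exact: ler1n.
have qR : (0 : R) < q%:R by rewrite ltr0n.
have qs : 0 < q%:R ^+ s :> R by rewrite exprn_gt0.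
have qw : 0 < q%:R `^ we :> R by apply: powR_gt0.
have nE : normc (q%:R ^- s * gauss_sum R F a) = normc (gauss_sum R F a) / q%:R ^+ s.
  have -> : (q%:R : R[i]) ^- s = ((q%:R : R) ^- s)%:C.
    by rewrite fmorphV rmorphXn rmorph_nat.
  by rewrite normcM normc_real ger0_norm ?invr_ge0 ?(ltW qs)// mulrC.
rewrite nE ler_pdivrMr//.
have [q4|q4] := leqP 4 q; last first.
  apply: le_trans (gauss_sum_trivial a) _; rewrite ler_peMl ?(ltW qs)//.
  rewrite ler_pdivlMr// mul1r; apply: (@le_trans _ _ (4 `^ we)); last by rewrite ler_peMl// ltW.
  by apply: ge0_ler_powR; rewrite ?nnegrE// ler_nat ltnW.
have q4R : 4 <= q%:R :> R by rewrite ler_nat.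
pose Y : R := q%:R / 2.
have Y0 : 0 < Y by rewrite divr_gt0.
have q1 : 1 <= q%:R :> R by lra.
have hY : q%:R `^ 2^-1 <= Y.
  rewrite -(@ler_pXn2r _ 2) ?nnegrE ?powR_ge0 ?(ltW Y0)// root_pow ?(ltW qR)//.
  rewrite /Y expr_div_n ler_pdivlMr ?exprn_gt0// (_ : 2 ^+ 2 = 4); last by rewrite -natrX.
  by rewrite [leRHS]expr2 ler_wpM2l// ltW.
have YP : Y <= q%:R ^+ (r * d.-1).
  apply: (@le_trans _ _ q%:R); first by rewrite /Y; lra.
  rewrite -[leLHS]expr1 ler_weXn2l// muln_gt0 r_gt0.
  by rewrite -ltnS prednK// ltnW.
have := W q%:R Y (fraction a) (fun=> 1) (fun=> q%:Z + 1) q1 hY YP.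
rewrite -gauss_sumE => /(_ _ _)[j|j||].
- by apply: le_trans (_ : (0 : R) <= _); rewrite ?oppr_le0 ?(ltW qR).
- by rewrite intrD addrK.
- move=> h; apply: le_trans h _.
  have -> : C * 4 `^ we / q%:R `^ we * q%:R ^+ s = C * q%:R ^+ s * (4 `^ we / q%:R `^ we).
    by rewrite -!mulrA [_^-1 * _]mulrC [4 `^ we * _]mulrCA !mulrA.
  rewrite ler_wpM2l ?mulr_ge0 ?(ltW qs)//; first lra.
  have -> : q%:R = 2 * Y by rewrite /Y mulrC divfK.
  rewrite powRM ?(ltW Y0)// -[X in X <= _]mul1r.
  have p2 : 0 < 2 `^ we :> R by apply: powR_gt0.
  have Yw : 0 < Y `^ we by apply: powR_gt0.
  rewrite invfM mulrA ler_wpM2r ?invr_ge0 ?(ltW Yw)// ler_pdivlMr// mul1r.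
  by apply: ge0_ler_powR => //; rewrite ?nnegrE// ler_nat.
move=> [q' [q'0 q'Y hq']]; exfalso.
have dv : (q %| q')%N.
  apply: biggcd_dvd ga => i; have [z hz] := hq' i.
  have h2 : `|q'%:R * (tnth a i)%:R - z%:~R * q%:R : R| <= 1 / 2.
    have -> : q'%:R * (tnth a i)%:R - z%:~R * q%:R = (q'%:R * fraction a i - z%:~R) * q%:R.
      by rewrite /fraction mulrBl -mulrA divfK// gt_eqF.
    rewrite normrM (gtr0_norm qR) -ler_pdivlMr//; apply: le_trans hz _.
    have -> : 1 / 2 / q%:R = Y / q%:R ^+ 2 by rewrite /Y; field; rewrite gt_eqF.
    by rewrite ler_wpM2l ?(ltW Y0)// lef_pV2 ?posrE ?exprn_gt0// ler_weXn2l.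
  have : `|q'%:Z * (tnth a i)%:Z - z * q%:Z| < 1.
    rewrite -(@ltr_int R) intr_norm intrB !intrM; apply: le_lt_trans h2 _; lra.
  rewrite -(dvdzE q%:Z (q' * tnth a i)%N%:Z) PoszM => h0.
  have -> : q'%:Z * (tnth a i)%:Z = z * q%:Z.
    by apply/eqP; rewrite -subr_eq0 -absz_eq0; move: h0; rewrite -abszE; case: absz.
  exact: dvdz_mull.
have := dvdn_leq q'0 dv; rewrite -(ler_nat R) => h; move: q'Y; rewrite /Y; lra.
Qed.

End GaussSums.

(** * Series with terms of power decay *)

Section PowerSeries.
Variable R : realType.

(** Obtained from ln (x - 1) <= ln x - 1/x and 1 + u <= exp u; it provides a telescoping majorant
    for the tails. *)
Lemma powR_telescope (c : R) (n : nat) : 0 < c ->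
  c / n.+2%:R `^ (1 + c) <= n.+1%:R `^ (- c) - n.+2%:R `^ (- c).
Proof.
move=> c0; have x0 : (0 : R) < n.+2%:R by rewrite ltr0n.
have y0 : (0 : R) < n.+1%:R by rewrite ltr0n.
set x : R := n.+2%:R in x0 *; set y : R := n.+1%:R in y0 *.
have xy : x = y + 1 by rewrite /x /y natr1.
have xc : 0 < x `^ (- c) by apply: powR_gt0.
have eE (z : R) : 0 < z -> z `^ (- c) = expR (- c * ln z).
  by move=> z0; rewrite -ln_powR lnK// posrE powR_gt0.
have lny : ln y <= ln x - x^-1.
  have -> : y = x * (1 - x^-1) by rewrite mulrBr mulr1 mulfV ?gt_eqF// xy addrK.
  have h1 : 0 < 1 - x^-1 by rewrite subr_gt0 invf_lt1// xy; lra.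
  rewrite lnM ?posrE// lerD2l; apply: le_ln1Dx.
  by rewrite ltrN2 invf_lt1// xy; lra.
have -> : x `^ (1 + c) = x * (x `^ (- c))^-1.
  by rewrite powRD ?(gt_eqF x0) ?implybT// powRr1 ?(ltW x0)// powRN invrK.
rewrite invfM invrK.
have h : x `^ (- c) * (1 + c / x) <= y `^ (- c).
  rewrite !eE// -[X in X * _]mulr1 -mulrA mul1r; apply: (@le_trans _ _ (expR (- c * ln x) * expR (c / x))).
    by rewrite ler_wpM2l ?expR_ge0// expR_ge1Dx.
  rewrite -expRD ler_expR.
  have : c * ln y <= c * (ln x - x^-1) by rewrite ler_wpM2l// ltW.
  rewrite mulrBr !mulNr; set A := c * ln y; set B := c * ln x; set D := c / x; lra.
rewrite lerBrDl; apply: le_trans h; rewrite le_eqVlt; apply/orP; left; apply/eqP; ring.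
Qed.

Lemma sum_powR (c : R) (m N : nat) : 0 < c -> (m.+2 <= N)%N ->
  \sum_(m.+2 <= q < N) q%:R `^ (- (1 + c)) <= c^-1 * m.+1%:R `^ (- c).
Proof.
move=> c0 mN; rewrite mulrC ler_pdivlMr//.
suff h : (\sum_(m.+2 <= q < N) q%:R `^ (- (1 + c))) * c <= m.+1%:R `^ (- c) - N.-1%:R `^ (- c).
  by apply: le_trans h _; rewrite gerBl powR_ge0.
elim: N mN => // N IH; rewrite leq_eqVlt => /predU1P[<-|mN].
  by rewrite big_geq//= mul0r subrr.
have {}IH := IH mN; rewrite big_nat_recr//= mulrDl.
case: N mN IH => // -[|N] // mN IH.
have := powR_telescope N c0; rewrite [c / _]mulrC -powRN /= in IH * => h; lra.
Qed.

Lemma real_series (w : nat -> R) (C c : R) : 0 <= C -> 0 < c -> w 0%N = 0 ->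
  (forall q, (0 < q)%N -> `|w q| <= C * q%:R `^ (- (1 + c))) ->
  exists l : R, series w @ \oo --> l /\
    forall m, `|l - series w m.+2| <= C / c * m.+1%:R `^ (- c).
Proof.
move=> C0 c0 w0 wC.
have tail m N : (m.+2 <= N)%N -> \sum_(m.+2 <= q < N) `|w q| <= C / c * m.+1%:R `^ (- c).
  move=> mN; apply: (@le_trans _ _ (C * \sum_(m.+2 <= q < N) q%:R `^ (- (1 + c)))).
    rewrite mulr_sumr !big_nat; apply: ler_sum => q /andP[mq _].
    by apply: wC; apply: leq_trans mq.
  by rewrite -mulrA ler_wpM2l// sum_powR.
have cv : cvgn (series w).
  apply: normed_cvg; apply: nondecreasing_is_cvgn.
    apply/nondecreasing_seqP => n; rewrite -subr_ge0 seriesSB; exact: normr_ge0.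
  exists (C + C / c) => _ [N _ <-].
  have -> : [normed series w] N = \sum_(0 <= i < N) `|w i| by [].

  case: N => [|[|N]].
  - by rewrite big_geq// addr_ge0// divr_ge0// ltW.
  - by rewrite big_nat1 w0 normr0 addr_ge0// divr_ge0// ltW.
  rewrite big_ltn// w0 normr0 add0r big_ltn// lerD//.
    by apply: le_trans (wC 1%N _) _ => //; rewrite powR1 mulr1.
  by have := @tail 0%N N.+2 isT; rewrite powR1 mulr1.
exists (limn (series w)); split=> // m.
apply/ler_addgt0Pr => eps e0.
have /cvgrPdist_le /(_ _ e0) [N0 _ hN] : series w @ \oo --> limn (series w) by [].
pose N := maxn N0 m.+2.
have h1 := hN N (leq_maxl _ _).
have -> : limn (series w) - series w m.+2 =
  (series w N - series w m.+2) + (limn (series w) - series w N) by ring.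
apply: le_trans (ler_normD _ _) _; apply: lerD => //.
have mN : (m.+2 <= N)%N by apply: leq_maxr.
rewrite /series /= (@big_cat_nat _ _ _ m.+2)//= addrAC subrr add0r.
by apply: le_trans (ler_norm_sum _ _ _) (tail m N mN).
Qed.

Lemma normr_complex (z : R[i]) : `|z| = (normc z)%:C.
Proof. by case: z. Qed.

Lemma complex_series (t : nat -> R[i]) (C c : R) : 0 <= C -> 0 < c ->
  (forall q, (0 < q)%N -> normc (t q) <= C * q%:R `^ (- (1 + c))) ->
  exists z : R[i], ((fun N => \sum_(1 <= q < N) t q : R[i]^o) @ \oo --> (z : R[i]^o)) /\
    forall m, normc (z - \sum_(1 <= q < m.+2) t q) <= 2 * (C / c) * m.+1%:R `^ (- c).
Proof.
move=> C0 c0 tC.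
have Re_le (z : R[i]) : `|complex.Re z| <= normc z.
  by case: z => x y; rewrite /normc /= -sqrtr_sqr ler_wsqrtr// lerDl sqr_ge0.
have Im_le (z : R[i]) : `|complex.Im z| <= normc z.
  by case: z => x y; rewrite /normc /= -sqrtr_sqr ler_wsqrtr// lerDr sqr_ge0.
(* The library series starts at index 0, the sums over q at 1; the default 0 reconciles them. *)
pose wr q := if q is q'.+1 then complex.Re (t q) else 0.
pose wi q := if q is q'.+1 then complex.Im (t q) else 0.
have [lr [cr br]] := @real_series wr C c C0 c0 erefl (fun q => match q with
  0%N => fun h => False_ind _ (notF h) | q'.+1 => fun h => le_trans (Re_le _) (tC q'.+1 h) end).
have [li [ci bi]] := @real_series wi C c C0 c0 erefl (fun q => match q with
  0%N => fun h => False_ind _ (notF h) | q'.+1 => fun h => le_trans (Im_le _) (tC q'.+1 h) end).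
have sE N : \sum_(1 <= q < N) t q = (series wr N) +i* (series wi N).
  case: N => [|N]; first by rewrite /series /= !big_geq.
  rewrite [LHS](_ : _ = (complex.Re (\sum_(1 <= q < N.+1) t q)) +i* (complex.Im (\sum_(1 <= q < N.+1) t q))); last by case: (\sum_(_ <= _ < _) _).
  rewrite Re_sum Im_sum /series /= [X in _ = X +i* _]big_ltn// [X in _ = _ +i* X]big_ltn// !add0r.
  by congr (_ +i* _); rewrite !big_nat; apply: eq_bigr => -[].
have dE (x : R) (y : R) N : normc (x +i* y - \sum_(1 <= q < N) t q) <=
    `|x - series wr N| + `|y - series wi N|.
  by rewrite sE; apply: le_trans (normc_le_parts _) _.
exists (lr +i* li); split=> [|m]; last first.
  apply: le_trans (dE _ _ _) _; have -> : 2 * (C / c) * m.+1%:R `^ (- c) =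
    C / c * m.+1%:R `^ (- c) + C / c * m.+1%:R `^ (- c) by ring.
  by apply: lerD.
apply/cvgrPdist_le => -[ex ey]; rewrite ltcE /= => /andP[/eqP ey0 ex0]; rewrite ey0.
have ex2 : 0 < ex / 2 by rewrite divr_gt0.
near=> N.
rewrite normr_complex lecR; apply: le_trans (dE _ _ _) _.
rewrite -[leRHS](@divfK _ 2)// mulr_natr mulr2n; apply: lerD; near: N.
  by move/cvgrPdist_le: cr; apply.
by move/cvgrPdist_le: ci; apply.
Unshelve. all: by end_near.
Qed.

End PowerSeries.

(** * Major arcs: splitting into residue classes *)

Lemma meval_mod n (p : {mpoly int[n]}) (q : int) (y z : 'I_n -> int) :
  exists m, meval (fun j => q * y j + z j) p = q * m + meval z p.
Proof.
elim/mpolyind: p => [|c u p _ _ [m IH]]; first by exists 0; rewrite !meval0 mulr0 addr0.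
have [m' hm'] : exists m', \prod_i (q * y i + z i) ^+ u i = q * m' + \prod_i z i ^+ u i.
  elim/big_rec2: _ => [|i A B _ [m1 ->]]; first by exists 0; rewrite mulr0 add0r.
  have [m2 ->] : exists m2, (q * y i + z i) ^+ u i = q * m2 + z i ^+ u i.
    elim: (u i) => [|k [m2 IHk]]; first by exists 0; rewrite !expr0 mulr0 add0r.
    exists (y i * (q * m2 + z i ^+ k) + z i * m2); rewrite !exprS IHk; ring.
  by exists (m2 * (q * m1 + A) + z i ^+ u i * m1); ring.
exists (c * m' + m); rewrite !mevalD !mevalZ !mevalX IH hm'; ring.
Qed.

Section ResidueClasses.
Variables (R : realType) (s : nat) (a b : 'I_s -> bool) (lo hi : 'I_s -> R).

Definition shift_scale (q : nat) (y z : s.-tuple int) : s.-tuple int :=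
  [tuple q%:Z * tnth y j + tnth z j | j < s].

(** Each x is written as q y + z with z between 1 and q; in terms of y the box becomes the same box
    seen on a grid of mesh q/P and offset z/P. *)
Lemma sum_residue_classes (A : nmodType) (P : R) (q : nat) (f : s.-tuple int -> A) :
  0 < P -> (0 < q)%N ->
  \sum_(x <- tseq (box_lo a lo P) (box_hi b hi P)) f x =
  \sum_(z <- tseq (fun=> 1) (fun=> q%:Z + 1))
    \sum_(y <- tseq (fun j => cut (a j) ((lo j - (tnth z j)%:~R / P) / (q%:R / P)))
                    (fun j => cut (b j) ((hi j - (tnth z j)%:~R / P) / (q%:R / P)))) f (shift_scale q y z).
Proof.
move=> P0 q0; have qR : (0 : R) < q%:R by rewrite ltr0n.
have qZ : q%:Z != 0 by rewrite -lt0n.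
pose rep (x : s.-tuple int) : s.-tuple int := [tuple ((tnth x j - 1) %% q%:Z)%Z + 1 | j < s].
have rep_in x : rep x \in tseq (fun=> 1) (fun=> q%:Z + 1).
  rewrite mem_tseq; apply/forallP => j; rewrite tnth_mktuple lerDr ltrD2r.
  by rewrite modz_ge0// ltz_pmod.
transitivity (\sum_(x <- tseq (box_lo a lo P) (box_hi b hi P))
    \sum_(z <- tseq (fun=> 1) (fun=> q%:Z + 1) | z == rep x) f x).
  apply: eq_bigr => x _; rewrite -big_filter filter_pred1_uniq ?tseq_uniq// big_seq1.
  by [].
under eq_bigr do rewrite big_mkcond.
rewrite exchange_big /= big_seq [RHS]big_seq; apply: eq_bigr => z hz.
rewrite -big_mkcond -big_filter.
set Ys := tseq (fun j => cut (a j) _) _.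
rewrite -(big_map (fun y => shift_scale q y z) xpredT f); apply: perm_big.
have inj : injective (fun y => shift_scale q y z).
  move=> y y' yy; apply/eq_from_tnth => j; have := congr1 (fun t => tnth t j) yy.
  by rewrite /= !tnth_mktuple => /addIr /(mulfI qZ).
apply: uniq_perm; [by rewrite filter_uniq// tseq_uniq|by rewrite map_inj_uniq// tseq_uniq|].
have memE y : (shift_scale q y z \in tseq (box_lo a lo P) (box_hi b hi P)) = (y \in Ys).
  rewrite !mem_tseq; apply: eq_forallb => j; rewrite tnth_mktuple.
  have h0 : 0 < q%:R / P by rewrite divr_gt0.
  rewrite -(mem_cut (a j) (b j) (lo j) (hi j) ((tnth z j)%:~R / P) _ h0).
  have := mem_cut (a j) (b j) (lo j) (hi j) 0 (q%:Z * tnth y j + tnth z j) (h := P^-1).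
  rewrite invr_gt0 => /(_ P0); rewrite !subr0 !invrK /box_lo /box_hi => <-.
  have P1 : P != 0 by rewrite gt_eqF.
  have -> : P^-1 * (q%:Z * tnth y j + tnth z j)%:~R + 0 =
      q%:R / P * (tnth y j)%:~R + (tnth z j)%:~R / P by rewrite intrD intrM; field.
  by [].
move: hz; rewrite mem_tseq => /forallP hz.
have rep_shift y : rep (shift_scale q y z) = z.
  apply/eq_from_tnth => j; rewrite tnth_mktuple.
  have -> : tnth (shift_scale q y z) j = tnth y j * q%:Z + tnth z j by rewrite tnth_mktuple mulrC.
  rewrite -[_ + _ - 1]addrA modzMDl modz_small ?subrK//.
  by have /andP[h1 h2] := hz j; rewrite subr_ge0 h1 /= ltrBlDr.
move=> x; rewrite mem_filter; apply/andP/mapP => [[/eqP zE xin]|[y yin ->]]; last first.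
  by rewrite rep_shift eqxx memE.
pose y : s.-tuple int := [tuple ((tnth x j - 1) %/ q%:Z)%Z | j < s].
have xE : x = shift_scale q y z.
  apply/eq_from_tnth => j; rewrite zE !tnth_mktuple addrA [q%:Z * _]mulrC -divz_eq.
  by rewrite subrK.
by exists y => //; rewrite -memE -xE.
Qed.

End ResidueClasses.

Section MajorArc.
Variables (R : realType) (r s d : nat) (F : 'I_r -> {mpoly int[s]}).
Hypothesis F_homog : forall i, F i \is ishomog1 d mdeg.
Variables (a b : 'I_s -> bool) (lo hi : 'I_s -> R).
Hypothesis lohi : forall j, lo j < hi j.
Hypothesis in_unit : tbox a b lo hi `<=` unit_box R s.
Local Notation B := (tbox a b lo hi).
Local Notation osc := (fun gamma : 'I_r -> R => oscillatory_integral F B (mktuple gamma)).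
Local Notation e := (@unit_exp R).

Definition tuple_comb (alpha : 'I_r -> R) (t : s.-tuple int) : R :=
  \sum_i alpha i * (meval (tnth t) (F i))%:~R.

Lemma tuple_comb_row alpha x : form_comb F alpha x = tuple_comb alpha (row_tuple x).
Proof.
apply: eq_bigr => i _; congr (_ * _%:~R); rewrite /evZ; congr meval.
by apply/funext => j; rewrite tnth_mktuple.
Qed.

Lemma unit_exp_mod q (c : r.-tuple 'I_q.+1) y z : (0 < q)%N ->
  e (tuple_comb (fraction R c) (shift_scale q y z)) = e (tuple_comb (fraction R c) z).
Proof.
move=> q0; have qR : q%:R != 0 :> R by rewrite pnatr_eq0 -lt0n.
have /choice[m hm] : forall i, exists m, meval (tnth (shift_scale q y z)) (F i) =
    q%:Z * m + meval (tnth z) (F i).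
  move=> i; have [m h] := meval_mod (F i) q%:Z (tnth y) (tnth z); exists m; rewrite -h.
  by congr meval; apply/funext => j; rewrite tnth_mktuple.
have -> : tuple_comb (fraction R c) (shift_scale q y z) =
    tuple_comb (fraction R c) z + (\sum_i (tnth c i)%:Z * m i)%:~R.
  rewrite rmorph_sum -big_split /=; apply: eq_bigr => i _.
  rewrite hm intrD !intrM mulrDr addrC; congr (_ + _).
  by rewrite /fraction mulrA divfK.
by rewrite unit_expD unit_exp_int mulr1.
Qed.

(** On each residue class modulo q the rational part of the phase is constant, and the rest is a
    Riemann sum of mesh q/P for the oscillatory integral. Summing the constant factors over the
    classes gives the Gauss sum. *)
Lemma major_arc : exists2 C : R, 0 <= C & forall (P T : R) q (c : r.-tuple 'I_q.+1) beta,
  0 < P -> (0 < q)%N -> q%:R <= P -> 0 <= T -> (forall i, `|P ^+ d * beta i| <= T) ->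
  normc (box_sum F a b lo hi P (fun i => fraction R c i + beta i) -
     (P ^+ s)%:C * (q%:R ^- s * gauss_sum R F c) * osc (fun i => P ^+ d * beta i)) <=
  C * (1 + T) * (q%:R / P) * P ^+ s.
Proof.
have [C C0 Q] := osc_riemann F lohi in_unit; exists C => // P T q c beta P0 q0 qP T0 hT.
have qR : (0 : R) < q%:R by rewrite ltr0n.
pose h := q%:R / P; have h0 : 0 < h by rewrite divr_gt0.
have h1 : h <= 1 by rewrite ler_pdivrMr// mul1r.
have hs : 0 < h ^+ s by apply: exprn_gt0.
set O := osc _; pose g z := e (tuple_comb (fraction R c) z).
pose U (z : s.-tuple int) := \sum_(y <- tseq (fun j => cut (a j) ((lo j - (tnth z j)%:~R / P) / h))
  (fun j => cut (b j) ((hi j - (tnth z j)%:~R / P) / h))) e (tuple_comb beta (shift_scale q y z)).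
have U_approx z : normc (U z - (h ^- s)%:C * O) <= C * (1 + T) * h * h ^- s.
  have := Q (fun i => P ^+ d * beta i) T h (fun j => (tnth z j)%:~R / P) T0 hT h0 h1.
  rewrite -/O.
  have -> : \sum_(t <- tseq (fun j => cut (a j) ((lo j - (tnth z j)%:~R / P) / h))
      (fun j => cut (b j) ((hi j - (tnth z j)%:~R / P) / h)))
      e (phase F (fun i => P ^+ d * beta i) (tnth (grid_at h (fun j => (tnth z j)%:~R / P) t))) = U z.
    apply: eq_bigr => y _; congr e.
    have -> : tnth (grid_at h (fun j => (tnth z j)%:~R / P) y) =
        (fun j => (tnth (shift_scale q y z) j)%:~R / P).
      apply/funext => j; rewrite !tnth_mktuple intrD intrM /h mulrDl mulrAC.
      by [].
    rewrite (phase_div F_homog) ?gt_eqF//; apply: eq_bigr => i _.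
    by rewrite (meval_map_intr R).
  move=> hU.
  have -> : U z - (h ^- s)%:C * O = (h ^- s)%:C * ((h ^+ s)%:C * U z - O).
    rewrite mulrBr mulrA -rmorphM mulVf ?gt_eqF//= mul1r.
    by [].
  rewrite normcM normc_real ger0_norm ?invr_ge0 ?(ltW hs)// mulrC.
  by rewrite ler_wpM2r ?invr_ge0 ?(ltW hs).
have SE : box_sum F a b lo hi P (fun i => fraction R c i + beta i) =
    \sum_(z <- tseq (fun=> 1) (fun=> q%:Z + 1)) g z * U z.
  rewrite /box_sum; under eq_bigr do rewrite tuple_comb_row.
  rewrite -(big_map (@row_tuple s) xpredT (fun t => e (tuple_comb (fun i => fraction R c i + beta i) t))).
  rewrite -/(tseq _ _) (sum_residue_classes a b lo hi _ P0 q0); apply: eq_bigr => z _.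
  rewrite mulr_sumr; apply: eq_bigr => y _; rewrite /g -(unit_exp_mod c y z q0) -unit_expD; congr e.
  by rewrite /tuple_comb -big_split /=; apply: eq_bigr => i _; rewrite mulrDl.
have GE : gauss_sum R F c = \sum_(z <- tseq (fun=> 1) (fun=> q%:Z + 1)) g z.
  by rewrite gauss_sumE [RHS]big_map; apply: eq_bigr => x _; rewrite tuple_comb_row.
have -> : (P ^+ s)%:C * (q%:R ^- s * gauss_sum R F c) * O =
    \sum_(z <- tseq (fun=> 1) (fun=> q%:Z + 1)) g z * ((h ^- s)%:C * O).
  rewrite -mulr_suml -GE.
  have -> : (h ^- s)%:C = (P ^+ s)%:C * (q%:R : R[i]) ^- s.
    have -> : (q%:R : R[i]) ^- s = ((q%:R : R) ^- s)%:C by rewrite fmorphV rmorphXn rmorph_nat.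
    by rewrite -rmorphM /= /h expr_div_n invf_div.
  by rewrite mulrA [gauss_sum _ _ _ * _]mulrC !mulrA.
rewrite SE -sumrB; apply: le_trans (normc_sum _ _ _) _.
apply: (@le_trans _ _ (\sum_(z <- tseq (fun _ : 'I_s => 1) (fun=> q%:Z + 1)) C * (1 + T) * h * h ^- s)).
  by apply: ler_sum => z _; rewrite -mulrBr normcM normc_unit_exp mul1r.
have -> : \sum_(z <- tseq (fun _ : 'I_s => 1) (fun=> q%:Z + 1)) C * (1 + T) * h * h ^- s =
    (C * (1 + T) * h * h ^- s) * q%:R ^+ s.
  rewrite -sum_residues sumr_const card_residues -[LHS]mulr_natr natrX.
  by [].
have hq : h ^- s * q%:R ^+ s = P ^+ s.
  by rewrite /h expr_div_n invf_div divfK// expf_neq0// gt_eqF.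
by rewrite -mulrA hq.
Qed.

End MajorArc.

(** * Minor arcs: counting grid points near rationals *)

Section NearRational.
Variable R : realType.

Lemma width_real (l u : int) : l <= u -> (width l u)%:R = u%:~R - l%:~R :> R.
Proof.
by move=> lu; rewrite -intrB [LHS]pmulrn /width abszE ger0_norm (max_idPr _) ?subr_ge0.
Qed.

Lemma size_zrange l u : size (zrange l u) = width l u.
Proof. by rewrite size_map size_iota. Qed.

(** The points q b/M fill an interval of length q, which comes near at most 5q integers, each within
    delta of at most 3 M delta/q of the points; hence 15. The condition [q <= M delta] absorbs the
    rounding errors. *)
Lemma dist_count (M q : nat) (l : int) (delta : R) : (0 < M)%N -> (0 < q)%N ->
  0 < delta -> q%:R <= M%:R * delta ->
  (count (fun b : int => dist (q%:R * (b%:~R / M%:R)) <= delta) (zrange l (l + M%:Z)))%:R <=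
  15 * (M%:R * delta).
Proof.
move=> M0 q0 d0 qM.
have MR : (0 : R) < M%:R by rewrite ltr0n.
have qR : (0 : R) < q%:R by rewrite ltr0n.
have Md0 : 0 < M%:R * delta by rewrite mulr_gt0.
have [d1|d1] := ltP 1 delta.
  apply: (@le_trans _ _ M%:R).
    rewrite ler_nat; apply: leq_trans (count_size _ _) _.
    by rewrite size_zrange /width addrAC subrr add0r max_r.
  have : M%:R * 1 <= M%:R * delta by rewrite ler_wpM2l// ltW.
  lra.
pose x (b : int) : R := q%:R * (b%:~R / M%:R).
pose f (b : int) : int := sval (cid (distE (x b))).
have fE b : dist (x b) = `|x b - (f b)%:~R| by rewrite /f; case: cid.
pose S := [seq b <- zrange l (l + M%:Z) | dist (x b) <= delta].
pose A := x l.
pose Y := zrange (Num.floor A - 1) (Num.floor A + q%:Z + 3).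
have SY b : b \in S -> f b \in Y.
  rewrite mem_filter mem_zrange fE => /andP[h /andP[lb bl]].
  have h1 : A <= x b.
    by rewrite /A /x ler_pM2l// ler_pM2r ?invr_gt0// ler_int.
  have h2 : x b <= A + q%:R.
    rewrite /A /x -[X in _ <= _ + X]mulr1 -mulrDr ler_pM2l// ler_pdivrMr// mulrDl divfK ?gt_eqF// mul1r.
    by rewrite -[M%:R]/((M%:Z)%:~R : R) -intrD ler_int ltW.
  have {}h := le_trans h d1; move: h; rewrite ler_norml => /andP[h3 h4].
  have /andP[f1 f2] := floor_itv A; rewrite intrD in f2.
  rewrite mem_zrange -(ler_int R) -(ltr_int R) !intrD rmorphN /=.
  have -> : (q%:Z)%:~R = q%:R :> R by [].
  by apply/andP; split; lra.
have sY : (size Y <= 5 * q)%N.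
  by rewrite size_zrange /width maxEle; case: ifP => _; lia.
pose K := 3 * (M%:R * delta) / q%:R.
have K0 : 0 <= K by rewrite divr_ge0 ?(ltW qR)// mulr_ge0// ltW.
have fib z : (count (fun b => f b == z) S <= Num.truncn K)%N.
  pose B0 : R := M%:R * (z%:~R - delta) / q%:R; pose B1 : R := M%:R * (z%:~R + delta) / q%:R.
  have B01 : B0 < B1 by rewrite ltr_pM2r ?invr_gt0// ltr_pM2l//; lra.
  rewrite truncn_ge_nat// -size_filter.
  apply: (@le_trans _ _ (width (cut true B0) (cut false B1))%:R).
    rewrite ler_nat -size_zrange; apply: uniq_leq_size.
      by rewrite !filter_uniq// zrange_uniq.
    move=> b; rewrite !mem_filter => /and3P[/eqP fz h _]; rewrite fE fz in h.
    rewrite mem_zrange ltNge !cut_le -leNgt.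
    have e1 : b%:~R = M%:R * x b / q%:R.
      by rewrite /x; field; rewrite !gt_eqF.
    move: h; rewrite ler_norml => /andP[h1 h2].
    rewrite /B0 /B1 e1; apply/andP; split; rewrite ler_pM2r ?invr_gt0// ler_pM2l//; lra.
  rewrite width_real ?cut_lt//.
  have := cut_ge true B0; have := cut_le1 false B1.
  have e : B1 - B0 = 2 * (M%:R * delta) / q%:R by rewrite /B1 /B0; field; rewrite gt_eqF.
  have e2 : K = 2 * (M%:R * delta) / q%:R + (M%:R * delta) / q%:R by rewrite /K; field; rewrite gt_eqF.
  have : 1 <= (M%:R * delta) / q%:R by rewrite ler_pdivlMr// mul1r.
  rewrite e2 -e; lra.
have := size_fibres SY fib; rewrite -(ler_nat R) natrM => h.
rewrite -size_filter -/S; apply: le_trans h _.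
have Kt : (Num.truncn K)%:R <= K by rewrite truncn_le.
have sYR : (size Y)%:R <= 5 * q%:R :> R by rewrite -natrM ler_nat.
apply: le_trans (ler_pM _ _ Kt sYR) _ => //.
by rewrite /K le_eqVlt; apply/orP; left; apply/eqP; field; rewrite gt_eqF.
Qed.

Variables (r M : nat) (l : int).
Hypothesis M_gt0 : (0 < M)%N.
Local Notation window := (tseq (fun _ : 'I_r => l) (fun=> l + M%:Z)).

Definition near_rational (alpha : 'I_r -> R) (Z delta : R) : Prop :=
  exists q : nat, [/\ (0 < q)%N, q%:R <= Z & forall i, exists z : int,
    `|q%:R * alpha i - z%:~R| <= delta].

Definition at_grid (t : r.-tuple int) (i : 'I_r) : R := (tnth t i)%:~R / M%:R.

Lemma near_count_fixed (q : nat) (delta : R) : (0 < q)%N -> 0 < delta -> q%:R <= M%:R * delta ->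
  \sum_(t <- window) ([forall i, dist (q%:R * at_grid t i) <= delta]%:R : R) <= (15 * (M%:R * delta)) ^+ r.
Proof.
move=> q0 d0 qM; rewrite big_map.
pose g (j : 'I_r) (z : int) : R := ((dist (q%:R * (z%:~R / M%:R)) <= delta)%R : bool)%:R.
have -> : \sum_(x <- ibox (fun=> l) (fun=> l + M%:Z))
    ([forall i, dist (q%:R * at_grid (row_tuple x) i) <= delta]%:R : R) =
    \sum_(x <- ibox (fun=> l) (fun=> l + M%:Z)) \prod_j g j (x 0 j).
  apply: eq_bigr => x _; rewrite /g.
  have [/forallP h|/forallPn[i hi]] :=
    boolP [forall i, (dist (q%:R * at_grid (row_tuple x) i) <= delta)%R].
    by rewrite big1// => i _; have := h i; rewrite /at_grid tnth_mktuple => ->.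
  by rewrite (bigD1 i)//=; move: hi; rewrite /at_grid tnth_mktuple => /negPf ->; rewrite mul0r.
rewrite sum_ibox -[X in _ ^+ X](card_ord r) -prodr_const; apply: ler_prod => j _.
apply/andP; split; first by apply: sumr_ge0 => k _; rewrite ler0n.
apply: le_trans (dist_count l M_gt0 q0 d0 qM).
rewrite -sum1_count natr_sum /zrange big_map.
rewrite [iota _ _](_ : _ = index_iota 0 (width l (l + M%:Z))); last by rewrite /index_iota subn0.
rewrite big_mkord [leRHS]big_mkcond.
by apply: ler_sum => k _; rewrite /g; case: ifP.
Qed.

(** A union over the denominators up to Z; the hypothesis [Z <= M delta] makes each of them
    admissible for [near_count_fixed]. *)
Lemma near_rational_count (Z delta : R) : 0 < delta -> Z <= M%:R * delta ->
  \sum_(t <- window) (`[< near_rational (at_grid t) Z delta >]%:R : R) <=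
  (Num.truncn Z)%:R * (15 * (M%:R * delta)) ^+ r.
Proof.
move=> d0 ZM.
apply: (@le_trans _ _ (\sum_(t <- window) \sum_(1 <= q < (Num.truncn Z).+1)
   ([forall i, dist (q%:R * at_grid t i) <= delta]%:R : R))).
  apply: ler_sum => t _; case: asboolP => [[q [q0 qZ hq]]|_]; last by apply: sumr_ge0 => q _; rewrite ler0n.
  have qI : q \in index_iota 1 (Num.truncn Z).+1.
    rewrite mem_index_iota q0 ltnS truncn_ge_nat//; apply: le_trans qZ; exact: ler0n.
  have tt : [forall i, (dist (q%:R * at_grid t i) <= delta)%R].
    by apply/forallP => i; have [z hz] := hq i; apply: le_trans (dist_le _ z) hz.
  by rewrite (big_rem q)//= tt lerDl sumr_ge0// => q' _; rewrite ler0n.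
rewrite exchange_big /=.
apply: (@le_trans _ _ (\sum_(1 <= q < (Num.truncn Z).+1) (15 * (M%:R * delta)) ^+ r)).
  rewrite !big_nat; apply: ler_sum => q /andP[q0 qZ]; apply: near_count_fixed => //.
  apply: le_trans ZM; have Z1 : (0 < Num.truncn Z)%N by apply: leq_trans q0 qZ.
  rewrite -truncn_ge_nat//; apply: le_trans (_ : 1 <= _) => //; by rewrite -truncn_gt0.
by rewrite sumr_const_nat subn1 /= -[leLHS]mulr_natl.
Qed.

Variables (f : r.-tuple int -> R) (A Pd Y Zmax c : R).
Hypothesis A_ge0 : 0 <= A.
Hypothesis c_gt0 : 0 < c.
Hypothesis Y_ge1 : 1 <= Y.
Hypothesis Pd_gt0 : 0 < Pd.
Hypothesis Pd_leM : Pd <= M%:R.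
Local Notation w := (r.+1%:R + c).
Hypothesis f_alt : forall t Z, Y <= Z -> Z <= Zmax ->
  f t <= A / Z `^ w \/ near_rational (at_grid t) Z (Z / Pd).

Let Y0 : 0 < Y. Proof. exact: lt_le_trans Y_ge1. Qed.
Let YJ j : Y <= 2 ^+ j * Y. Proof. by rewrite ler_peMl ?(ltW Y0)// exprn_ege1// ler1n. Qed.

Definition near_level j t : R := `[< near_rational (at_grid t) (2 ^+ j * Y) (2 ^+ j * Y / Pd) >]%:R.

(** Doubling the level: if t is first near a rational at level 2^(j+1) Y, the alternative at level
    2^j Y gives the j-th term; if it is not near one up to level J, the last term applies. *)
Lemma minor_pointwise t J : ~ near_rational (at_grid t) Y (Y / Pd) -> 2 ^+ J * Y <= Zmax ->
  f t <= \sum_(j < J) A / (2 ^+ j * Y) `^ w * near_level j.+1 t + A / (2 ^+ J * Y) `^ w.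
Proof.
have term0 j : 0 <= A / (2 ^+ j * Y) `^ w * near_level j.+1 t.
  by rewrite !mulr_ge0 ?invr_ge0 ?powR_ge0// /near_level ler0n.
move=> nY; elim: J => [|J IH] hJ.
  rewrite big_ord0 add0r expr0 mul1r; have := @f_alt t Y (lexx Y).
  by rewrite expr0 mul1r in hJ => /(_ hJ)[].
have hJ' : 2 ^+ J * Y <= Zmax.
  apply: le_trans hJ; rewrite ler_pM2r// exprS ler_peMl ?exprn_ge0// ler1n//.
case: (f_alt t (YJ J.+1) hJ) => h.
  by apply: le_trans h _; rewrite lerDr sumr_ge0.
apply: le_trans (IH hJ') _; rewrite big_ord_recr /= -addrA lerD2l.
rewrite /near_level asboolT//= mulr1 lerDl.
by rewrite divr_ge0 ?powR_ge0.
Qed.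

(** At level Z the bound A/Z^(r+1+c) is met by about Z^(r+1) (M/Pd)^r points, so that Z^(-c) is
    left, and the levels 2^j Y form a geometric series. Beyond the last level all M^r points are
    counted with the bound at Zmax, up to a factor. *)
Lemma minor_sum : Y <= Zmax ->
  \sum_(t <- window | ~~ `[< near_rational (at_grid t) Y (Y / Pd) >]) f t <=
  A * (2 ^+ r.+1 / (1 - 2 `^ (- c)) * (15 * M%:R / Pd) ^+ r * Y `^ (- c) +
       2 `^ w * M%:R ^+ r / Zmax `^ w).
Proof.
move=> YZ.
(* The last doubling of Y that does not exceed [Zmax]. *)
have [J hJ1 hJ2] : exists2 J, 2 ^+ J * Y <= Zmax & Zmax < 2 ^+ J.+1 * Y.
  have exJ : exists j, Zmax < 2 ^+ j.+1 * Y.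
    exists (Num.truncn Zmax); apply: lt_le_trans (truncnS_gt Zmax) _.
    apply: (@le_trans _ _ (2 ^+ (Num.truncn Zmax).+1)); last by rewrite ler_peMr// exprn_ge0.
    by rewrite -natrX ler_nat; apply: ltnW; apply: ltn_expl.
  have [j hj jmin] := ex_minnP exJ; exists j => //.
  case: j hj jmin => [|j] hj jmin; first by rewrite expr0 mul1r.
  by rewrite leNgt; apply/negP => /jmin; rewrite ltnn.
have p2 : 0 < 2 `^ (- c) :> R by apply: powR_gt0.
have p1 : 2 `^ (- c) < 1 :> R.
  rewrite powRN invf_lt1 ?powR_gt0// -(@lnK _ (2 `^ c)) ?posrE ?powR_gt0// ln_powR expR_gt1.
  by rewrite mulr_gt0// ln_gt0// ltr1n.
pose rho : R := 2 `^ (- c).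
have size_w : \sum_(t <- window) (1 : R) = M%:R ^+ r.
  rewrite big_const_seq count_predT iter_addr_0 size_map size_ibox -natrX.
  rewrite (eq_bigr (fun=> M)) ?prod_nat_const ?card_ord// => j _.
  by rewrite /width addrAC subrr add0r max_r.
have w0 : 0 <= w by rewrite addr_ge0// ltW.
apply: (@le_trans _ _ (\sum_(t <- window)
   (\sum_(j < J) A / (2 ^+ j * Y) `^ w * near_level j.+1 t + A / (2 ^+ J * Y) `^ w))).
  rewrite big_mkcond /=; apply: ler_sum => t _; case: ifPn => [/asboolPn h|_].
    exact: minor_pointwise.
  rewrite addr_ge0 ?sumr_ge0// => [j _|]; last by rewrite divr_ge0 ?powR_ge0.
  by rewrite !mulr_ge0 ?invr_ge0 ?powR_ge0// /near_level ler0n.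
rewrite big_split /= exchange_big /= mulrDr; apply: lerD; last first.
  rewrite -[X in \sum_(_ <- _) X]mulr1 -mulr_sumr size_w.
  have -> : A * (2 `^ w * M%:R ^+ r / Zmax `^ w) = A * (2 `^ w / Zmax `^ w) * M%:R ^+ r by ring.
  rewrite ler_wpM2r ?exprn_ge0// ler_wpM2l//.
  have Zm0 : 0 < Zmax by apply: lt_le_trans YZ.
  have q0 : 0 < 2 ^+ J * Y by rewrite mulr_gt0 ?exprn_gt0.
  have hz : Zmax `^ w <= 2 `^ w * (2 ^+ J * Y) `^ w.
    have q1 : 0 <= 2 * (2 ^+ J * Y) by rewrite mulr_ge0// ltW.
    rewrite -powRM ?(ltW q0)//; apply: ge0_ler_powR; rewrite ?nnegrE ?(ltW Zm0)//.
    by rewrite mulrA -exprS ltW.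
  by rewrite ler_pdivlMr ?powR_gt0// mulrC ler_pdivrMr ?powR_gt0//.
have lev (j : 'I_J) : \sum_(t <- window) A / (2 ^+ j * Y) `^ w * near_level j.+1 t <=
    A * (2 ^+ r.+1 * (15 * M%:R / Pd) ^+ r * Y `^ (- c)) * rho ^+ j.
  rewrite -mulr_sumr.
  set Z := 2 ^+ j.+1 * Y; have Z0 : 0 < Z by rewrite mulr_gt0 ?exprn_gt0.
  have hc : \sum_(t <- window) near_level j.+1 t <= Z * (15 * (M%:R * (Z / Pd))) ^+ r.
    apply: le_trans (near_rational_count _ _) _; first by rewrite divr_gt0.
      by rewrite mulrCA ler_peMr ?(ltW Z0)// ler_pdivlMr// mul1r.
    apply: ler_wpM2r; last by rewrite truncn_le ltW.
    by apply: exprn_ge0; apply: mulr_ge0 => //; apply: mulr_ge0 => //; apply: divr_ge0; apply: ltW.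
  have q0 : 0 < 2 ^+ j * Y by rewrite mulr_gt0 ?exprn_gt0.
  apply: le_trans (ler_wpM2l _ hc) _; first by rewrite divr_ge0 ?powR_ge0.
  have -> : Z = 2 * (2 ^+ j * Y) by rewrite /Z exprS mulrA.
  have -> : rho ^+ j = (2 ^+ j) `^ (- c).
    by rewrite /rho -!powR_mulrn ?powR_ge0// -!powRrM mulrC.
  have -> : A * (2 ^+ r.+1 * (15 * M%:R / Pd) ^+ r * Y `^ (- c)) * (2 ^+ j) `^ (- c) =
     A * (2 ^+ r.+1 * (15 * M%:R / Pd) ^+ r * (2 ^+ j * Y) `^ (- c)).
    rewrite powRM ?exprn_ge0 ?(ltW Y0)//; ring.
  set q := 2 ^+ j * Y in q0 *.
  have -> : q `^ w = q ^+ r.+1 * q `^ c by rewrite powRD ?(gt_eqF q0) ?implybT// powR_mulrn// ltW.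
  rewrite [q `^ (- c)]powRN.
  have -> : (15 * (M%:R * (2 * q / Pd))) ^+ r = 2 ^+ r * q ^+ r * (15 * M%:R / Pd) ^+ r.
    by rewrite -!exprMn; congr (_ ^+ r); ring.
  rewrite [q ^+ r.+1]exprS [2 ^+ r.+1]exprS.
  have qc : q `^ c != 0 by rewrite gt_eqF// powR_gt0.
  have qr : q ^+ r != 0 by rewrite gt_eqF// exprn_gt0.
  have qn : q != 0 by rewrite gt_eqF.
  set x1 := q `^ c in qc *; set x2 := q ^+ r in qr *; set x3 := (_ / Pd) ^+ r; set x4 := 2 ^+ r.
  by rewrite le_eqVlt; apply/orP; left; apply/eqP; field; rewrite qc qr qn.
apply: le_trans (ler_sum _ (fun j _ => lev j)) _.
rewrite -mulr_sumr.
have geo : \sum_(j < J) rho ^+ j <= (1 - rho)^-1.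
  have r1 : 0 < 1 - rho by rewrite subr_gt0.
  rewrite -[leRHS]mul1r ler_pdivlMr// mulrC.
  have -> : (1 - rho) * (\sum_(j < J) rho ^+ j) = 1 - rho ^+ J.
    by rewrite -[1 - rho]opprB mulNr -subrX1 opprB.
  by rewrite gerBl; apply: exprn_ge0; apply: ltW.
pose X := A * (2 ^+ r.+1 * (15 * M%:R / Pd) ^+ r * Y `^ (- c)); rewrite -/X.
have X0 : 0 <= X by rewrite !mulr_ge0 ?powR_ge0 ?exprn_ge0 ?mulr_ge0 ?invr_ge0 ?(ltW Pd_gt0).
apply: le_trans (ler_wpM2l X0 geo) _.
by rewrite /X -/rho le_eqVlt; apply/orP; left; apply/eqP; ring.
Qed.

End NearRational.

(** * Discrete major arcs: disjointness and covering *)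

Lemma int_norm_lt1 (x : int) : `|x| < 1 -> x = 0.
Proof. by case: x => [[|n]|n]. Qed.

Section ArcDecomposition.
Variables (R : realType) (r M : nat) (Y delta : R).
Let Q := Num.truncn Y.
Let c0 := Num.truncn (M%:R * delta).
Hypothesis Y_ge1 : 1 <= Y.
Hypothesis delta_gt0 : 0 < delta.
Hypothesis delta_small : 4 * Y ^+ 3 * delta <= 1.
Hypothesis M_large : 1 <= M%:R * delta.
Hypothesis M_div : forall q, (0 < q <= Q)%N -> (q %| M)%N.

(** [M] consecutive integers, starting at [c0 + 1] so that every arc of radius [c0] about a fraction
    a/q with 1 <= a <= q lies inside without wrapping around. *)
Local Notation window := (tseq (fun _ : 'I_r => c0%:Z + 1) (fun=> c0%:Z + 1 + M%:Z)).

Definition reduced q (a : r.-tuple 'I_q.+1) : bool :=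
  (a \in residues r q) && (\big[gcdn/q]_(i < r) (tnth a i : nat) == 1%N).

Definition arc_center q (a : r.-tuple 'I_q.+1) (i : 'I_r) : int := ((tnth a i : nat) * (M %/ q))%N%:Z.

Definition arc q (a : r.-tuple 'I_q.+1) : seq (r.-tuple int) :=
  tseq (fun i => arc_center a i - c0%:Z) (fun i => arc_center a i + c0%:Z + 1).

Definition arc_shift q (a : r.-tuple 'I_q.+1) (c : r.-tuple int) : r.-tuple int :=
  [tuple arc_center a i + tnth c i | i < r].

Let Y0 : 0 < Y. Proof. exact: lt_le_trans Y_ge1. Qed.
Let YY : Y * Y <= Y ^+ 3.
Proof. by rewrite -expr2 ler_weXn2l. Qed.
Let Y_YY : Y <= Y * Y. Proof. by rewrite ler_peMl// ltW. Qed.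
Let QY : Q%:R <= Y. Proof. by rewrite truncn_le ltW. Qed.
Let c0_le : c0%:R <= M%:R * delta. Proof. by rewrite truncn_le mulr_ge0// ltW. Qed.
Let c0_gt : M%:R * delta < c0%:R + 1. Proof. by rewrite natr1; exact: truncnS_gt. Qed.
Let MR : (0 : R) < M%:R.
Proof. by rewrite lt_neqAle ler0n andbT; apply: contraTneq M_large => <-; rewrite mul0r -ltNge. Qed.
Let M_gt0 : (0 < M)%N. Proof. by rewrite -(ltr_nat R). Qed.

Lemma arc_shift_in q (a : r.-tuple 'I_q.+1) t :
  (t \in arc a) = [forall i, `|tnth t i - arc_center a i| <= c0%:Z].
Proof.
rewrite mem_tseq; apply: eq_forallb => i; rewrite ler_norml.
move: (tnth t i) (arc_center a i) (c0) => x y c; clear.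
by apply/andP/andP => -[? ?]; split; lia.
Qed.

(** The first inequality separates the arcs, the second keeps those with smallest numerators inside
    the window. Both follow from [delta_small], with [M_large] controlling the rounding. *)
Lemma arc_bound : (2 * c0 * Q * Q < M)%N /\ ((2 * c0 + 1) * Q <= M)%N.
Proof.
have h1 : 4 * (Y * Y) * (M%:R * delta) <= M%:R.
  have : 4 * Y ^+ 3 * delta * M%:R <= 1 * M%:R by rewrite ler_wpM2r// ltW.
  rewrite mul1r; apply: le_trans; rewrite -[leRHS]mulrA [delta * _]mulrC ler_wpM2r//.
    by rewrite mulr_ge0// ltW.
  by rewrite ler_wpM2l.
have Md : 0 < M%:R * delta by rewrite mulr_gt0.
have QQ : Q%:R * Q%:R <= Y * Y by apply: ler_pM.
have cQQ : c0%:R * (Q%:R * Q%:R) <= (M%:R * delta) * (Y * Y) :> R.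
  by apply: ler_pM => //; rewrite mulr_ge0.
have cQ : c0%:R * Q%:R <= (M%:R * delta) * (Y * Y) :> R.
  by apply: ler_pM => //; apply: le_trans QY Y_YY.
have Q1 : Q%:R <= (M%:R * delta) * (Y * Y) :> R.
  rewrite -[leLHS]mul1r; apply: ler_pM => //; exact: le_trans QY Y_YY.
have W0 : 0 < (M%:R * delta) * (Y * Y) by rewrite mulr_gt0// mulr_gt0.
move: h1 cQQ cQ Q1 W0; rewrite -mulrA [Y * Y * _]mulrC; set W := M%:R * delta * (Y * Y).
move=> h1 cQQ cQ Q1 W0; split.
  rewrite -(ltr_nat R) !natrM -!mulrA; lra.
rewrite -(ler_nat R) natrM natrD natrM mulrDl -mulrA; lra.
Qed.

Lemma div_mul q : (0 < q <= Q)%N -> (M %/ q * q = M)%N.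
Proof. by move=> hq; rewrite divnK// M_div. Qed.

Lemma arc_sub_window q (a : r.-tuple 'I_q.+1) : (0 < q <= Q)%N -> reduced a ->
  {subset arc a <= window}.
Proof.
move=> hq /andP[+ _] t; rewrite inE => /forallP a0; rewrite {1}/arc mem_tseq => /forallP ht.
have [_ h2] := arc_bound; have hM := div_mul hq; case/andP: hq => q0 qQ.
rewrite mem_tseq; apply/forallP => i.
have /andP[t1 t2] := ht i; rewrite /arc_center in t1 t2.
have ai := ltn_ord (tnth a i); have ai0 := a0 i.
set A := (tnth a i : nat) in t1 t2 ai ai0 *; set m := (M %/ q)%N in t1 t2 hM *.
have mc : (2 * c0 + 1 <= m)%N.
  rewrite -(leq_pmul2r q0) hM; apply: leq_trans h2; exact: leq_mul.
have Am : (m <= A * m)%N by rewrite leq_pmull.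
have AM : (A * m <= M)%N by rewrite -hM mulnC leq_mul2l -ltnS ai orbT.
move: t1 t2 mc Am AM; clear; set X := (A * m)%N; set x := tnth t i.
by clearbody X x => *; apply/andP; split; lia.
Qed.

(** Centres of two arcs through a common point differ by at most [2 c0]. Multiplied by q q' the
    difference becomes a multiple of M, yet it is at most 2 c0 Q^2 < M, so it vanishes. *)
Lemma arc_inj q q' (a : r.-tuple 'I_q.+1) (a' : r.-tuple 'I_q'.+1) t :
  (0 < q <= Q)%N -> (0 < q' <= Q)%N -> reduced a -> reduced a' -> t \in arc a -> t \in arc a' ->
  forall i, (tnth a i * q' = tnth a' i * q)%N.
Proof.
move=> hq hq' _ _; rewrite !arc_shift_in => /forallP h /forallP h' i.
have := h i; have := h' i; rewrite /arc_center.
have [h1 _] := arc_bound; have hM := div_mul hq; have hM' := div_mul hq'.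
case/andP: hq => q0 qQ; case/andP: hq' => q0' qQ'.
set A := (tnth a i : nat); set A' := (tnth a' i : nat).
set m := (M %/ q)%N in hM *; set m' := (M %/ q')%N in hM' *.
set x := tnth t i => b1 b2.
have d1 : `|(A * m)%N%:Z - (A' * m')%N%:Z| <= (2 * c0)%N%:Z.
  move: b1 b2; set X := (A * m)%N; set X' := (A' * m')%N; clearbody X X' x; clear.
  rewrite !ler_norml => /andP[? ?] /andP[? ?]; apply/andP; split; lia.
have e : ((A * m)%N%:Z - (A' * m')%N%:Z) * (q * q')%N%:Z = ((A * q')%N%:Z - (A' * q)%N%:Z) * M%:Z.
  rewrite !mulrBl -!PoszM; congr (Posz _ - Posz _).
    by rewrite -[in RHS]hM; ring.
  by rewrite -[in RHS]hM'; ring.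
have lt : `|((A * q')%N%:Z - (A' * q)%N%:Z) * M%:Z| < M%:Z.
  rewrite -e normrM [X in _ * X]ger0_norm//.
  apply: (@le_lt_trans _ _ ((2 * c0)%N%:Z * (q * q')%N%:Z)); first by rewrite ler_wpM2r.
  rewrite -PoszM ltz_nat; apply: leq_ltn_trans h1.
  by rewrite -[X in (_ <= X)%N]mulnA leq_mul2l leq_mul ?orbT.
move: lt; rewrite normrM [X in _ * X]ger0_norm// gtr_pMl ?ltz_nat// => lt.
by move/eqP: (int_norm_lt1 lt); rewrite subr_eq0 => /eqP[].
Qed.

Lemma arc_inj_q q q' (a : r.-tuple 'I_q.+1) (a' : r.-tuple 'I_q'.+1) t :
  (0 < q <= Q)%N -> (0 < q' <= Q)%N -> reduced a -> reduced a' -> t \in arc a -> t \in arc a' -> q = q'.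
Proof.
move=> hq hq' ra ra' ta ta'; have e := arc_inj hq hq' ra ra' ta ta'.
case/andP: ra => _ /eqP ga; case/andP: ra' => _ /eqP ga'.
apply/eqP; rewrite eqn_dvd; apply/andP; split.
  by apply: biggcd_dvd ga => i; rewrite mulnC e dvdn_mull.
by apply: biggcd_dvd ga' => i; rewrite mulnC -e dvdn_mull.
Qed.

Lemma arc_inj_a q (a a' : r.-tuple 'I_q.+1) t :
  (0 < q <= Q)%N -> reduced a -> reduced a' -> t \in arc a -> t \in arc a' -> a = a'.
Proof.
move=> hq ra ra' ta ta'; have e := arc_inj hq hq ra ra' ta ta'.
apply/eq_from_tnth => i; apply/val_inj/eqP; have /eqP := e i.
by case/andP: hq => q0 _; rewrite eqn_pmul2r.
Qed.

(** Cancelling the common divisor of the denominator and all numerators gives a reduced fraction;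
    division by the denominator turns the error [delta] into a distance at most [M delta] on the
    grid. *)
Lemma near_in_arc t : t \in window -> near_rational (at_grid R M t) Y delta ->
  exists q (a : r.-tuple 'I_q.+1), [/\ (0 < q <= Q)%N, reduced a & t \in arc a].
Proof.
rewrite mem_tseq => /forallP tw [q0 [q0_gt0 q0Y /choice[z hz]]].
have q0R : (1 : R) <= q0%:R by rewrite ler1n.
have q00 : (0 : R) < q0%:R by lra.
have dY : 2 * Y * delta < 1.
  have : Y * delta <= Y ^+ 3 * delta by rewrite ler_wpM2r ?(ltW delta_gt0)// (le_trans Y_YY).
  have : 0 < Y * delta by rewrite mulr_gt0.
  move: delta_small; rewrite -!mulrA; set u := Y ^+ 3 * delta; set v := Y * delta; lra.
have q0d : q0%:R * delta <= Y * delta by rewrite ler_wpM2r// ltW.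
have dd : delta <= Y * delta by rewrite ler_peMl// ltW.
(* The position of the window puts t_i/M between delta and 1 + delta, which forces the numerators
   into the range from 1 to q0. *)
have zb i : 0 < z i <= q0%:Z.
  have /andP[t1 t2] := tw i; have := hz i; rewrite /at_grid; set x := tnth t i in t1 t2 *.
  set u := q0%:R * _ => hu.
  have u1 : q0%:R * delta < u.
    rewrite ltr_pM2l// ltr_pdivlMr// mulrC; apply: lt_le_trans c0_gt _.
    by rewrite -[1]/(1%:~R) -[c0%:R]/(c0%:Z%:~R : R) -intrD ler_int.
  have u2 : u <= q0%:R + q0%:R * delta.
    rewrite -[X in X + _]mulr1 -mulrDr ler_pM2l// ler_pdivrMr// mulrDl mul1r [delta * _]mulrC.
    apply: (@le_trans _ _ (M%:R + c0%:R)); last by rewrite lerD2l.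
    rewrite -[M%:R]/(M%:Z%:~R : R) -[c0%:R]/(c0%:Z%:~R : R) -intrD ler_int -ltzD1.
    by have -> : M%:Z + c0%:Z + 1 = c0%:Z + 1 + M%:Z by ring.
  have q1d : delta <= q0%:R * delta by rewrite ler_peMl// ltW.
  move: hu; rewrite ler_norml => /andP[hu1 hu2].
  apply/andP; split; first by rewrite -(ltr_int R); lra.
  rewrite -ltzD1 -(ltr_int R) intrD -[(q0%:Z)%:~R]/(q0%:R : R); lra.
pose zn i := absz (z i).
have znE i : z i = (zn i)%:Z by rewrite /zn abszE gtr0_norm//; case/andP: (zb i).
(* The divisor common to the denominator and to all numerators at once. *)
pose g := \big[gcdn/q0]_(i < r) zn i.
have gq : (g %| q0)%N by rewrite /g; elim/big_rec: _ => // i x _ h; apply: dvdn_trans (dvdn_gcdr _ _) h.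
have gz i : (g %| zn i)%N.
  by rewrite /g (bigD1 i)//= dvdn_gcdl.
have g0 : (0 < g)%N by apply: dvdn_gt0 gq.
pose q := (q0 %/ g)%N; have qg : (q * g = q0)%N by rewrite divnK.
pose av i := (zn i %/ g)%N; have ag i : (av i * g = zn i)%N by rewrite divnK.
have q_gt0 : (0 < q)%N by rewrite divn_gt0// dvdn_leq.
have avq i : (av i < q.+1)%N.
  by rewrite ltnS -(leq_pmul2r g0) ag qg -lez_nat -znE; case/andP: (zb i).
have av0 i : (0 < av i)%N.
  by rewrite -(ltn_pmul2r g0) mul0n ag -ltz_nat -znE; case/andP: (zb i).
have qQ : (q <= Q)%N.
  apply: leq_trans (leq_div _ _) _; rewrite /Q truncn_ge_nat//; exact: ltW.
exists q, [tuple Ordinal (avq i) | i < r]; split; first by rewrite q_gt0.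
  rewrite /reduced inE; apply/andP; split; first by apply/forallP => i; rewrite tnth_mktuple /=; apply: av0.
  have e : (g * \big[gcdn/q]_(i < r) av i = g * 1)%N.
    rewrite muln1 [in RHS]/g -qg; elim/big_rec2: _ => [|i x y _ <-]; first by rewrite mulnC.
    by rewrite muln_gcdr mulnC ag.
  move/eqP: e; rewrite eqn_pmul2l// => /eqP <-; apply/eqP.
  by apply: eq_bigr => i _; rewrite tnth_mktuple.
rewrite arc_shift_in; apply/forallP => i; rewrite /arc_center tnth_mktuple /=.
have hM := div_mul (introT andP (conj q_gt0 qQ)).
have qR : (0 : R) < q%:R by rewrite ltr0n.
have key : (`|tnth t i - (av i * (M %/ q))%N%:Z|)%:~R <= M%:R * delta :> R.
  rewrite intr_norm intrB.
  have -> : (tnth t i)%:~R - ((av i * (M %/ q))%N%:Z)%:~R =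
     M%:R / q0%:R * (q0%:R * at_grid R M t i - (z i)%:~R) :> R.
    rewrite /at_grid znE -ag -[((av i * _)%N%:Z)%:~R]/((av i * _)%N%:R : R) -[((av i * g)%N%:Z)%:~R]/((av i * g)%N%:R : R).
    rewrite natrM (natrM _ (av i) g).
    have gR : (g%:R : R) != 0 by rewrite pnatr_eq0 -lt0n.
    have mR : ((M %/ q)%N%:R : R) != 0.
      by rewrite pnatr_eq0 -lt0n; move: M_gt0; rewrite -{1}hM muln_gt0 => /andP[].
    have eM : M%:R = (M %/ q)%N%:R * q%:R :> R by rewrite -natrM hM.
    have eq0 : q0%:R = q%:R * g%:R :> R by rewrite -natrM qg.
    move: mR; rewrite eM eq0; set m : R := (M %/ q)%N%:R => mR.
    by field; rewrite gR mR gt_eqF.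
  rewrite normrM ger0_norm ?divr_ge0// ?(ltW q00)//.
  apply: (@le_trans _ _ (M%:R / q0%:R * delta)); first by rewrite ler_wpM2l ?divr_ge0// ltW.
  by rewrite ler_wpM2r ?(ltW delta_gt0)// ler_pdivrMr// ler_peMr.
have [n en] : exists n : nat, `|tnth t i - (av i * (M %/ q))%N%:Z| = n%:Z.
  by exists (absz (tnth t i - (av i * (M %/ q))%N%:Z)); rewrite abszE.
by rewrite en in key *; rewrite lez_nat /c0 truncn_ge_nat// mulr_ge0// ltW.
Qed.

Definition arc_mult (t : r.-tuple int) : nat :=
  (\sum_(1 <= q < Q.+1) \sum_(a : r.-tuple 'I_q.+1 | reduced a) (t \in arc a))%N.

Lemma arc_mult_unique q (a : r.-tuple 'I_q.+1) t : (0 < q <= Q)%N -> reduced a -> t \in arc a ->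
  arc_mult t = 1%N.
Proof.
move=> hq ra ta; have qI : q \in index_iota 1 Q.+1 by rewrite mem_index_iota ltnS.
rewrite /arc_mult (bigD1_seq q) ?iota_uniq//= (bigD1 a)//= ta.
rewrite big1 => [|a' /andP[ra' na]]; last first.
  by apply/eqP; rewrite eqb0; apply: contra na => ta'; rewrite (arc_inj_a hq ra' ra ta' ta).
rewrite big_seq_cond big1// => q' /andP[]; rewrite mem_index_iota ltnS => hq' nq.
apply: big1 => a' ra'; apply/eqP; rewrite eqb0; apply: contra nq => ta'.
by rewrite (arc_inj_q hq' hq ra' ra ta' ta).
Qed.

(** Every point lies in at most one arc, and every point near a rational lies in one; what remains
    is a sum over some of the points that are not near a rational. *)
Lemma arc_decomposition (S : r.-tuple int -> R[i]) :
  normc (\sum_(t <- window) S t -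
    \sum_(1 <= q < Q.+1) \sum_(a : r.-tuple 'I_q.+1 | reduced a)
      \sum_(c <- tseq (fun=> - c0%:Z) (fun=> c0%:Z + 1)) S (arc_shift a c)) <=
  \sum_(t <- window | ~~ `[< near_rational (at_grid R M t) Y delta >]) normc (S t).
Proof.
have shiftE q (a : r.-tuple 'I_q.+1) : (0 < q <= Q)%N -> reduced a ->
    \sum_(c <- tseq (fun=> - c0%:Z) (fun=> c0%:Z + 1)) S (arc_shift a c) =
    \sum_(t <- window) (S t *+ (t \in arc a)).
  move=> hq ra; rewrite [RHS](eq_bigr (fun t => if t \in arc a then S t else 0)); last first.
    by move=> t _; case: ifP => _; rewrite ?mulr1n ?mulr0n.
  rewrite -big_mkcond -big_filter -(big_map (arc_shift a) xpredT S).
  apply: perm_big; apply: uniq_perm.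
  - rewrite map_inj_uniq ?tseq_uniq// => c c' cc; apply/eq_from_tnth => i.
    by have := congr1 (fun t => tnth t i) cc; rewrite /= !tnth_mktuple => /addrI.
  - by rewrite filter_uniq// tseq_uniq.
  move=> t; rewrite mem_filter; apply/mapP/andP => [[c cin ->]|[ta tw]].
    suff ta : arc_shift a c \in arc a by split=> //; apply: arc_sub_window ta.
    rewrite arc_shift_in; apply/forallP => i; rewrite tnth_mktuple addrAC subrr add0r.
    by move: cin; rewrite mem_tseq => /forallP /(_ i); rewrite ler_norml ltzD1.
  exists [tuple tnth t i - arc_center a i | i < r].
    rewrite mem_tseq; apply/forallP => i; rewrite tnth_mktuple ltzD1 -ler_norml.
    by move: ta; rewrite arc_shift_in => /forallP.
  by apply/eq_from_tnth => i; rewrite !tnth_mktuple addrC subrK.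
have -> : \sum_(1 <= q < Q.+1) \sum_(a : r.-tuple 'I_q.+1 | reduced a)
      \sum_(c <- tseq (fun=> - c0%:Z) (fun=> c0%:Z + 1)) S (arc_shift a c) =
   \sum_(t <- window) (S t *+ arc_mult t).
  transitivity (\sum_(1 <= q < Q.+1) \sum_(a : r.-tuple 'I_q.+1 | reduced a)
     \sum_(t <- window) (S t *+ (t \in arc a))).
    by rewrite !big_nat; apply: eq_bigr => q hq; apply: eq_bigr => a ra; apply: shiftE.
  under eq_bigr do rewrite exchange_big.
  rewrite exchange_big /=; apply: eq_bigr => t _; rewrite /arc_mult -sumrMnr.
  by apply: eq_bigr => q _; rewrite -sumrMnr.
rewrite -sumrB; apply: le_trans (normc_sum _ _ _) _.
rewrite [leRHS]big_mkcond big_seq [leRHS]big_seq; apply: ler_sum => t tw.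
case: ifPn => [/asboolPn nn|/negPn/asboolP nr].
  have [/eqP ->|m0] := boolP (arc_mult t == 0%N); first by rewrite mulr0n subr0.
  suff -> : arc_mult t = 1%N by rewrite mulr1n subrr normc0 normc_ge0.
  have [q [a [hq ra ta]]] : exists q (a : r.-tuple 'I_q.+1), [/\ (0 < q <= Q)%N, reduced a & t \in arc a].
    apply: contrapT => nex; move/eqP: m0; apply; rewrite /arc_mult big_nat big1// => q hq.
    apply: big1 => a ra; apply/eqP; rewrite eqb0; apply/negP => ta; apply: nex.
    by exists q, a; split.
  exact: arc_mult_unique ta.
have [q [a [hq ra ta]]] := near_in_arc tw nr.
by rewrite (arc_mult_unique hq ra ta) mulr1n subrr normc0.
Qed.

End ArcDecomposition.

(** * Orthogonality modulo [M] *)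

Section Orthogonality.
Variable R : realType.
Local Notation e := (@unit_exp R).

Lemma unit_exp_eq1 (x : R) : e x = 1 -> exists z : int, x = z%:~R.
Proof.
move=> ex; have [z hz] := distE x; exists z.
have := unit_exp_sub1 x; rewrite ex subrr normc0 => h.
have d0 : dist x = 0 by have := dist_ge0 x; lra.
by apply/eqP; rewrite -subr_eq0 -normr_eq0 -hz d0.
Qed.

Lemma character_sum (M : nat) (l f : int) : (0 < M)%N -> `|f| < M%:Z ->
  \sum_(k < width l (l + M%:Z)) e ((l + k%:Z)%:~R / M%:R * f%:~R) = (M * (f == 0%R))%N%:R :> R[i].
Proof.
move=> M0 fM; have MR : (0 : R) < M%:R by rewrite ltr0n.
have wM : width l (l + M%:Z) = M by rewrite /width addrAC subrr add0r max_r.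
rewrite wM; pose x : R := f%:~R / M%:R.
have -> : \sum_(k < M) e ((l + k%:Z)%:~R / M%:R * f%:~R) = e (l%:~R * x) * \sum_(k < M) e x ^+ k.
  rewrite mulr_sumr; apply: eq_bigr => k _; rewrite -unit_expMn -unit_expD; congr e.
  by rewrite intrD -mulr_natl /x -[(k%:Z)%:~R]/(k%:R : R); field; rewrite gt_eqF.
have [f0|f0] := eqVneq f 0.
  rewrite muln1 /x f0 mul0r mulr0 unit_exp0 mul1r.
  under eq_bigr do rewrite expr1n.
  by rewrite sumr_const card_ord.
rewrite muln0; have x1 : e x - 1 != 0.
  apply: contra f0; rewrite subr_eq0 => /eqP /unit_exp_eq1[z hz].
  have fE : f = z * M%:Z.
    by apply: (@intr_inj R); rewrite intrM -hz /x divfK// gt_eqF.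
  move: fM; rewrite fE normrM [X in _ * X]ger0_norm// gtr_pMl ?ltz_nat// => /int_norm_lt1 ->.
  by rewrite mul0r.
have : (e x - 1) * \sum_(k < M) e x ^+ k = 0.
  rewrite -subrX1 -unit_expMn -mulr_natl /x mulrC divfK ?gt_eqF//.
  by rewrite unit_exp_int subrr.
by move/eqP; rewrite mulf_eq0 (negPf x1) => /eqP ->; rewrite mulr0.
Qed.

Variables (r s : nat) (F : 'I_r -> {mpoly int[s]}).
Variables (a b : 'I_s -> bool) (lo hi : 'I_s -> R).
Local Notation B := (tbox a b lo hi).
Local Notation L P := (tseq (box_lo a lo P) (box_hi b hi P)).

Lemma mem_dilate (P : R) (x : s.-tuple int) : 0 < P ->
  dilate P B (map_tuple intr x) <-> x \in L P.
Proof.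
move=> P0; have Pn : P != 0 by rewrite gt_eqF.
have mem j : ((tnth x j)%:~R / P \in Interval (BSide (a j) (lo j)) (BSide (b j) (hi j))) =
    (box_lo a lo P j <= tnth x j) && (tnth x j < box_hi b hi P j).
  have := mem_cut (a j) (b j) (lo j) (hi j) 0 (tnth x j) (h := P^-1).
  by rewrite invr_gt0 => /(_ P0); rewrite !subr0 !invrK addr0 mulrC.
rewrite mem_tseq; split=> [[y By yx]|/forallP h].
  apply/forallP => j; rewrite -mem; have := congr1 (fun t => tnth t j) yx; rewrite /= !tnth_map => <-.
  by rewrite mulrC mulKf//; apply: By.
exists (map_tuple (fun t : int => t%:~R / P) x).
  by move=> j; rewrite tnth_map mem.
by apply/eq_from_tnth => j; rewrite !tnth_map mulrC divfK.
Qed.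

Lemma rho_size (P : R) : 0 < P ->
  rho F B P = size [seq x <- L P | [forall i, meval (tnth x) (F i) == 0]].
Proof.
move=> P0; rewrite /rho; set l := [seq _ <- _ | _].
have -> : solutions F B P = [set` [fset x in l]%fset].
  apply/seteqP; split=> x /=; rewrite !inE mem_filter.
    by move=> [/(mem_dilate _ P0) -> h]; rewrite andbT; apply/forallP => i; apply/eqP.
  move=> /andP[/forallP h /(mem_dilate _ P0) ?]; split=> // i; exact/eqP.
by rewrite set_fsetK card_fseq undup_id// filter_uniq// tseq_uniq.
Qed.

(** [M] exceeds all values |F_i(x)| on the box, so vanishing modulo [M] is vanishing, and averaging
    over the [M]-division points detects the solutions exactly. *)
Lemma orthogonality (P : R) (M : nat) (l : int) : 0 < P -> (0 < M)%N ->
  (forall x i, x \in L P -> `|meval (tnth x) (F i)| < M%:Z) ->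
  \sum_(t <- tseq (fun _ : 'I_r => l) (fun=> l + M%:Z)) box_sum F a b lo hi P (at_grid R M t) =
  (M ^ r * rho F B P)%N%:R.
Proof.
move=> P0 M0 hM; rewrite rho_size//.
have -> : \sum_(t <- tseq (fun _ : 'I_r => l) (fun=> l + M%:Z)) box_sum F a b lo hi P (at_grid R M t) =
    \sum_(x <- L P) \sum_(t <- tseq (fun _ : 'I_r => l) (fun=> l + M%:Z))
      e (tuple_comb F (at_grid R M t) x).
  rewrite [RHS]exchange_big /=; apply: eq_bigr => t _; rewrite [RHS]big_map /box_sum.
  by apply: eq_bigr => x _; rewrite tuple_comb_row.
have inner x : x \in L P -> \sum_(t <- tseq (fun _ : 'I_r => l) (fun=> l + M%:Z))
    e (tuple_comb F (at_grid R M t) x) =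
    (M ^ r * [forall i, meval (tnth x) (F i) == 0])%N%:R.
  move=> xL; rewrite big_map.
  pose g (i : 'I_r) (z : int) := e (z%:~R / M%:R * (meval (tnth x) (F i))%:~R).
  rewrite (eq_bigr (fun y : 'rV[int]_r => \prod_i g i (y 0 i))); last first.
    move=> y _; rewrite /tuple_comb /g.
    rewrite (eq_bigr (fun i => (y 0 i)%:~R / M%:R * (meval (tnth x) (F i))%:~R)); last first.
      by move=> i _; rewrite /at_grid tnth_mktuple.
    by elim/big_rec2: _ => [|i A C _ <-]; rewrite ?unit_exp0// unit_expD.
  rewrite sum_ibox (eq_bigr (fun i => (M * (meval (tnth x) (F i) == 0%R))%N%:R)); last first.
    by move=> i _; apply: character_sum => //; apply: hM.
  rewrite -natr_prod; congr _%:R; rewrite big_split /= prod_nat_const card_ord; congr (_ * _)%N.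
  have [/forallP h|/forallPn[i ni]] := boolP [forall i, meval (tnth x) (F i) == 0].
    by rewrite big1// => i _; rewrite (eqP (h i)) eqxx.
  by rewrite (bigD1 i)//= (negPf ni) mul0n.
rewrite big_seq (eq_bigr _ inner) -big_seq -natr_sum -big_distrr /= -sum1_size big_filter.
by congr (_ * _)%N%:R; rewrite [RHS]big_mkcond; apply: eq_bigr => x _; case: ifP.
Qed.

Lemma values_bounded (P : R) : exists m : nat, forall x i, x \in L P -> `|meval (tnth x) (F i)| < m%:Z.
Proof.
exists (\sum_(x <- L P) \sum_i absz (meval (tnth x) (F i))).+1 => x i xL.
rewrite -abszE ltz_nat ltnS (big_rem x)//= (bigD1 i)//= -addnA leq_addr//.
Qed.

End Orthogonality.

(** * Riemann sums for the truncated singular integral *)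

Section OscillatoryRiemann.
Variables (R : realType) (r s : nat) (F : 'I_r -> {mpoly int[s]}).
Variables (a b : 'I_s -> bool) (lo hi : 'I_s -> R).
Hypothesis lohi : forall j, lo j < hi j.
Hypothesis in_unit : tbox a b lo hi `<=` unit_box R s.
Local Notation B := (tbox a b lo hi).
Local Notation RR := (measurableTypeR R).
Local Notation mu := (lebesgue_tuple R).

Definition osc_Re (t : r.-tuple RR) : R := complex.Re (oscillatory_integral F B t).
Definition osc_Im (t : r.-tuple RR) : R := complex.Im (oscillatory_integral F B t).

Lemma osc_parts : exists2 C : R, 0 <= C &
  [/\ forall t, `|osc_Re t| <= C, forall t, `|osc_Im t| <= C, lipschitz C osc_Re & lipschitz C osc_Im].
Proof.
have [C C0 h] := osc_lip F lohi in_unit; exists C => //.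
have tE (t : r.-tuple RR) : t = mktuple (tnth t) by apply/eq_from_tnth => i; rewrite tnth_mktuple.
split=> [t|t|t u|t u].
- by have [+ _ _ _] := h (tnth t) (tnth t); rewrite /= -tE.
- by have [_ + _ _] := h (tnth t) (tnth t); rewrite /= -tE.
- by have [_ _ + _] := h (tnth t) (tnth u); rewrite /= -!tE.
- by have [_ _ _ +] := h (tnth t) (tnth u); rewrite /= -!tE.
Qed.

Definition cube_integral (T : R) : R[i] :=
  cintegral (mu r) (cube T) (oscillatory_integral F B).

End OscillatoryRiemann.

Section CubeRiemannSum.
Variables (R : realType) (r s : nat) (F : 'I_r -> {mpoly int[s]}).
Variables (a b : 'I_s -> bool) (lo hi : 'I_s -> R).
Hypothesis lohi : forall j, lo j < hi j.
Hypothesis in_unit : tbox a b lo hi `<=` unit_box R s.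
Local Notation B := (tbox a b lo hi).
Local Notation RR := (measurableTypeR R).
Local Notation mu := (lebesgue_tuple R).

Local Notation osc_Re := (osc_Re F a b lo hi).
Local Notation osc_Im := (osc_Im F a b lo hi).
Local Notation cube_integral := (cube_integral F a b lo hi).

(** The constant depends on [T], which will be a power of P; this is harmless because the mesh is
    made small afterwards through [M]. *)
Lemma osc_grid_sum (T : R) : 0 < T -> exists2 C : R, 0 <= C & forall h, 0 < h -> h <= 1 ->
  normc ((h ^+ r)%:C * (\sum_(c <- tseq (fun=> - (Num.truncn (T / h))%:Z) (fun=> (Num.truncn (T / h))%:Z + 1))
     oscillatory_integral F B (mktuple (fun i => h * (tnth c i)%:~R))) - cube_integral T) <= C * h.
Proof.
move=> T0; have [C C0 [bR bI lR lI]] := osc_parts F lohi in_unit.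
pose E := r%:R * (2 * T + 1) ^+ r * (2 * C + C * (2 * T + 1)).
have E0 : 0 <= E by rewrite !mulr_ge0 ?exprn_ge0 ?addr_ge0 ?mulr_ge0 ?addr_ge0 ?mulr_ge0 ?(ltW T0).
exists (E + E) => [|h h0 h1]; first by rewrite addr_ge0.
have Th : 0 <= T / h by rewrite divr_ge0 ?ltW.
set L := tseq _ _.
(* The integers c with |h c| <= T are those with |c| at most the integral part of T/h, in the
   half-open conventions of [cut]. *)
have LE : L = tseq (fun j : 'I_r => cut true ((- T - 0) / h)) (fun j => cut false ((T - 0) / h)).
  have /andP[n1 n2] := truncn_itv Th; rewrite -natr1 in n2.
  set n := Num.truncn (T / h) in n1 n2 *.
  have nE : (n%:Z)%:~R = n%:R :> R by [].
  have e1 : cut true ((- T - 0) / h) = - n%:Z.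
    apply/eqP; rewrite eq_le cut_le -ltzD1 ltNge -[X in ~~ (_ <= X)]addr0.
    have -> : (cut true ((- T - 0) / h) + 1 <= - n%:Z + 0) = (cut true ((- T - 0) / h) <= - n%:Z - 1).
      by rewrite addr0 lerBrDr.
    by rewrite cut_le rmorphB rmorphN /= nE subr0 mulNr; apply/andP; split; [|rewrite -ltNge]; lra.
  have e2 : cut false ((T - 0) / h) = n%:Z + 1.
    apply/eqP; rewrite eq_le cut_le lezD1 [n%:Z < _]ltNge cut_le intrD nE subr0.
    by apply/andP; split; [|rewrite -leNgt]; lra.
  by rewrite /L; congr tseq; apply/funext => j; rewrite ?e1 ?e2.
have gE (c : r.-tuple int) : (mktuple (fun i => h * (tnth c i)%:~R) : r.-tuple R) = grid_at h (fun=> 0) c.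
  by apply/eq_from_tnth => i; rewrite !tnth_mktuple addr0.
have lh0 : - T < T by lra.
have lW0 : T - - T <= 2 * T by lra.
have lh (j : 'I_r) : - T < T by exact: lh0.
have lW (j : 'I_r) : T - - T <= 2 * T by exact: lW0.
have T2 : 0 <= 2 * T by rewrite mulr_ge0 ?ltW.
apply: le_trans (normc_le_parts _) _.
have split_re (x y : R[i]) : complex.Re (x - y) = complex.Re x - complex.Re y.
  by case: x y => [? ?] [? ?].
have split_im (x y : R[i]) : complex.Im (x - y) = complex.Im x - complex.Im y.
  by case: x y => [? ?] [? ?].
rewrite split_re split_im Re_scale Im_scale Re_sum Im_sum /= LE.
have -> : (E + E) * h = h * E + h * E by ring.
have := @riemann_sum R r (fun=> true) (fun=> false) (fun=> - T) (fun=> T) (fun=> 0) h C C (2 * T) osc_Re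
  lh lW T2 h0 h1 bR lR.
have := @riemann_sum R r (fun=> true) (fun=> false) (fun=> - T) (fun=> T) (fun=> 0) h C C (2 * T) osc_Im
  lh lW T2 h0 h1 bI lI.
move=> hI hR; apply: lerD.
  by under eq_bigr do rewrite gE; exact: hR.
by under eq_bigr do rewrite gE; exact: hI.
Qed.

End CubeRiemannSum.

(** * Singular series, singular integral and minor arcs *)

Lemma gain_gt0 (R : realType) (r d : nat) : (0 < r)%N -> (1 < d)%N ->
  (0 : R) < (2 * (r * d.-1) * 2 ^ d.-1)%N%:R^-1.
Proof.
move=> r0 d1; have d0 : (0 < d.-1)%N by case: d d1 => [|[]].
by rewrite invr_gt0 ltr0n !muln_gt0 r0 d0 expn_gt0.
Qed.

Lemma gain_le1 (R : realType) (r d : nat) : (0 < r)%N -> (1 < d)%N ->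
  (2 * (r * d.-1) * 2 ^ d.-1)%N%:R^-1 <= 1 :> R.
Proof.
move=> r0 d1; have := gain_gt0 R r0 d1; rewrite invr_gt0.
by move: (2 * _ * _)%N => m m0; rewrite invf_le1// ler1n -(ltr_nat R).
Qed.

Section CircleMethodEstimate.
Variables (R : realType) (r s d : nat) (F : 'I_r -> {mpoly int[s]}).
Hypothesis r_gt0 : (0 < r)%N.
Hypothesis s_gt0 : (0 < s)%N.
Hypothesis F_homog : forall i, F i \is ishomog1 d mdeg.
Hypothesis d_gt1 : (1 < d)%N.
Variable k : nat.
Hypothesis k_dim : forall (a : {ffun 'I_r -> int}) m Z, a != 0%R ->
  irreducible_chain (gradient_zeros R F a) m Z -> (m <= k)%N.
Hypothesis s_large : (k + 2 ^ d.-1 * r.+1 * (r * d.-1) < s)%N.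
Variables (a b : 'I_s -> bool) (lo hi : 'I_s -> R).
Hypothesis lohi : forall j, lo j < hi j.
Hypothesis in_unit : tbox a b lo hi `<=` unit_box R s.
Local Notation B := (tbox a b lo hi).
Local Notation n0 := (r * d.-1)%N.
Local Notation c1 := ((2 * n0 * 2 ^ d.-1)%N%:R^-1 : R).
Local Notation we := (weyl_exponent R r d).

Let n0_gt0 : (0 < n0)%N.
Proof. by rewrite muln_gt0 r_gt0 -ltnS prednK// ltnW. Qed.
Let c1_gt0 : 0 < c1. Proof. exact: gain_gt0. Qed.
Let c1_le1 : c1 <= 1. Proof. exact: gain_le1. Qed.

(** At most q^r numerators, each with a normalised Gauss sum of order q^(-r-1-c1), leave the
    summable q^(-1-c1). *)
Lemma series_term_bound : exists2 C : R, 0 <= C & forall q, (0 < q)%N ->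
  normc (singular_series_term R F q) <= C * q%:R `^ (- (1 + c1)).
Proof.
have [C C1 G] := gauss_sum_bound r_gt0 s_gt0 F_homog d_gt1 k_dim s_large.
exists C => [|q q0]; first by lra.
have qR : (0 : R) < q%:R by rewrite ltr0n.
apply: le_trans (normc_sum _ _ _) _.
apply: (@le_trans _ _ (\sum_(x in residues r q) C / q%:R `^ we)).
  rewrite big_mkcondr /=; apply: ler_sum => x _; case: ifP => [/eqP gx|_]; first exact: G.
  by rewrite divr_ge0 ?powR_ge0//; lra.
rewrite sumr_const card_residues -[leLHS]mulr_natr natrX.
have -> : q%:R `^ we = q%:R ^+ r * q%:R `^ (1 + c1).
  rewrite -powR_mulrn ?(ltW qR)// -powRD ?(gt_eqF qR) ?implybT//; congr (_ `^ _).
  by rewrite /weyl_exponent -natr1 addrA.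
rewrite powRN; have h1 : q%:R `^ (1 + c1) != 0 by rewrite gt_eqF// powR_gt0.
have h2 : q%:R ^+ r != 0 :> R by rewrite expf_neq0// gt_eqF.
by rewrite le_eqVlt; apply/orP; left; apply/eqP; field; rewrite h1 h2.
Qed.

Lemma singular_series_cvg : exists2 C : R, 0 <= C &
  [/\ singular_series_converges R F,
    normc (singular_series R F) <= C,
    forall m, normc (\sum_(1 <= q < m.+2) singular_series_term R F q) <= C &
    forall m, normc (singular_series R F - \sum_(1 <= q < m.+2) singular_series_term R F q) <=
      C * m.+1%:R `^ (- c1)].
Proof.
have [C C0 tC] := series_term_bound.
have [z [cz bz]] := complex_series C0 c1_gt0 tC.
have limz : singular_series R F = z.
  first [exact: (@cvg_lim R[i]^o (@norm_hausdorff _ R[i]^o) _ _ _ _ _ cz) | exact: (cvg_lim (@norm_hausdorff _ R[i]^o) cz)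
  | by rewrite /singular_series; apply/(@cvg_lim R[i]^o (@norm_hausdorff _ R[i]^o)); exact: cz].
pose K := 2 * (C / c1).
have K0 : 0 <= K by rewrite mulr_ge0// divr_ge0// ltW.
have bz1 m : normc (z - \sum_(1 <= q < m.+2) singular_series_term R F q) <= K.
  apply: le_trans (bz m) _; rewrite -/K -[leRHS]mulr1 ler_wpM2l//.
  by rewrite powRN invf_le1 ?powR_gt0 ?ltr0n// -[leLHS](powRr0 (m.+1%:R : R)) ler_powR ?ler1n// ltW.
have nz : 0 <= normc z by apply: normc_ge0.
exists (normc z + K); first by rewrite addr_ge0.
rewrite limz; split=> [|||m]; first by apply/cvg_ex; exists z.
- by rewrite lerDl.
- move=> m; rewrite -[X in normc X](subKr z); apply: le_trans (le_normcD _ _) _.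
  by rewrite normcN lerD2l.
- by apply: le_trans (bz m) _; rewrite ler_wpM2r ?powR_ge0// lerDr.
Qed.

(** Decay of order [r + 1] in dimension [r] gives integrability, and truncation to the cube of
    half-side T costs a multiple of 1/T. *)
Lemma singular_integral_cvg : exists2 C : R, 0 <= C &
  [/\ singular_integral_converges F B, normc (singular_integral F B) <= C &
    forall T, 4 <= T -> normc (cube_integral F a b lo hi T - singular_integral F B) <= C / T].
Proof.
have [C C0 [bR bI lR lI]] := osc_parts F lohi in_unit.
have [C2 C20 dec] := osc_decay r_gt0 s_gt0 F_homog d_gt1 k_dim s_large lohi in_unit.
pose K := C + C2.
have tE (t : r.-tuple (measurableTypeR R)) : t = mktuple (tnth t).
  by apply/eq_from_tnth => i; rewrite tnth_mktuple.
have decR t T : 4 <= T -> (exists i, T <= `|tnth t i : R|) ->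
    normc (oscillatory_integral F B t) <= K / T ^+ r.+1.
  move=> T4 ht; rewrite {1}(tE t); apply: le_trans (dec (tnth t) T T4 ht) _.
  by rewrite ler_wpM2r ?invr_ge0 ?exprn_ge0 ?lerDr//; lra.
have Re_le (z : R[i]) : `|complex.Re z| <= normc z.
  by case: z => x y; rewrite /normc /= -sqrtr_sqr ler_wsqrtr// lerDl sqr_ge0.
have Im_le (z : R[i]) : `|complex.Im z| <= normc z.
  by case: z => x y; rewrite /normc /= -sqrtr_sqr ler_wsqrtr// lerDr sqr_ge0.
have CK : C <= K by rewrite lerDl.
have mR := lipschitz_measurable lR; have mI := lipschitz_measurable lI.
have bRK t := le_trans (bR t) CK; have bIK t := le_trans (bI t) CK.
have dR t T T4 ht := le_trans (Re_le _) (decR t T T4 ht).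
have dI t T T4 ht := le_trans (Im_le _) (decR t T T4 ht).
have iR := tail_integrable mR bRK dR; have iI := tail_integrable mI bIK dI.
have tR T (T4 : 4 <= T) := tail_bound mR bRK dR T4.
have tI T (T4 : 4 <= T) := tail_bound mI bIK dI T4.
pose K2 := 2 * (2 * K * 4 ^+ r).
have K0 : 0 <= K by rewrite addr_ge0.
have K20 : 0 <= K2 by rewrite !mulr_ge0 ?exprn_ge0.
exists (normc (singular_integral F B) + K2); first by rewrite addr_ge0// normc_ge0.
split; [by split| by rewrite lerDl|move=> T T4].
apply: le_trans (normc_le_parts _) _.
apply: (@le_trans _ _ (K2 / T)); last first.
  by rewrite ler_wpM2r ?invr_ge0 ?lerDr ?normc_ge0//; lra.
have -> : K2 / T = 2 * K * 4 ^+ r / T + 2 * K * 4 ^+ r / T by rewrite /K2; ring.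
by apply: lerD; rewrite distrC; [exact: tR|exact: tI].
Qed.

(** [minor_sum] with levels from Y up to P^n0, the range of the Weyl alternative. The exponent
    1/(4r+6) anticipates the final choice of Y as a power of P. *)
Lemma minor_estimate : exists2 C : R, 0 <= C & forall (P Y : R) (M : nat) (l : int),
  1 <= P -> 1 <= Y -> P `^ (4 * r + 6)%N%:R^-1 <= Y -> Y <= P ^+ n0 -> (0 < M)%N -> P ^+ d <= M%:R ->
  \sum_(t <- tseq (fun _ : 'I_r => l) (fun=> l + M%:Z) | ~~ `[< near_rational (at_grid R M t) Y (Y / P ^+ d) >])
    normc (box_sum F a b lo hi P (at_grid R M t)) <=
  C * (P ^+ s * (M%:R / P ^+ d) ^+ r * Y `^ (- c1)).
Proof.
have [C C1 W] := weyl_alternative r_gt0 s_gt0 F_homog d_gt1 k_dim s_large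
  (eta := (4 * r + 6)%N%:R^-1) ltac:(by rewrite invr_gt0 ltr0n addnS).
pose K := 2 ^+ r.+1 / (1 - 2 `^ (- c1)) * 15 ^+ r.
exists (C * (K + 2 `^ we)) => [|P Y M l P1 Y1 PY YP M0 PM].
  have p1 : 2 `^ (- c1) <= 1 :> R.
    by rewrite powRN invf_le1 ?powR_gt0// -[leLHS](powRr0 (2 : R)) ler_powR ?ler1n// ltW.
  by rewrite mulr_ge0 ?addr_ge0 ?powR_ge0 ?mulr_ge0 ?invr_ge0 ?subr_ge0 ?exprn_ge0//; lra.
have P0 : 0 < P by lra.
have Pd0 : 0 < P ^+ d by apply: exprn_gt0.
have A0 : 0 <= C * P ^+ s by rewrite mulr_ge0 ?exprn_ge0//; lra.
have alt t Z : Y <= Z -> Z <= P ^+ n0 ->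
    normc (box_sum F a b lo hi P (at_grid R M t)) <= C * P ^+ s / Z `^ (r.+1%:R + c1) \/
    near_rational (at_grid R M t) Z (Z / P ^+ d).
  move=> YZ ZP; apply: W => //; first exact: le_trans YZ.
    by move=> j; apply: (box_lo_ge lohi in_unit); apply: ltW.
  by move=> j; apply: (box_hi_le lohi in_unit); apply: ltW.
apply: le_trans (minor_sum l M0 A0 c1_gt0 Y1 Pd0 PM alt YP) _.
have Y0 : 0 < Y by lra.
have MR : (0 : R) < M%:R by rewrite ltr0n.
have e1 : (15 * M%:R / P ^+ d) ^+ r = 15 ^+ r * (M%:R / P ^+ d) ^+ r by rewrite -exprMn mulrA.
have Z0 : 0 < P ^+ n0 by apply: exprn_gt0.
(* Since d <= (d-1)(r+1), the saving at the top level P^n0 is large enough to count all M^r points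
   there. *)
have Zw : (P ^+ d) ^+ r * Y `^ c1 <= (P ^+ n0) `^ (r.+1%:R + c1).
  rewrite powRD ?(gt_eqF Z0) ?implybT// powR_mulrn ?(ltW Z0)//; apply: ler_pM.
  - by rewrite exprn_ge0// ltW.
  - exact: powR_ge0.
  - rewrite -!exprM; apply: ler_weXn2l => //.
    case: (d) d_gt1 => [|[|d']]// _; rewrite /= [(_ * r)%N]mulnC -mulnA leq_mul2l; apply/orP; right.
    by rewrite mulnSr -[d'.+2]add1n leq_add2r muln_gt0 r_gt0.
  - by apply: ge0_ler_powR; rewrite ?nnegrE ?(ltW Y0) ?(ltW Z0)// ltW.
have Yc : 0 < Y `^ c1 by apply: powR_gt0.
have e2 : M%:R ^+ r / (P ^+ n0) `^ (r.+1%:R + c1) <= (M%:R / P ^+ d) ^+ r * Y `^ (- c1).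
  rewrite expr_div_n powRN -mulrA -invfM ler_wpM2l ?exprn_ge0//.
  by rewrite lef_pV2 ?posrE ?powR_gt0// mulr_gt0 ?exprn_gt0.
set x := (M%:R / P ^+ d) ^+ r in e1 e2 *; set y := Y `^ (- c1) in e2 *.
apply: (@le_trans _ _ (C * P ^+ s * (K * (x * y) + 2 `^ we * (x * y)))).
  rewrite ler_wpM2l//; apply: lerD; first by rewrite e1 /K !mulrA.
  by rewrite -[leLHS]mulrA ler_wpM2l ?powR_ge0.
by rewrite le_eqVlt; apply/orP; left; apply/eqP; ring.
Qed.

End CircleMethodEstimate.

(** * Comparison of the count with the main term *)

Section MainEstimate.
Variables (R : realType) (r s d : nat) (F : 'I_r -> {mpoly int[s]}).
Hypothesis r_gt0 : (0 < r)%N.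
Hypothesis s_gt0 : (0 < s)%N.
Hypothesis F_homog : forall i, F i \is ishomog1 d mdeg.
Hypothesis d_gt1 : (1 < d)%N.
Variable k : nat.
Hypothesis k_dim : forall (a : {ffun 'I_r -> int}) m Z, a != 0%R ->
  irreducible_chain (gradient_zeros R F a) m Z -> (m <= k)%N.
Hypothesis s_large : (k + 2 ^ d.-1 * r.+1 * (r * d.-1) < s)%N.
Variables (a b : 'I_s -> bool) (lo hi : 'I_s -> R).
Hypothesis lohi : forall j, lo j < hi j.
Hypothesis in_unit : tbox a b lo hi `<=` unit_box R s.
Local Notation B := (tbox a b lo hi).
Local Notation n0 := (r * d.-1)%N.
Local Notation c1 := ((2 * n0 * 2 ^ d.-1)%N%:R^-1 : R).
Local Notation N := (4 * r + 6)%N.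
Local Notation osc := (fun gamma : 'I_r -> R => oscillatory_integral F B (mktuple gamma)).

Lemma sum_singular_terms (Q : nat) :
  \sum_(1 <= q < Q.+1) \sum_(c : r.-tuple 'I_q.+1 | reduced c) (q%:R ^- s * gauss_sum R F c) =
  \sum_(1 <= q < Q.+1) singular_series_term R F q.
Proof. by []. Qed.

(** There are at most Y^(r+1) arcs, each with at most (3 M Y/P^d)^r points, and by [major_arc] each
    point costs about Y^2 P^(s-1). Altogether this is the relative error Y^(2r+3)/P. *)
Lemma major_estimate : exists2 C : R, 0 <= C & forall (P Y : R) (M : nat),
  1 <= P -> 1 <= Y -> Y <= P -> (0 < M)%N ->
  (forall q, (0 < q <= Num.truncn Y)%N -> (q %| M)%N) -> 1 <= M%:R * (Y / P ^+ d) ->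
  normc (\sum_(1 <= q < (Num.truncn Y).+1) \sum_(c : r.-tuple 'I_q.+1 | reduced c)
      \sum_(t <- tseq (fun=> - (Num.truncn (M%:R * (Y / P ^+ d)))%:Z)
                      (fun=> (Num.truncn (M%:R * (Y / P ^+ d)))%:Z + 1))
         box_sum F a b lo hi P (at_grid R M (arc_shift M c t)) -
    (P ^+ s)%:C * (\sum_(1 <= q < (Num.truncn Y).+1) singular_series_term R F q) *
      \sum_(t <- tseq (fun=> - (Num.truncn (M%:R * (Y / P ^+ d)))%:Z)
                      (fun=> (Num.truncn (M%:R * (Y / P ^+ d)))%:Z + 1))
        osc (fun i => P ^+ d / M%:R * (tnth t i)%:~R)) <=
  C * (P ^+ s * (M%:R / P ^+ d) ^+ r * (Y ^+ (2 * r + 3) / P)).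
Proof.
have [C C0 hC] := major_arc F_homog lohi in_unit.
exists (2 * C * 3 ^+ r) => [|P Y M P1 Y1 YP M0 Mdiv MY].
  by rewrite !mulr_ge0 ?exprn_ge0.
have P0 : 0 < P by lra.
have Y0 : 0 < Y by lra.
have MR : (0 : R) < M%:R by rewrite ltr0n.
have Pd0 : 0 < P ^+ d by apply: exprn_gt0.
set m0 := Num.truncn (M%:R * _) in MY *; set Q := Num.truncn Y in Mdiv *.
set L := tseq _ _.
have QY : Q%:R <= Y by rewrite truncn_le ltW.
have m0Y : m0%:R <= M%:R * (Y / P ^+ d).
  by rewrite truncn_le mulr_ge0// divr_ge0 ?(ltW Y0) ?(ltW Pd0).
rewrite -sum_singular_terms mulrAC mulr_sumr -sumrB.
pose err := C * (1 + Y) * (Y / P) * P ^+ s.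
have err0 : 0 <= err by rewrite !mulr_ge0 ?exprn_ge0 ?addr_ge0 ?invr_ge0 ?(ltW Y0) ?(ltW P0).
have point q (c : r.-tuple 'I_q.+1) t : (0 < q <= Q)%N -> t \in L ->
    normc (box_sum F a b lo hi P (at_grid R M (arc_shift M c t)) -
      (P ^+ s)%:C * (q%:R ^- s * gauss_sum R F c) * osc (fun i => P ^+ d / M%:R * (tnth t i)%:~R)) <= err.
  move=> hq tL; have [q0 qQ] := andP hq.
  have qR : (0 : R) < q%:R by rewrite ltr0n.
  have qY : q%:R <= Y by apply: le_trans QY; rewrite ler_nat.
  pose beta (i : 'I_r) : R := (tnth t i)%:~R / M%:R.
  have gE : at_grid R M (arc_shift M c t) = (fun i => fraction R c i + beta i).
    apply/funext => i; rewrite /at_grid tnth_mktuple intrD mulrDl; congr (_ + _).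
    rewrite /arc_center /fraction -[(_%:Z)%:~R]/((tnth c i * (M %/ q))%N%:R : R) natrM.
    have eM : M%:R = (M %/ q)%N%:R * q%:R :> R by rewrite -natrM divnK ?Mdiv.
    have mR : ((M %/ q)%N%:R : R) != 0.
      by apply: contraTneq MR => e0; rewrite eM e0 mul0r ltxx.
    by rewrite [M%:R]eM; field; rewrite mR gt_eqF.
  have oE : (fun i => P ^+ d / M%:R * (tnth t i)%:~R) = (fun i => P ^+ d * beta i).
    by apply/funext => i; rewrite /beta mulrA mulrAC.
  rewrite gE oE; apply: le_trans (hC P Y q c beta P0 q0 (le_trans qY YP) (ltW Y0) _) _.
    move=> i; rewrite /beta normrM (gtr0_norm Pd0) normf_div (gtr0_norm MR).
    have ti : `|(tnth t i)%:~R : R| <= m0%:R.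
      rewrite -intr_norm [leRHS]pmulrn ler_int ler_norml.
      by move: tL; rewrite mem_tseq => /forallP /(_ i); rewrite ltzD1.
    apply: (@le_trans _ _ (P ^+ d * (M%:R * (Y / P ^+ d) / M%:R))).
      rewrite ler_wpM2l ?(ltW Pd0)// ler_wpM2r ?invr_ge0 ?(ltW MR)//.
      exact: le_trans ti m0Y.
    have hp : P ^+ d != 0 by rewrite gt_eqF.
    have hm : M%:R != 0 :> R by rewrite gt_eqF.
    move: hp hm; set p := P ^+ d; set m : R := M%:R => hp hm.
    by rewrite le_eqVlt; apply/orP; left; apply/eqP; field; rewrite hp hm.
  by rewrite /err ler_wpM2r ?exprn_ge0 ?(ltW P0)// ler_wpM2l ?mulr_ge0 ?addr_ge0 ?(ltW Y0)// ler_wpM2r ?invr_ge0 ?(ltW P0).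
have sizeL : (size L)%:R = (2 * m0 + 1)%N%:R ^+ r :> R.
  rewrite size_map size_ibox (eq_bigr (fun=> (2 * m0 + 1)%N)) ?prod_nat_const ?card_ord ?natrX// => i _.
  rewrite /width opprK max_r; last by rewrite addr_ge0.
  by have -> : m0%:Z + 1 + m0%:Z = (2 * m0 + 1)%N%:Z by rewrite mul2n -addnn !PoszD addrAC.
apply: (@le_trans _ _ (\sum_(1 <= q < Q.+1) (Y ^+ r * ((size L)%:R * err)))).
  apply: le_trans (normc_sum _ _ _) _; rewrite !big_nat; apply: ler_sum => q hq.
  have qY : q%:R <= Y by apply: le_trans QY; rewrite ler_nat; case/andP: hq.
  rewrite mulr_sumr -sumrB; apply: le_trans (normc_sum _ _ _) _.
  apply: (@le_trans _ _ (\sum_(c in residues r q) (size L)%:R * err)).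
    rewrite [leLHS]big_mkcondr; apply: ler_sum => c _; case: ifP => [_|_]; last by rewrite mulr_ge0.
    rewrite [_ * (\sum_(t <- L) _) * _]mulrAC mulr_sumr -sumrB; apply: le_trans (normc_sum _ _ _) _.
    apply: (@le_trans _ _ (\sum_(t <- L) err)).
      rewrite big_seq [leRHS]big_seq; apply: ler_sum => t tL; exact: (point q c t hq tL).
    by rewrite big_const_seq count_predT iter_addr_0 -[leLHS]mulr_natl.
  rewrite sumr_const card_residues -[leLHS]mulr_natl natrX; apply: ler_wpM2r; first by rewrite mulr_ge0.
  by rewrite lerXn2r ?nnegrE ?(ltW Y0).
rewrite sumr_const_nat subn1 /= -[leLHS]mulr_natl.
have hsz : (size L)%:R <= (3 * (M%:R * (Y / P ^+ d))) ^+ r.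
  rewrite sizeL lerXn2r ?nnegrE//; first by lra.
  by rewrite natrD natrM; lra.
have herr : err <= 2 * C * (Y ^+ 2 / P) * P ^+ s.
  rewrite /err ler_wpM2r ?exprn_ge0 ?(ltW P0)// mulrA [leRHS]mulrA ler_wpM2r ?invr_ge0 ?(ltW P0)//.
  rewrite -mulrA [2 * C]mulrC -mulrA ler_wpM2l// expr2 mulrA ler_wpM2r ?(ltW Y0)//; lra.
apply: (@le_trans _ _ (Y * (Y ^+ r * ((3 * (M%:R * (Y / P ^+ d))) ^+ r * (2 * C * (Y ^+ 2 / P) * P ^+ s))))).
  have Yr : 0 <= Y ^+ r by apply: exprn_ge0; apply: ltW.
  have se : 0 <= (size L)%:R * err by apply: mulr_ge0.
  apply: ler_pM => //; first by apply: mulr_ge0.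
  by apply: ler_wpM2l => //; apply: ler_pM.
have -> : (3 * (M%:R * (Y / P ^+ d))) ^+ r = 3 ^+ r * Y ^+ r * (M%:R / P ^+ d) ^+ r.
  by rewrite -!exprMn; congr (_ ^+ r); ring.
have -> : Y ^+ (2 * r + 3) = Y ^+ r * Y ^+ r * Y ^+ 2 * Y.
  by rewrite mul2n -addnn !exprD; ring.
by rewrite le_eqVlt; apply/orP; left; apply/eqP; ring.
Qed.

(** N = 2(2r+3), so for Y = P^(1/N) the major arc error Y^(2r+3)/P is Y^(-2r-3), and the minor arc
    saving Y^(-c1) dominates all errors. The condition [4 ^+ N <= P] means Y >= 4, the range in
    which the singular integral may be truncated at Y. *)
Lemma main_estimate : exists2 C : R, 0 <= C & forall P : R, 4 ^+ N <= P ->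
  normc ((rho F B P)%:R - (P ^+ s / P ^+ (r * d))%:C * (singular_series R F * singular_integral F B)) <=
  C * (P ^+ s / P ^+ (r * d) * (P `^ N%:R^-1) `^ (- c1)).
Proof.
have [C1 C10 hmaj] := major_estimate.
have [C2 C20 hmin] := minor_estimate r_gt0 s_gt0 F_homog d_gt1 k_dim s_large lohi in_unit.
have [C3 C30 [_ s3 p3 t3]] := singular_series_cvg r_gt0 s_gt0 F_homog d_gt1 k_dim s_large.
have [C4 C40 [_ i4 t4]] := singular_integral_cvg r_gt0 s_gt0 F_homog d_gt1 k_dim s_large lohi in_unit.
exists (C1 + C2 + C3 + C3 * C4 + 2 * (C3 * C4)) => [|P hP].
  by rewrite !addr_ge0 ?mulr_ge0.
have c1_gt0 : 0 < c1 by exact: gain_gt0.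
have c1_le1 : c1 <= 1 by exact: gain_le1.
have N0 : (0 < N)%N by rewrite addnS.
have P1 : 1 <= P by apply: le_trans hP; apply: exprn_ege1; lra.
have P0 : 0 < P by lra.
set Y := P `^ N%:R^-1.
have YN : Y ^+ N = P by apply: root_pow => //; lra.
have Y0 : 0 < Y by apply: powR_gt0.
have Y4 : 4 <= Y by rewrite -(ler_pXn2r N0) ?nnegrE ?(ltW Y0)// YN.
have Y1 : 1 <= Y by lra.
have YP : Y <= P by rewrite -YN -[leLHS]expr1 ler_weXn2l.
have n0_gt0 : (0 < n0)%N by rewrite muln_gt0 r_gt0 -ltnS prednK// ltnW.
have YPn : Y <= P ^+ n0 by apply: le_trans YP _; rewrite -[leLHS]expr1 ler_weXn2l.
have Pd0 : 0 < P ^+ d by apply: exprn_gt0.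
set Q := Num.truncn Y.
have [m hm] := values_bounded F a b lo hi P.
have [Cg Cg0 hg] := osc_grid_sum F lohi in_unit Y0.
(* [M] is divisible by all denominators up to Q through the factorial. The second factor makes it
   exceed the values [m] of the forms and makes the mesh P^d/M small against the constant [Cg],
   which depends on P. *)
pose K := Num.truncn (P ^+ d * (Cg * Y + 1) + m%:R).
pose M := (Q`! * K.+1)%N.
have CgY : 0 <= Cg * Y by rewrite mulr_ge0// ltW.
have PdC : P ^+ d <= P ^+ d * (Cg * Y + 1) by rewrite ler_peMr ?(ltW Pd0)//; lra.
have MK : P ^+ d * (Cg * Y + 1) + m%:R <= M%:R.
  apply: le_trans (ltW (truncnS_gt _)) _.
  by rewrite -/K ler_nat /M leq_pmull// fact_gt0.
have m0 : (0 : R) <= m%:R by apply: ler0n.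
have PM : P ^+ d <= M%:R by lra.
have M0 : (0 < M)%N by rewrite -(ltr_nat R); lra.
have MR : (0 : R) < M%:R by rewrite ltr0n.
have Mdiv q : (0 < q <= Q)%N -> (q %| M)%N by move=> hq; rewrite dvdn_mulr// dvdn_fact.
have MY : 1 <= M%:R * (Y / P ^+ d).
  apply: le_trans Y1 _; rewrite mulrCA ler_peMr ?(ltW Y0)//.
  by rewrite ler_pdivlMr// mul1r.
have delta0 : 0 < Y / P ^+ d by rewrite divr_gt0.
have delta_small : 4 * Y ^+ 3 * (Y / P ^+ d) <= 1.
  rewrite mulrA ler_pdivrMr// mul1r -mulrA -exprSr; apply: (@le_trans _ _ (Y ^+ 5)).
    by rewrite [leRHS]exprS ler_wpM2r// exprn_ge0// ltW.
  apply: (@le_trans _ _ P); first by rewrite -YN ler_weXn2l// addnC.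
  by rewrite -[leLHS]expr1 ler_weXn2l// ltnW.
pose h := P ^+ d / M%:R.
have h0 : 0 < h by rewrite divr_gt0.
have h1 : h <= 1 by rewrite ler_pdivrMr// mul1r.
have Yh : Y / h = M%:R * (Y / P ^+ d) by rewrite /h invf_div mulrCA.
have G := hg h h0 h1; rewrite Yh in G.
set c0 := Num.truncn (M%:R * (Y / P ^+ d)) in G *.
set X := \sum_(c <- tseq _ _) _ in G.
have D1 := arc_decomposition Y1 delta0 delta_small MY Mdiv
  (fun t => box_sum F a b lo hi P (at_grid R M t)).
have Mval x i : x \in tseq (box_lo a lo P) (box_hi b hi P) -> `|meval (tnth x) (F i)| < M%:Z.
  move=> xL; apply: lt_le_trans (hm x i xL) _; rewrite lez_nat -(ler_nat R).
  have : 0 <= P ^+ d * (Cg * Y + 1) by rewrite mulr_ge0 ?(ltW Pd0) ?addr_ge0.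
  by move: MK; set z := _ * (_ + 1); lra.
cbv beta in D1; rewrite (orthogonality (c0%:Z + 1) P0 M0 Mval) in D1.
have D2 := hmin P Y M (c0%:Z + 1) P1 Y1 (lexx _) YPn M0 PM.
have D3 := hmaj P Y M P1 Y1 YP M0 Mdiv MY.
rewrite -/c0 -/Q -/X in D1 D3.
set MAJ := \sum_(1 <= q < Q.+1) \sum_(c : r.-tuple 'I_q.+1 | reduced c) _ in D1 D3.
set SQ := \sum_(1 <= q < Q.+1) _ in D3.
set SS := singular_series R F; set SI := singular_integral F B.
set J := cube_integral _ _ _ _ _ _ in G.
pose y := Y `^ (- c1); pose V := P ^+ s * (M%:R / P ^+ d) ^+ r.
have y0 : 0 <= y by apply: powR_ge0.
have V0 : 0 <= V by rewrite mulr_ge0 ?exprn_ge0 ?divr_ge0 ?(ltW Pd0) ?(ltW P0).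
have Yy : Y^-1 <= y.
  rewrite /y powRN lef_pV2 ?posrE ?powR_gt0// -[leRHS]powRr1 ?(ltW Y0)//.
  exact: ler_powR.
have Q0 : (0 < Q)%N by rewrite truncn_gt0.
have E1 : normc ((M ^ r * rho F B P)%N%:R - MAJ) <= C2 * (V * y) by apply: le_trans D1 D2.
have E2 : normc (MAJ - (P ^+ s)%:C * SQ * X) <= C1 * (V * y).
  apply: le_trans D3 _; rewrite ler_wpM2l// ler_wpM2l//; apply: le_trans Yy.
  have -> : P = Y ^+ (2 * r + 3) * Y ^+ (2 * r + 3).
    by rewrite -YN -exprD; congr (_ ^+ _); rewrite addnACA -mulnDl.
  have z0 : 0 < Y ^+ (2 * r + 3) by apply: exprn_gt0.
  rewrite invfM mulrA mulfV ?gt_eqF// mul1r lef_pV2 ?posrE//.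
  by rewrite -[leLHS]expr1 ler_weXn2l// addn3.
have QE : Q.-1.+2 = Q.+1 by rewrite prednK.
have SQ3 : normc SQ <= C3 by have := p3 Q.-1; rewrite QE.
have SQt : normc (SQ - SS) <= C3 * (2 * y).
  rewrite -normcN opprB; have := t3 Q.-1; rewrite QE -/SQ -/SS prednK// => ht.
  apply: le_trans ht _; rewrite ler_wpM2l//.
  have QR : (0 : R) < Q%:R by rewrite ltr0n.
  have Q1 : (1 : R) <= Q%:R by rewrite ler1n.
  have YQ : Y / 2 <= Q%:R by have := truncnS_gt Y; rewrite -/Q -natr1; lra.
  have Yc : 0 < Y `^ c1 by apply: powR_gt0.
  rewrite /y !powRN ler_pdivlMr// mulrC ler_pdivrMr ?powR_gt0//.
  have YE : Y = 2 * (Y / 2) by rewrite mulrC divfK.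
  have Y20 : 0 <= Y / 2 by rewrite divr_ge0// ltW.
  rewrite {1}YE powRM//; apply: ler_pM; rewrite ?powR_ge0//.
    by rewrite -[leRHS]powRr1// ler_powR// ler1n.
  by apply: ge0_ler_powR; rewrite ?nnegrE ?(ltW QR)// ltW.
have GY : normc ((h ^+ r)%:C * X - J) <= y.
  apply: le_trans Yy; apply: le_trans G _.
  rewrite -[leRHS]mul1r ler_pdivlMr//.
  have -> : Cg * h * Y = P ^+ d * (Cg * Y) / M%:R by rewrite /h; ring.
  rewrite ler_pdivrMr// mul1r; move: MK Pd0; rewrite mulrDr mulr1.
  by set u := P ^+ d * (Cg * Y); set v := P ^+ d => MK Pd0; lra.
have JI : normc (J - SI) <= C4 * y.
  by apply: le_trans (t4 Y Y4) _; rewrite ler_wpM2l.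
have E3 : normc ((P ^+ s)%:C * SQ * X - V%:C * (SS * SI)) <= (C3 + C3 * C4 + 2 * (C3 * C4)) * (V * y).
  have hr : 0 < h ^+ r by apply: exprn_gt0.
  (* The grid sum over the arc carries the weight h^r as a Riemann sum for the cube integral; V =
     P^s h^(-r) is the size of the main term before averaging. *)
  have VE : P ^+ s = V * h ^+ r.
    by rewrite /V /h -mulrA -exprMn [X in X ^+ r](_ : _ = 1) ?expr1n ?mulr1//; field; rewrite !gt_eqF.
  have -> : (P ^+ s)%:C * SQ * X - V%:C * (SS * SI) =
      V%:C * (SQ * ((h ^+ r)%:C * X - J) + SQ * (J - SI) + (SQ - SS) * SI).
    by rewrite VE rmorphM /=; ring.
  have -> : (C3 + C3 * C4 + 2 * (C3 * C4)) * (V * y) = V * ((C3 + C3 * C4 + 2 * (C3 * C4)) * y) by ring.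
  rewrite normcM normc_real ger0_norm//; apply: ler_wpM2l => //.
  apply: le_trans (le_normcD _ _) _.
  have -> : (C3 + C3 * C4 + 2 * (C3 * C4)) * y = C3 * y + C3 * (C4 * y) + C3 * (2 * y) * C4 by ring.
  apply: lerD; last by rewrite normcM; apply: ler_pM; rewrite ?normc_ge0.
  apply: le_trans (le_normcD _ _) _; rewrite !normcM.
  by apply: lerD; apply: ler_pM; rewrite ?normc_ge0.
pose W := P ^+ s / P ^+ (r * d).
have VW : V = M%:R ^+ r * W.
  rewrite /V /W expr_div_n -exprM [(d * r)%N]mulnC; ring.
have Mr : 0 < M%:R ^+ r :> R by apply: exprn_gt0.
(* Estimate multiplied by M^r, the number of points of the average: minor arcs, major arcs, and
   completion of series and integral. *)
have E : normc ((M%:R ^+ r)%:C * ((rho F B P)%:R - W%:C * (SS * SI))) <=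
    (C1 + C2 + C3 + C3 * C4 + 2 * (C3 * C4)) * (V * y).
  have -> : (M%:R ^+ r)%:C * ((rho F B P)%:R - W%:C * (SS * SI)) =
    ((M ^ r * rho F B P)%N%:R - MAJ) + (MAJ - (P ^+ s)%:C * SQ * X) +
    ((P ^+ s)%:C * SQ * X - V%:C * (SS * SI)).
    have ME : (M%:R ^+ r)%:C = M%:R ^+ r :> R[i] by first [by rewrite -natrX rmorph_nat natrX | by rewrite rmorphXn /= rmorph_nat | by rewrite rmorphXn rmorph_nat | ring].
    have VWC : V%:C = M%:R ^+ r * W%:C by first [by rewrite VW rmorphM ME | by rewrite VW rmorphM /= ME].
    by rewrite ME VWC natrM natrX mulrBr; first [ring | by rewrite !addrA !subrK !mulrA].
  have -> : (C1 + C2 + C3 + C3 * C4 + 2 * (C3 * C4)) * (V * y) =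
    C2 * (V * y) + C1 * (V * y) + (C3 + C3 * C4 + 2 * (C3 * C4)) * (V * y) by ring.
  apply: le_trans (le_normcD _ _) _; apply: lerD => //.
  by apply: le_trans (le_normcD _ _) _; apply: lerD.
rewrite normcM normc_real (gtr0_norm Mr) VW in E.
rewrite -(ler_pM2l Mr); apply: le_trans E _.
by rewrite le_eqVlt; apply/orP; left; apply/eqP; rewrite -/W -/y; ring.
Qed.

End MainEstimate.

(** * The asymptotic formula *)

Lemma origin_gradient_zero (R : realType) (r s d : nat) (F : 'I_r -> {mpoly int[s]}) (c : {ffun 'I_r -> int}) :
  (forall i, F i \is ishomog1 d mdeg) -> (1 < d)%N -> gradient_zeros R F c [tuple 0 | _ < s].
Proof.
case: d => [|[|d]]// hF _ j.
have hG : map_mpoly intr (\sum_(i < r) c i *: F i) \is @ishomog1 s R[i] d.+2 mdeg.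
  by apply: map_homog; apply: rpred_sum => i _; apply: rpredZ; apply: hF.
have hD := mderiv_homog j hG.
have -> : tnth [tuple 0 | _ < s] = (fun i : 'I_s => 0 * 0) :> ('I_s -> R[i]).
  by apply/funext => i; rewrite tnth_mktuple mulr0.
by rewrite (meval_homog_scale 0 (fun=> 0) hD) exprS mul0r mul0r.
Qed.

Theorem theorem1 (R : realType) (r s d : nat)
  (hr : (1 <= r)%N) (hs : (1 <= s)%N) (hd : (2 <= d)%N)
  (F : 'I_r -> {mpoly int[s]})
  (hF : forall i, F i \is ishomog1 d mdeg)
  (hdim : (ereal_sup [set variety_dim R (gradient_zeros R F a)
                         | a in [set a : {ffun 'I_r -> int} | a != 0%R]]
           + (r * r.+1 * (d - 1) * 2 ^ (d - 1))%N%:R%:E < s%:R%:E)%E)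
  (B : set (s.-tuple R)) (hB : is_box B) (hB1 : B `<=` unit_box R s) :
  singular_integral_converges F B /\ singular_series_converges R F /\
  exists delta C : R, 0 < delta /\
    \forall P \near +oo,
      `| (rho F B P)%:R
         - singular_integral F B * singular_series R F
           * (P `^ (s%:R - (r * d)%:R))%:C |
      <= (C * P `^ (s%:R - (r * d)%:R - delta))%:C.
Proof.
case: hB => lo [hi [a [b [lohi BE]]]]; subst B.
have in_unit : tbox a b lo hi `<=` unit_box R s by exact: hB1.
pose D := (2 ^ d.-1 * r.+1 * (r * d.-1))%N.
have DE : (r * r.+1 * (d - 1) * 2 ^ (d - 1) = D)%N by rewrite /D subn1; ring.
rewrite DE in hdim.
have chain (c : {ffun 'I_r -> int}) m Z : c != 0%R ->
    irreducible_chain (gradient_zeros R F c) m Z -> (m + D < s)%N.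
  move=> c0 hZ; rewrite -(ltr_nat R) natrD -lte_fin EFinD; apply: le_lt_trans hdim.
  rewrite leeD2r//; apply: (@le_trans _ _ (variety_dim R (gradient_zeros R F c))).
    by apply: ereal_sup_ubound; exists m => //; exists Z.
  by apply: ereal_sup_ubound; exists c.
(* The origin is a chain of length 0 in a singular locus, so the hypothesis yields [D < s], and the
   subtraction defining [k] below is a true one. *)
have Ds : (D < s)%N.
  have c0 : [ffun=> 1 : int] != 0 :> {ffun 'I_r -> int}.
    by apply/eqP => /ffunP /(_ (Ordinal hr)); rewrite !ffunE.
  apply: (@chain _ 0%N (fun=> [set [tuple 0 | _ < s]]) c0); split=> // i _; split.
    exact: irreducible_origin.
  by move=> _ ->; apply: origin_gradient_zero hF hd.
(* The largest chain length m compatible with m + D < s. *)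
pose k := (s - D).-1.
have k_dim (c : {ffun 'I_r -> int}) m Z : c != 0%R ->
    irreducible_chain (gradient_zeros R F c) m Z -> (m <= k)%N.
  by move=> c0 hZ; have := chain c m Z c0 hZ; rewrite -ltn_subRL /k => h; rewrite -ltnS prednK ?subn_gt0// ltn_subRL addnC -ltn_subRL.
have s_large : (k + 2 ^ d.-1 * r.+1 * (r * d.-1) < s)%N.
  by rewrite -/D addnC -ltn_subRL /k prednK ?subn_gt0.
have [_ _ [ic _ _]] := singular_integral_cvg hr hs hF hd k_dim s_large lohi in_unit.
have [_ _ [sc _ _ _]] := singular_series_cvg hr hs hF hd k_dim s_large.
have [C C0 hC] := main_estimate hr hs hF hd k_dim s_large lohi in_unit.
split; first exact: ic.
split; first exact: sc.
pose N := (4 * r + 6)%N; pose c1 : R := (2 * (r * d.-1) * 2 ^ d.-1)%N%:R^-1.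
have N0 : (0 : R) < N%:R by rewrite ltr0n /N addnS.
(* The saving Y^(-c1) at Y = P^(1/N), expressed in powers of P. *)
exists (c1 / N%:R), C; split; first by rewrite divr_gt0// gain_gt0.
near=> P.
have hP : 4 ^+ N <= P by near: P; apply: nbhs_pinfty_ge; exact: num_real.
have P0 : 0 < P by apply: lt_le_trans hP; apply: exprn_gt0.
have E1 : P `^ (s%:R - (r * d)%:R) = P ^+ s / P ^+ (r * d).
  by rewrite powRD ?(gt_eqF P0) ?implybT// powRN !powR_mulrn ?(ltW P0).
have E2 : P `^ (s%:R - (r * d)%:R - c1 / N%:R) =
    P ^+ s / P ^+ (r * d) * (P `^ N%:R^-1) `^ (- c1).
  by rewrite powRD ?(gt_eqF P0) ?implybT// E1 -powRrM mulrN [_^-1 * _]mulrC.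
rewrite normr_complex lecR E2 E1 mulrC [singular_integral _ _ * _]mulrC.
exact: hC.
Unshelve. all: by end_near.
Qed.
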